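(* Let $R=\mathbb C[x,y]$, $\alpha$ a $\mathbb C$-algebra automorphism of $R$, and $S=R[\theta;\alpha]$. (a) If $\alpha$ is triangular, then $S$ satisfies $(\diamond)$ if and only if $\alpha$ has finite order, if and only if $\alpha$ is conjugate to an automorphism of type (i) with $\lambda,\mu$ roots of unity. (b) If $\alpha$ is square, then $S$ satisfies $(\diamond)$ if and only if $S$ is not primitive.
   Context: $R[\theta;\alpha]$: skew polynomial ring with $\theta r=\alpha(r)\theta$. A ring satisfies $(\diamond)$ if for every simple right module $V$, every finitely generated submodule of the injective hull $E(V)$ is Artinian; a ring is primitive if it has a faithful simple right module. Let $A$ be the group of $\mathbb C$-algebra automorphisms of $\mathbb C[x,y]$. An element of $A$ is triangular if it is conjugate in $A$ to an automorphism of one of the types: (i) $x\mapsto\lambda x$, $y\mapsto\mu y$ with $\lambda,\mu\in\mathbb C\setminus\{0\}$; (ii) $x\mapsto\lambda x$, $y\mapsto y+c$ with $\lambda,c\in\mathbb C\setminus\{0\}$; (iii) $x\mapsto \lambda x+\sum_{\{i:\lambda=\mu^i\}}\eta_i y^i$, $y\mapsto\mu y$ with $\eta_i\in\mathbb C$, $\lambda,\mu\in\mathbb C\setminus\{0\}$. An element of $A$ is square if it is not triangular. *)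

(* Defs.v *)
From HB Require Import structures.
From mathcomp Require Import all_boot all_order all_algebra.
From mathcomp Require Import complex.
From mathcomp Require Import Rstruct.
From Stdlib Require Import Reals.

Set Implicit Arguments.
Unset Strict Implicit.
Unset Printing Implicit Defensive.

Import Order.TTheory GRing.Theory Num.Theory.
Local Open Scope ring_scope.

Definition CC : numClosedFieldType := complex Rdefinitions.R.

Definition Rxy := {poly {poly CC}}.
Definition varx : Rxy := (('X : {poly CC})%:P).
Definition vary : Rxy := 'X.
Definition cst (c : CC) : Rxy := c%:P%:P.

Definition is_aut (f : Rxy -> Rxy) : Prop :=
  [/\ (forall a b, f (a + b) = f a + f b),
      (forall a b, f (a * b) = f a * f b),
      f 1 = 1,
      (forall c, f (cst c) = cst c) & bijective f].

Definition type_i (f : Rxy -> Rxy) (lam mu : CC) : Prop :=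
  [/\ lam != 0, mu != 0, f varx = cst lam * varx & f vary = cst mu * vary].

Definition type_ii (f : Rxy -> Rxy) : Prop :=
  exists lam c : CC,
  [/\ lam != 0, c != 0, f varx = cst lam * varx & f vary = vary + cst c].

(* x |-> lam x + sum_{i : lam = mu^i} eta_i y^i ,  y |-> mu y ;
   the sum is encoded as the polynomial p(y) whose only possibly nonzero
   coefficients are at indices i with lam = mu^i *)
Definition type_iii (f : Rxy -> Rxy) : Prop :=
  exists (lam mu : CC) (p : {poly CC}),
  [/\ lam != 0, mu != 0,
      (forall i, p`_i != 0 -> lam = mu ^+ i),
      f varx = cst lam * varx + map_poly polyC p
    & f vary = cst mu * vary].

Definition conj_in_A (f g : Rxy -> Rxy) : Prop :=
  exists b, is_aut b /\ forall r, f (b r) = b (g r).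

Definition triangular (f : Rxy -> Rxy) : Prop :=
  exists g, [/\ is_aut g, conj_in_A f g &
    [\/ exists lam mu, type_i g lam mu, type_ii g | type_iii g]].

Definition square (f : Rxy -> Rxy) : Prop := is_aut f /\ ~ triangular f.

Definition finite_order (f : Rxy -> Rxy) : Prop :=
  exists n : nat, (0 < n)%nat /\ forall r, ssrnat.iter n f r = r.

Definition is_root_of_unity (z : CC) : Prop := exists n : nat, (0 < n)%nat /\ z ^+ n = 1.

(* The skew polynomial ring S = R[theta; alpha], theta r = alpha(r) theta.
   Carrier: {poly Rxy}, p = sum_i p_i theta^i (coefficients on the left),
   with the usual addition, unit 1 and skew multiplication
   (p_i theta^i)(q_j theta^j) = p_i alpha^i(q_j) theta^(i+j). *)
Definition skS := {poly Rxy}.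
Definition skmul (alpha : Rxy -> Rxy) (p q : skS) : skS :=
  \poly_(k < size p + size q) \sum_(i < k.+1) p`_i * ssrnat.iter i alpha q`_(k - i).

Record rmod (alpha : Rxy -> Rxy) := RMod {
  rm_car :> zmodType;
  rm_act : rm_car -> skS -> rm_car;
  rm_actDl : forall m1 m2 s, rm_act (m1 + m2) s = rm_act m1 s + rm_act m2 s;
  rm_actDr : forall m s1 s2, rm_act m (s1 + s2) = rm_act m s1 + rm_act m s2;
  rm_actM : forall m s1 s2, rm_act m (skmul alpha s1 s2) = rm_act (rm_act m s1) s2;
  rm_act1 : forall m, rm_act m 1 = m }.

Section Modules.
Variable alpha : Rxy -> Rxy.
Implicit Types M N V E : rmod alpha.

Definition is_submod M (P : M -> Prop) : Prop :=
  [/\ P 0, (forall x y, P x -> P y -> P (x - y)) &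
      (forall x s, P x -> P (rm_act x s))].

Definition is_hom M N (f : M -> N) : Prop :=
  (forall x y, f (x + y) = f x + f y) /\
  (forall x s, f (rm_act x s) = rm_act (f x) s).

Definition simple_mod V : Prop :=
  (exists v : V, v != 0) /\
  forall P : V -> Prop, is_submod P -> (forall x, P x -> x = 0) \/ (forall x, P x).

Definition faithful_mod V : Prop :=
  forall s : skS, s != 0 -> exists v : V, rm_act v s != 0.

Definition injective_mod E : Prop :=
  forall (A B : rmod alpha) (i : A -> B) (f : A -> E),
    is_hom i -> injective i -> is_hom f ->
    exists g : B -> E, is_hom g /\ forall a, g (i a) = f a.

Definition inj_hull V E (j : V -> E) : Prop :=
  [/\ is_hom j, injective j, injective_mod E &
      forall P : E -> Prop, is_submod P -> (exists x, P x /\ x != 0) ->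
        exists v : V, j v != 0 /\ P (j v)].

Definition fg_submod M (N : M -> Prop) : Prop :=
  is_submod N /\
  exists l : seq M, forall x, N x <->
    exists ss : seq skS, size ss = size l /\
      x = \sum_(i < size l) rm_act (nth 0 l i) (nth 0 ss i).

Definition artinian_submod M (N : M -> Prop) : Prop :=
  forall P : nat -> M -> Prop,
    (forall n, is_submod (P n)) -> (forall n x, P n x -> N x) ->
    (forall n x, P n.+1 x -> P n x) ->
    exists n0, forall n, (n0 <= n)%nat -> forall x, P n x <-> P n0 x.

End Modules.

Definition diamond (alpha : Rxy -> Rxy) : Prop :=
  forall (V E : rmod alpha) (j : V -> E), simple_mod V -> inj_hull j ->
    forall N : E -> Prop, fg_submod N -> artinian_submod N.

Definition primitive (alpha : Rxy -> Rxy) : Prop :=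
  exists V : rmod alpha, simple_mod V /\ faithful_mod V.

(* Main.v *)
From HB Require Import structures.
From mathcomp Require Import all_boot all_order all_algebra.
From mathcomp Require Import boolp classical_sets functions fraction generic_quotient.
From mathcomp Require Import complex Rstruct ring lra zify reals.
Require Import Defs.

(** A right module over S = R[theta; alpha] is an R-module V with an additive operator
    t satisfying t(v alpha(r)) = t(v) r.

    Diamond holds when every simple V with t <> 0 contains a joint eigenvector of R: an
    Artin-Rees argument shows that a finitely generated essential extension is killed by
    a power of the ideal of the (finite) orbit of the eigenvalue, hence has finite length.
    If alpha has finite order, symmetric functions of the orbit of r act as scalars
    (Dixmier's form of Schur's lemma), which gives the eigenvector.  If S is not primitive
    and alpha has infinite order, every simple V is R-torsion, and either it has a joint
    eigenvector or some irreducible polynomial is mapped by a power of alpha to a multiple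
    of itself.  The second case forces alpha to be triangular: by Jung's theorem (proved
    through the locally nilpotent derivation J(alpha x, .) and its weighted top form),
    alpha is conjugate to a triangular map or to a product of Henon maps, and a degree
    count excludes invariant curves of the latter.

    Diamond fails when S has the following bad extension: B is a quotient of R with an
    induced automorphism beta, and theta acts on Frac(B) by f |-> beta^-1(f)/a, where a is
    chosen so that 1.S is simple; then (1/g).S is an essential, non-Artinian extension for
    suitable g.  A faithful simple S-module supplies a for B = R; an infinite-order
    triangular alpha supplies it on an invariant line (of alpha or of one of its powers). *)

Set Implicit Arguments.
Unset Strict Implicit.
Unset Printing Implicit Defensive.
Import Order.TTheory GRing.Theory Num.Theory.
Local Open Scope ring_scope.

(** * Modules over a skew polynomial ring *)

(** Diamond speaks about injective hulls that are given, so refuting it requires building one: a bad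
    extension is embedded in a coinduced module, which contains a hull. Uncountability of the
    scalars enters twice, in Schur's lemma for spaces of countable dimension and in the choice of a
    line x = c or y = c that misses countably many zero sets. The divisor a attached to a faithful
    simple module is the leading coefficient of a shortest relation among v, v theta, v theta^2,
    ...; reducing modulo this relation shows that every non-zero stable ideal contains a product of
    conjugates of a, which is what makes 1.S simple. On an invariant line a is 1 if the automorphism
    is a translation, and the coordinate if it is a scaling by a number that is not a root of unity.
    When both multipliers of a triangular alpha are roots of unity and its order is infinite, only a
    power of alpha translates a line; the bad module is then induced from that power, and
    interpolation polynomials separate the conjugate lines. In (b) finite order is not excluded but
    treated apart: diamond holds and S is not primitive. *)

Lemma iter_morphD (M : nmodType) (t : M -> M) n :
  {morph t : x y / x + y} -> {morph iter n t : x y / x + y}.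
Proof. by move=> tD; elim: n => //= n IH x y /=; rewrite IH tD. Qed.

Lemma iter_rmorph0 (A : pzRingType) (f : {rmorphism A -> A}) n : iter n f 0 = 0.
Proof. by elim: n => //= n ->; rewrite rmorph0. Qed.
Lemma iter_rmorph1 (A : pzRingType) (f : {rmorphism A -> A}) n : iter n f 1 = 1.
Proof. by elim: n => //= n ->; rewrite rmorph1. Qed.
Lemma iter_rmorphM (A : pzRingType) (f : {rmorphism A -> A}) n :
  {morph iter n f : x y / x * y}.
Proof. by elim: n => //= n IH x y /=; rewrite IH rmorphM. Qed.
Lemma iter_rmorphB (A : pzRingType) (f : {rmorphism A -> A}) n :
  {morph iter n f : x y / x - y}.
Proof. by elim: n => //= n IH x y /=; rewrite IH rmorphB. Qed.
Lemma iter_rmorphD (A : pzRingType) (f : {rmorphism A -> A}) n :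
  {morph iter n f : x y / x + y}.
Proof. by elim: n => //= n IH x y /=; rewrite IH rmorphD. Qed.

Lemma iter_can (T : Type) (f g : T -> T) n : cancel f g -> cancel (iter n f) (iter n g).
Proof. by move=> fK; elim: n => // n IH x; rewrite iterSr /= fK IH. Qed.

Definition ideal (B : comNzRingType) (I : B -> Prop) : Prop :=
  [/\ I 0, forall x y, I x -> I y -> I (x - y) & forall x r, I x -> I (x * r)].

(* A right module over A[theta; alpha], given by the action of A and by the operator
   tt of multiplication by theta. *)
Record tmod (A : comNzRingType) (alpha : A -> A) := Tmod {
  tcar :> zmodType;
  rho : tcar -> A -> tcar;
  tt : tcar -> tcar;
  rhoDl : forall r x y, rho (x + y) r = rho x r + rho y r;
  rhoDr : forall x r s, rho x (r + s) = rho x r + rho x s;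
  rhoM : forall x r s, rho x (r * s) = rho (rho x r) s;
  rho1 : forall x, rho x 1 = x;
  ttD : forall x y, tt (x + y) = tt x + tt y;
  tt_rho : forall x r, tt (rho x (alpha r)) = rho (tt x) r }.

Section Theory.
Variables (A : comNzRingType) (alpha : {rmorphism A -> A}).

Section Module.
Variable M : tmod alpha.
Implicit Types (m x y : M) (r s : A).

Lemma rho0l r : rho (0 : M) r = 0.
Proof. by apply: (addrI (rho 0 r)); rewrite -rhoDl !addr0. Qed.
Lemma rho0 m : rho m 0 = 0.
Proof. by apply: (addrI (rho m 0)); rewrite -rhoDr !addr0. Qed.
Lemma rhoNl m r : rho (- m) r = - rho m r.
Proof. by apply: (addrI (rho m r)); rewrite -rhoDl !subrr rho0l. Qed.
Lemma rhoNr m r : rho m (- r) = - rho m r.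
Proof. by apply: (addrI (rho m r)); rewrite -rhoDr !subrr rho0. Qed.
Lemma rhoBl x y r : rho (x - y) r = rho x r - rho y r.
Proof. by rewrite rhoDl rhoNl. Qed.
Lemma rhoBr m r s : rho m (r - s) = rho m r - rho m s.
Proof. by rewrite rhoDr rhoNr. Qed.
Lemma rhoAC m r s : rho (rho m r) s = rho (rho m s) r.
Proof. by rewrite -!rhoM mulrC. Qed.
Lemma rho_suml I (l : seq I) P (F : I -> M) r :
  rho (\sum_(i <- l | P i) F i) r = \sum_(i <- l | P i) rho (F i) r.
Proof. by apply: (big_morph (fun m => rho m r)); [exact: rhoDl | exact: rho0l]. Qed.
Lemma rho_sumr I (l : seq I) P (F : I -> A) m :
  rho m (\sum_(i <- l | P i) F i) = \sum_(i <- l | P i) rho m (F i).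
Proof. by apply: (big_morph (rho m)); [exact: rhoDr | exact: rho0]. Qed.

Lemma tt0 : tt (0 : M) = 0.
Proof. by apply: (addrI (tt 0)); rewrite -ttD !addr0. Qed.
Lemma ttN m : tt (- m) = - tt m.
Proof. by apply: (addrI (tt m)); rewrite -ttD !subrr tt0. Qed.
Lemma ttB x y : tt (x - y) = tt x - tt y. Proof. by rewrite ttD ttN. Qed.
Lemma iter_ttD n : {morph iter n (@tt _ _ M) : x y / x + y}.
Proof. exact/iter_morphD/ttD. Qed.
Lemma iter_tt0 n : iter n (@tt _ _ M) 0 = 0.
Proof. by elim: n => //= n ->; rewrite tt0. Qed.
Lemma iter_ttN n m : iter n (@tt _ _ M) (- m) = - iter n (@tt _ _ M) m.
Proof. by elim: n => //= n ->; rewrite ttN. Qed.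
Lemma iter_ttB n x y :
  iter n (@tt _ _ M) (x - y) = iter n (@tt _ _ M) x - iter n (@tt _ _ M) y.
Proof. by rewrite iter_ttD iter_ttN. Qed.
Lemma iter_tt_sum n I (l : seq I) P (F : I -> M) :
  iter n (@tt _ _ M) (\sum_(i <- l | P i) F i)
  = \sum_(i <- l | P i) iter n (@tt _ _ M) (F i).
Proof. by apply: big_morph; [exact: iter_ttD | exact: iter_tt0]. Qed.
Lemma iter_tt_rho n m r :
  iter n (@tt _ _ M) (rho m (iter n alpha r)) = rho (iter n (@tt _ _ M) m) r.
Proof. by elim: n m r => //= n IH m r; rewrite -tt_rho -IH -iterSr. Qed.

Definition tsub (P : M -> Prop) : Prop :=
  [/\ P 0, (forall x y, P x -> P y -> P (x - y)),
      (forall x r, P x -> P (rho x r)) & (forall x, P x -> P (tt x))].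

Lemma tsubN P x : tsub P -> P x -> P (- x).
Proof. by case=> P0 PB _ _ Px; rewrite -sub0r; apply: PB. Qed.
Lemma tsubD P x y : tsub P -> P x -> P y -> P (x + y).
Proof.
by move=> sP Px Py; case: (sP) => _ PB _ _; rewrite -[y]opprK; apply: PB => //; apply: tsubN.
Qed.
Lemma tsub_sum P I (l : seq I) (Q : pred I) (F : I -> M) : tsub P -> (forall i, Q i -> P (F i)) ->
  P (\sum_(i <- l | Q i) F i).
Proof. by move=> sP PF; elim/big_ind: _ => // [|x y]; [case: sP | exact: tsubD]. Qed.
Lemma tsub_iter P n x : tsub P -> P x -> P (iter n (@tt _ _ M) x).
Proof. by case=> _ _ _ PT Px; elim: n => //= n; apply: PT. Qed.

Implicit Types p q : {poly A}.

(** Coefficients stand to the left of the powers of theta, so in a right module the coefficient acts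
    first and [tt] afterwards. *)
Definition tact (m : M) (s : {poly A}) : M :=
  \sum_(i < size s) iter i (@tt _ _ M) (rho m s`_i).

Lemma tactE m (s : {poly A}) n : (size s <= n)%N ->
  tact m s = \sum_(i < n) iter i (@tt _ _ M) (rho m s`_i).
Proof.
move=> le_n; rewrite /tact (big_ord_widen n (fun i => iter i (@tt _ _ M) (rho m s`_i)) le_n).
rewrite big_mkcond /=; apply: eq_bigr => i _; case: ltnP => // le_i.
by rewrite nth_default // rho0 iter_tt0.
Qed.

Lemma tactDl x y (s : {poly A}) : tact (x + y) s = tact x s + tact y s.
Proof. by rewrite -big_split; apply: eq_bigr => i _; rewrite rhoDl iter_ttD. Qed.

Lemma tactDr m (s1 s2 : {poly A}) : tact m (s1 + s2) = tact m s1 + tact m s2.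
Proof.
rewrite (tactE m (size_polyD s1 s2)) (tactE m (leq_maxl (size s1) (size s2))).
rewrite (tactE m (leq_maxr (size s1) (size s2))) -big_split.
by apply: eq_bigr => i _; rewrite coefD rhoDr iter_ttD.
Qed.

Lemma tact0 m : tact m 0 = 0.
Proof. by rewrite /tact size_poly0 big_ord0. Qed.

Lemma tactN m (s : {poly A}) : tact m (- s) = - tact m s.
Proof. by apply: (addrI (tact m s)); rewrite -tactDr !subrr tact0. Qed.

Lemma tact1 m : tact m 1 = m.
Proof. by rewrite /tact size_poly1 big_ord1 coef1 eqxx /= rho1. Qed.

Lemma tactC m r : tact m r%:P = rho m r.
Proof.
rewrite (@tactE _ _ 1) ?big_ord1 ?coefC ?eqxx //.
exact: leq_trans (size_polyC_leq1 _) _.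
Qed.

Lemma tactX m : tact m 'X = tt m.
Proof.
rewrite (@tactE _ _ 2) ?size_polyX // big_ord_recl big_ord1 /= !coefX /=.
by rewrite rho1 rho0 add0r.
Qed.

Lemma tsub_tact P m (s : {poly A}) : tsub P -> P m -> P (tact m s).
Proof.
move=> sP Pm; apply: tsub_sum => // i _; apply: tsub_iter => //.
by case: sP => _ _ PR _; apply: PR.
Qed.

(** The formula of [skmul] over an arbitrary [A]; over [Rxy] the two are convertible, on which the
    comparison with the modules of the statement relies. *)
Definition kmul (p q : {poly A}) : {poly A} :=
  \poly_(k < size p + size q) \sum_(i < k.+1) p`_i * iter i alpha q`_(k - i).

Lemma coef_kmul p q k :
  (kmul p q)`_k = \sum_(i < k.+1) p`_i * iter i alpha q`_(k - i).
Proof.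
rewrite coef_poly; case: ltnP => // le_k; rewrite big1 // => i _.
case: (ltnP i (size p)) => [lt_i|/leq_sizeP-> //]; last by rewrite mul0r.
have /leq_sizeP -> // : (size q <= k - i)%N.
  by move: lt_i le_k; case: i => i /=; lia.
by rewrite iter_rmorph0 mulr0.
Qed.

Lemma tactM m p q : tact m (kmul p q) = tact (tact m p) q.
Proof.
rewrite (@tactE _ _ (size p + size q)) ?size_poly //.
transitivity (\sum_(i < size p) \sum_(j < size q)
    iter (i + j) (@tt _ _ M) (rho m (p`_i * iter i alpha q`_j))); last first.
  rewrite exchange_big /=; apply: eq_bigr => j _.
  rewrite rho_suml iter_tt_sum; apply: eq_bigr => i _.
  by rewrite rhoM -(iter_tt_rho i) addnC iterD.
(* Both sides are sums of [G i j] over a rectangle of index pairs; the left one is grouped by the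
   total degree k = i + j. *)
pose G i j := iter (i + j) (@tt _ _ M) (rho m (p`_i * iter i alpha q`_j)).
rewrite (eq_bigr (fun k : 'I_ _ => \sum_(i < size p + size q | (i <= k)%N) G i (k - i)%N)); last first.
  move=> k _; rewrite coef_kmul rho_sumr iter_tt_sum.
  rewrite (big_ord_widen _ (fun i => iter k (@tt _ _ M) (rho m (p`_i * iter i alpha q`_(k - i)))) (ltn_ord k)).
  by apply: eq_big => [i|i]; rewrite ?ltnS // => le_i; rewrite /G subnKC.
rewrite (exchange_big_dep xpredT) //=.
rewrite (big_ord_widen _ (fun i => \sum_(j < size q) G i j) (leq_addr (size q) (size p))).
rewrite [RHS]big_mkcond /=; apply: eq_bigr => i _; case: ltnP => [lt_i|le_i]; last first.
  by rewrite big1 // => k _; rewrite /G nth_default // mul0r rho0 iter_tt0.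
rewrite (big_ord_widen (size p + size q) (fun j => G i j) (leq_addl _ _)).
rewrite -(big_mkord (fun k => (i <= k)%N) (fun k => G i (k - i)%N)).
rewrite -(big_mkord (fun k => (k < size q)%N) (fun k => G i k)).
rewrite (big_cat_nat (leq0n i) (ltnW (ltn_ord i))) /=.
rewrite big_nat_cond big1 ?add0r; last by move=> k; case: leqP => //; lia.
rewrite -{1}[i : nat]add0n big_addn.
rewrite [RHS](@big_cat_nat _ _ _ (size p + size q - i)) ?leq_subr //=.
rewrite [X in _ = _ + X]big_nat_cond [X in _ = _ + X]big1 ?addr0; last by move=> k; lia.
rewrite [RHS]big_mkcond; apply: eq_big => [k|k _]; first by rewrite leq_addl.
rewrite addnK; case: ltnP => // le_k.
by rewrite /G [q`__]nth_default // iter_rmorph0 mulr0 rho0 iter_tt0.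
Qed.

Lemma kmulCC r s : kmul r%:P s%:P = (r * s)%:P.
Proof.
apply/polyP=> k; rewrite coef_kmul big_ord_recl subn0 /= !coefC big1 ?addr0.
  by case: (k == 0%N); rewrite ?mulr0.
by move=> i _; rewrite coefC /= mul0r.
Qed.

Lemma kmulCX r n : kmul r%:P 'X^n = r%:P * 'X^n.
Proof.
apply/polyP=> k; rewrite coef_kmul big_ord_recl subn0 coefCM /= coefC eqxx big1 ?addr0 //.
by move=> i _; rewrite coefC mul0r.
Qed.

Lemma kmulXC r : kmul 'X r%:P = (alpha r)%:P * 'X.
Proof.
apply/polyP=> k; rewrite coef_kmul coefCM coefX.
case: k => [|k]; first by rewrite big_ord_recl big_ord0 coefX mul0r mulr0 addr0.
rewrite !big_ord_recl big1 ?coefX ?mul0r ?add0r /= ?mul1r ?addr0; last first.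
  by move=> i _; rewrite coefX /= mul0r.
by rewrite subSS subn0 coefC; case: k => [|k] /=; rewrite ?mulr1 ?mulr0 ?rmorph0.
Qed.

Lemma kmulXX n : kmul 'X^n 'X = 'X^(n.+1).
Proof.
apply/polyP=> k; rewrite coef_kmul coefXn.
case: k => [|k].
  by rewrite big_ord_recl big_ord0 subn0 coefX iter_rmorph0 mulr0 addr0.
case: (eqVneq k.+1 n.+1) => [[->]|neq].
  rewrite (bigD1 (inord n)) //= inordK // subSnn coefX coefXn !eqxx iter_rmorph1 mulr1.
  rewrite big1 ?addr0 // => i ni; rewrite coefXn; case: eqP => e; last by rewrite mul0r.
  by case/negP: ni; apply/eqP/val_inj; rewrite /= inordK // e.
rewrite big1 // => i _; rewrite coefXn coefX.
case: eqP => e; last by rewrite mul0r.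
case: eqP => e2; last by rewrite iter_rmorph0 mulr0.
by exfalso; move/eqP: neq; move: (ltn_ord i); lia.
Qed.

End Module.

Definition thom (M N : tmod alpha) (f : M -> N) : Prop :=
  [/\ (forall x y, f (x + y) = f x + f y), (forall x r, f (rho x r) = rho (f x) r) &
      (forall x, f (tt x) = tt (f x))].

Definition tsimple (V : tmod alpha) : Prop :=
  (exists v : V, v != 0) /\
  forall P : V -> Prop, tsub P -> (forall x, P x -> x = 0) \/ (forall x, P x).

Lemma tsimple_all (V : tmod alpha) (P : V -> Prop) : tsimple V -> tsub P ->
  (exists v, P v /\ v != 0) -> forall v, P v.
Proof.
by case=> _ h sP [v [Pv v0]]; have [z|//] := h P sP; rewrite (z v Pv) eqxx in v0.
Qed.

Definition tinjective (E : tmod alpha) : Prop :=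
  forall (M N : tmod alpha) (i : M -> N) (f : M -> E),
    thom i -> injective i -> thom f ->
    exists g : N -> E, thom g /\ forall a, g (i a) = f a.

Definition tessential (V E : tmod alpha) (j : V -> E) : Prop :=
  forall P : E -> Prop, tsub P -> (exists x, P x /\ x != 0) ->
        exists v : V, j v != 0 /\ P (j v).

Definition tartinian (M : tmod alpha) (N : M -> Prop) : Prop :=
  forall P : nat -> M -> Prop,
    (forall n, tsub (P n)) -> (forall n x, P n x -> N x) ->
    (forall n x, P n.+1 x -> P n x) ->
    exists n0, forall n, (n0 <= n)%N -> forall x, P n x <-> P n0 x.

(** Generation is expressed by minimality among submodules, which avoids linear combinations over
    the skew ring; [fg_to] and [fg_of] reconcile the two forms. *)
Definition tfg (M : tmod alpha) (N : M -> Prop) : Prop :=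
  tsub N /\ exists l : seq M, (forall x, x \in l -> N x) /\
    forall P, tsub P -> (forall x, x \in l -> P x) -> forall x, N x -> P x.

Definition tdiamond : Prop :=
  forall (V E : tmod alpha) (j : V -> E), tsimple V ->
    thom j -> injective j -> tinjective E -> tessential j ->
    forall N : E -> Prop, tfg N -> tartinian N.

Definition tprimitive : Prop :=
  exists2 V : tmod alpha, tsimple V & forall s : {poly A}, s != 0 -> exists v : V, tact v s != 0.

Lemma thom0 (M N : tmod alpha) (f : M -> N) : thom f -> f 0 = 0.
Proof. by case=> fD _ _; apply: (addrI (f 0)); rewrite -fD !addr0. Qed.
Lemma thomN (M N : tmod alpha) (f : M -> N) x : thom f -> f (- x) = - f x.
Proof. by move=> h; case: (h) => fD _ _; apply: (addrI (f x)); rewrite -fD !subrr thom0. Qed.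
Lemma thomB (M N : tmod alpha) (f : M -> N) x y : thom f -> f (x - y) = f x - f y.
Proof. by move=> h; case: (h) => fD _ _; rewrite fD (thomN _ h). Qed.

End Theory.

(** * Injective hulls *)

(** [Zorn_bigcup] also asks for the union of the empty chain, so the predicate is relaxed to admit
    the empty set; a maximal element still satisfies [P] and contains [A0]. *)
Lemma zorn_above (T : Type) (P : set T -> Prop) (A0 : set T) : P A0 ->
  (forall F : set (set T), (exists X, F X) -> (forall X, F X -> P X) ->
     total_on F subset -> P (\bigcup_(X in F) X)%classic) ->
  exists A, [/\ (A0 `<=` A)%classic, P A & forall B, (A `<=` B)%classic -> P B -> B = A].
Proof.
move=> PA0 chP; pose P' : set (set T) := fun X => X = set0 \/ (P X /\ (A0 `<=` X)%classic).
have [|A [PA mA]] := @Zorn_bigcup T P'.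
  move=> F FP' totF; case: (pselect (exists X, F X /\ X <> set0)) => [[X [FX X0]]|no]; last first.
    left; apply/seteqP; split=> // x [X FX Xx]; case: no; exists X; split=> // X0.
    by rewrite X0 in Xx.
  right; pose F' : set (set T) := fun X => F X /\ X <> set0.
  have F'P Y : F' Y -> P Y /\ (A0 `<=` Y)%classic by case=> /FP' [].
  have -> : (\bigcup_(X in F) X = \bigcup_(X in F') X)%classic.
    apply/seteqP; split=> x [Y FY Yx]; exists Y => //; last by case: FY.
    by split=> // Y0; rewrite Y0 in Yx.
  split; first apply: chP.
  - by exists X.
  - by move=> Y /F'P [].
  - by move=> Y Z [FY _] [FZ _]; apply: totF.
  by move=> x A0x; exists X => //; have [_] := F'P X (conj FX X0); apply.
have [A_P A0A] : P A /\ (A0 `<=` A)%classic.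
  case: PA => // A_0; case: (pselect (A0 = set0)) => [e0|ne]; last first.
    exfalso; apply: (mA A0); last by right; split.
    by rewrite A_0; split=> // h; apply: ne; apply/seteqP; split.
  by rewrite A_0 -e0; split.
exists A; split=> // B AB PB; apply: contrapT => nAB.
apply: (mA B); last by right; split=> //; apply: subset_trans AB.
by split=> // BA; apply: nAB; apply/seteqP.
Qed.

Definition zmod_sub (X : zmodType) (P : X -> Prop) : Prop :=
  P 0 /\ forall x y, P x -> P y -> P (x - y).

Record sub_car (X : zmodType) (P : X -> Prop) (h : zmod_sub P) :=
  SubCar { sub_val : X; sub_valP : P sub_val }.

Section SubZmod.
Variables (X : zmodType) (P : X -> Prop) (P_sub : zmod_sub P).
Local Notation sub_car := (sub_car P_sub).

Lemma sub_val_inj : injective (@sub_val _ _ P_sub).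
Proof. by move=> [x px] [y py] /= xy; case: _ / xy in py *; congr SubCar. Qed.

HB.instance Definition _ := gen_eqMixin sub_car.
HB.instance Definition _ := gen_choiceMixin sub_car.

Let P0 : P 0 := proj1 P_sub.
Let PN x : P x -> P (- x).
Proof. by move=> Px; rewrite -sub0r; apply: (proj2 P_sub). Qed.
Let PD x y : P x -> P y -> P (x + y).
Proof. by move=> Px Py; rewrite -[y]opprK; apply: (proj2 P_sub) => //; exact: PN. Qed.
Let subN (x : sub_car) : sub_car := @SubCar _ _ P_sub (- sub_val x) (PN (sub_valP x)).
Let subD (x y : sub_car) : sub_car :=
  @SubCar _ _ P_sub (sub_val x + sub_val y) (PD (sub_valP x) (sub_valP y)).
Let subDA : associative subD.
Proof. by move=> x y z; apply: sub_val_inj; rewrite /= addrA. Qed.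
Let subDC : commutative subD.
Proof. by move=> x y; apply: sub_val_inj; rewrite /= addrC. Qed.
Let subD0 : left_id (@SubCar _ _ P_sub 0 P0) subD.
Proof. by move=> x; apply: sub_val_inj; rewrite /= add0r. Qed.
Let subDN : left_inverse (@SubCar _ _ P_sub 0 P0) subN subD.
Proof. by move=> x; apply: sub_val_inj; rewrite /= addNr. Qed.

HB.instance Definition _ := GRing.isZmodule.Build sub_car subDA subDC subD0 subDN.
End SubZmod.

Section Hull.
Variables (A : comNzRingType) (alpha : {rmorphism A -> A}).
Variables (K : fieldType) (kc : {rmorphism K -> A}).
Hypothesis alpha_kc : forall c, alpha (kc c) = kc c.

Section Submodule.
Variables (M : tmod alpha) (P : M -> Prop) (sP : tsub P).

Lemma tsub_zmod : zmod_sub P.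
Proof. by case: sP. Qed.

Let T := sub_car tsub_zmod.
Let sub_rho (x : T) (r : A) : T :=
  @SubCar _ _ tsub_zmod (rho (sub_val x) r) (let: And4 _ _ h _ := sP in h _ r (sub_valP x)).
Let sub_tt (x : T) : T :=
  @SubCar _ _ tsub_zmod (tt (sub_val x)) (let: And4 _ _ _ h := sP in h _ (sub_valP x)).

Definition sub_tmod : tmod alpha.
refine (@Tmod A alpha T sub_rho sub_tt _ _ _ _ _ _).
- by move=> r x y; apply: sub_val_inj; exact: rhoDl.
- by move=> x r s; apply: sub_val_inj; exact: rhoDr.
- by move=> x r s; apply: sub_val_inj; exact: rhoM.
- by move=> x; apply: sub_val_inj; exact: rho1.
- by move=> x y; apply: sub_val_inj; exact: ttD.
- by move=> x r; apply: sub_val_inj; exact: tt_rho.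
Defined.

Definition smval (x : sub_tmod) : M := @sub_val _ _ tsub_zmod x.
Definition tsubin (x : M) (Px : P x) : sub_tmod := @SubCar _ _ tsub_zmod x Px.
Lemma smval_hom : thom smval. Proof. by split. Qed.
Lemma smval_inj : injective smval. Proof. exact: sub_val_inj. Qed.
Lemma smvalP x : P (smval x). Proof. exact: sub_valP. Qed.
End Submodule.

(** * Coinduced modules and their injectivity *)

Section Coinduced.
Variable M : tmod alpha.

(* phi i a is the value at a theta^i of a K-linear map from A[theta; alpha] to M. *)
Definition klin (phi : nat -> A -> M) : Prop :=
  (forall i a b, phi i (a + b) = phi i a + phi i b) /\
  (forall i c a, phi i (kc c * a) = rho (phi i a) (kc c)).

Lemma klin_zmod : zmod_sub klin.
Proof.
have E0 i a : (0 : nat -> A -> M) i a = 0 by [].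
have EB (x y : nat -> A -> M) i a : (x - y) i a = x i a - y i a by [].
split=> [|x y [xD xK] [yD yK]]; split=> *.
- by rewrite !E0 addr0.
- by rewrite !E0 rho0l.
- by rewrite !EB xD yD opprD addrACA.
- by rewrite !EB xK yK rhoBl.
Qed.

Let T := sub_car klin_zmod.

Lemma coind_rho_subproof (x : T) r : klin (fun i a => sub_val x i (r * a)).
Proof.
have [xD xK] := sub_valP x; split=> i => [a b|c a]; first by rewrite mulrDr xD.
by rewrite mulrCA xK.
Qed.
(** The action is (phi s)(u) = phi(s u), and theta a theta^i = alpha(a) theta^(i+1): theta raises
    the index and twists the coefficient. *)
Lemma coind_tt_subproof (x : T) : klin (fun i a => sub_val x i.+1 (alpha a)).
Proof.
have [xD xK] := sub_valP x; split=> i => [a b|c a]; first by rewrite rmorphD xD.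
by rewrite rmorphM alpha_kc xK.
Qed.

Let coind_rho x r : T := @SubCar _ _ klin_zmod _ (coind_rho_subproof x r).
Let coind_tt x : T := @SubCar _ _ klin_zmod _ (coind_tt_subproof x).
Let T_ext (x y : T) : (forall i a, sub_val x i a = sub_val y i a) -> x = y.
Proof. by move=> e; apply/sub_val_inj/funext => i; apply/funext => a. Qed.

Definition coind : tmod alpha.
refine (@Tmod A alpha T coind_rho coind_tt _ _ _ _ _ _).
- by move=> r x y; apply: T_ext.
- by move=> x r s; apply: T_ext => i a /=; have [xD _] := sub_valP x; rewrite mulrDl xD.
- by move=> x r s; apply: T_ext => i a /=; rewrite -mulrA mulrCA.
- by move=> x; apply: T_ext => i a /=; rewrite mul1r.
- by move=> x y; apply: T_ext.
- by move=> x r; apply: T_ext => i a /=; rewrite rmorphM.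
Defined.

Definition cval (x : coind) : nat -> A -> M := @sub_val _ _ klin_zmod x.
Definition cin phi (h : klin phi) : coind := @SubCar _ _ klin_zmod phi h.
Lemma cval_ext (x y : coind) : (forall i a, cval x i a = cval y i a) -> x = y.
Proof. exact: T_ext. Qed.
Lemma cvalP x : klin (cval x). Proof. exact: sub_valP. Qed.

Lemma iter_tt_cval n (x : coind) i a : cval (iter n (@tt _ _ coind) x) i a = cval x (n + i) (iter n alpha a).
Proof.
by elim: n i a => //= n IH i a; rewrite [LHS]IH -iterSr addnS.
Qed.

Lemma to_coind_subproof (m : M) : klin (fun i a => iter i (@tt _ _ M) (rho m a)).
Proof.
split=> i => [a b|c a]; first by rewrite rhoDr iter_ttD.
rewrite -iter_tt_rho; congr (iter _ _ _).
have -> : iter i alpha (kc c) = kc c by elim: i => //= i ->; rewrite alpha_kc.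
by rewrite -rhoM mulrC.
Qed.
Definition to_coind (m : M) : coind := cin (to_coind_subproof m).

Lemma to_coind_hom : thom to_coind.
Proof.
split=> [x y|x r|x]; apply: cval_ext => i a /=.
- by rewrite rhoDl iter_ttD.
- by rewrite -rhoM.
- by rewrite -tt_rho -iterSr.
Qed.

Lemma to_coind_inj : injective to_coind.
Proof.
move=> x y e; have := f_equal (fun z => cval z 0%N 1) e.
by rewrite /= !rho1.
Qed.

Definition ksub (X : tmod alpha) (P : X -> Prop) : Prop :=
  [/\ P 0, (forall x y, P x -> P y -> P (x - y)) & (forall x c, P x -> P (rho x (kc c)))].

Lemma rho_kV (X : tmod alpha) (x : X) c : c != 0 -> rho (rho x (kc c)) (kc c^-1) = x.
Proof. by move=> c0; rewrite -rhoM -rmorphM divff // rmorph1 rho1. Qed.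

(** Take Q maximal among the subspaces meeting P in 0. If x lies outside Q, then Q + Kx meets P in
    some non-zero z = y + cx with c non-zero, and x can be read off from it. *)
Lemma ksub_compl (X : tmod alpha) (P : X -> Prop) : ksub P ->
  exists Q, [/\ ksub Q, (forall x, P x -> Q x -> x = 0) &
    forall x, exists y z, [/\ P y, Q z & x = y + z]].
Proof.
move=> [P0 PB PK].
have [||Q [_ [[Q0 QB QK] PQ] mQ]] := @zorn_above X
    (fun Q => ksub Q /\ forall x, P x -> Q x -> x = 0) (fun x => x = 0).
- split=> //; split=> // [x y -> ->|x c ->]; [exact: subr0 | exact: rho0l].
- move=> F [X0 FX0] FP totF; split; last first.
    by move=> x Px [Y FY Yx]; case: (FP _ FY) => _; apply.
  split.
  + by exists X0 => //; case: (FP _ FX0) => -[].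
  + move=> x y [Y FY Yx] [Z FZ Zy]; case: (totF _ _ FY FZ) => YZ.
      by exists Z => //; case: (FP _ FZ) => -[_ h _ _]; apply: h => //; apply: YZ.
    by exists Y => //; case: (FP _ FY) => -[_ h _ _]; apply: h => //; apply: YZ.
  + by move=> x c [Y FY Yx]; exists Y => //; case: (FP _ FY) => -[_ _ h _]; apply: h.
exists Q; split=> // x.
have QN y : Q y -> Q (- y) by move=> Qy; rewrite -sub0r; apply: QB.
have QD y z : Q y -> Q z -> Q (y + z).
  by move=> Qy Qz; rewrite -[z]opprK; apply: QB => //; exact: QN.
case: (pselect (Q x)) => [Qx|nQx]; first by exists 0, x; rewrite add0r.
pose Q' : X -> Prop := fun z => exists y c, Q y /\ z = y + rho x (kc c).
case: (pselect (forall z, P z -> Q' z -> z = 0)) => [PQ'|].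
  have sQ' : ksub Q'.
    split.
    - by exists 0, 0; rewrite rmorph0 rho0 addr0.
    - move=> _ _ [y [c [Qy ->]]] [z [d [Qz ->]]]; exists (y - z), (c - d).
      by split; [exact: QB | rewrite rmorphB rhoBr addrACA opprD].
    - move=> _ c [y [d [Qy ->]]]; exists (rho y (kc c)), (d * c).
      by split; [exact: QK | rewrite rhoDl rmorphM rhoM].
  have e : Q' = Q.
    apply: mQ => // y Qy; exists y, 0; rewrite rmorph0 rho0 addr0.
    by [].
  by case: nQx; rewrite -e; exists 0, 1; rewrite rmorph1 rho1 add0r.
move/existsNP=> [z /not_implyP [Pz /not_implyP [[y [c [Qy zE]]] z0]]].
have c0 : c != 0.
  apply/eqP=> c0; apply: z0; apply: PQ => //.
  by rewrite zE c0 rmorph0 rho0 addr0.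
exists (rho z (kc c^-1)), (- rho y (kc c^-1)); split.
- exact: PK.
- by apply: QN; apply: QK.
- by rewrite zE rhoDl rho_kV // addrAC subrr add0r.
Qed.

(** By adjunction a morphism into the coinduced module is the same as a K-linear map into M, namely
    its value at 1. Over a field this map extends along [i], by projecting on the image of [i] along
    a complement; [g'] is the extension. *)
Lemma coind_injective : tinjective coind.
Proof.
move=> X N i f hi ii hf.
case: (hi) (hf) => iD iR iT [fD fR fT].
have [|Q [[Q0 QB QK] PQ dec]] := @ksub_compl N (fun y => exists x, y = i x).
  split.
  - by exists 0; rewrite (thom0 hi).
  - by move=> _ _ [x ->] [y ->]; exists (x - y); rewrite (thomB _ _ hi).
  - by move=> _ c [x ->]; exists (rho x (kc c)).
have QN y : Q y -> Q (- y) by move=> Qy; rewrite -sub0r; apply: QB.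
have QD y z : Q y -> Q z -> Q (y + z).
  by move=> Qy Qz; rewrite -[z]opprK; apply: QB => //; exact: QN.
have dec1 y : exists x, Q (y - i x).
  by have [_ [z [[x ->] Qz ->]]] := dec y; exists x; rewrite addrC addKr.
pose p y := projT1 (cid (dec1 y)).
have pP y : Q (y - i (p y)) by rewrite /p; case: cid.
have pU y x : Q (y - i x) -> p y = x.
  move=> Qx; apply: ii; apply/eqP; rewrite -subr_eq0; apply/eqP; apply: PQ.
    by exists (p y - x); rewrite (thomB _ _ hi).
  rewrite (_ : _ - _ = (y - i x) - (y - i (p y))); last by rewrite opprB [RHS]addrC addrA subrK.
  exact: QB.
have pD y z : p (y + z) = p y + p z.
  apply: pU; rewrite iD (_ : _ - _ = (y - i (p y)) + (z - i (p z))); last by rewrite opprD addrACA.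
  exact: QD.
have pK y c : p (rho y (kc c)) = rho (p y) (kc c).
  by apply: pU; rewrite iR -rhoBl; apply: QK.
have pi x : p (i x) = x by apply: pU; rewrite subrr.
pose g' y : M := cval (f (p y)) 0%N 1.
have g'D y z : g' (y + z) = g' y + g' z by rewrite /g' pD fD.
have g'K y c : g' (rho y (kc c)) = rho (g' y) (kc c).
  by rewrite /g' pK fR; have [_ h] := cvalP (f (p y)); exact: h.
have gk y : klin (fun n a => g' (iter n (@tt _ _ N) (rho y a))).
  split=> n => [a b|c a]; first by rewrite rhoDr iter_ttD g'D.
  rewrite mulrC rhoM -g'K -iter_tt_rho; congr (g' (iter _ _ (rho _ _))).
  by elim: n => //= n <-; rewrite alpha_kc.
exists (fun y => cin (gk y)); split; first split.
- by move=> y z; apply: cval_ext => n a /=; rewrite rhoDl iter_ttD g'D.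
- by move=> y r; apply: cval_ext => n a /=; rewrite -rhoM.
- by move=> y; apply: cval_ext => n a /=; rewrite -tt_rho -iterSr.
move=> x; apply: cval_ext => n a /=.
have -> : iter n (@tt _ _ N) (rho (i x) a) = i (iter n (@tt _ _ X) (rho x a)).
  by rewrite -iR; elim: n => // n IH; rewrite !iterS iT IH.
rewrite /g' pi.
have -> : f (iter n (@tt _ _ X) (rho x a)) = iter n (@tt _ _ coind) (rho (f x) a).
  by rewrite -fR; elim: n => // n IH; rewrite !iterS fT IH.
by rewrite iter_tt_cval /= addn0 iter_rmorph1 mulr1.
Qed.
End Coinduced.

Lemma tsub_bigcup (M : tmod alpha) (F : set (set M)) : (exists X, F X) ->
  (forall X, F X -> tsub X) -> total_on F subset -> tsub (\bigcup_(X in F) X)%classic.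
Proof.
move=> [X FX] sF totF; split.
- by exists X => //; case: (sF _ FX).
- move=> x y [Y FY Yx] [Z FZ Zy]; case: (totF _ _ FY FZ) => YZ.
    by exists Z => //; case: (sF _ FZ) => _ h _ _; apply: h => //; apply: YZ.
  by exists Y => //; case: (sF _ FY) => _ h _ _; apply: h => //; apply: YZ.
- by move=> x r [Y FY Yx]; exists Y => //; case: (sF _ FY) => _ _ h _; apply: h.
- by move=> x [Y FY Yx]; exists Y => //; case: (sF _ FY) => _ _ _ h; apply: h.
Qed.

Lemma tsub_sum2 (M : tmod alpha) (P Q : M -> Prop) : tsub P -> tsub Q ->
  tsub (fun x => exists y z, [/\ P y, Q z & x = y + z]).
Proof.
move=> [P0 PB PR PT] [Q0 QB QR QT]; split.
- by exists 0, 0; rewrite addr0.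
- move=> _ _ [x [y [Px Qy ->]]] [x' [y' [Px' Qy' ->]]]; exists (x - x'), (y - y').
  by split; [exact: PB | exact: QB | rewrite opprD addrACA].
- move=> _ r [x [y [Px Qy ->]]]; exists (rho x r), (rho y r).
  by split; [exact: PR | exact: QR | rewrite rhoDl].
- move=> _ [x [y [Px Qy ->]]]; exists (tt x), (tt y).
  by split; [exact: PT | exact: QT | rewrite ttD].
Qed.

(** Inside the injective module [H] take a maximal essential extension E of M and a maximal
    submodule Kr meeting E in 0. The projection of E + Kr on E extends to an endomorphism [psi] of H
    whose image turns out to be E, so E is a retract of H and hence injective. *)
Theorem injective_hull_exists (M : tmod alpha) :
  exists (E : tmod alpha) (j : M -> E), [/\ thom j, injective j, tinjective E & tessential j].
Proof.
pose H := coind M; pose j0 : M -> H := @to_coind M.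
have hj0 : thom j0 := @to_coind_hom M.
have ij0 : injective j0 := @to_coind_inj M.
case: (hj0) => jD jR jT.
pose im : H -> Prop := fun y => exists x, y = j0 x.
have sim : tsub im.
  split.
  - by exists 0; rewrite (thom0 hj0).
  - by move=> _ _ [x ->] [y ->]; exists (x - y); rewrite (thomB _ _ hj0).
  - by move=> _ r [x ->]; exists (rho x r).
  - by move=> _ [x ->]; exists (tt x).
pose ess (E : H -> Prop) := tsub E /\ forall P : H -> Prop, tsub P -> (forall x, P x -> E x) ->
  (exists x, P x /\ x != 0) -> exists v, im v /\ P v /\ v != 0.
have [||E [imE [sE eE] mE]] := @zorn_above H ess im.
- by split=> // P sP Pim [x [Px x0]]; exists x; split=> //; exact: Pim.
- move=> F neF FP totF; split.
    by apply: tsub_bigcup => // X /FP [].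
  move=> P sP PF [x [Px x0]].
  have [Y FY Yx] := PF _ Px.
  have [sY eY] := FP _ FY.
  have [|||v [vim [[Pv Yv] v0]]] := eY (fun z => P z /\ Y z).
  + case: (sP) (sY) => p0 pB pR pT [y0 yB yR yT].
    by split=> [|z t [? ?] [? ?]|z r [? ?]|z [? ?]]; split; auto.
  + by move=> z [].
  + by exists x.
  by exists v.
have [||Kr [_ [sK EK] mK]] := @zorn_above H
    (fun Kr => tsub Kr /\ forall x, E x -> Kr x -> x = 0) (fun x => x = 0).
- split=> //; split=> // [x y -> ->|x r ->|x ->]; rewrite ?subr0 ?rho0l ?tt0 //.
- move=> F neF FP totF; split; first by apply: tsub_bigcup => // X /FP [].
  by move=> x Ex [Y FY Yx]; case: (FP _ FY) => _; apply.
have sEK := tsub_sum2 sE sK.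
pose EKm := sub_tmod sEK.
have prU (z : EKm) : exists2 y, E y & Kr (smval z - y).
  have [y [k [Ey Kk ->]]] := smvalP z.
  by exists y => //; rewrite addrC addKr.
pose pr (z : EKm) : H := projT1 (cid2 (prU z)).
have prE z : E (pr z) by rewrite /pr; case: cid2.
have prK z : Kr (smval z - pr z) by rewrite /pr; case: cid2.
case: (sE) (sK) => E0 EB ER ET [K0 KB KR KT].
have prP z y : E y -> Kr (smval z - y) -> pr z = y.
  move=> Ey Ky; apply/eqP; rewrite -subr_eq0; apply/eqP; apply: EK; first exact: EB.
  rewrite (_ : _ - _ = (smval z - y) - (smval z - pr z)); last by rewrite opprB [RHS]addrC addrA subrK.
  exact: KB.
have hpr : thom pr.
  split=> [x y|x r|x]; apply: prP.
  - exact: tsubD.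
  - rewrite (_ : _ - _ = (smval x - pr x) + (smval y - pr y)); last by rewrite opprD addrACA.
    by apply: (tsubD sK).
  - exact: ER.
  - by have := KR _ r (prK x); rewrite rhoBl.
  - exact: ET.
  - by have := KT _ (prK x); rewrite ttB.
have [psi [hpsi psiE]] := @coind_injective M EKm H (@smval _ _ sEK) pr (smval_hom sEK) (@smval_inj _ _ sEK) hpr.
case: (hpsi) => psiD psiR psiT.
have psi_id x : E x -> psi x = x.
  move=> Ex; have ex : exists y z, [/\ E y, Kr z & x = y + z] by exists x, 0; rewrite addr0.
  by rewrite -[x in LHS]/(smval (tsubin sEK ex)) psiE; apply: prP; rewrite //= subrr.
have psi0 x : Kr x -> psi x = 0.
  move=> Kx; have ex : exists y z, [/\ E y, Kr z & x = y + z] by exists 0, x; rewrite add0r.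
  by rewrite -[x in LHS]/(smval (tsubin sEK ex)) psiE; apply: prP; rewrite //= subr0.
(* The kernel of [psi] contains Kr and meets E in 0, so maximality of Kr applies. *)
have kerK : (fun x => psi x = 0) = Kr.
  apply: mK => //; split; last by move=> x Ex; rewrite psi_id.
  split=> [|x y ex ey|x r ex|x ex].
  - exact: (thom0 hpsi).
  - by rewrite (thomB _ _ hpsi) ex ey subr0.
  - by rewrite psiR ex rho0l.
  - by rewrite psiT ex tt0.
pose I : H -> Prop := fun y => exists x, y = psi x.
have sI : tsub I.
  split.
  - by exists 0; rewrite (thom0 hpsi).
  - by move=> _ _ [x ->] [y ->]; exists (x - y); rewrite (thomB _ _ hpsi).
  - by move=> _ r [x ->]; exists (rho x r).
  - by move=> _ [x ->]; exists (tt x).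
(* The image of [psi] is essential over M: the preimage of a non-zero submodule of it is strictly
   larger than Kr, hence meets E. Maximality of E then gives equality. *)
have IE : I = E.
  apply: mE.
    by move=> x Ex; exists x; rewrite psi_id.
  split=> // P sP PI [y [Py y0]].
  case: (sP) => P0 PB PR PT.
  pose Q x := P (psi x).
  have sQ : tsub Q.
    split=> [|x x' Qx Qx'|x r Qx|x Qx]; rewrite /Q.
    - by rewrite (thom0 hpsi).
    - by rewrite (thomB _ _ hpsi); apply: PB.
    - by rewrite psiR; apply: PR.
    - by rewrite psiT; apply: PT.
  have [e [Ee Qe e0]] : exists e, [/\ E e, Q e & e <> 0].
    apply: contrapT => no.
    have QK : Q = Kr.
      apply: mK.
        by move=> x Kx; rewrite /Q psi0.
      split=> // x Ex Qx; apply: contrapT => x0; apply: no; by exists x.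
    have [x yE] := PI _ Py.
    have : Kr x by rewrite -QK /Q -yE.
    by move/psi0; rewrite -yE => y00; rewrite y00 eqxx in y0.
  have [|||v [vim [[Ev Pv] v0]]] := eE (fun z => E z /\ P z).
  - by split=> [|z t [? ?] [? ?]|z r [? ?]|z [? ?]]; split; auto.
  - by move=> z [].
  - by exists e; split; [split=> //; rewrite -[e]psi_id | apply/eqP].
  by exists v.
have psiE' x : E (psi x) by rewrite -IE; exists x.
exists (sub_tmod sE), (fun m => tsubin sE (imE (j0 m) (ex_intro _ m erefl))); split.
- by split=> [x y|x r|x]; apply: smval_inj => /=; rewrite ?jD ?jR ?jT.
- by move=> x y /(f_equal (@smval _ _ sE)) /ij0.
- move=> X N i f hi ii hf.
  have hf' : thom (fun x => smval (f x) : H).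
    by case: hf => fD fR fT; split=> [x y|x r|x]; rewrite ?fD ?fR ?fT.
  have [g [[gD gR gT] gi]] := @coind_injective M X N i _ hi ii hf'.
  exists (fun y => tsubin sE (psiE' (g y))); split; first split.
  + by move=> x y; apply: smval_inj => /=; rewrite gD psiD.
  + by move=> x r; apply: smval_inj => /=; rewrite gR psiR.
  + by move=> x; apply: smval_inj => /=; rewrite gT psiT.
  by move=> x; apply: smval_inj => /=; rewrite gi psi_id //; exact: smvalP.
- move=> P sP [x [Px x0]].
  pose P' (y : H) := exists2 z, P z & y = smval z.
  case: (sP) => P0 PB PR PT.
  have [|||v [[m ->] [[z Pz zE] v0]]] := eE P'.
  + split.
    * by exists 0.
    * by move=> _ _ [y Py ->] [z Pz ->]; exists (y - z) => //; exact: PB.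
    * by move=> _ r [y Py ->]; exists (rho y r) => //; exact: PR.
    * by move=> _ [y Py ->]; exists (tt y) => //; exact: PT.
  + by move=> _ [y Py ->]; exact: smvalP.
  + exists (smval x); split; first by exists x.
    by apply: contraNneq x0 => e; apply/eqP/smval_inj.
  exists m; split.
    by apply: contraNneq v0 => /(f_equal (@smval _ _ sE)) /= ->.
  by rewrite (_ : tsubin _ _ = z) //; apply: smval_inj; rewrite -zE.
Qed.

(** Essential extensions compose, so the injective hull of M is also one of V, and it contains the
    non-Artinian M. *)
Lemma not_tdiamond (V M : tmod alpha) (j : V -> M) : tsimple V -> thom j -> injective j ->
  tessential j -> @tfg _ alpha M (fun _ => True) -> ~ @tartinian _ alpha M (fun _ => True) ->
  ~ tdiamond alpha.
Proof.
move=> sV hj ij ej [_ [l [_ genl]]] nart D; apply: nart => P sP _ dP.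
have [E [k [hk ik iE ek]]] := injective_hull_exists M.
case: (hj) (hk) => jD jR jT [kD kR kT].
have imsub (Q : M -> Prop) : tsub Q -> tsub (fun y => exists2 x, Q x & y = k x).
  case=> Q0 QB QR QT; split.
  - by exists 0; rewrite // (thom0 hk).
  - by move=> _ _ [x Qx ->] [y Qy ->]; exists (x - y); rewrite ?(thomB _ _ hk) //; exact: QB.
  - by move=> _ r [x Qx ->]; exists (rho x r) => //; exact: QR.
  - by move=> _ [x Qx ->]; exists (tt x) => //; exact: QT.
have [||||||n0 n0P] := D V E (k \o j) sV _ _ iE _ (fun y => exists2 x, True & y = k x) _ 
   (fun n y => exists2 x, P n x & y = k x) (fun n => imsub _ (sP n)) _ _.
- by split=> [x y|x r|x] /=; rewrite ?jD ?jR ?jT ?kD ?kR ?kT.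
- exact: inj_comp.
- move=> Q sQ neQ; have [m [km0 Qm]] := ek Q sQ neQ.
  case: (sQ) => Q0 QB QR QT.
  have [||v [jv Qv]] := ej (fun m => Q (k m)).
  + split=> [|x y|x r|x]; rewrite ?(thom0 hk) ?(thomB _ _ hk) ?kR ?kT //; auto.
  + by exists m; split=> //; apply: contraNneq km0 => ->; rewrite (thom0 hk).
  exists v; split=> //=; apply: contraNneq jv; rewrite -(thom0 hk).
  by move/ik => ->.
- split; first exact: imsub.
  exists (map k l); split; first by move=> _ /mapP [x _ ->]; exists x.
  move=> Q [Q0 QB QR QT] Ql _ [x _ ->].
  apply: (genl (fun m => Q (k m))) => //.
    by split=> [|y z|y r|y]; rewrite ?(thom0 hk) ?(thomB _ _ hk) ?kR ?kT //; auto.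
  by move=> y yl; apply: Ql; apply: map_f.
- by move=> n _ [x _ ->]; exists x.
- by move=> n _ [x Px ->]; exists x => //; exact: dP.
exists n0 => n le_n x; split=> Px.
  by have [/(_ (ex_intro2 _ _ x Px erefl)) [y Py /ik ->]] := n0P n le_n (k x).
by have [_ /(_ (ex_intro2 _ _ x Px erefl)) [y Py /ik ->]] := n0P n le_n (k x).
Qed.

(** The elements [Q] that annihilate M and the vector on which theta does not vanish are what the
    induction from a power of [alpha] consumes. *)
Definition bad_ext (Q : A -> Prop) : Prop :=
  exists (V M : tmod alpha) (j : V -> M),
   [/\ tsimple V, thom j, injective j & tessential j] /\
   [/\ @tfg _ alpha M (fun _ => True), ~ @tartinian _ alpha M (fun _ => True),
     (forall r, Q r -> forall m : M, rho m r = 0) & exists v : V, tt v != 0].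

Lemma bad_ext_not_tdiamond Q : bad_ext Q -> ~ tdiamond alpha.
Proof. by case=> V [M [j [[sV hj ij ej] [fM aM _ _]]]]; exact: (not_tdiamond sV hj ij ej fM aM). Qed.
End Hull.

(** * A cyclic non-Artinian essential extension inside a fraction field *)

Local Notation "x %:F"  := (@FracField.tofrac _ x).

Section FracMap.
Variables (B : idomainType) (gamma : {rmorphism B -> B}).
Hypothesis gamma_inj : injective gamma.

Lemma fracP (f : {fraction B}) : exists bd : B * B, bd.2 != 0 /\ f = bd.1%:F / bd.2%:F.
Proof.
elim/quotW: f => x; exists (\n_x, \d_x) => /=.
have d0 := denom_ratioP x; split=> //.
have dF : (\d_x)%:F != 0 by rewrite tofrac_eq0.
apply: (mulIf dF); rewrite divfK //.
rewrite /FracField.tofrac; unlock.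
rewrite -[_ * _]/(FracField.mul _ _) -FracField.pi_mul.
apply/eqP; rewrite FracField.equivf_def /=.
rewrite /FracField.mulf !numden_Ratio ?oner_eq0 // ?mulf_neq0 ?oner_eq0 //.
by rewrite !mulr1 mulrC.
Qed.

(** Numerator and denominator are picked by choice; [frac_mapE] shows that the value does not depend
    on the pick. *)
Definition frac_map (f : {fraction B}) : {fraction B} :=
  let bd := projT1 (cid (fracP f)) in (gamma bd.1)%:F / (gamma bd.2)%:F.

Lemma gamma_neq0 b : b != 0 -> gamma b != 0.
Proof. by move=> b0; rewrite -(rmorph0 gamma) (inj_eq gamma_inj). Qed.

Lemma frac_mapE b d : d != 0 -> frac_map (b%:F / d%:F) = (gamma b)%:F / (gamma d)%:F.
Proof.
move=> d0; rewrite /frac_map; case: cid => -[b' d'] /= [d'0] /eqP.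
rewrite eqr_div ?tofrac_eq0 // -!tofracM tofrac_eq => /eqP e.
by apply/eqP; rewrite eqr_div ?tofrac_eq0 ?gamma_neq0 // -!tofracM -!rmorphM e.
Qed.

Lemma frac_map_tofrac b : frac_map b%:F = (gamma b)%:F.
Proof.
by rewrite -[b%:F]divr1 -tofrac1 frac_mapE ?oner_neq0 // rmorph1 tofrac1 divr1.
Qed.

Lemma frac_mapD x y : frac_map (x + y) = frac_map x + frac_map y.
Proof.
have [[b d] /= [d0 ->]] := fracP x; have [[b' d'] /= [d'0 ->]] := fracP y.
rewrite addf_div ?tofrac_eq0 // -!tofracM -tofracD !frac_mapE ?mulf_neq0 //.
by rewrite addf_div ?tofrac_eq0 ?gamma_neq0 // -!tofracM -tofracD !rmorphD !rmorphM.
Qed.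

Lemma frac_mapM x y : frac_map (x * y) = frac_map x * frac_map y.
Proof.
have [[b d] /= [d0 ->]] := fracP x; have [[b' d'] /= [d'0 ->]] := fracP y.
by rewrite mulf_div -!tofracM !frac_mapE ?mulf_neq0 // !rmorphM mulf_div.
Qed.
End FracMap.

Section FracModule.
Variables (A : comNzRingType) (alpha : {rmorphism A -> A}).
Variables (B : idomainType) (beta gamma : {rmorphism B -> B}).
Hypotheses (betaK : cancel beta gamma) (gammaK : cancel gamma beta).
Variable psi : {rmorphism A -> B}.
Hypothesis psi_alpha : forall r, psi (alpha r) = beta (psi r).
Hypothesis psi_surj : forall b, exists r, psi r = b.
Variable a : B.
Hypothesis a0 : a != 0.

Let gamma_inj : injective gamma := can_inj gammaK.
Local Notation gF := (frac_map gamma).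

(* The action of theta sends f to beta^-1(f) / a. *)
Definition frac_tmod : tmod alpha.
refine (@Tmod A alpha {fraction B} (fun f r => f * (psi r)%:F) (fun f => gF f / a%:F) _ _ _ _ _ _).
- by move=> r x y; rewrite mulrDl.
- by move=> x r s; rewrite rmorphD tofracD mulrDr.
- by move=> x r s; rewrite rmorphM tofracM mulrA.
- by move=> x; rewrite rmorph1 tofrac1 mulr1.
- by move=> x y; rewrite (frac_mapD gamma_inj) mulrDl.
- by move=> x r; rewrite (frac_mapM gamma_inj) (frac_map_tofrac gamma_inj) psi_alpha betaK mulrAC.
Defined.

Local Notation F := frac_tmod.
(** The denominator of theta^n applied to 1. *)
Definition anorm n : B := \prod_(l < n) iter l gamma a.

Lemma iter_gamma_neq0 n b : b != 0 -> iter n gamma b != 0.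
Proof. by move=> b0; elim: n => //= n; apply: gamma_neq0. Qed.

Lemma anorm_neq0 n : anorm n != 0.
Proof. by apply/prodf_neq0 => i _; apply: iter_gamma_neq0. Qed.

Lemma anormS n : anorm n.+1 = a * gamma (anorm n).
Proof. by rewrite /anorm big_ord_recl /= rmorph_prod. Qed.

Lemma iter_tt_frac n b d : d != 0 ->
  iter n (@tt _ _ F) (b%:F / d%:F) = (iter n gamma b)%:F / (iter n gamma d * anorm n)%:F.
Proof.
move=> d0; elim: n => [|n IH]; first by rewrite /anorm big_ord0 mulr1.
rewrite iterS IH /= (frac_mapE gamma_inj) ?mulf_neq0 ?iter_gamma_neq0 ?anorm_neq0 //.
by rewrite rmorphM -mulrA -invfM -tofracM -mulrA [_ * a]mulrC -anormS.
Qed.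

(** This is 1.S in closed form: fractions whose denominator is some [anorm n]. It is closed under
    differences because [anorm n] divides [anorm m] for n <= m. *)
Definition unit_sub (f : F) : Prop := exists n b, f = b%:F / (anorm n)%:F.

Lemma anorm_dvd n m : (n <= m)%N -> exists c, anorm m = anorm n * c.
Proof.
move=> le; rewrite -(subnKC le); exists (\prod_(l < m - n) iter (n + l) gamma a).
by rewrite /anorm big_split_ord.
Qed.

Lemma unit_sub_tsub : tsub unit_sub.
Proof.
split.
- by exists 0%N, 0; rewrite tofrac0 mul0r.
- have H n m b b' : (n <= m)%N -> exists c, b%:F / (anorm n)%:F - b'%:F / (anorm m)%:F
      = c%:F / (anorm m)%:F :> {fraction B}.
    move=> /anorm_dvd [c e]; exists (b * c - b').
    have c0 : c%:F != 0 by rewrite tofrac_eq0; apply: contraNneq (anorm_neq0 m) => c0; rewrite e c0 mulr0.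
    by rewrite tofracB mulrBl e !tofracM -mulf_div divff // mulr1.
  move=> _ _ [n [b ->]] [m [b' ->]]; case: (leqP n m) => [le|/ltnW le].
    by have [c ->] := H n m b b' le; exists m, c.
  have [c e] := H m n b' b le; exists n, (- c).
  by rewrite tofracN mulNr -e opprB.
- by move=> _ r [n [b ->]]; exists n, (b * psi r); rewrite /= tofracM mulrAC.
- move=> _ [n [b ->]]; exists n.+1, (gamma b).
  by rewrite anormS /= (frac_mapE gamma_inj) ?anorm_neq0 // -mulrA -invfM -tofracM [a * _]mulrC.
Qed.

Lemma unit_subP (P : F -> Prop) : tsub P -> P 1 -> forall f, unit_sub f -> P f.
Proof.
move=> sP P1 _ [n [b ->]]; have [r <-] := psi_surj b; case: (sP) => _ _ PR _.
rewrite mulrC; apply: (PR _ r).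
have /(tsub_iter n sP) : P (1%:F / 1%:F) by rewrite tofrac1 divr1.
by rewrite iter_tt_frac ?oner_neq0 // !iter_rmorph1 tofrac1 !mul1r.
Qed.

Lemma unit_sub1 : unit_sub 1.
Proof. by exists 0%N, 1; rewrite /anorm big_ord0 tofrac1 divr1. Qed.

Hypothesis a_special : forall I : B -> Prop, ideal I -> (forall x, I x -> I (gamma x)) ->
  (exists x, I x /\ x != 0) -> exists m, I (\prod_(j < m) iter j.+1 beta a).

(** For a non-zero submodule U, the b in B that lie in U form a non-zero ideal; it is stable under
    [gamma], since multiplying theta(b) by [a] gives [gamma b]. By [a_special] it contains beta(a)
    ... beta^m(a), which theta^m sends to 1, so U is everything. *)
Lemma unit_sub_simple : tsimple (sub_tmod unit_sub_tsub).
Proof.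
split.
  exists (tsubin unit_sub_tsub unit_sub1); apply/eqP=> /(f_equal (@smval _ _ _ _ _)) /= /eqP.
  by rewrite oner_eq0.
move=> P sP; case: (pselect (exists x, P x /\ x != 0)) => [|no]; last first.
  by left=> x Px; apply: contrapT => /eqP x0; apply: no; exists x.
move=> [[u uV] [Pu u0]]; right.
pose U (f : F) := exists2 x, P x & f = smval x.
case: (sP) => P0 PB PR PT.
have sU : tsub U.
  split.
  - by exists 0.
  - by move=> _ _ [y Py ->] [z Pz ->]; exists (y - z) => //; exact: PB.
  - by move=> _ r [y Py ->]; exists (rho y r) => //; exact: PR.
  - by move=> _ [y Py ->]; exists (tt y) => //; exact: PT.
case: (sU) => U0 UB UR UT.
have UBr f b : U f -> U (f * b%:F) by move=> Uf; have [r <-] := psi_surj b; exact: UR.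
have [||| m Im] := @a_special (fun b => U b%:F).
- split=> [|x y|x r Ux]; rewrite ?tofrac0 ?tofracB ?tofracM //; [exact: UB|exact: UBr].
- move=> b /UT Ub; have := UBr _ a Ub; rewrite /= (frac_map_tofrac gamma_inj) divfK //.
  by rewrite tofrac_eq0.
- have [n [b uE]] := uV; exists b; split.
    have : U u by exists (SubCar (tsub_zmod unit_sub_tsub) uV).
    by move=> Uu; have := UBr u (anorm n) Uu; rewrite uE divfK // tofrac_eq0 anorm_neq0.
  apply: contraNneq u0 => b0; apply/eqP/smval_inj => /=.
  by rewrite uE b0 tofrac0 mul0r.
have : U 1.
  have := tsub_iter m sU Im; rewrite -[X in iter _ _ X]divr1 -tofrac1 iter_tt_frac ?oner_neq0 //.
  rewrite iter_rmorph1 mul1r (_ : iter m gamma _ = anorm m) ?divff ?tofrac_eq0 ?anorm_neq0 //.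
  rewrite (_ : iter m gamma _ = \prod_(j < m) iter m gamma (iter j.+1 beta a)); last first.
    exact: (big_morph _ (@iter_rmorphM _ gamma m) (@iter_rmorph1 _ gamma m)).
  rewrite (reindex_inj rev_ord_inj) /=; apply: eq_bigr => j _.
  case: j => j /= lt_j; rewrite -[beta _]/(iter (m - j.+1).+1 beta a).
  have {1}-> : m = (j + (m - j.+1).+1)%N by lia.
  by rewrite iterD (iter_can _ betaK).
move=> U1 x; have [y Py] := unit_subP sU U1 (smvalP x).
by move/smval_inj => ->.
Qed.

Variables (L : idomainType) (e : {rmorphism B -> L}) (g : B).
Hypotheses (eg : e g = 0) (g0 : g != 0).
Hypothesis eg_gamma : forall k, e (iter k.+1 gamma g) != 0.
Hypotheses (ea_beta : forall k, e (iter k beta a) != 0)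
  (ea_gamma : forall k, e (iter k gamma a) != 0).

Definition ginv_sub (f : F) : Prop := forall P : F -> Prop, tsub P -> P (1 / g%:F) -> P f.

Lemma ginv_sub_tsub : tsub ginv_sub.
Proof.
split=> [|x y Hx Hy|x r Hx|x Hx] P sP Pg; case: (sP) => P0 PB PR PT //.
- by apply: PB; [apply: Hx | apply: Hy].
- by apply: PR; apply: Hx.
- by apply: PT; apply: Hx.
Qed.

Lemma unit_sub_ginv f : unit_sub f -> ginv_sub f.
Proof.
move=> Vf P sP Pg; apply: unit_subP Vf => //; case: (sP) => _ _ PR _.
have [r rE] := psi_surj g; have := PR _ r Pg.
by rewrite /= rE mul1r mulVf // tofrac_eq0.
Qed.

(** Think of [e] as a point. Requiring d not to vanish along the whole forward orbit makes the
    condition stable under theta; n backward steps is the exact range that admits the denominator of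
    theta^(n+1)(1/g) and excludes that of theta^n(1/g). *)
Definition good_den n (d : B) : Prop :=
  (forall k, e (iter k gamma d) != 0) /\ (forall k, (k <= n)%N -> e (iter k beta d) != 0).

Lemma good_denM n d d' : good_den n d -> good_den n d' -> good_den n (d * d').
Proof.
move=> [h1 h2] [h1' h2']; split=> k => [|le_k]; rewrite iter_rmorphM rmorphM mulf_neq0 //.
- exact: h2.
- exact: h2'.
Qed.

Lemma good_den1 n : good_den n 1.
Proof. by split=> k => [|_]; rewrite iter_rmorph1 rmorph1 oner_neq0. Qed.

Lemma good_den_neq0 n d : good_den n d -> d != 0.
Proof. by case=> /(_ 0%N) h _; apply: contraNneq h => ->; rewrite /= rmorph0. Qed.

Lemma good_den_gamma n d : good_den n d -> good_den n (gamma d).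
Proof.
move=> [h1 h2]; split=> [k|[|k] le_k]; first by rewrite -iterSr.
  exact: (h1 1%N).
by rewrite iterSr gammaK; apply: h2; apply: ltnW.
Qed.

Lemma good_den_a n k : good_den n (iter k gamma a).
Proof.
split=> l => [|_]; first by rewrite -iterD.
case: (leqP k l) => [le|/ltnW le].
  by rewrite -(subnK le) iterD (iter_can k gammaK).
by rewrite -(subnKC le) iterD (iter_can l gammaK).
Qed.

Lemma good_den_anorm n k : good_den n (anorm k).
Proof.
rewrite /anorm; elim/big_ind: _ => [|x y|i _]; [exact: good_den1|exact: good_denM|].
exact: good_den_a.
Qed.

Lemma good_den_g n : good_den n (iter n.+1 gamma g).
Proof.
split=> l => [|le]; first by rewrite -iterD addnS.
by rewrite -(subnKC (leqW le)) iterD (iter_can l gammaK) subSn.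
Qed.

(** The fractions with [good_den n] denominators form a submodule containing 1 and theta^(n+1)(1/g).
    They miss theta^n(1/g): its denominator contains gamma^n(g), which beta^n takes back to g, where
    [e] vanishes. *)
Lemma ginv_chain_strict n (P : F -> Prop) :
  (forall Q : F -> Prop, tsub Q -> Q 1 -> Q (iter n.+1 (@tt _ _ F) (1 / g%:F)) -> forall f, P f -> Q f) ->
  ~ P (iter n (@tt _ _ F) (1 / g%:F)).
Proof.
pose Q (f : F) := exists b d, good_den n d /\ f = b%:F / d%:F.
move=> /(_ Q) PQ /PQ h.
have [|||b [d [gd]]] := h.
- split.
  + by exists 0, 1; rewrite tofrac0 mul0r; split=> //; exact: good_den1.
  + move=> _ _ [b [d [gd ->]]] [b' [d' [gd' ->]]]; exists (b * d' - b' * d), (d * d').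
    split; first exact: good_denM.
    rewrite -mulNr -tofracN addf_div ?tofrac_eq0 ?(good_den_neq0 gd) ?(good_den_neq0 gd') //.
    by rewrite -!tofracM -tofracD mulNr.
  + by move=> _ r [b [d [gd ->]]]; exists (b * psi r), d; rewrite /= tofracM mulrAC.
  + move=> _ [b [d [gd ->]]]; exists (gamma b), (gamma d * a); split.
      by apply: good_denM; [exact: good_den_gamma | exact: (good_den_a n 0)].
    by rewrite /= (frac_mapE gamma_inj) ?(good_den_neq0 gd) // -mulrA -invfM -tofracM.
- by exists 1, 1; rewrite tofrac1 divr1; split=> //; exact: good_den1.
- rewrite -[1]tofrac1 iter_tt_frac //; exists (iter n.+1 gamma 1), (iter n.+1 gamma g * anorm n.+1).
  by split=> //; apply: good_denM; [exact: good_den_g | exact: good_den_anorm].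
rewrite -[1]tofrac1 iter_tt_frac // iter_rmorph1 => /eqP.
have d0 := good_den_neq0 gd.
rewrite eqr_div ?tofrac_eq0 ?mulf_neq0 ?iter_gamma_neq0 ?anorm_neq0 //.
rewrite -!tofracM mul1r tofrac_eq => /eqP dE.
have /negP[] := gd.2 n (leqnn n).
by rewrite dE !iter_rmorphM !rmorphM (iter_can n gammaK) eg mul0r mulr0.
Qed.

(** Essentiality is clear, as multiplying a fraction by its denominator lands in B, inside 1.S. The
    failure of the Artinian condition is witnessed by the submodules generated by 1 and
    theta^n(1/g). *)
Theorem frac_bad_ext : bad_ext alpha (fun r => psi r = 0).
Proof.
have sV := unit_sub_simple; have sM := ginv_sub_tsub.
pose j (v : sub_tmod unit_sub_tsub) : sub_tmod sM := tsubin sM (unit_sub_ginv (smvalP v)).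
pose g1 : sub_tmod sM := tsubin sM (fun P _ h => h : P (1 / g%:F)).
have g1n n : smval (iter n (@tt _ _ _) g1) = iter n (@tt _ _ F) (1 / g%:F).
  by elim: n => // n IH; rewrite !iterS -IH.
have jh : thom j by split=> *; apply: smval_inj.
exists (sub_tmod unit_sub_tsub), (sub_tmod sM), j; split; split=> //.
- by move=> x y /(f_equal (@smval _ _ _ _ _)) exy; apply: smval_inj.
- move=> P [P0 PB PR PT] [x [Px x0]].
  have [[b d] /= [d0 xE]] := fracP (smval x).
  have bV : unit_sub b%:F by exists 0%N, b; rewrite /anorm big_ord0 tofrac1 divr1.
  exists (tsubin unit_sub_tsub bV).
  have [r rE] := psi_surj d.
  have -> : j (tsubin unit_sub_tsub bV) = rho x r.
    by apply: smval_inj; rewrite /= -/(smval x) xE rE divfK // tofrac_eq0.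
  split; last exact: PR.
  apply: contraNneq x0 => e1; have /eqP := f_equal (@smval _ _ _ _ sM) e1.
  rewrite /= -/(smval x) rE mulf_eq0 tofrac_eq0 (negPf d0) orbF => /eqP e0.
  by apply/eqP; apply: (@smval_inj _ _ _ _ sM); rewrite -[RHS]/(0 : {fraction B}).
- split; first by split.
  exists [:: g1]; split=> // P sP Pg x _; case: (sP) => P0 PB PR PT.
  have [||y Py exy] := smvalP x (fun f => exists2 y, P y & f = smval y).
    split.
    + by exists 0.
    + by move=> _ _ [y Py ->] [z Pz ->]; exists (y - z) => //; exact: PB.
    + by move=> _ r [y Py ->]; exists (rho y r) => //; exact: PR.
    + by move=> _ [y Py ->]; exists (tt y) => //; exact: PT.
    by exists g1 => //; apply: Pg; rewrite inE.
  by rewrite (smval_inj exy).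
- move=> art.
  (* The submodule generated by 1 and theta^n(1/g), described as an intersection. *)
  pose Pn n (x : sub_tmod sM) := forall Q : F -> Prop, tsub Q -> Q 1 ->
    Q (iter n (@tt _ _ F) (1 / g%:F)) -> Q (smval x).
  have [n|//|n x Px|n0 st] := art Pn.
  + split=> [|x y Hx Hy|x r Hx|x Hx] Q sQ Q1 Qg; case: (sQ) => Q0 QB QR QT //.
    * by apply: QB; [apply: Hx | apply: Hy].
    * by apply: QR; apply: Hx.
    * by apply: QT; apply: Hx.
  + move=> Q sQ Q1 Qg; apply: Px => //.
    by case: sQ => _ _ _ QT; exact: QT.
  apply: (@ginv_chain_strict n0 (fun f => exists2 x, Pn n0.+1 x & f = smval x)).
    by move=> Q sQ Q1 Qg _ [x Px ->]; exact: Px.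
  exists (iter n0 (@tt _ _ _) g1); last by rewrite g1n.
  apply/(st n0.+1 (leqnSn _)) => Q sQ Q1 Qg.
  by rewrite g1n.
- by move=> r r0 m; apply: smval_inj; rewrite /= r0 tofrac0 mulr0.
- exists (tsubin unit_sub_tsub unit_sub1); apply/eqP => e1.
  have /eqP := f_equal (@smval _ _ _ _ unit_sub_tsub) e1.
  rewrite /= -tofrac1 (frac_map_tofrac gamma_inj) rmorph1 tofrac1 mul1r.
  by rewrite invr_eq0 tofrac_eq0 (negPf a0).
Qed.
End FracModule.

(** * Induction from a power of the automorphism *)

Section Induced.
Variables (A : comNzRingType) (alpha alphaN : {rmorphism A -> A}) (n : nat).
Hypothesis alphaNE : forall r, alphaN r = iter n.+1 alpha r.
Hypothesis alpha_surj : forall r, exists r', alpha r' = r.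

Section Ind.
Variable M : tmod alphaN.
Local Notation T := {ffun 'I_n.+1 -> M}.

Let ind_rho (f : T) (r : A) : T := [ffun i : 'I_n.+1 => rho (f i) (iter i alpha r)].
Let ind_tt (f : T) : T :=
  [ffun i : 'I_n.+1 => if i == 0%N :> nat then tt (f ord_max) else f (inord i.-1)].

(* The i-th component is the summand M theta^i of the module induced along
   A[theta^(n+1)] in A[theta]. *)
Definition ind_tmod : tmod alpha.
refine (@Tmod A alpha T ind_rho ind_tt _ _ _ _ _ _).
- by move=> r x y; apply/ffunP=> i; rewrite !ffunE rhoDl.
- by move=> x r s; apply/ffunP=> i; rewrite !ffunE iter_rmorphD rhoDr.
- by move=> x r s; apply/ffunP=> i; rewrite !ffunE iter_rmorphM rhoM.
- by move=> x; apply/ffunP=> i; rewrite !ffunE iter_rmorph1 rho1.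
- by move=> x y; apply/ffunP=> i; rewrite !ffunE; case: ifP => _ //; rewrite ttD.
- move=> x r; apply/ffunP=> -[i lti]; rewrite !ffunE /=; case: eqP => [->|i0] /=.
    by rewrite -tt_rho alphaNE -iterSr.
  have i1 : (0 < i)%N by lia.
  by rewrite -iterSr inordK ?prednK //; lia.
Defined.

Definition delta (i : 'I_n.+1) (m : M) : ind_tmod := [ffun j => if j == i then m else 0].

Lemma deltaB i m m' : delta i (m - m') = delta i m - delta i m'.
Proof. by apply/ffunP=> j; rewrite !ffunE; case: ifP => // _; rewrite subr0. Qed.
Lemma delta0 i : delta i 0 = 0.
Proof. by apply/ffunP=> j; rewrite !ffunE; case: ifP. Qed.
Lemma delta_rho i m r : rho (delta i m) r = delta i (rho m (iter i alpha r)).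
Proof.
apply/ffunP=> j; rewrite !ffunE; case: eqP => [-> //|_]; exact: (@rho0l _ alphaN M).
Qed.
Lemma delta_tt_lt (i : 'I_n.+1) (lt_i : (i.+1 < n.+1)%N) m :
  tt (delta i m) = delta (Ordinal lt_i) m.
Proof.
apply/ffunP=> -[j ltj]; rewrite !ffunE -!(inj_eq val_inj) /=.
case: eqP => [->|j0] /=.
  rewrite ifN; last by move: lt_i; case: i => i /= ?; lia.
  exact: (@tt0 _ alphaN M).
rewrite inordK; last lia.
by congr (if _ then _ else _); move: lt_i; case: i => i /= ?; lia.
Qed.
Lemma delta_tt_max m : tt (delta ord_max m) = delta ord0 (tt m).
Proof.
apply/ffunP=> -[j ltj]; rewrite !ffunE -!(inj_eq val_inj) /= eqxx; case: eqP => // j0.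
by rewrite inordK; [case: eqP => //; lia | lia].
Qed.
Lemma delta_sum (f : ind_tmod) : f = \sum_i delta i (f i).
Proof.
apply/ffunP=> j; rewrite sum_ffunE (bigD1 j) //= ffunE eqxx big1 ?addr0 // => i ij.
by rewrite ffunE eq_sym (negPf ij).
Qed.

Lemma iter_delta k (i : 'I_n.+1) (lt : (i + k < n.+1)%N) m :
  iter k (@tt _ _ ind_tmod) (delta i m) = delta (Ordinal lt) m.
Proof.
elim: k lt => [|k IH] lt; first by rewrite /=; congr delta; apply: val_inj; rewrite /= addn0.
have lt' : (i + k < n.+1)%N by lia.
rewrite iterS (IH lt').
have lt2 : ((Ordinal lt').+1 < n.+1)%N by rewrite /= -addnS.
by rewrite (delta_tt_lt lt2); congr delta; apply: val_inj; rewrite /= addnS.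
Qed.

Lemma iter_delta_full (i : 'I_n.+1) m :
  iter n.+1 (@tt _ _ ind_tmod) (delta i m) = delta i (tt m).
Proof.
have le : (i <= n)%N by rewrite -ltnS.
have -> : n.+1 = (i + (1 + (n - i)))%N by lia.
have lt : (i + (n - i) < n.+1)%N by lia.
rewrite !iterD (iter_delta lt) (_ : Ordinal lt = ord_max); last by apply: val_inj; rewrite /= subnKC.
rewrite -[iter 1 _ _]/(tt (delta ord_max m)) delta_tt_max; have lt2 : (@ord0 n + i < n.+1)%N by rewrite add0n.
by rewrite (iter_delta lt2); congr delta; apply: val_inj.
Qed.

Lemma delta_tsub (P : ind_tmod -> Prop) i : tsub P -> tsub (fun m => P (delta i m)).
Proof.
move=> sP; case: (sP) => P0 PB PR PT; split.
- by rewrite delta0.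
- by move=> x y Px Py; rewrite deltaB; apply: PB.
- move=> x r Px.
  have [r' <-] : exists r', iter i alpha r' = r.
    elim: (i : nat) r => [|k IH] r; first by exists r.
    by have [s <-] := alpha_surj r; have [s' <-] := IH s; exists s'.
  by rewrite -delta_rho; apply: PR.
- by move=> x Px; rewrite -iter_delta_full; apply: tsub_iter.
Qed.
End Ind.

Variables (Q : A -> Prop) (eps : 'I_n.+1 -> A).
Hypothesis epsQ : forall i j : 'I_n.+1, Q (iter j alpha (eps i) - (j == i)%:R).

(** On the j-th component a ring element acts through alpha^j, so by [epsQ] the element [eps i] acts
    as the projection on the i-th component. Submodules of the induced module thus split into
    components, and theta carries each component to the next. *)
Theorem bad_ext_ind : bad_ext alphaN Q -> bad_ext alpha (fun _ => False).
Proof.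
case=> V [M [j [[sV hj ij ej] [fM aM QM [v0 tv0]]]]].
case: (hj) => jD jR jT.
have QV r : Q r -> forall v : V, rho v r = 0.
  by move=> Qr v; apply: ij; rewrite jR (thom0 hj) QM.
have comp (N : tmod alphaN) (QN : forall r, Q r -> forall m : N, rho m r = 0)
    (f : ind_tmod N) i : rho f (eps i) = delta i (f i).
  apply/ffunP=> k; rewrite !ffunE.
  have := QN _ (epsQ i k) (f k); rewrite rhoBr => /eqP; rewrite subr_eq0 => /eqP ->.
  by case: eqP => [->|_]; [exact: rho1 | exact: rho0].
pose J (f : ind_tmod V) : ind_tmod M := [ffun i => j (f i)].
exists (ind_tmod V), (ind_tmod M), J; split; split.
- split.
    exists (delta ord0 v0); apply/eqP=> /ffunP /(_ ord0); rewrite !ffunE eqxx => v00.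
    by rewrite v00 tt0 eqxx in tv0.
  move=> P sP; case: (sP) => P0 PB PR PT.
  case: (pselect (exists f i, P f /\ f i != 0)) => [[f [i [Pf fi0]]]|no]; last first.
    left=> f Pf; apply/ffunP=> i; rewrite ffunE; apply: contrapT => /eqP fi.
    by apply: no; exists f, i.
  right.
  have full k : (exists m, P (delta k m) /\ m != 0) -> forall m, P (delta k m).
    move=> [m [Pm m0]]; have [z|//] := sV.2 _ (delta_tsub k sP).
    by rewrite (z m Pm) eqxx in m0.
  have Pi : forall m, P (delta i m).
    by apply: full; exists (f i); split=> //; rewrite -(comp V QV); apply: PR.
  have Pmax : forall m, P (delta ord_max m).
    move=> m; have le : (i <= n)%N by rewrite -ltnS.
    have lt : (i + (n - i) < n.+1)%N by lia.
    rewrite (_ : ord_max = Ordinal lt); last by apply: val_inj; rewrite /= subnKC.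
    by rewrite -iter_delta; apply: tsub_iter.
  (* The last component wraps around to component 0 through [tt]; the vector with [tt v0] non-zero
     ensures that something non-zero arrives there. *)
  have P00 : forall m, P (delta ord0 m).
    by apply: full; exists (tt v0); split=> //; rewrite -delta_tt_max; apply: PT.
  move=> g; rewrite (delta_sum g); apply: tsub_sum => // k _.
  have lt : (@ord0 n + k < n.+1)%N by rewrite add0n.
  rewrite (_ : k = Ordinal lt); last by apply: val_inj.
  by rewrite -iter_delta; apply: tsub_iter.
- split=> [x y|x r|x]; apply/ffunP=> i; rewrite !ffunE ?jD ?jR //.
  by case: ifP => _; rewrite ?jT.
- by move=> x y /ffunP e; apply/ffunP=> i; apply: ij; have := e i; rewrite !ffunE.
- move=> P sP [f [Pf f0]]; case: (sP) => P0 PB PR PT.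
  have [i fi0] : exists i, f i != 0.
    apply: contrapT => no; move/eqP: f0; apply; apply/ffunP=> i; rewrite ffunE.
    by apply: contrapT => /eqP fi; apply: no; exists i.
  have [|v [jv Pv]] := ej _ (delta_tsub i sP).
    by exists (f i); split=> //; rewrite -(comp M QM); apply: PR.
  exists (delta i v).
  have -> : J (delta i v) = delta i (j v).
    by apply/ffunP => k; rewrite !ffunE; case: ifP => // _; exact: (thom0 hj).
  split=> //; apply/eqP=> /ffunP /(_ i); rewrite !ffunE eqxx => jv0.
  by rewrite jv0 eqxx in jv.
- split; first by split.
  have [_ [l [_ lP]]] := fM.
  exists (map (delta ord0) l); split=> // P sP Pl f _.
  rewrite (delta_sum f); apply: tsub_sum => // k _.
  have lt : (@ord0 n + k < n.+1)%N by rewrite add0n.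
  rewrite (_ : k = Ordinal lt); last by apply: val_inj.
  rewrite -iter_delta; apply: tsub_iter => //.
  apply: (lP (fun m => P (delta ord0 m))) => //; first exact: delta_tsub.
  by move=> x xl; apply: Pl; apply: map_f.
- move=> art; apply: aM => P sP _ dP.
  have [|||n0 st] := art (fun k f => forall i, P k (f i)) => //.
  + move=> k; case: (sP k) => P0 PB PR PT; split=> [i|x y Px Py i|x r Px i|x Px i]; rewrite ffunE //.
    * by rewrite ffunE; apply: PB.
    * exact: PR.
    * by case: ifP => _ //; exact: PT.
  + by move=> k f Pf i; apply: dP.
  exists n0 => k le x; have [h1 h2] := st k le (delta ord0 x); split=> Px.
    have := h1 _ ord0; rewrite ffunE eqxx; apply=> i; rewrite ffunE; case: ifP => // _.
    by case: (sP k).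
  have := h2 _ ord0; rewrite ffunE eqxx; apply=> i; rewrite ffunE; case: ifP => // _.
  by case: (sP n0).
- by [].
- exists (delta ord_max v0); rewrite delta_tt_max; apply/eqP=> /ffunP /(_ ord0).
  by rewrite !ffunE eqxx => v00; rewrite v00 eqxx in tv0.
Qed.
End Induced.

(** * Chain conditions *)

Section ChainConditions.
Variable X : zmodType.
Implicit Types (Om : (X -> X) -> Prop) (P Q L : X -> Prop).

(** Chain conditions are stated for subgroups stable under a family of operators, so that the same
    lemmas serve vector subspaces, R-modules, modules over the skew ring and Rees modules. *)
Definition osub Om P : Prop :=
  [/\ P 0, forall x y, P x -> P y -> P (x - y) & forall w x, Om w -> P x -> P (w x)].

Definition acc Om Q : Prop := forall L : nat -> X -> Prop,
  (forall n, osub Om (L n)) -> (forall n x, L n x -> Q x) ->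
  (forall n x, L n x -> L n.+1 x) ->
  exists n0, forall n, (n0 <= n)%N -> forall x, L n x -> L n0 x.

Definition dcc Om Q : Prop := forall L : nat -> X -> Prop,
  (forall n, osub Om (L n)) -> (forall n x, L n x -> Q x) ->
  (forall n x, L n.+1 x -> L n x) ->
  exists n0, forall n, (n0 <= n)%N -> forall x, L n0 x -> L n x.

Lemma osubD Om P x y : osub Om P -> P x -> P y -> P (x + y).
Proof.
case=> P0 PB _ Px Py; rewrite -[y]opprK; apply: (PB) => //.
by rewrite -sub0r; apply: PB.
Qed.

Lemma osubI Om P Q : osub Om P -> osub Om Q -> osub Om (fun x => P x /\ Q x).
Proof.
move=> [P0 PB PO] [Q0 QB QO]; split=> // [x y [? ?] [? ?]|w x Ow [? ?]]; split.
- exact: PB.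
- exact: QB.
- exact: PO.
- exact: QO.
Qed.

Lemma chain_le (L : nat -> X -> Prop) m n : (forall n x, L n x -> L n.+1 x) -> (m <= n)%N ->
  forall x, L m x -> L n x.
Proof.
move=> mono le; rewrite -(subnK le); elim: (n - m)%N => [|k IH] x Lx //.
by rewrite addSn; apply: mono; apply: IH.
Qed.

Lemma chain_ge (L : nat -> X -> Prop) m n : (forall n x, L n.+1 x -> L n x) -> (m <= n)%N ->
  forall x, L n x -> L m x.
Proof.
move=> mono le; rewrite -(subnK le); elim: (n - m)%N => [|k IH] x Lx //.
by apply: IH; apply: mono; rewrite -addSn.
Qed.

Lemma acc_sub Om Om' Q Q' : (forall P, osub Om' P -> osub Om P) ->
  (forall x, Q' x -> Q x) -> acc Om Q -> acc Om' Q'.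
Proof.
move=> sO QQ aQ L sL LQ mL; apply: aQ => // n; first exact: sO.
by move=> x /LQ /QQ.
Qed.

Lemma dcc_sub Om Q Q' : (forall x, Q' x -> Q x) -> dcc Om Q -> dcc Om Q'.
Proof. by move=> QQ aQ L sL LQ mL; apply: aQ => // n x /LQ /QQ. Qed.

Lemma prop_mono_stable (b : nat -> Prop) : (forall n, b n -> b n.+1) ->
  exists n0, forall n, (n0 <= n)%N -> b n -> b n0.
Proof.
move=> mono; case: (pselect (exists n, b n)) => [[n0 bn]|no]; first by exists n0.
by exists 0%N => n _ bn; case: no; exists n.
Qed.

Lemma prop_anti_stable (b : nat -> Prop) : (forall n, b n.+1 -> b n) ->
  exists n0, forall n, (n0 <= n)%N -> b n0 -> b n.
Proof.
move=> mono; case: (pselect (exists n, ~ b n)) => [[n0 bn]|no]; first by exists n0.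
by exists 0%N => n _ _; apply: contrapT => nb; apply: no; exists n.
Qed.

Section Line.
Variables (K : fieldType) (sc : K -> X -> X) (Om : (X -> X) -> Prop).
Hypothesis sc1 : forall x, sc 1 x = x.
Hypothesis scM : forall c d x, sc c (sc d x) = sc (c * d) x.
Hypothesis scD : forall c x y, sc c (x + y) = sc c x + sc c y.
Hypothesis sc0 : forall x, sc 0 x = 0.
Hypothesis OmK : forall c, Om (sc c).
Variables (Q : X -> Prop) (e : X).
Hypothesis sQ : osub Om Q.

(** Modulo Q only the line of e remains: L and a larger L' coincide once they have the same trace on
    Q and agree on whether they meet the coset Q + e. *)
Lemma line_eq (L L' : X -> Prop) : osub Om L -> osub Om L' -> (forall x, L x -> L' x) ->
  (forall x, L' x -> exists q c, Q q /\ x = q + sc c e) ->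
  (forall x, Q x -> L' x -> L x) ->
  ((exists q, Q q /\ L' (q + e)) -> exists q, Q q /\ L (q + e)) ->
  forall x, L' x -> L x.
Proof.
move=> sL sL' LL' L'Q QL eL x L'x; have [q [c [Qq xE]]] := L'Q x L'x.
case: (sQ) (sL) (sL') => Q0 QB QO [L0 LB LO] [L'0 L'B L'O].
case: (eqVneq c 0) => [c0|c0].
  by apply: QL => //; rewrite xE c0 sc0 addr0.
have [|q' [Qq' Lq']] := eL.
  exists (sc c^-1 q); split; first exact: QO.
  by have := L'O _ _ (OmK c^-1) L'x; rewrite xE scD scM mulVf // sc1.
have Lc : L (sc c (q' + e)) by apply: LO.
rewrite -(subrK (sc c (q' + e)) x); apply: (osubD sL) => //.
apply: QL; last by apply: L'B => //; apply: LL'.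
rewrite xE scD opprD addrACA subrr addr0; apply: QB => //; exact: QO.
Qed.

Lemma acc_line : acc Om Q -> acc Om (fun x => exists q c, Q q /\ x = q + sc c e).
Proof.
move=> aQ L sL LQ mL.
have [n1 n1P] := aQ (fun n x => Q x /\ L n x) (fun n => osubI sQ (sL n))
  (fun n x h => h.1) (fun n x h => conj h.1 (mL n x h.2)).
have [|n2 n2P] := @prop_mono_stable (fun n => exists q, Q q /\ L n (q + e)).
  by move=> n [q [Qq Lq]]; exists q; split=> //; apply: mL.
exists (maxn n1 n2) => n le; apply: (@line_eq (L (maxn n1 n2)) (L n)) => //.
- exact: (chain_le mL le).
- by move=> x /LQ.
- move=> x Qx Lx; have [|_] := n1P n _ x (conj Qx Lx); first lia.
  by apply: chain_le => //; lia.
- move=> h; have [|q [Qq Lq]] := n2P n _ h; first lia.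
  by exists q; split=> //; apply: (chain_le mL) Lq; lia.
Qed.
End Line.

Lemma acc0 Om : acc Om (fun x => x = 0).
Proof. by move=> L sL L0 _; exists 0%N => n _ x /L0 ->; case: (sL 0%N). Qed.
Lemma dcc0 Om : dcc Om (fun x => x = 0).
Proof. by move=> L sL L0 _; exists 0%N => n _ x /L0 ->; case: (sL n). Qed.

Section HilbertStep.
Variables (Om : (X -> X) -> Prop) (T : X -> X) (P : X -> Prop).
Hypothesis TD : forall x y, T (x + y) = T x + T y.
Hypothesis OmD : forall w, Om w -> forall x y, w (x + y) = w x + w y.
Hypothesis sP : osub Om P.
Hypothesis swapl : forall w, Om w -> exists2 w', Om w' & forall x, w (T x) = T (w' x).
Hypothesis swapr : forall w', Om w' -> exists2 w, Om w & forall x, w (T x) = T (w' x).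

(** Polynomials of degree less than n in the operator T, with coefficients in P. *)
Definition tspan n (x : X) : Prop :=
  exists2 p : nat -> X, (forall i, P (p i)) & x = \sum_(i < n) iter i T (p i).
Definition tclosure (x : X) : Prop := exists n, tspan n x.
Definition addop : (X -> X) -> Prop := fun w => Om w \/ w = T.

Let P0 : P 0. Proof. by case: sP. Qed.
Let T0 : T 0 = 0. Proof. by apply: (addrI (T 0)); rewrite -TD !addr0. Qed.
Let iT n : {morph iter n T : x y / x + y}. Proof. exact: iter_morphD. Qed.
Let iT0 n : iter n T 0 = 0. Proof. by elim: n => //= n ->. Qed.
Let w0 w : Om w -> w 0 = 0.
Proof. by move=> Ow; apply: (addrI (w 0)); rewrite -(OmD Ow) !addr0. Qed.
Let TN x : T (- x) = - T x.
Proof. by apply: (addrI (T x)); rewrite -TD !subrr T0. Qed.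
Let iTN n x : iter n T (- x) = - iter n T x.
Proof. by elim: n => //= n ->; rewrite TN. Qed.

Let swapl_n n w : Om w -> exists2 w', Om w' & forall x, w (iter n T x) = iter n T (w' x).
Proof.
elim: n w => [|n IH] w Ow; first by exists w.
have [w' Ow' e] := swapl Ow; have [w'' Ow'' e'] := IH _ Ow'.
by exists w'' => // x; rewrite iterS e e'.
Qed.
Let swapr_n n w' : Om w' -> exists2 w, Om w & forall x, w (iter n T x) = iter n T (w' x).
Proof.
elim: n w' => [|n IH] w Ow; first by exists w.
have [w' Ow' e] := IH _ Ow; have [w'' Ow'' e'] := swapr Ow'.
by exists w'' => // x; rewrite iterS e' e.
Qed.

Lemma tspanS n x : tspan n.+1 x <-> exists p q, [/\ P p, tspan n q & x = q + iter n T p].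
Proof.
split=> [[p Pp ->]|[p [q [Pp [p' Pp' ->] ->]]]].
  exists (p n), (\sum_(i < n) iter i T (p i)); rewrite big_ord_recr; split=> //.
  by exists p.
exists (fun i => if (i < n)%N then p' i else p); first by move=> i; case: ifP.
rewrite big_ord_recr /= ltnn; congr (_ + _).
by apply: eq_bigr => i _; rewrite ltn_ord.
Qed.

Lemma tspan_osub n : osub Om (tspan n).
Proof.
case: (sP) => _ PB PO; elim: n => [|n [IH0 IHB IHO]].
  have e x : tspan 0 x <-> x = 0.
    by split=> [[p _ ->]|->]; [rewrite big_ord0 | exists (fun _ => 0); rewrite ?big_ord0].
  split=> [|x y /e -> /e ->|w x Ow /e ->]; apply/e; rewrite ?subr0 //; exact: w0.
split=> [|x y /tspanS [p [q [Pp sq ->]]] /tspanS [p' [q' [Pp' sq' ->]]]|w x Ow /tspanS [p [q [Pp sq ->]]]]; apply/tspanS.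
- by exists 0, 0; rewrite iT0 addr0.
- exists (p - p'), (q - q'); split; [exact: PB | exact: IHB |].
  by rewrite iT iTN opprD addrACA.
- have [w' Ow' e] := swapl_n n Ow; exists (w' p), (w q); split; [exact: PO | exact: IHO |].
  by rewrite (OmD Ow) e.
Qed.

Lemma tspan_T n x : tspan n x -> tspan n.+1 (T x).
Proof.
elim: n x => [|n IH] x; last first.
  move=> /tspanS [p [q [Pp sq ->]]]; apply/tspanS; exists p, (T q); split=> //; exact: IH.
case=> p _ ->; rewrite big_ord0 T0.
by case: (tspan_osub 1).
Qed.

Lemma tspan_le m n x : (m <= n)%N -> tspan m x -> tspan n x.
Proof.
move=> le; rewrite -(subnK le); elim: (n - m)%N => // k IH sx.
rewrite addSn; apply/tspanS; exists 0, x; split=> //; last by rewrite iT0 addr0.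
exact: IH.
Qed.

Lemma tclosure_osub : osub addop tclosure.
Proof.
split.
- by exists 0%N; case: (tspan_osub 0).
- move=> x y [n sx] [m sy]; exists (maxn n m); case: (tspan_osub (maxn n m)) => _ h _.
  by apply: h; [apply: tspan_le sx; exact: leq_maxl | apply: tspan_le sy; exact: leq_maxr].
- move=> w x [Ow [n sx]|-> [n sx]]; last by exists n.+1; apply: tspan_T.
  by exists n; case: (tspan_osub n) => _ _ h; apply: h.
Qed.

Lemma tclosure_incl x : P x -> tclosure x.
Proof. by move=> Px; exists 1%N; exists (fun _ => x) => //; rewrite big_ord1. Qed.

(** The leading coefficients, in degree n, of the elements of L. *)
Let lead (L : X -> Prop) n (p : X) := P p /\ exists q, tspan n q /\ L (q + iter n T p).

Let lead_osub L n : osub addop L -> osub Om (lead L n).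
Proof.
case: (sP) (tspan_osub n) => _ PB PO [S0 SB SO] [L0 LB LO]; split.
- by split=> //; exists 0; rewrite iT0 addr0.
- move=> x y [Px [q [sq Lq]]] [Py [q' [sq' Lq']]]; split; first exact: PB.
  exists (q - q'); split; first exact: SB.
  by rewrite iT iTN addrACA -opprD; apply: LB.
- move=> w' x Ow' [Px [q [sq Lq]]]; split; first exact: PO.
  have [w Ow e] := swapr_n n Ow'; exists (w q); split; first exact: SO.
  by rewrite -e -(OmD Ow); apply: LO => //; left.
Qed.

Let lead_S L n x : osub addop L -> lead L n x -> lead L n.+1 x.
Proof.
move=> [_ _ LO] [Px [q [sq Lq]]]; split=> //; exists (T q); split; first exact: tspan_T.
by rewrite iterS -TD; apply: LO => //; right.
Qed.

Let lead_eq L L' : osub addop L -> osub addop L' -> (forall x, L x -> L' x) ->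
  (forall n x, lead L' n x -> lead L n x) -> forall n x, tspan n x -> L' x -> L x.
Proof.
move=> sL sL' LL' ll; elim=> [|n IH] x sx L'x.
  by case: sx => p _ ->; rewrite big_ord0; case: sL.
have [p [q [Pp sq xE]]] := (tspanS n x).1 sx.
have [|_ [q' [sq' Lq']]] := ll n p; first by split=> //; exists q; rewrite -xE.
rewrite -(subrK (q' + iter n T p) x); apply: (osubD sL) => //; apply: IH.
  rewrite xE opprD addrACA subrr addr0.
  by case: (tspan_osub n) => _ h _; apply: h.
by case: (sL') => _ h _; apply: h => //; apply: LL'.
Qed.

(* The leading-coefficient argument of the Hilbert basis theorem. *)
Theorem acc_tclosure : acc Om P -> acc addop tclosure.
Proof.
move=> aP L sL LQ mL.
pose l k n := lead (L k) n.
have lk k n x : l k n x -> l k.+1 n x.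
  by move=> [Px [q [sq Lq]]]; split=> //; exists q; split=> //; apply: mL.
have ln k n x : l k n x -> l k n.+1 x by apply: lead_S.
have lkn k k' n n' x : (k <= k')%N -> (n <= n')%N -> l k n x -> l k' n' x.
  move=> lek len lx; apply: (@chain_le (fun n => l k' n) n n') => // [m y|].
    exact: ln.
  by apply: (@chain_le (fun k => l k n) k k') => // m y; exact: lk.
(* The diagonal chain settles all degrees beyond [k0] at once; the finitely many degrees below are
   then stabilised one at a time. *)
have [||k0 k0P] := aP (fun k => l k k) (fun k => lead_osub k (sL k)).
- by move=> k x [].
- by move=> k x /ln /lk.
have [m mP] : exists m, forall n, (n < k0)%N -> forall k, (m <= k)%N -> forall x, l k n x -> l m n x.
  elim: k0 {k0P} => [|b [m IH]]; first by exists 0%N.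
  have [||m' m'P] := aP (fun k => l k b) (fun k => lead_osub b (sL k)).
  - by move=> k x [].
  - by move=> k x /lk.
  exists (maxn m m') => n ltn k lek x lx.
  move: ltn; rewrite ltnS leq_eqVlt => /orP [/eqP e|ltn].
    rewrite e in lx *; apply: (@lkn m' _ b b) => //; first exact: leq_maxr.
    by apply: (m'P k) => //; lia.
  by apply: (@lkn m _ n n) => //; [exact: leq_maxl | apply: (IH n ltn k) => //; lia].
exists (maxn k0 m) => n len x Lx; have [d sx] := LQ n x Lx.
apply: (@lead_eq (L (maxn k0 m)) (L n) (sL _) (sL _) _ _ d) => //.
  exact: (chain_le mL len).
move=> b y ly; case: (ltnP b k0) => [ltb|leb].
  apply: (@lkn m _ b b) => //; first exact: leq_maxr.
  by apply: (mP b ltb n) => //; lia.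
apply: (@lkn k0 _ k0 b) => //; first exact: leq_maxl.
apply: (k0P (maxn n b)); first lia.
by apply: lkn ly; lia.
Qed.
End HilbertStep.
End ChainConditions.

Definition fam_op (X I : Type) (w : I -> X -> X) : (X -> X) -> Prop :=
  fun v => exists i, v = w i.

(** The minimum condition passes to extensions: in a descending chain both the part killed by f and
    the image under f become stationary, and these two determine the members of the chain. *)
Lemma dcc_ext (X Y : zmodType) (I : Type) (wX : I -> X -> X) (wY : I -> Y -> Y)
    (f : X -> Y) (Q : X -> Prop) (Q' : Y -> Prop) :
  (forall x y, f (x + y) = f x + f y) -> (forall i x, f (wX i x) = wY i (f x)) ->
  (forall i, wY i 0 = 0) -> (forall x, Q x -> Q' (f x)) ->
  dcc (fam_op wY) Q' -> dcc (fam_op wX) (fun x => Q x /\ f x = 0) -> dcc (fam_op wX) Q.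
Proof.
move=> fD fw w0 fQ dY dX L sL LQ mL.
have f0 : f 0 = 0 by apply: (addrI (f 0)); rewrite -fD !addr0.
have fB x y : f (x - y) = f x - f y by apply: (addIr (f y)); rewrite -fD !subrK.
have [||| n1 n1P] := dX (fun n x => L n x /\ f x = 0).
- move=> n; apply: osubI => //; split=> // [x y ex ey|w x [i ->] ex].
    by rewrite fB ex ey subr0.
  by rewrite fw ex w0.
- by move=> n x [Lx fx]; split=> //; apply: LQ Lx.
- by move=> n x [Lx fx]; split=> //; apply: mL.
have [||| n2 n2P] := dY (fun n y => exists2 x, L n x & y = f x).
- move=> n; case: (sL n) => L0 LB LO; split.
  + by exists 0.
  + by move=> _ _ [x Lx ->] [y Ly ->]; exists (x - y); [exact: LB | rewrite fB].
  + by move=> w _ [i ->] [x Lx ->]; exists (wX i x); [apply: LO => //; exists i | rewrite fw].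
- by move=> n _ [x Lx ->]; apply: fQ; apply: LQ Lx.
- by move=> n _ [x Lx ->]; exists x => //; apply: mL.
exists (maxn n1 n2) => n le x Lx.
have [||x' Lx' e] := n2P n _ (f x); first lia.
  by exists x => //; apply: (chain_ge mL) Lx; exact: leq_maxr.
have [||Ld _] := n1P n _ (x - x'); first lia.
  split; last by rewrite fB e subrr.
  case: (sL n1) => _ h _; apply: h; first by apply: (chain_ge mL) Lx; exact: leq_maxl.
  by apply: (chain_ge mL) Lx'; lia.
by rewrite -(subrK x' x); apply: (osubD (sL n)).
Qed.

Lemma dcc_line (X : zmodType) (K : fieldType) (sc : K -> X -> X) (e : X) :
  (forall c d x, sc c (sc d x) = sc (c * d) x) -> (forall x, sc 0 x = 0) ->
  dcc (fam_op sc) (fun x => exists c, x = sc c e).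
Proof.
move=> scM sc0 L sL LQ mL.
have [|n1 n1P] := @prop_anti_stable (fun n => exists2 c, c != 0 & L n (sc c e)).
  by move=> n [c c0 Lc]; exists c => //; apply: mL.
exists n1 => n le x Lx; have [c xE] := LQ _ _ Lx.
case: (sL n) => L0 _ LO; case: (eqVneq c 0) => [c0|c0]; first by rewrite xE c0 sc0.
have [|d d0 Ld] := n1P n le; first by exists c => //; rewrite -xE.
have /= := LO (sc (c / d)) _ (ex_intro _ (c / d) erefl) Ld.
by rewrite scM divfK // -xE.
Qed.

(** * Noetherianity and the Artin-Rees property *)

Definition inseq (X : eqType) (l : seq X) (x : X) : Prop := x \in l.

Section Closure.
Variable X : zmodType.
Implicit Types (Om : (X -> X) -> Prop) (P Q : X -> Prop).

Definition oclos Om P (x : X) : Prop := forall Q, osub Om Q -> (forall y, P y -> Q y) -> Q x.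

Lemma oclos_osub Om P : osub Om (oclos Om P).
Proof.
split=> [Q sQ PQ|x y Hx Hy Q sQ PQ|w x Ow Hx Q sQ PQ]; case: (sQ) => Q0 QB QO //.
- by apply: QB; [apply: Hx | apply: Hy].
- by apply: QO => //; apply: Hx.
Qed.

Lemma oclos_incl Om P x : P x -> oclos Om P x.
Proof. by move=> Px Q _; apply. Qed.

(** Otherwise one could forever choose an element of N outside what has been generated so far,
    producing a strictly increasing chain. *)
Lemma acc_fg Om Q N : acc Om Q -> osub Om N -> (forall x, N x -> Q x) ->
  exists l : seq X, (forall x, x \in l -> N x) /\ forall x, N x -> oclos Om (inseq l) x.
Proof.
move=> aQ sN NQ; apply: contrapT => no.
have ext (l : seq X) : exists y, (forall x, x \in l -> N x) -> N y /\ ~ oclos Om (inseq l) y.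
  case: (pselect (forall x, x \in l -> N x)) => [lN|nl]; last by exists 0 => /nl.
  apply: contrapT => no2; apply: no; exists l; split=> // x Nx.
  by apply: contrapT => nx; apply: no2; exists x.
pose f l := projT1 (cid (ext l)).
have fP l : (forall x, x \in l -> N x) -> N (f l) /\ ~ oclos Om (inseq l) (f l).
  by rewrite /f; case: cid.
pose s n := iter n (fun l => f l :: l) [::].
have sNn n : forall x, x \in s n -> N x.
  elim: n => [x|n IH x]; first by rewrite in_nil.
  by rewrite inE => /orP [/eqP ->|/IH //]; exact: (fP _ IH).1.
have [n||n x|n0 st] := aQ (fun n => oclos Om (inseq (s n))).
- exact: oclos_osub.
- move=> n x H; apply: NQ; apply: H => //; exact: sNn.
- by move=> H Q' sQ' PQ'; apply: H => // y ys; apply: PQ'; rewrite /inseq /= inE; apply/orP; right.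
have [_] := fP _ (sNn n0); apply; apply: (st n0.+1 (leqnSn _)).
by apply: oclos_incl; rewrite /inseq /= inE eqxx.
Qed.

Fixpoint inops (ws : seq (X -> X)) (w : X -> X) : Prop :=
  if ws is v :: ws' then v = w \/ inops ws' w else False.

Definition addops Om ws : (X -> X) -> Prop := fun w => Om w \/ inops ws w.

Lemma acc_eq Om Q Q' : (forall x, Q' x -> Q x) -> acc Om Q -> acc Om Q'.
Proof. exact: acc_sub. Qed.

Lemma acc_step Om T P : (forall x y, T (x + y) = T x + T y) ->
  (forall w, Om w -> forall x y, w (x + y) = w x + w y) -> osub Om P ->
  (forall w, Om w -> exists2 w', Om w' & forall x, w (T x) = T (w' x)) ->
  (forall w', Om w' -> exists2 w, Om w & forall x, w (T x) = T (w' x)) ->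
  acc Om P -> acc (addop Om T) (oclos (addop Om T) P).
Proof.
move=> TD OD sP sl sr aP; apply: acc_eq (acc_tclosure TD OD sP sl sr aP) => x Hx.
by apply: Hx => [|y Py]; [exact: tclosure_osub | exact: tclosure_incl].
Qed.

(** Hilbert's basis theorem, applied once for each of the commuting operators of [ws]. *)
Lemma acc_tower ws : forall Om P,
  (forall w, Om w \/ inops ws w -> forall x y, w (x + y) = w x + w y) ->
  (forall w v, Om w \/ inops ws w -> inops ws v -> forall x, w (v x) = v (w x)) ->
  osub Om P -> acc Om P -> acc (addops Om ws) (oclos (addops Om ws) P).
Proof.
elim: ws => [|T ws IH] Om P wD wC sP aP.
  have e Q : osub (addops Om [::]) Q -> osub Om Q.
    by case=> Q0 QB QO; split=> // w x Ow; apply: QO; left.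
  apply: (acc_sub e) aP => x; apply=> //.
  by case: sP => P0 PB PO; split=> // w x' [Ow|[]]; exact: PO.
have aT : acc (addop Om T) (oclos (addop Om T) P).
  apply: acc_step => //.
  - by apply: wD; right; left.
  - by move=> w Ow; apply: wD; left.
  - by move=> w Ow; exists w => // x; apply: (wC w T); [left | left].
  - by move=> w Ow; exists w => // x; apply: (wC w T); [left | left].
have e Q : osub (addops Om (T :: ws)) Q -> osub (addops (addop Om T) ws) Q.
  case=> Q0 QB QO; split=> // w x Ow; apply: QO.
  by case: Ow => [[Ow|->]|Iw]; [left | right; left | right; right].
apply: (acc_sub e) (IH _ _ _ _ (oclos_osub _ _) aT).
- move=> x Hx Q sQ PQ; apply: Hx; last by move=> y Py; apply: PQ; exact: oclos_incl.
  case: sQ => Q0 QB QO; split=> // w z Ow; apply: QO.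
  by case: Ow => [Ow|[<-|Iw]]; [left; left | left; right | right].
- by move=> w [[Ow|->]|Iw]; apply: wD; [left | right; left | right; right].
- move=> w v Ow Iv; apply: wC; last by right.
  by case: Ow => [[Ow|->]|Iw]; [left | right; left | right; right].
Qed.

Section Noeth.
Variables (K : fieldType) (sc : K -> X -> X).
Hypothesis sc1 : forall x, sc 1 x = x.
Hypothesis scM : forall c d x, sc c (sc d x) = sc (c * d) x.
Hypothesis scD : forall c x y, sc c (x + y) = sc c x + sc c y.
Hypothesis scDl : forall c d x, sc (c + d) x = sc c x + sc d x.

Let sc0 x : sc 0 x = 0.
Proof. by apply: (addrI (sc 0 x)); rewrite -scDl !addr0. Qed.
Let scN c x : sc (- c) x = - sc c x.
Proof. by apply: (addrI (sc c x)); rewrite -scDl !subrr sc0. Qed.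

Lemma acc_kspan (l : seq X) : acc (fam_op sc) (oclos (fam_op sc) (inseq l)).
Proof.
elim: l => [|e l IH].
  apply: acc_eq (@acc0 _ _) => x Hx; apply: (Hx (fun z => z = 0)) => //; split=> // [y z -> ->|w y [c ->] ->].
    by rewrite subr0.
  by apply: (addrI (sc c 0)); rewrite -scD !addr0.
have OmK c : fam_op sc (sc c) by exists c.
have sC := oclos_osub (fam_op sc) (inseq l).
apply: acc_eq (acc_line sc1 scM scD sc0 OmK (e := e) sC IH) => x Hx.
apply: (Hx (fun x => exists q c, oclos (fam_op sc) (inseq l) q /\ x = q + sc c e)).
  case: sC => C0 CB CO; split.
  - by exists 0, 0; rewrite sc0 addr0.
  - move=> _ _ [q [c [Cq ->]]] [q' [c' [Cq' ->]]]; exists (q - q'), (c - c'); split; first exact: CB.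
    by rewrite scDl scN opprD addrACA.
  - move=> w _ [d ->] [q [c [Cq ->]]]; exists (sc d q), (d * c); split; first exact: CO.
    by rewrite scD scM.
move=> y; rewrite /inseq /= inE => /orP [/eqP ->|yl]; first by exists 0, 1; rewrite sc1 add0r; split=> //; case: sC.
by exists y, 0; rewrite sc0 addr0; split=> //; exact: oclos_incl.
Qed.

Variables (ws : seq (X -> X)) (Om : (X -> X) -> Prop) (T : X -> X).
Hypothesis wsD : forall w, inops ws w -> forall x y, w (x + y) = w x + w y.
Hypothesis wsC : forall w v, inops ws w -> inops ws v -> forall x, w (v x) = v (w x).
Hypothesis wssc : forall w c, inops ws w -> forall x, sc c (w x) = w (sc c x).
Hypothesis OmE : forall Q, osub (addops (fam_op sc) ws) Q <-> osub Om Q.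
Hypothesis OmD : forall w, Om w -> forall x y, w (x + y) = w x + w y.
Hypothesis TD : forall x y, T (x + y) = T x + T y.
Hypothesis swapl : forall w, Om w -> exists2 w', Om w' & forall x, w (T x) = T (w' x).
Hypothesis swapr : forall w', Om w' -> exists2 w, Om w & forall x, w (T x) = T (w' x).

(** [OmE] reconciles two descriptions of the coefficients: the finite list [ws] allows Hilbert's
    theorem to be applied one operator at a time, while the twisted commutation with [T] holds for
    the full family [Om]. *)
Lemma acc_noeth (l : seq X) : acc (addop Om T) (oclos (addop Om T) (inseq l)).
Proof.
have aO : acc Om (oclos Om (inseq l)).
  have aW : acc (addops (fam_op sc) ws)
      (oclos (addops (fam_op sc) ws) (oclos (fam_op sc) (inseq l))).
    apply: (@acc_tower ws _ _ _ _ (oclos_osub _ _) (@acc_kspan l)).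
    - by move=> w [[c ->]|Iw]; [exact: scD | exact: wsD].
    - by move=> w v [[c ->]|Iw] Iv; [exact: wssc | exact: wsC].
  apply: (acc_sub _ _ aW) => [P /OmE //|x Hx Q sQ PQ].
  apply: Hx; first exact/OmE.
  by move=> y yl; apply: PQ; exact: oclos_incl.
apply: acc_eq (acc_step TD OmD (oclos_osub _ _) swapl swapr aO) => x Hx Q sQ PQ.
by apply: Hx => // y yl; apply: PQ; exact: oclos_incl.
Qed.
End Noeth.
End Closure.

Section Affine.
Variables (K : fieldType) (A : comNzRingType) (kc : {rmorphism K -> A}).
Variables (alpha alpha' : {rmorphism A -> A}).
Hypotheses (alphaK : cancel alpha alpha') (alpha'K : cancel alpha' alpha).
Hypothesis alpha_kc : forall c, alpha (kc c) = kc c.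
Variables (gx gy : A).
Hypothesis Agen : forall P : A -> Prop, (forall c, P (kc c)) ->
  (forall r s, P r -> P s -> P (r + s)) -> (forall r, P r -> P (r * gx)) ->
  (forall r, P r -> P (r * gy)) -> forall r, P r.

Section ModuleNoeth.
Variable E : tmod alpha.
Let sc c (x : E) := rho x (kc c).
Definition rho_op : (E -> E) -> Prop := fam_op (fun r (x : E) => rho x r).
Definition s_op := addop rho_op (@tt _ _ E).

Lemma s_opP P : osub s_op P <-> tsub P.
Proof.
split=> [[P0 PB PO]|[P0 PB PR PT]].
  split=> // [x r Px|x Px].
    by apply: (PO (fun x => rho x r)) => //; left; exists r.
  by apply: (PO (@tt _ _ E)) => //; right.
by split=> // w x [[r ->]|->] Px; [exact: PR | exact: PT].
Qed.

Lemma rho_gen (Q : E -> Prop) : (forall x y, Q x -> Q y -> Q (x + y)) ->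
  (forall c x, Q x -> Q (rho x (kc c))) -> (forall x, Q x -> Q (rho x gx)) ->
  (forall x, Q x -> Q (rho x gy)) -> forall r x, Q x -> Q (rho x r).
Proof.
move=> QD QK Qx Qy; apply: Agen.
- by move=> c x; apply: QK.
- by move=> r s Hr Hs x Px; rewrite rhoDr; apply: QD; [apply: Hr | apply: Hs].
- by move=> r Hr x Px; rewrite rhoM; apply: Qx; apply: Hr.
- by move=> r Hr x Px; rewrite rhoM; apply: Qy; apply: Hr.
Qed.

Theorem tmod_acc (l : seq E) : acc s_op (oclos s_op (inseq l)).
Proof.
apply: (@acc_noeth E K sc _ _ _ _ [:: (fun x => rho x gx); (fun x => rho x gy)]).
- by move=> x; rewrite /sc rmorph1 rho1.
- by move=> c d x; rewrite /sc -rhoM -rmorphM mulrC.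
- by move=> c x y; rewrite /sc rhoDl.
- by move=> c d x; rewrite /sc rmorphD rhoDr.
- by move=> w [<-|[<-|[]]] x y; rewrite rhoDl.
- by move=> w v [<-|[<-|[]]] [<-|[<-|[]]] x; rewrite // rhoAC.
- by move=> w c [<-|[<-|[]]] x; rewrite /sc rhoAC.
- move=> Q; split=> sQ; case: (sQ) => Q0 QB QO; split=> // w x.
    move=> [r ->] Qx; apply: rho_gen => //.
    + by move=> y z; exact: (osubD sQ).
    + by move=> c y Qy; apply: (QO (sc c)) => //; left; exists c.
    + by move=> y Qy; apply: (QO (fun x => rho x gx)) => //; right; left.
    + by move=> y Qy; apply: (QO (fun x => rho x gy)) => //; right; right; left.
  move=> [[c ->]|[<-|[<-|[]]]] Qx.
  + by apply: (QO (fun x => rho x (kc c))) => //; exists (kc c).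
  + by apply: (QO (fun x => rho x gx)) => //; exists gx.
  + by apply: (QO (fun x => rho x gy)) => //; exists gy.
- by move=> w [r ->] x y; rewrite rhoDl.
- exact: ttD.
- by move=> w [r ->]; exists (fun x => rho x (alpha r)); [exists (alpha r) | move=> x; rewrite tt_rho].
- move=> w [r ->]; exists (fun x => rho x (alpha' r)); first by exists (alpha' r).
  by move=> x; rewrite -tt_rho alpha'K.
Qed.

Lemma tfg_acc (N : E -> Prop) : tfg N -> acc s_op N.
Proof.
case=> sN [l [_ lP]]; apply: (acc_eq _ (@tmod_acc l)) => x Nx P sP PP.
by apply: lP Nx => //; apply/s_opP.
Qed.
End ModuleNoeth.
Arguments s_op : clear implicits.

(** With theta acting as zero, the submodules of A are its ideals, so Noetherianity of A is an
    instance of the result on modules. *)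
Definition reg_tmod : tmod alpha.
refine (@Tmod A alpha A (fun x r => x * r) (fun _ => 0) _ _ _ _ _ _).
- by move=> r x y; rewrite mulrDl.
- by move=> x r s; rewrite mulrDr.
- by move=> x r s; rewrite mulrA.
- by move=> x; rewrite mulr1.
- by move=> x y; rewrite addr0.
- by move=> x r; rewrite mul0r.
Defined.

Lemma ideal_tsub I : ideal I <-> @tsub _ _ reg_tmod I.
Proof. by split=> [[I0 IB IM]|[I0 IB IM IT]]; split. Qed.

Lemma reg_all : forall x : A, oclos (s_op reg_tmod) (inseq [:: (1 : reg_tmod)]) x.
Proof.
move=> x; rewrite -[x]mul1r; case: (oclos_osub (s_op reg_tmod) (inseq [:: (1 : reg_tmod)])) => _ _ h.
apply: (h (fun y => rho (y : reg_tmod) x)); first by left; exists x.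
by apply: oclos_incl; rewrite /inseq inE.
Qed.

Lemma ideal_acc (L : nat -> A -> Prop) : (forall n, ideal (L n)) ->
  (forall n x, L n x -> L n.+1 x) -> exists n0, forall n, (n0 <= n)%N -> forall x, L n x -> L n0 x.
Proof.
move=> iL mL; apply: (@tmod_acc reg_tmod [:: (1 : reg_tmod)] L) => //.
- by move=> n; apply/s_opP/ideal_tsub.
- by move=> n x _; exact: reg_all.
Qed.

Lemma ideal_fg (I : A -> Prop) : ideal I -> exists l : seq A, (forall g, g \in l -> I g) /\
  forall J, ideal J -> (forall g, g \in l -> J g) -> forall b, I b -> J b.
Proof.
move=> iI; have [||l [lI lP]] := acc_fg (@tmod_acc reg_tmod [:: (1 : reg_tmod)]) (N := I).
- exact: (proj2 (@s_opP reg_tmod _) (proj1 (ideal_tsub _) iI)).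
- by move=> x _; exact: reg_all.
exists l; split=> // J iJ lJ b Ib; apply: (lP b Ib) => //.
exact: (proj2 (@s_opP reg_tmod _) (proj1 (ideal_tsub _) iJ)).
Qed.

(** * The Artin-Rees property through the Rees module *)

Section ArtinRees.
Variables (E : tmod alpha) (I : A -> Prop).
Hypothesis iI : ideal I.
Hypotheses (I_alpha : forall b, I b -> I (alpha b)) (I_alpha' : forall b, I b -> I (alpha' b)).

Definition mulI (Q : E -> Prop) (x : E) : Prop :=
  forall P : E -> Prop, P 0 -> (forall x y, P x -> P y -> P (x - y)) ->
    (forall q b, Q q -> I b -> P (rho q b)) -> P x.

Lemma mulI_tsub Q : tsub Q -> tsub (mulI Q).
Proof.
move=> [Q0 QB QR QT]; split.
- by move=> P P0.
- by move=> x y Hx Hy P P0 PB PI; apply: (PB); [apply: Hx | apply: Hy].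
- move=> x r Hx P P0 PB PI; apply: (Hx (fun x => P (rho x r))).
  + by rewrite rho0l.
  + by move=> y z Py Pz; rewrite rhoBl; apply: PB.
  + by move=> q b Qq Ib; rewrite -rhoM mulrC rhoM; apply: PI => //; exact: QR.
- move=> x Hx P P0 PB PI; apply: (Hx (fun x => P (tt x))).
  + by rewrite tt0.
  + by move=> y z Py Pz; rewrite ttB; apply: PB.
  + by move=> q b Qq Ib; rewrite -[b]alpha'K tt_rho; apply: PI; [exact: QT | exact: I_alpha'].
Qed.

Variable N : E -> Prop.
Hypothesis fN : tfg N.

Definition npow n := iter n mulI N.
Lemma npow_tsub n : tsub (npow n).
Proof. by elim: n => [|n IH]; [case: fN | exact: mulI_tsub]. Qed.

Variable W : E -> Prop.
Hypotheses (sW : tsub W) (WI : forall x b, W x -> I b -> rho x b = 0).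

(** A sequence stands for the formal series of the e_i z^i. Here [mr r] multiplies by r, [mz b] by
    bz, [mT] applies theta coefficientwise, and [dl n x] is the monomial x z^n. *)
Let X := nat -> E.
Let sc c (e : X) : X := fun i => rho (e i) (kc c).
Let mr r (e : X) : X := fun i => rho (e i) r.
Let mz b (e : X) : X := fun i => if i is k.+1 then rho (e k) b else 0.
Let mT (e : X) : X := fun i => tt (e i).
Let dl n (x : E) : X := fun i => if i == n then x else 0.
Let Om : (X -> X) -> Prop := fun w => (exists r, w = mr r) \/ exists2 b, I b & w = mz b.

Let XD (e f : X) i : (e + f) i = e i + f i. Proof. by []. Qed.
Let XB (e f : X) i : (e - f) i = e i - f i. Proof. by []. Qed.
Let X0 i : (0 : X) i = 0. Proof. by []. Qed.

Let mrD r e f : mr r (e + f) = mr r e + mr r f.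
Proof. by apply/funext => i; rewrite /mr !XD rhoDl. Qed.
Let mzD b e f : mz b (e + f) = mz b e + mz b f.
Proof. by apply/funext => -[|i]; rewrite XD /mz ?addr0 // XD rhoDl. Qed.
Let mTD e f : mT (e + f) = mT e + mT f.
Proof. by apply/funext => i; rewrite /mT !XD ttD. Qed.

Lemma rees_acc (l : seq X) : acc (addop Om mT) (oclos (addop Om mT) (inseq l)).
Proof.
have [g [gI gP]] := ideal_fg iI.
pose zs := [seq mz b | b <- g].
have zsP w : inops zs w -> exists2 b, b \in g & w = mz b.
  rewrite /zs; elim: (g) => //= b g' IH [<-|/IH [b' b'g ->]].
    by exists b => //; rewrite inE eqxx.
  by exists b' => //; rewrite inE b'g orbT.
have inzs b : b \in g -> inops zs (mz b).
  rewrite /zs; elim: (g) => //= b' g' IH; rewrite inE => /orP [/eqP ->|/IH]; [by left | by right].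
have mzC b c e : mz b (mz c e) = mz c (mz b e).
  by apply/funext => -[|[|i]] /=; rewrite ?rho0l // rhoAC.
have mrz r b e : mr r (mz b e) = mz b (mr r e).
  by apply/funext => -[|i] /=; rewrite /mr /= ?rho0l // rhoAC.
have mrC r r' e : mr r (mr r' e) = mr r' (mr r e).
  by apply/funext => i; rewrite /mr rhoAC.
have scE c : sc c = mr (kc c) by [].
apply: (@acc_noeth X K sc _ _ _ _ [:: mr gx, mr gy & zs]).
- by move=> x; apply/funext => i; rewrite /sc rmorph1 rho1.
- by move=> c d x; apply/funext => i; rewrite /sc -rhoM -rmorphM mulrC.
- by move=> c x y; rewrite scE mrD.
- by move=> c d x; apply/funext => i; rewrite XD /sc rmorphD rhoDr.
- by move=> w [<-|[<-|/zsP [b _ ->]]] x y; rewrite ?mrD ?mzD.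
- move=> w v [<-|[<-|/zsP [b _ ->]]] [<-|[<-|/zsP [b' _ ->]]] x;
  first [by [] | exact: mrC | exact: mrz | exact/esym/mrz | exact: mzC].
- move=> w c [<-|[<-|/zsP [b _ ->]]] x; rewrite scE; first [exact: mrC | exact: mrz].
- move=> Q; split=> sQ; case: (sQ) => Q0 QB QO; split=> // w x.
    have Qmr : forall r (x : X), Q x -> Q (mr r x).
      apply: Agen.
      + by move=> c y Qy; apply: (QO (sc c)) => //; left; exists c.
      + move=> r s Hr Hs y Qy; rewrite (_ : mr (r + s) y = mr r y + mr s y).
          by apply: (osubD sQ); [apply: Hr | apply: Hs].
        by apply/funext => i; rewrite XD /mr rhoDr.
      + move=> r Hr y Qy; rewrite (_ : mr (r * gx) y = mr gx (mr r y)).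
          by apply: (QO (mr gx)); [right; left | exact: Hr].
        by apply/funext => i; rewrite /mr rhoM.
      + move=> r Hr y Qy; rewrite (_ : mr (r * gy) y = mr gy (mr r y)).
          by apply: (QO (mr gy)); [right; right; left | exact: Hr].
        by apply/funext => i; rewrite /mr rhoM.
    move=> [[r ->]|[b Ib ->]] Qx; first exact: Qmr.
    apply: (gP (fun b => forall x, Q x -> Q (mz b x))) Ib _ Qx.
      split.
      + move=> y Qy; rewrite (_ : mz 0 y = 0) //; apply/funext => -[|i] //=; exact: rho0.
      + move=> b1 b2 H1 H2 y Qy; rewrite (_ : mz (b1 - b2) y = mz b1 y - mz b2 y).
          by apply: QB; [apply: H1 | apply: H2].
        by apply/funext => -[|i]; rewrite XB /= ?subr0 ?rhoBr.
      + move=> b1 r H1 y Qy; rewrite (_ : mz (b1 * r) y = mr r (mz b1 y)).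
          by apply: Qmr; apply: H1.
        by apply/funext => -[|i]; rewrite /mr /= ?rho0l ?rhoM.
    by move=> b1 b1g y Qy; apply: (QO (mz b1)) => //; right; right; right; exact: inzs.
  move=> [[c ->]|[<-|[<-|/zsP [b bg ->]]]] Qx.
  + by apply: (QO (mr (kc c))) => //; left; exists (kc c).
  + by apply: (QO (mr gx)) => //; left; exists gx.
  + by apply: (QO (mr gy)) => //; left; exists gy.
  + by apply: (QO (mz b)) => //; right; exists b => //; apply: gI.
- by move=> w [[r ->]|[b Ib ->]] x y; rewrite ?mrD ?mzD.
- exact: mTD.
- move=> w [[r ->]|[b Ib ->]].
    exists (mr (alpha r)); first by left; exists (alpha r).
    by move=> x; apply/funext => i; rewrite /mr /mT tt_rho.
  exists (mz (alpha b)); first by right; exists (alpha b) => //; exact: I_alpha.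
  by move=> x; apply/funext => -[|i]; rewrite /mT /= ?tt0 ?tt_rho.
- move=> w [[r ->]|[b Ib ->]].
    exists (mr (alpha' r)); first by left; exists (alpha' r).
    by move=> x; apply/funext => i; rewrite /mr /mT -tt_rho alpha'K.
  exists (mz (alpha' b)); first by right; exists (alpha' b) => //; exact: I_alpha'.
  by move=> x; apply/funext => -[|i]; rewrite /mT /= ?tt0 // -tt_rho alpha'K.
Qed.

(** Inside the Noetherian Rees module generated by N, consider the sequences with entries in the
    intersections of N I^i with W, truncated at degree k. As I kills W, multiplication by bz
    annihilates them, so each truncation is a submodule; the increasing chain of truncations stops,
    which means that the intersection vanishes in some degree. *)
Theorem artin_rees : exists n, forall x, npow n x -> W x -> x = 0.
Proof.
case: (fN) => sN [l [lN lP]].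
pose C := oclos (addop Om mT) (inseq [seq dl 0 x | x <- l]).
have sC : osub (addop Om mT) C := oclos_osub _ _.
case: (sC) => C0 CB CO.
have dlB n x y : dl n (x - y) = dl n x - dl n y.
  by apply/funext => i; rewrite XB /dl; case: ifP => // _; rewrite subr0.
have dl0 n : dl n 0 = 0 by apply/funext => i; rewrite /dl; case: ifP.
have dlC n x : npow n x -> C (dl n x).
  elim: n x => [|n IH] x.
    apply: (lP (fun x => C (dl 0 x))); last first.
      by move=> y yl; apply: oclos_incl; apply: map_f.
    split=> [|y z Cy Cz|y r Cy|y Cy]; first by rewrite dl0.
    - by rewrite dlB; apply: CB.
    - rewrite (_ : dl 0 (rho y r) = mr r (dl 0 y)).
        by apply: CO => //; left; left; exists r.
      by apply/funext => i; rewrite /mr /dl; case: ifP => // _; rewrite rho0l.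
    - rewrite (_ : dl 0 (tt y) = mT (dl 0 y)); first by apply: CO => //; right.
      by apply/funext => i; rewrite /mT /dl; case: ifP => // _; rewrite tt0.
  move=> Hx; apply: (Hx (fun z => C (dl n.+1 z))); first by rewrite dl0.
    by move=> y z Cy Cz; rewrite dlB; apply: CB.
  move=> q b Nq Ib; rewrite (_ : dl n.+1 _ = mz b (dl n q)).
    by apply: CO; [left; right; exists b | exact: IH].
  by apply/funext => -[|i] //=; rewrite /dl eqSS; case: ifP => // _; rewrite rho0l.
pose L k (e : X) := (forall i, npow i (e i) /\ W (e i)) /\ forall i, (k <= i)%N -> e i = 0.
have [|||n0 st] := @rees_acc [seq dl 0 x | x <- l] L.
- move=> k; case: (sW) => W0 WB WR WT; split.
  + by split=> // i; split=> //; case: (npow_tsub i).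
  + move=> e f [He ze] [Hf zf]; split=> i => [|le]; last by rewrite XB ze // zf // subr0.
    have [n1 w1] := He i; have [n2 w2] := Hf i; case: (npow_tsub i) => _ h _ _.
    by split; [exact: h | exact: WB].
  + move=> w e [[[r ->]|[b Ib ->]]|->] [He ze].
    * split=> i => [|le]; last by rewrite /mr ze // rho0l.
      by have [n1 w1] := He i; case: (npow_tsub i) => _ _ h _; split; [exact: h | exact: WR].
    * have -> : mz b e = 0.
        by apply/funext => -[|i] //=; apply: WI => //; have [] := He i.
      by split=> // i; split=> //; case: (npow_tsub i).
    * split=> i => [|le]; last by rewrite /mT ze // tt0.
      by have [n1 w1] := He i; case: (npow_tsub i) => _ _ _ h; split; [exact: h | exact: WT].
- move=> k; elim: k => [|k IH] e [He ze].
    by rewrite (_ : e = 0) //; apply/funext => i; exact: ze.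
  rewrite -(subrK (dl k (e k)) e); apply: (osubD sC); last by apply: dlC; have [] := He k.
  apply: IH; split=> i => [|le]; rewrite XB /dl; case: eqP => [->|ik].
  + by rewrite subrr; split; [case: (npow_tsub k) | case: sW].
  + by rewrite subr0.
  + by rewrite subrr.
  + by rewrite subr0 ze //; lia.
- by move=> k e [He ze]; split=> // i le; apply: ze; lia.
exists n0 => x nx Wx.
have [|_ /(_ n0 (leqnn _))] := st n0.+1 (leqnSn _) (dl n0 x); last by rewrite /dl eqxx.
split=> i => [|le]; rewrite /dl; case: eqP => [ik|ik] //.
- by rewrite ik.
- by split; [case: (npow_tsub i) | case: sW].
- by lia.
Qed.
End ArtinRees.
End Affine.

(** * Essential extensions of simple modules with a joint eigenvector *)

Section PolyEigen.
Variables (K : closedFieldType) (X : zmodType) (sc : K -> X -> X) (phi : X -> X).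
Hypothesis sc1 : forall x, sc 1 x = x.
Hypothesis scM : forall c d x, sc c (sc d x) = sc (c * d) x.
Hypothesis scD : forall c x y, sc c (x + y) = sc c x + sc c y.
Hypothesis scDl : forall c d x, sc (c + d) x = sc c x + sc d x.
Hypothesis phiD : forall x y, phi (x + y) = phi x + phi y.
Hypothesis phi_sc : forall c x, phi (sc c x) = sc c (phi x).

Let sc0 x : sc 0 x = 0.
Proof. by apply: (addrI (sc 0 x)); rewrite -scDl !addr0. Qed.
Let sc00 c : sc c 0 = 0.
Proof. by apply: (addrI (sc c 0)); rewrite -scD !addr0. Qed.
Let scNr c x : sc c (- x) = - sc c x.
Proof. by apply: (addrI (sc c x)); rewrite -scD !subrr sc00. Qed.
Let scNl c x : sc (- c) x = - sc c x.
Proof. by apply: (addrI (sc c x)); rewrite -scDl !subrr sc0. Qed.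
Let iphiD n : {morph iter n phi : x y / x + y}. Proof. exact: iter_morphD. Qed.

Definition pev n (q : {poly K}) (v : X) : X := \sum_(i < n) sc q`_i (iter i phi v).

Lemma pev_root (z : K) (q : {poly K}) v n : (size q <= n)%N ->
  pev n.+1 (('X - z%:P) * q) v = pev n q (phi v - sc z v).
Proof.
move=> le; have phiN x : phi (- x) = - phi x.
  have p0 : phi 0 = 0 by apply: (addrI (phi 0)); rewrite -phiD !addr0.
  by apply: (addrI (phi x)); rewrite -phiD !subrr p0.
have iphi_sc i c x : iter i phi (sc c x) = sc c (iter i phi x).
  by elim: i => //= i ->.
have iphiN i x : iter i phi (- x) = - iter i phi x by elim: i => //= i ->.
have c1 i : (('X - z%:P) * q)`_i = (if i is k.+1 then q`_k else 0) + - (z * q`_i).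
  by rewrite mulrBl coefB coefXM coefCM; case: i.
have e i : sc (('X - z%:P) * q)`_i (iter i phi v)
    = sc (if i is k.+1 then q`_k else 0) (iter i phi v) + - sc q`_i (iter i phi (sc z v)).
  by rewrite c1 scDl scNl iphi_sc scM [q`_i * z]mulrC.
rewrite /pev (eq_bigr _ (fun (i : 'I_n.+1) _ => e i)) big_split /= big_ord_recl sc0 add0r.
rewrite sumrN [X in _ - X]big_ord_recr /= (nth_default _ le) sc0 addr0 -sumrB.
by apply: eq_bigr => i _; rewrite iphiD iphiN scD scNr -iterSr.
Qed.

(** Split off a root z of q: either phi - z kills v, or v is replaced by (phi - z) v and q by its
    cofactor. The last clause places w in every phi-stable subspace containing v, so that properties
    of v are inherited. *)
Lemma poly_eigenvector (q : {poly K}) v : q != 0 -> v != 0 -> pev (size q) q v = 0 ->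
  exists (mu : K) (w : X), [/\ w != 0, phi w = sc mu w &
    forall P : X -> Prop, (forall x y, P x -> P y -> P (x - y)) ->
      (forall c x, P x -> P (sc c x)) -> (forall x, P x -> P (phi x)) -> P v -> P w].
Proof.
move: {2}(size q) (leqnn (size q)) => n; elim: n q v => [|n IH] q v le q0 v0 ev.
  by move: le; rewrite leqn0 size_poly_eq0 (negPf q0).
have [sq|/closed_rootP [z rz]] := eqVneq (size q) 1.
  have [c c0 qE] := size_poly1P q (introT eqP sq).
  move: ev; rewrite qE size_polyC c0 /pev big_ord1 coefC /= => /(f_equal (sc c^-1)).
  by rewrite scM mulVf // sc1 sc00 => v00; rewrite v00 eqxx in v0.
have [p qE] := factor_theorem q z rz; rewrite mulrC in qE.
have p0 : p != 0 by apply: contraNneq q0 => p0; rewrite qE p0 mulr0.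
have sq : size q = (size p).+1 by rewrite qE mulrC size_Mmonic ?monicXsubC // size_XsubC addn2.
move: ev; rewrite sq qE pev_root // => ev.
case: (eqVneq (phi v - sc z v) 0) => [e|ne].
  by exists z, v; split=> //; apply/eqP; rewrite -subr_eq0 e.
have [|mu [w [w0 wE wP]]] := IH p _ _ p0 ne ev; first by move: le; rewrite sq.
exists mu, w; split=> // P PB PK Pphi Pv; apply: wP => //.
by apply: PB; [apply: Pphi | apply: PK].
Qed.
End PolyEigen.

Section DccNil.
Variables (X : zmodType) (I : Type) (sc : I -> X -> X).
Hypothesis sc0 : forall c, sc c 0 = 0.

Lemma dcc_nil (phi : X -> X) (Q : X -> Prop) n :
  (forall x y, phi (x + y) = phi x + phi y) -> (forall c x, phi (sc c x) = sc c (phi x)) ->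
  (forall x, Q x -> Q (phi x)) -> (forall x, Q x -> iter n phi x = 0) ->
  dcc (fam_op sc) (fun x => Q x /\ phi x = 0) -> dcc (fam_op sc) Q.
Proof.
move=> phiD phisc Qphi nil dk.
have : dcc (fam_op sc) (fun x => Q x /\ iter n phi x = 0).
  elim: (n) => [|m IH]; first by apply: dcc_sub (@dcc0 _ _) => x [].
  apply: (dcc_ext phiD phisc sc0 (Q' := fun x => Q x /\ iter m phi x = 0) _ IH).
    by move=> x [Qx e]; split; [exact: Qphi | rewrite -iterSr].
  by apply: dcc_sub dk => x [[Qx _] e].
by apply: dcc_sub => x Qx; split=> //; exact: nil.
Qed.

Lemma dcc_exts (T : eqType) (l : seq T) (f : T -> X -> X) (Q Q' : X -> Prop) :
  (forall t x y, f t (x + y) = f t x + f t y) -> (forall t c x, f t (sc c x) = sc c (f t x)) ->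
  (forall t x, t \in l -> Q x -> Q' (f t x)) -> dcc (fam_op sc) Q' ->
  dcc (fam_op sc) (fun x => Q x /\ forall t, t \in l -> f t x = 0) -> dcc (fam_op sc) Q.
Proof.
move=> fD fsc fQ dQ'; elim: l Q fQ => [|t l IH] Q fQ dk.
  by apply: dcc_sub dk => x Qx; split.
apply: (dcc_ext (fD t) (fsc t) sc0 (Q' := Q') _ dQ').
  by move=> x; apply: fQ; rewrite inE eqxx.
apply: IH; first by move=> s x sl [Qx _]; apply: fQ => //; rewrite inE sl orbT.
apply: dcc_sub dk => x [[Qx e] h]; split=> // s.
by rewrite inE => /orP [/eqP ->|/h].
Qed.
End DccNil.

Section Artinian.
Variables (K : closedFieldType) (A : comNzRingType) (kc : {rmorphism K -> A}).
Variables (alpha alpha' : {rmorphism A -> A}).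
Hypotheses (alphaK : cancel alpha alpha') (alpha'K : cancel alpha' alpha).
Hypothesis alpha_kc : forall c, alpha (kc c) = kc c.
Variables (gx gy : A).
Hypothesis Agen : forall P : A -> Prop, (forall c, P (kc c)) ->
  (forall r s, P r -> P s -> P (r + s)) -> (forall r, P r -> P (r * gx)) ->
  (forall r, P r -> P (r * gy)) -> forall r, P r.

Definition ksc (E : tmod alpha) (c : K) (x : E) : E := rho x (kc c).

Section Essential.
Variable E : tmod alpha.
Implicit Types (x y : E) (P Q N : E -> Prop).
Local Notation sc := (@ksc E).

Lemma ksc1 x : sc 1 x = x. Proof. by rewrite /ksc rmorph1 rho1. Qed.
Lemma kscM c d x : sc c (sc d x) = sc (c * d) x.
Proof. by rewrite /ksc -rhoM -rmorphM mulrC. Qed.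
Lemma kscD c x y : sc c (x + y) = sc c x + sc c y. Proof. by rewrite /ksc rhoDl. Qed.
Lemma kscDl c d x : sc (c + d) x = sc c x + sc d x. Proof. by rewrite /ksc rmorphD rhoDr. Qed.
Lemma ksc0l x : sc 0 x = 0. Proof. by rewrite /ksc rmorph0 rho0. Qed.
Lemma ksc0 c : sc c 0 = 0. Proof. by rewrite /ksc rho0l. Qed.
Lemma kscB c x y : sc c (x - y) = sc c x - sc c y. Proof. by rewrite /ksc rhoBl. Qed.
Lemma ksc_rho c x r : rho (sc c x) r = sc c (rho x r). Proof. by rewrite /ksc rhoAC. Qed.
Lemma ksc_tt c x : tt (sc c x) = sc c (tt x).
Proof. by rewrite /ksc -tt_rho alpha_kc. Qed.
Lemma ksc_iter_tt n c x : iter n (@tt _ _ E) (sc c x) = sc c (iter n (@tt _ _ E) x).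
Proof. by elim: n => //= n ->; rewrite ksc_tt. Qed.
Lemma ksc_eq0 c x : c != 0 -> sc c x = 0 -> x = 0.
Proof. by move=> c0 /(f_equal (sc c^-1)); rewrite kscM mulVf // ksc1 ksc0. Qed.
Lemma tsub_ksc P c x : tsub P -> P x -> P (sc c x).
Proof. by case=> _ _ h _; apply: h. Qed.
Lemma tsub_kscV P c x : tsub P -> c != 0 -> P (sc c x) -> P x.
Proof.
by move=> sP c0 /(tsub_ksc c^-1 sP); rewrite kscM mulVf // ksc1.
Qed.
Lemma tt_rho' x r : tt (rho x r) = rho (tt x) (alpha' r).
Proof. by rewrite -tt_rho alpha'K. Qed.
Lemma iter_tt_rho' n x r :
  iter n (@tt _ _ E) (rho x r) = rho (iter n (@tt _ _ E) x) (iter n alpha' r).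
Proof. by elim: n => //= n ->; rewrite tt_rho'. Qed.

Lemma dcc_tartinian N : dcc (fam_op sc) N -> tartinian N.
Proof.
move=> dN P sP PN mP; have [|n0 st] := dN P _ PN mP.
  by move=> n; case: (sP n) => P0 PB PR _; split=> // w x [c ->] Px; exact: PR.
exists n0 => n le x; split=> [Px|]; last exact: st.
exact: (chain_ge mP le).
Qed.

Variable W : E -> Prop.
Hypothesis essW : forall P, tsub P -> (exists x, P x /\ x != 0) -> exists w, [/\ W w, w != 0 & P w].

(** Fitting's argument. Let the kernels of the powers of phi be stationary from n0 on. If the image
    of phi^n0 is non-zero, by essentiality it contains some non-zero w = phi^n0(y) in W; then phi(w)
    = 0, so y already lies in the kernel of phi^n0 and w = 0. As phi need not be a module morphism,
    [pre] and [img] ask that it respect submodules. *)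
Lemma fitting (N : E -> Prop) (phi : E -> E) : tsub N -> acc (s_op (E := E)) N ->
  phi 0 = 0 -> (forall x, N x -> N (phi x)) -> (forall w, W w -> phi w = 0) ->
  (forall P, tsub P -> tsub (fun x => N x /\ P (phi x))) ->
  (forall P, tsub P -> (forall x, P x -> N x) -> tsub (fun y => exists2 x, P x & y = phi x)) ->
  exists n, forall x, N x -> iter n phi x = 0.
Proof.
move=> sN aN phi0 Nphi phiW pre img.
have iphi0 n : iter n phi 0 = 0 by elim: n => //= n ->.
have sL n : tsub (fun x => N x /\ iter n phi x = 0).
  elim: n => [|n /pre IH].
    case: sN => N0 NB NR NT; split=> //= [x y [? ->] [? ->]|x r [? ->]|x [? ->]];
    by rewrite ?subr0 ?rho0l ?tt0.
  case: IH => I0 IB IR IT.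
  have e x : (N x /\ iter n.+1 phi x = 0) <-> N x /\ N (phi x) /\ iter n phi (phi x) = 0.
    by rewrite iterSr; split=> [[Nx ?]|[Nx [_ ?]]] //; split=> //; split=> //; exact: Nphi.
  split.
  - by apply/e.
  - by move=> x y /e Hx /e Hy; apply/e; exact: IB.
  - by move=> x r /e Hx; apply/e; exact: IR.
  - by move=> x /e Hx; apply/e; exact: IT.
have [|||n0 st] := aN (fun n x => N x /\ iter n phi x = 0).
- by move=> n; apply/s_opP.
- by move=> n x [].
- by move=> n x [Nx e]; split=> //; rewrite iterS e.
exists n0 => x Nx; apply: contrapT => /eqP nz.
have Nn n y : N y -> N (iter n phi y) by elim: n => //= n IH Ny; apply: Nphi; exact: IH.
have sI : tsub (fun y => exists2 x, N x & y = iter n0 phi x).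
  elim: (n0) => [|n IH].
    case: sN => N0 NB NR NT; split=> [|_ _ [y Ny ->] [z Nz ->]|_ r [y Ny ->]|_ [y Ny ->]].
    - by exists 0.
    - by exists (y - z) => //; exact: NB.
    - by exists (rho y r) => //; exact: NR.
    - by exists (tt y) => //; exact: NT.
  have := img _ IH (fun y => _).
  case=> [_ [z Nz ->]|I0 IB IR IT]; first exact: Nn.
  have e y : (exists2 x, N x & y = iter n.+1 phi x)
     <-> exists2 z, (exists2 x, N x & z = iter n phi x) & y = phi z.
    by split=> [[z Nz ->]|[_ [z Nz ->] ->]]; [exists (iter n phi z) => //; exists z | exists z].
  split.
  - by apply/e.
  - by move=> y z /e Hy /e Hz; apply/e; exact: IB.
  - by move=> y r /e Hy; apply/e; exact: IR.
  - by move=> y /e Hy; apply/e; exact: IT.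
have [|w [Ww w0 [y Ny wE]]] := essW sI.
  by exists (iter n0 phi x); split=> //; exists x.
have [|_] := st n0.+1 (leqnSn _) y; first by split=> //; rewrite iterS -wE phiW.
by rewrite -wE => wz; rewrite wz eqxx in w0.
Qed.
End Essential.

Section Cases.
Variables (V E : tmod alpha) (j : V -> E).
Hypotheses (sV : tsimple V) (hj : thom j) (ij : injective j) (ej : tessential j).
Variable N : E -> Prop.
Hypothesis fN : tfg N.
Variable chi : {rmorphism A -> K}.
Hypothesis chi_kc : forall c, chi (kc c) = c.

Let W (y : E) := exists v, y = j v.
Let sN : tsub N := proj1 fN.

Lemma im_tsub : tsub W.
Proof.
case: hj => jD jR jT; split.
- by exists 0; rewrite (thom0 hj).
- by move=> _ _ [x ->] [y ->]; exists (x - y); rewrite (thomB _ _ hj).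
- by move=> _ r [x ->]; exists (rho x r).
- by move=> _ [x ->]; exists (tt x).
Qed.

Lemma im_ess P : tsub P -> (exists x, P x /\ x != 0) -> exists w, [/\ W w, w != 0 & P w].
Proof. by move=> sP /(ej sP) [v [v0 Pv]]; exists (j v); split=> //; exists v. Qed.

(** V is a line on which A acts by the character [chi]. The operators theta, gx - chi(gx) and gy -
    chi(gy) are successively nilpotent, and their joint kernel is at most a line, so N satisfies the
    minimum condition already for vector subspaces. *)
Theorem tartinian_theta0 : (forall v : V, tt v = 0) ->
  (forall (v : V) r, rho v r = rho v (kc (chi r))) -> tartinian N.
Proof.
move=> tt0V chiV; apply: dcc_tartinian.
case: (hj) => jD jR jT; case: (sN) => N0 NB NR NT.
have aN := tfg_acc alpha'K Agen fN.
have [] := @fitting E W im_ess N (@tt _ _ E) sN aN.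
- exact: tt0.
- exact: NT.
- by move=> _ [v ->]; rewrite -jT tt0V (thom0 hj).
- move=> P [P0 PB PR PT]; split.
  + by rewrite tt0.
  + by move=> x y [Nx Px] [Ny Py]; rewrite ttB; split; [exact: NB | exact: PB].
  + by move=> x r [Nx Px]; rewrite tt_rho'; split; [exact: NR | exact: PR].
  + by move=> x [Nx Px]; split; [exact: NT | exact: PT].
- move=> P [P0 PB PR PT] PN; split.
  + by exists 0; rewrite ?tt0.
  + by move=> _ _ [x Px ->] [y Py ->]; exists (x - y); [exact: PB | rewrite ttB].
  + by move=> _ r [x Px ->]; exists (rho x (alpha r)); [exact: PR | rewrite tt_rho].
  + by move=> _ [x Px ->]; exists (tt x) => //; exact: PT.
move=> n nilN.
pose N1 x := N x /\ tt x = 0.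
have sN1 : tsub N1.
  split=> [|x y [Nx ex] [Ny ey]|x r [Nx ex]|x [Nx ex]]; split.
  - by [].
  - exact: tt0.
  - exact: NB.
  - by rewrite ttB ex ey subr0.
  - exact: NR.
  - by rewrite tt_rho' ex rho0l.
  - exact: NT.
  - by rewrite ex tt0.
have aN1 : acc (s_op (E := E)) N1 by apply: acc_eq aN => x [].
(* On the kernel of theta, g - chi(g) commutes trivially with theta, so it maps submodules to
   submodules and [fitting] applies. *)
have nil1 g : exists m, forall x, N1 x -> iter m (fun x => rho x (g - kc (chi g))) x = 0.
  case: (sN1) => M0 MB MR MT.
  apply: (@fitting E W im_ess N1 _ sN1 aN1); first exact: rho0l.
  - by move=> x Nx; exact: MR.
  - by move=> _ [v ->]; rewrite -jR rhoBr chiV subrr (thom0 hj).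
  - move=> P [P0 PB PR PT]; split.
    + by rewrite rho0l.
    + by move=> x y [Nx Px] [Ny Py]; rewrite rhoBl; split; [exact: MB | exact: PB].
    + by move=> x r [Nx Px]; rewrite rhoAC; split; [exact: MR | exact: PR].
    + by move=> x [Nx Px]; split; [exact: MT | case: Nx => _ ->; rewrite rho0l].
  - move=> P [P0 PB PR PT] PN; split.
    + by exists 0; rewrite ?rho0l.
    + by move=> _ _ [x Px ->] [y Py ->]; exists (x - y); [exact: PB | rewrite rhoBl].
    + by move=> _ r [x Px ->]; exists (rho x r); [exact: PR | rewrite rhoAC].
    + move=> _ [x Px ->]; exists 0 => //.
      by have [_ ex] := PN x Px; rewrite tt_rho' ex !rho0l.
have [mx nilx] := nil1 gx; have [my nily] := nil1 gy.
pose dx := gx - kc (chi gx); pose dy := gy - kc (chi gy).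
have [v0 v00] := sV.1.
have Vline (v : V) : exists c, v = ksc c v0.
  move: v; apply: (tsimple_all sV); last by exists v0; split=> //; exists 1; rewrite ksc1.
  split.
  - by exists 0; rewrite ksc0l.
  - by move=> _ _ [c ->] [d ->]; exists (c - d); rewrite /ksc rmorphB rhoBr.
  - move=> _ r [c ->]; exists (c * chi r).
    by rewrite chiV /ksc -rhoM -rmorphM.
  - by move=> _ [c ->]; exists 0; rewrite ksc_tt tt0V ksc0 ksc0l.
have scx := @ksc_rho E.
apply: (dcc_nil (@ksc0 E) (phi := @tt _ _ E) (n := n)) => //.
- exact: ttD.
- by move=> c x; rewrite ksc_tt.
apply: (dcc_nil (@ksc0 E) (phi := fun x => rho x dx) (n := mx)).
- by move=> x y; rewrite rhoDl.
- by move=> c x; rewrite scx.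
- by move=> x Nx; case: (sN1) => _ _ MR _; exact: MR.
- by move=> x Nx; exact: nilx.
apply: (dcc_nil (@ksc0 E) (phi := fun x => rho x dy) (n := my)).
- by move=> x y; rewrite rhoDl.
- by move=> c x; rewrite scx.
- move=> x [Nx ex]; split; first by case: (sN1) => _ _ MR _; exact: MR.
  by rewrite rhoAC ex rho0l.
- by move=> x [Nx _]; exact: nily.
(* A vector of the joint kernel spans a stable line, which by essentiality meets the image of V,
   itself the line through [j v0]. *)
apply: dcc_sub (dcc_line (e := j v0) (@kscM E) (@ksc0l E)) => x [[[Nx ttx] ex] ey].
case: (eqVneq x 0) => [->|x0]; first by exists 0; rewrite ksc0l.
have rx r : exists c, rho x r = ksc c x.
  move: r; apply: Agen.
  - by move=> c; exists c.
  - by move=> r s [c rE] [d sE]; exists (c + d); rewrite rhoDr rE sE kscDl.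
  - move=> r [c rE]; exists (c * chi gx); rewrite rhoM rE scx.
    move/eqP: ex; rewrite rhoBr subr_eq0 => /eqP ->.
    by rewrite -[rho x _]/(ksc _ x) kscM.
  - move=> r [c rE]; exists (c * chi gy); rewrite rhoM rE scx.
    move/eqP: ey; rewrite rhoBr subr_eq0 => /eqP ->.
    by rewrite -[rho x _]/(ksc _ x) kscM.
have [||_ [[v ->] jv0 [c jvE]]] := @im_ess (fun y => exists c, y = ksc c x).
- split.
  + by exists 0; rewrite ksc0l.
  + by move=> _ _ [c ->] [d ->]; exists (c - d); rewrite /ksc rmorphB rhoBr.
  + move=> _ r [c ->]; have [d rE] := rx r; exists (c * d).
    by rewrite scx rE kscM.
  + by move=> _ [c ->]; exists 0; rewrite ksc_tt ttx ksc0 ksc0l.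
- by exists x; split=> //; exists 1; rewrite ksc1.
have c0 : c != 0 by apply: contraNneq jv0 => c0; rewrite jvE c0 ksc0l.
have [d vE] := Vline v; exists (c^-1 * d).
have -> : x = ksc c^-1 (j v) by rewrite jvE kscM mulVf // ksc1.
by rewrite vE /ksc jR -rhoM -rmorphM mulrC.
Qed.

(** * The finite orbit of a joint eigenvalue *)

Section Torsionfree.
Variable v0 : V.
Hypotheses (v0_neq0 : v0 != 0) (ttv0 : tt v0 != 0).
Hypothesis chi_v0 : forall r, rho v0 r = rho v0 (kc (chi r)).

Lemma ttV_inj (v : V) : tt v = 0 -> v = 0.
Proof.
move=> tv; apply: contrapT => /eqP nv; case/eqP: ttv0; move: v0.
apply: (tsimple_all sV); last by exists v.
by split=> [|x y ex ey|x r ex|x ex]; rewrite ?ttB ?tt_rho' ?ex ?ey ?rho0l ?tt0 ?subr0.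
Qed.

Lemma chi_iter n r : rho (iter n (@tt _ _ V) v0) r
  = ksc (chi (iter n alpha r)) (iter n (@tt _ _ V) v0).
Proof. by rewrite -iter_tt_rho chi_v0 -[rho v0 _]/(ksc _ v0) ksc_iter_tt. Qed.

(** Each theta^i v0 is a joint eigenvector of A, so the span of those with i >= 1 is a submodule. It
    contains the non-zero [tt v0], hence it is all of V. *)
Lemma v0_rel : exists (n : nat) (c : nat -> K),
  v0 = \sum_(i < n) ksc (c i) (iter i.+1 (@tt _ _ V) v0).
Proof.
pose P (v : V) := exists (n : nat) (c : nat -> K),
  v = \sum_(i < n) ksc (c i) (iter i.+1 (@tt _ _ V) v0).
have ext n m (c : nat -> K) : (n <= m)%N -> exists c' : nat -> K,
    \sum_(i < n) ksc (c i) (iter i.+1 (@tt _ _ V) v0)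
    = \sum_(i < m) ksc (c' i) (iter i.+1 (@tt _ _ V) v0).
  move=> le; exists (fun i => if (i < n)%N then c i else 0).
  rewrite (big_ord_widen m (fun i => ksc (c i) (iter i.+1 (@tt _ _ V) v0)) le) big_mkcond.
  by apply: eq_bigr => i _; case: ifP => //; rewrite ksc0l.
suff: forall v, P v by apply.
apply: (tsimple_all sV); last first.
  exists (tt v0); split=> //; exists 1%N, (fun _ => 1).
  by rewrite big_ord1 ksc1.
split.
- by exists 0%N, (fun _ => 0); rewrite big_ord0.
- move=> _ _ [n [c ->]] [m [d ->]].
  have [c' ->] := ext n (maxn n m) c (leq_maxl _ _).
  have [d' ->] := ext m (maxn n m) d (leq_maxr _ _).
  exists (maxn n m), (fun i => c' i - d' i); rewrite -sumrB.
  by apply: eq_bigr => i _; rewrite /ksc rmorphB rhoBr.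
- move=> _ r [n [c ->]]; exists n, (fun i => c i * chi (iter i.+1 alpha r)).
  by rewrite rho_suml; apply: eq_bigr => i _; rewrite ksc_rho chi_iter kscM.
- move=> _ [n [c ->]]; exists n.+1, (fun i => if i is k.+1 then c k else 0).
  rewrite big_ord_recl ksc0l add0r (big_morph _ (@ttD _ _ V) (@tt0 _ _ V)).
  by apply: eq_bigr => i _; rewrite ksc_tt.
Qed.

Definition sepa (i : nat) := exists r, chi (iter i alpha r) <> chi r.

(** Chinese remaindering: multiply one separating factor for each i, normalised so that [chi] takes
    the value 1. *)
Lemma sep_prod (n : nat) : (forall i, (0 < i <= n)%N -> sepa i) ->
  exists e, chi e = 1 /\ forall i, (0 < i <= n)%N -> chi (iter i alpha e) = 0.
Proof.
elim: n => [|n IH] sep; first by exists 1; rewrite rmorph1; split=> // i; case: i.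
have [|e [e1 e0]] := IH; first by move=> i h; apply: sep; lia.
have [|r rn] := sep n.+1; first lia.
have nz : chi r - chi (iter n.+1 alpha r) != 0.
  by rewrite subr_eq0 eq_sym; apply/eqP.
exists (e * (r - kc (chi (iter n.+1 alpha r))) * kc (chi r - chi (iter n.+1 alpha r))^-1).
have ikc i c : iter i alpha (kc c) = kc c by elim: i => //= i ->; rewrite alpha_kc.
split; first by rewrite !rmorphM rmorphB !chi_kc e1 mul1r divff.
move=> i h; rewrite !iter_rmorphM iter_rmorphB !ikc !rmorphM rmorphB !chi_kc.
case: (eqVneq i n.+1) => [->|ni]; first by rewrite subrr mulr0 mul0r.
by rewrite e0 ?mul0r //; lia.
Qed.

(** If no later character equalled [chi], a separating e would fix v0 and kill every term on the
    right of [v0_rel]. *)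
Lemma finite_orbit : exists k, (0 < k)%N /\ ~ sepa k.
Proof.
apply: contrapT => no.
have sep i : (0 < i)%N -> sepa i by move=> i0; apply: contrapT => h; apply: no; exists i.
have [n [c vE]] := v0_rel.
have [|e [e1 e0]] := @sep_prod n; first by move=> i /andP [i0 _]; exact: sep.
case/eqP: v0_neq0; rewrite -[v0]ksc1 -e1 -[LHS]/(rho v0 (kc (chi e))) -chi_v0 vE rho_suml.
rewrite big1 // => i _; rewrite ksc_rho chi_iter e0 ?ksc0l ?ksc0 //.
by case: i => i /=; lia.
Qed.

Lemma min_orbit : exists k, [/\ (0 < k)%N, ~ sepa k & forall i, (0 < i < k)%N -> sepa i].
Proof.
have [k0 [k0p k0s]] := finite_orbit.
have [|k /andP [kp /asboolP ks] kmin] := @ex_minnP (fun k => (0 < k)%N && `[< ~ sepa k >]).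
  by exists k0; rewrite k0p; apply/asboolP.
exists k; split=> // i /andP [i0 ik]; apply: contrapT => h.
have := kmin i; rewrite i0 /=; move/asboolP: (h) => -> /(_ isT); lia.
Qed.

(** Let k be the length of the orbit of [chi] and I the ideal of functions vanishing on it.
    Artin-Rees gives N I^n = 0. On the part N1 of N killed by I, Z = theta^k - c is nilpotent; its
    kernel N2 embeds in k copies of the chi-eigenspace N3 by x -> (theta^i x) e; and N3 is at most a
    line. The minimum condition on subspaces then climbs back from N3 to N. *)
Theorem tartinian_torsionfree : tartinian N.
Proof.
have [k [k0 knsep kmin]] := min_orbit.
have per r : chi (iter k alpha r) = chi r by apply: contrapT => h; apply: knsep; exists r.
have [|e [e1 e0]] := @sep_prod k.-1; first by move=> i h; apply: kmin; lia.
have perm i m r : chi (iter (i + k * m) alpha r) = chi (iter i alpha r).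
  elim: m => [|m IH]; first by rewrite muln0 addn0.
  by rewrite mulnS addnCA iterD per IH.
have eE i : chi (iter i alpha e) = (k %| i)%:R.
  rewrite (divn_eq i k) addnC mulnC perm dvdn_addl ?dvdn_mulr //.
  have : (i %% k < k)%N by rewrite ltn_mod.
  case: (posnP (i %% k)) => [->|ip] lt; first by rewrite e1 dvdn0.
  rewrite e0; last by lia.
  by rewrite /dvdn modn_small // eqn0Ngt ip.
pose I (r : A) := forall i, chi (iter i alpha r) = 0.
have iI : ideal I.
  split=> [i|x y Ix Iy i|x r Ix i].
  - by rewrite iter_rmorph0 rmorph0.
  - by rewrite iter_rmorphB rmorphB Ix Iy subr0.
  - by rewrite iter_rmorphM rmorphM Ix mul0r.
have Ia b : I b -> I (alpha b) by move=> Ib i; rewrite -iterSr.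
have Ia' b : I b -> I (alpha' b).
  move=> Ib i; rewrite -(perm i 1%N) muln1 -(prednK k0) addnS iterSr alpha'K.
  exact: Ib.
have Ik r : I (iter k alpha r - r).
  by move=> i; rewrite iter_rmorphB rmorphB -iterD -[k in (i + k)%N]muln1 perm subrr.
have Iadd r : I (r * e - kc (chi r) * e).
  move=> i; rewrite iter_rmorphB !iter_rmorphM rmorphB !rmorphM eE.
  have -> : iter i alpha (kc (chi r)) = kc (chi r) by elim: (i) => //= l ->; rewrite alpha_kc.
  rewrite chi_kc; case: (boolP (k %| i)%N) => [/dvdnP [m ->]|_]; last by rewrite !mulr0 subrr.
  by rewrite -[(m * k)%N]add0n mulnC perm subrr.
have I1 : I (1 - \sum_(l < k) iter l alpha e).
  move=> i; rewrite iter_rmorphB rmorphB iter_rmorph1 rmorph1.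
  rewrite (big_morph _ (@iter_rmorphD _ alpha i) (@iter_rmorph0 _ alpha i)) rmorph_sum /=.
  (* The only index below k for which i + l0 is divisible by k: exactly one conjugate of e takes the
     value 1 at each point of the orbit. *)
  pose l0 := ((k - i %% k) %% k)%N; have lt0 : (l0 < k)%N by rewrite ltn_mod.
  have dv : (k %| i + l0)%N.
    rewrite /dvdn modnDmr -modnDml subnKC ?modnn //.
    by apply: ltnW; rewrite ltn_mod.
  rewrite (bigD1 (Ordinal lt0)) //= -iterD eE dv big1 ?addr0 ?subrr // => l ll0.
  rewrite -iterD eE; case: (boolP (k %| i + l)%N) => // dl.
  case/eqP: ll0; apply: val_inj => /=; apply/eqP.
  have : (i + l == i + l0 %[mod k])%N.
    by move: dl dv; rewrite /dvdn => /eqP -> /eqP ->.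
  by rewrite eqn_modDl !modn_small.
case: (hj) => jD jR jT; case: (sN) => N0 NB NR NT.
have WI x b : W x -> I b -> rho x b = 0.
  move=> [v ->] Ib; rewrite -jR; suff -> : rho v b = 0 by rewrite (thom0 hj).
  move: b Ib; move: v; apply: (tsimple_all sV); last first.
    by exists v0; split=> // b' Ib'; rewrite chi_v0 (Ib' 0%N) rmorph0 rho0.
  split=> [b' _|y z ey ez b' Ib'|y r ey b' Ib'|y ey b' Ib'].
  - exact: rho0l.
  - by rewrite rhoBl ey ?ez ?subr0.
  - by rewrite rhoAC ey ?rho0l.
  - by rewrite -tt_rho ey ?tt0 //; exact: Ia.
have VI (v : V) b : I b -> rho v b = 0.
  by move=> Ib; apply: ij; rewrite (thom0 hj) jR; apply: WI => //; exists v.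
have ttk (X : tmod alpha) (x : X) r : (forall b, I b -> rho x b = 0) ->
    iter k (@tt _ _ X) (rho x r) = rho (iter k (@tt _ _ X) x) r.
  move=> xI; rewrite -[RHS]iter_tt_rho -[iter k alpha r](subrK r) rhoDr.
  by rewrite (xI _ (Ik r)) add0r.
have [c [c0 Vc]] : exists c, c != 0 /\ forall v : V, iter k (@tt _ _ V) v = ksc c v.
  have [n [cf vE]] := v0_rel.
  (* [v0_rel] says that q(theta) kills v0, and the constant term 1 makes q non-zero, so theta has an
     eigenvector. Its eigenvalue is non-zero because theta is injective on V, and theta^k, which
     commutes with A on V, is therefore a non-zero scalar. *)
  pose q : {poly K} := 1 - \poly_(i < n.+1) (if i is l.+1 then cf l else 0).
  have q0 : q != 0.
    apply/eqP=> /(f_equal (fun p : {poly K} => p`_0)); rewrite coefB coef1 coef_poly /= coef0 subr0.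
    by move/eqP; rewrite oner_eq0.
  have sq : (size q <= n.+1)%N.
    by rewrite (leq_trans (size_polyD _ _)) // geq_max size_polyN size_poly1 size_poly.
  have qv : pev (@ksc V) (@tt _ _ V) (size q) q v0 = 0.
    transitivity (pev (@ksc V) (@tt _ _ V) n.+1 q v0).
      rewrite /pev (big_ord_widen n.+1 (fun i => ksc q`_i (iter i (@tt _ _ V) v0)) sq) big_mkcond.
      by apply: eq_bigr => i _; case: ltnP => // le; rewrite nth_default // ksc0l.
    rewrite /pev big_ord_recl /q coefB coef1 coef_poly /= subr0 ksc1.
    rewrite [X in X + _]vE -big_split big1 //= => i _.
    rewrite coefB coef1 coef_poly /= ltnS ltn_ord sub0r -kscDl.
    by rewrite subrr ksc0l.
  have [mu [w [w0 wE _]]] := poly_eigenvector (@ksc1 V) (@kscM V) (@kscD V) (@kscDl V)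
     (@ttD _ _ V) (fun c x => ksc_tt c x) q0 v0_neq0 qv.
  have wk m : iter m (@tt _ _ V) w = ksc (mu ^+ m) w.
    elim: m => [|m IH]; first by rewrite expr0 ksc1.
    by rewrite iterS IH ksc_tt wE kscM exprSr.
  exists (mu ^+ k); split.
    apply: expf_neq0; apply: contraNneq w0 => mu0.
    by apply/eqP; apply: ttV_inj; rewrite wE mu0 ksc0l.
  apply: (tsimple_all sV); last by exists w.
  split=> [|x y ex ey|x r ex|x ex].
  - by rewrite iter_tt0 ksc0.
  - by rewrite iter_ttB ex ey kscB.
  - by rewrite ttk ?ex ?ksc_rho // => b; exact: VI.
  - by rewrite -iterSr iterS ex ksc_tt.
have aN := tfg_acc alpha'K Agen fN.
(* N I^n meets the image of V only in 0, so by essentiality N I^n itself is 0. *)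
have [n npow0] := artin_rees alpha'K Agen iI Ia Ia' fN im_tsub WI.
have {}npow0 x : npow I N n x -> x = 0.
  move=> nx; apply: contrapT => /eqP x0.
  have [|w [Ww w0 nw]] := im_ess (npow_tsub alpha'K Ia' fN n); first by exists x.
  by case/eqP: w0; exact: npow0.
pose N1 x := N x /\ forall b, I b -> rho x b = 0.
have sN1 : tsub N1.
  split=> [|x y [Nx ex] [Ny ey]|x r [Nx ex]|x [Nx ex]]; split=> //.
  - by move=> b _; exact: rho0l.
  - exact: NB.
  - by move=> b Ib; rewrite rhoBl ex ?ey ?subr0.
  - exact: NR.
  - by move=> b Ib; rewrite rhoAC ex ?rho0l.
  - exact: NT.
  - by move=> b Ib; rewrite -tt_rho ex ?tt0 //; exact: Ia.
pose Z x := iter k (@tt _ _ E) x - ksc c x.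
have ZD x y : Z (x + y) = Z x + Z y by rewrite /Z iter_ttD kscD opprD addrACA.
have ZB x y : Z (x - y) = Z x - Z y by apply: (addIr (Z y)); rewrite -ZD !subrK.
have Zsc d x : Z (ksc d x) = ksc d (Z x).
  by rewrite /Z ksc_iter_tt kscB !kscM mulrC.
have Z0 : Z 0 = 0 by rewrite /Z iter_tt0 ksc0 subr0.
have Zrho x r : N1 x -> Z (rho x r) = rho (Z x) r.
  by move=> [_ xI]; rewrite /Z ttk // rhoBl ksc_rho.
have Ztt x : Z (tt x) = tt (Z x) by rewrite /Z ttB ksc_tt -iterSr -iterS.
have ZW w : W w -> Z w = 0.
  move=> [v ->]; rewrite /Z -[ksc c _]/(rho (j v) (kc c)) -jR -[rho v _]/(ksc c v) -Vc.
  suff -> : iter k (@tt _ _ E) (j v) = j (iter k (@tt _ _ V) v) by rewrite subrr.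
  by elim: (k) => // l IH; rewrite !iterS IH jT.
case: (sN1) => M0 MB MR MT.
have ZN x : N1 x -> N1 (Z x).
  by move=> Nx; apply: MB; [exact: tsub_iter | exact: MR].
have [|||m nilZ] := @fitting E W im_ess N1 Z sN1 _ Z0 ZN ZW.
- by apply: acc_eq aN => x [].
- move=> P [P0 PB PR PT]; split.
  + by rewrite Z0.
  + by move=> x y [Nx Px] [Ny Py]; rewrite ZB; split; [exact: MB | exact: PB].
  + by move=> x r [Nx Px]; rewrite Zrho //; split; [exact: MR | exact: PR].
  + by move=> x [Nx Px]; rewrite Ztt; split; [exact: MT | exact: PT].
- move=> P [P0 PB PR PT] PN; split.
  + by exists 0; rewrite ?Z0.
  + by move=> _ _ [x Px ->] [y Py ->]; exists (x - y); [exact: PB | rewrite ZB].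
  + by move=> _ r [x Px ->]; exists (rho x r); [exact: PR | rewrite Zrho //; exact: PN].
  + by move=> _ [x Px ->]; exists (tt x); [exact: PT | rewrite Ztt].
pose N2 x := N1 x /\ Z x = 0.
have sN2 : tsub N2.
  split=> [|x y [Nx ex] [Ny ey]|x r [Nx ex]|x [Nx ex]]; split=> //.
  - exact: MB.
  - by rewrite ZB ex ey subr0.
  - exact: MR.
  - by rewrite Zrho // ex rho0l.
  - exact: MT.
  - by rewrite Ztt ex tt0.
have N2k x : N2 x -> iter k (@tt _ _ E) x = ksc c x.
  by case=> _ /eqP; rewrite /Z subr_eq0 => /eqP.
have tt_inj2 i x : N2 x -> iter i (@tt _ _ E) x = 0 -> x = 0.
  move=> Nx; have tt1 y : N2 y -> tt y = 0 -> y = 0.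
    move=> Ny ey; apply: (@ksc_eq0 E c) => //; rewrite -N2k //.
    by rewrite -(prednK k0) iterSr ey iter_tt0.
  elim: i => //= i IH tti; apply: IH; apply: tt1 => //; exact: tsub_iter.
(* The conjugates of e sum to 1 modulo I, and theta is injective on N2 because theta^k is the
   non-zero scalar c there. *)
have joint x : N2 x -> (forall i, (i < k)%N -> rho (iter i (@tt _ _ E) x) e = 0) -> x = 0.
  move=> Nx h; have [_ xI] := Nx.1.
  have := xI _ I1; rewrite rhoBr rho1 => /eqP; rewrite subr_eq0 => /eqP ->.
  rewrite rho_sumr big1 // => i _; apply: (tt_inj2 i); last by rewrite iter_tt_rho h.
  by case: sN2 => _ _ h' _; exact: h'.
have VP (v : V) i : exists d, rho (iter i (@tt _ _ V) v) e = ksc d v0.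
  move: i; move: v; apply: (tsimple_all sV); last first.
    exists v0; split=> // i; rewrite chi_iter eE.
    case: (boolP (k %| i)%N) => [/dvdnP [l ->]|_]; last by exists 0; rewrite !ksc0l.
    exists (c ^+ l); rewrite ksc1; elim: l => [|l IH]; first by rewrite expr0 ksc1.
    by rewrite mulSn iterD IH Vc kscM exprS.
  split=> [i|x y Hx Hy i|x r Hx i|x Hx i].
  - by exists 0; rewrite iter_tt0 rho0l ksc0l.
  - have [d dE] := Hx i; have [d' d'E] := Hy i; exists (d - d').
    by rewrite iter_ttB rhoBl dE d'E /ksc rmorphB rhoBr.
  - have [d dE] := Hx i; exists (d * chi (iter i alpha' r)).
    by rewrite iter_tt_rho' rhoAC dE ksc_rho chi_v0 -[rho v0 _]/(ksc _ v0) kscM.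
  - by have [d dE] := Hx i.+1; exists d; rewrite -iterSr.
pose N3 x := N2 x /\ forall r, rho x r = ksc (chi r) x.
(* The x in N2 all of whose components (theta^i x) e are multiples of u form a submodule containing
   u. It meets the image of V in some w != 0; a non-zero component of w is a multiple of u, so u
   lies in the image of V, where [VP] leaves only multiples of v0. *)
have N3line u : N3 u -> exists d, u = ksc d (j v0).
  move=> [Nu uchi]; case: (eqVneq u 0) => [->|u0]; first by exists 0; rewrite ksc0l.
  pose P x := N2 x /\ forall i, exists d, rho (iter i (@tt _ _ E) x) e = ksc d u.
  have sP : tsub P.
    case: (sN2) => S0 SB SR ST; split=> [|x y [Nx Hx] [Ny Hy]|x r [Nx Hx]|x [Nx Hx]]; split=> //.
    - by move=> i; exists 0; rewrite iter_tt0 rho0l ksc0l.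
    - exact: SB.
    - move=> i; have [d dE] := Hx i; have [d' d'E] := Hy i; exists (d - d').
      by rewrite iter_ttB rhoBl dE d'E /ksc rmorphB rhoBr.
    - exact: SR.
    - move=> i; have [d dE] := Hx i; exists (d * chi (iter i alpha' r)).
      by rewrite iter_tt_rho' rhoAC dE ksc_rho uchi kscM.
    - exact: ST.
    - by move=> i; have [d dE] := Hx i.+1; exists d; rewrite -iterSr.
  have Pu : P u.
    split=> // i; rewrite -iter_tt_rho uchi eE ksc_iter_tt.
    case: (boolP (k %| i)%N) => [/dvdnP [l ->]|_]; last by exists 0; rewrite !ksc0l.
    exists (c ^+ l); rewrite ksc1; elim: l => [|l IH]; first by rewrite expr0 ksc1.
    by rewrite mulSn iterD IH ksc_iter_tt N2k // kscM exprSr.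
  have [|w [Ww w0 [Nw Pw]]] := im_ess sP; first by exists u.
  have [i hi] : exists i, rho (iter i (@tt _ _ E) w) e != 0.
    apply: contrapT => no; case/eqP: w0; apply: joint => // i _.
    by apply: contrapT => /eqP h; apply: no; exists i.
  have [d dE] := Pw i.
  have d0 : d != 0 by apply: contraNneq hi => d0; rewrite dE d0 ksc0l.
  have [v uE] : W u.
    apply: (tsub_kscV im_tsub d0); rewrite -dE.
    by case: (im_tsub) => _ _ h _; apply: h; apply: tsub_iter => //; exact: im_tsub.
  have [d' d'E] := VP v 0%N; exists d'.
  have : rho (j v) e = j v by rewrite -uE uchi e1 ksc1.
  by rewrite -jR /= d'E uE => <-; rewrite /ksc jR.
have d3 : dcc (fam_op (@ksc E)) N3.
  by apply: dcc_sub N3line (dcc_line (@kscM E) (@ksc0l E)).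
have d2 : dcc (fam_op (@ksc E)) N2.
  apply: (dcc_exts (@ksc0 E) (l := iota 0 k) (f := fun i x => rho (iter i (@tt _ _ E) x) e) _ _ _ d3).
  - by move=> i x y; rewrite iter_ttD rhoDl.
  - by move=> i d x; rewrite ksc_iter_tt ksc_rho.
  - move=> i x _ Nx; have Nx' := tsub_iter i sN2 Nx.
    split; first by case: (sN2) => _ _ h _; exact: h.
    move=> r; have [_ xI] := Nx'.1.
    have := xI _ (Iadd r); rewrite rhoBr => /eqP; rewrite subr_eq0 => /eqP.
    by rewrite mulrC !rhoM => ->; rewrite -[rho _ (kc _)]/(ksc _ _) ksc_rho.
  - apply: dcc_sub (@dcc0 _ _) => x [Nx h]; apply: joint => // i lt.
    by apply: h; rewrite mem_iota.
have d1 : dcc (fam_op (@ksc E)) N1.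
  exact: (dcc_nil (@ksc0 E) ZD (fun d x => Zsc d x) ZN nilZ d2).
(* [Nn l] is the part of N killed by I^l; for l = n it is all of N. *)
pose Nn := fix Nn m x := if m is l.+1 then N x /\ forall b, I b -> Nn l (rho x b) else x = 0.
have Nnn l : (l <= n)%N -> forall x, npow I N (n - l) x -> Nn l x.
  elim: l => [|l IH] le x nx; first by apply: npow0; rewrite -[n]subn0.
  split.
    elim: (n - l.+1)%N x nx => // a IHa x nx; apply: (nx N) => // q b nq _.
    by apply: NR; apply: IHa.
  move=> b Ib; apply: IH; first lia.
  rewrite -[(n - l)%N](@prednK) ?subn_gt0 // -subnS => P P0 PB PI.
  by apply: PI.
have [g [gI gP]] := ideal_fg alpha'K Agen iI.
have dn l : dcc (fam_op (@ksc E)) (Nn l).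
  elim: l => [|l IH]; first exact: dcc0.
  apply: (dcc_exts (@ksc0 E) (l := g) (f := fun b x => rho x b) _ _ _ IH).
  - by move=> b x y; rewrite rhoDl.
  - by move=> b d x; rewrite ksc_rho.
  - by move=> b x bg [Nx h]; apply: h; exact: gI.
  - apply: dcc_sub d1 => x [[Nx _] h]; split=> // b Ib.
    apply: (gP (fun b => rho x b = 0)) Ib => //; split=> [|b1 b2 e1' e2'|b1 r e1'].
    + exact: rho0.
    + by rewrite rhoBr e1' e2' subr0.
    + by rewrite rhoM e1' rho0l.
apply: dcc_tartinian; apply: dcc_sub (dn n) => x Nx.
by apply: Nnn => //; rewrite subnn.
Qed.
End Torsionfree.
End Cases.
End Artinian.

(** * Schur's lemma over an uncountable field *)

Section Uncountable.
Variable K : choiceType.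
Hypothesis unc : forall s : nat -> K, exists c, forall n, s n <> c.

Lemma unc_seq (c0 : K) (s : nat -> seq K) : exists c, forall n, c \notin s n.
Proof.
have [c cP] := unc (fun m => if unpickle m is Some (n, i) then nth c0 (s n) i else c0).
exists c => n; apply/negP => cs; apply: (cP (pickle (n, index c (s n)))).
by rewrite pickleK nth_index.
Qed.

(** Countably many finite fibres would enumerate K, so some fibre is infinite; this is stated as
    lists of every length. *)
Lemma unc_fiber (c0 : K) (nu : K -> nat) :
  exists n, forall k, exists l : seq K, [/\ uniq l, size l = k & forall c, c \in l -> nu c = n].
Proof.
apply: contrapT => no.
have fin n : exists l : seq K, forall c, nu c = n -> c \in l.
  apply: contrapT => nofin; apply: no; exists n; elim=> [|k [l [ul sl lP]]].
    by exists [::].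
  have [c [cn cl]] : exists c, nu c = n /\ c \notin l.
    apply: contrapT => h; apply: nofin; exists l => c cn.
    by apply/negPn/negP => cl; apply: h; exists c.
  exists (c :: l); split=> /=; [by rewrite cl | by rewrite sl |].
  by move=> d; rewrite inE => /orP [/eqP ->|/lP].
have [c cP] := unc_seq c0 (fun n => projT1 (cid (fin n))).
by have /negP := cP (nu c); apply; case: cid => l /= lP; exact: lP.
Qed.
End Uncountable.

Lemma dependent (K : fieldType) n (M : 'M[K]_(n.+1, n)) :
  exists d : 'rV[K]_n.+1, d != 0 /\ d *m M = 0.
Proof.
have : kermx M != 0.
  apply/eqP=> k0; have := mxrank_ker M; rewrite k0 mxrank0 => /esym/eqP.
  rewrite subn_eq0 leqNgt ltnS (leq_trans (rank_leq_col M)) //.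
move=> /rowV0Pn [d dk d0]; exists d; split=> //.
by apply/sub_kermxP.
Qed.

Section Schur.
Variables (K : closedFieldType) (A : comNzRingType) (kc : {rmorphism K -> A}).
Hypothesis unc : forall s : nat -> K, exists c, forall n, s n <> c.
Variables (alpha alpha' : {rmorphism A -> A}).
Hypotheses (alphaK : cancel alpha alpha') (alpha'K : cancel alpha' alpha).
Hypothesis alpha_kc : forall c, alpha (kc c) = kc c.
Variables (gx gy : A).
Hypothesis Agen : forall P : A -> Prop, (forall c, P (kc c)) ->
  (forall r s, P r -> P s -> P (r + s)) -> (forall r, P r -> P (r * gx)) ->
  (forall r, P r -> P (r * gy)) -> forall r, P r.

Section Simple.
Variable V : tmod alpha.
Hypothesis sV : tsimple V.
Local Notation sc := (@ksc K A kc alpha V).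

Lemma countable_span : exists e : nat -> V, forall v, exists n (c : nat -> K),
  v = \sum_(m < n) sc (c m) (e m).
Proof.
have [v0 v00] := sV.1.
pose e (m : nat) : V := if unpickle m is Some (i, j, k) then
  iter k (@tt _ _ V) (rho v0 (gx ^+ i * gy ^+ j)) else 0.
pose S v := exists n (c : nat -> K), v = \sum_(m < n) sc (c m) (e m).
have Se k i j : S (iter k (@tt _ _ V) (rho v0 (gx ^+ i * gy ^+ j))).
  pose m := pickle (i, j, k); exists m.+1, (fun l => if l == m then 1 else 0).
  rewrite big_ord_recr /= eqxx ksc1 /e pickleK big1 ?add0r // => l _.
  by rewrite ifN ?ksc0l //; case: l => l /= ll; lia.
have ext n m (c : nat -> K) : (n <= m)%N -> exists c' : nat -> K,
    \sum_(i < n) sc (c i) (e i) = \sum_(i < m) sc (c' i) (e i).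
  move=> le; exists (fun i => if (i < n)%N then c i else 0).
  rewrite (big_ord_widen m (fun i => sc (c i) (e i)) le) big_mkcond.
  by apply: eq_bigr => i _; case: ifP => //; rewrite ksc0l.
have SB x y : S x -> S y -> S (x - y).
  move=> [n [c ->]] [m [d ->]].
  have [c' ->] := ext n (maxn n m) c (leq_maxl _ _).
  have [d' ->] := ext m (maxn n m) d (leq_maxr _ _).
  exists (maxn n m), (fun i => c' i - d' i); rewrite -sumrB.
  by apply: eq_bigr => i _; rewrite /ksc rmorphB rhoBr.
have S0 : S 0 by exists 0%N, (fun _ => 0); rewrite big_ord0.
have SD x y : S x -> S y -> S (x + y).
  by move=> Sx Sy; rewrite -[y]opprK; apply: (SB) => //; rewrite -sub0r; exact: SB.
have SK d x : S x -> S (sc d x).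
  move=> [n [c ->]]; exists n, (fun i => d * c i).
  rewrite /ksc rho_suml; apply: eq_bigr => i _; rewrite -rhoM -rmorphM mulrC //.
have SA k r : S (iter k (@tt _ _ V) (rho v0 r)).
  suff [F rE] : exists s : seq (K * nat * nat), r = \sum_(t <- s) kc t.1.1 * (gx ^+ t.1.2 * gy ^+ t.2).
    rewrite rE rho_sumr iter_tt_sum; elim/big_ind: _ => // -[[c i] j] _ /=.
    rewrite mulrC rhoM -[rho _ (kc c)]/(sc c _) ksc_iter_tt //.
    by apply: SK; exact: Se.
  move: r; apply: Agen.
  - by move=> c; exists [:: (c, 0%N, 0%N)]; rewrite big_seq1 /= !mulr1.
  - by move=> r s [l ->] [l' ->]; exists (l ++ l'); rewrite big_cat.
  - move=> r [l ->]; exists [seq (t.1.1, t.1.2.+1, t.2) | t <- l].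
    rewrite big_map mulr_suml; apply: eq_bigr => t _ /=.
    by rewrite exprSr -!mulrA [gx * _]mulrC.
  - move=> r [l ->]; exists [seq (t.1.1, t.1.2, t.2.+1) | t <- l].
    rewrite big_map mulr_suml; apply: eq_bigr => t _ /=.
    by rewrite exprSr -!mulrA.
exists e => v; suff: forall v, S v by apply.
have stt x : S x -> S (tt x).
  move=> [n [c ->]]; rewrite (big_morph _ (@ttD _ _ V) (@tt0 _ _ V)).
  elim/big_ind: _ => // i _; rewrite ksc_tt //; apply: SK.
  by rewrite /e; case: unpickle => [[[a b] k]|]; [exact: (Se k.+1) | rewrite tt0].
apply: (tsimple_all sV); last first.
  by exists v0; split=> //; have := SA 0%N 1; rewrite /= rho1.
split=> // x r [n [c ->]]; rewrite rho_suml; elim/big_ind: _ => // i _.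
rewrite ksc_rho; apply: SK; rewrite /e; case: unpickle => [[[a b] k]|]; last by rewrite rho0l.
by rewrite -iter_tt_rho -rhoM; exact: SA.
Qed.

(* Dixmier's form of Schur's lemma: the vectors (phi - c)^-1 v, for c in the uncountable
   field K, would be linearly independent in a space of countable dimension. *)
Theorem schur (phi : V -> V) : thom phi -> exists c, forall v, phi v = sc c v.
Proof.
move=> hphi; case: (hphi) => phiD phiR phiT; apply: contrapT => no.
have [v0 v00] := sV.1.
have scB c d x : sc (c - d) x = sc c x - sc d x by rewrite /ksc rmorphB rhoBr.
have noeig c w : w != 0 -> phi w <> sc c w.
  move=> w0 we; apply: no; exists c; apply: (tsimple_all sV); last by exists w.
  split=> [|x y ex ey|x r ex|x ex].
  - by rewrite (thom0 hphi) ksc0.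
  - by rewrite (thomB _ _ hphi) ex ey kscB.
  - by rewrite phiR ex ksc_rho.
  - by rewrite phiT ex ksc_tt.
(* In the absence of eigenvectors, phi - c has a non-zero image, which is a submodule and therefore
   all of V. *)
have inv c : exists u, phi u - sc c u = v0.
  suff: forall v, exists u, phi u - sc c u = v by apply.
  apply: (tsimple_all sV); last first.
    exists (phi v0 - sc c v0); split; first by exists v0.
    by rewrite subr_eq0; apply/eqP; exact: noeig.
  split.
  - by exists 0; rewrite (thom0 hphi) ksc0 subr0.
  - move=> _ _ [x <-] [y <-]; exists (x - y).
    by rewrite (thomB _ _ hphi) kscB !opprD !opprK addrACA.
  - by move=> _ r [x <-]; exists (rho x r); rewrite phiR -ksc_rho rhoBl.
  - by move=> _ [x <-]; exists (tt x); rewrite phiT -ksc_tt // ttB.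
pose u c := projT1 (cid (inv c)).
have uP c : phi (u c) - sc c (u c) = v0 by rewrite /u; case: cid.
have [e eP] := countable_span.
pose nu c := projT1 (cid (eP (u c))).
have nuP c : exists d : nat -> K, u c = \sum_(m < nu c) sc (d m) (e m) by rewrite /nu; case: cid.
have [n nP] := unc_fiber unc 0 nu.
have [l [ul sl lP]] := nP n.+1.
pose cs (i : 'I_n.+1) := nth 0 l i.
have csn i : nu (cs i) = n by apply: lP; rewrite mem_nth // sl.
have cs_inj i j : cs i = cs j -> i = j.
  by move/eqP; rewrite nth_uniq ?sl // => /eqP/val_inj.
have coefs i : exists d : nat -> K, u (cs i) = \sum_(m < n) sc (d m) (e m).
  by have := nuP (cs i); rewrite csn.
pose D i := projT1 (cid (coefs i)).
have DP i : u (cs i) = \sum_(m < n) sc (D i m) (e m) by rewrite /D; case: cid.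
have [d [d0 dM]] := dependent (\matrix_(i, m) D i m : 'M[K]_(n.+1, n)).
have du : \sum_i sc (d 0 i) (u (cs i)) = 0.
  transitivity (\sum_(m < n) sc ((d *m (\matrix_(i, m) D i m : 'M[K]_(n.+1, n))) 0 m) (e m)).
    rewrite (eq_bigr (fun i => \sum_(m < n) sc (d 0 i * D i m) (e m))); last first.
      move=> i _; rewrite DP /ksc rho_suml; apply: eq_bigr => m _.
      by rewrite -rhoM -rmorphM mulrC.
    rewrite exchange_big; apply: eq_bigr => m _; rewrite mxE /ksc rmorph_sum rho_sumr.
    by apply: eq_bigr => i _; rewrite mxE.
  by rewrite dM big1 // => m _; rewrite mxE ksc0l.
(* Clearing denominators in the dependence of the (phi - c_i)^-1 v0 gives q(phi) v0 = 0. The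
   polynomial q is non-zero, since at c_i0 only the term of index i0 survives, and so phi would have
   an eigenvector. *)
pose p i : {poly K} := \prod_(k < n.+1 | k != i) ('X - (cs k)%:P).
pose q : {poly K} := \sum_i d 0 i *: p i.
have sp i : (size (p i) <= n.+1)%N.
  have : size (\prod_(k < n.+1) ('X - (cs k)%:P)) = n.+2.
    by rewrite size_prod_XsubC -[index_enum _]enumT size_enum_ord.
  rewrite (bigD1 i) //= -/(p i) size_Mmonic ?polyXsubC_eq0 //; last first.
    by apply: monic_prod => k _; exact: monicXsubC.
  by rewrite size_XsubC add2n /= => -[->].
have sq : (size q <= n.+1)%N.
  by apply: (leq_trans (size_sum _ _ _)); apply/bigmax_leqP => i _; rewrite (leq_trans (size_scale_leq _ _)).
have [i0 di0] : exists i, d 0 i != 0.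
  apply: contrapT => h; case/eqP: d0; apply/rowP=> i; rewrite mxE.
  by apply: contrapT => /eqP di; apply: h; exists i.
have q0 : q != 0.
  apply/eqP => /(f_equal (fun p : {poly K} => p.[cs i0])).
  rewrite horner0 horner_sum (bigD1 i0) //= big1 ?addr0.
    rewrite hornerZ horner_prod => /eqP; rewrite mulf_eq0 (negPf di0) /=.
    move/prodf_eq0 => [k ki]; rewrite hornerXsubC subr_eq0 => /eqP /cs_inj ik.
    by rewrite ik eqxx in ki.
  move=> i ii0; rewrite hornerZ /p horner_prod (bigD1 i0) //=; last by rewrite eq_sym.
  by rewrite hornerXsubC subrr mul0r mulr0.
have pevE m (r : {poly K}) v : (size r <= m)%N -> pev sc phi (size r) r v = pev sc phi m r v.
  move=> le; rewrite /pev (big_ord_widen m (fun i => sc r`_i (iter i phi v)) le) big_mkcond.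
  by apply: eq_bigr => i _; case: ltnP => // lei; rewrite nth_default // ksc0l.
have iD i : {morph iter i phi : x y / x + y} by exact: iter_morphD.
have isc i c x : iter i phi (sc c x) = sc c (iter i phi x).
  by elim: i => //= i ->; rewrite /ksc phiR.
have qv : pev sc phi (size q) q v0 = 0.
  rewrite (pevE n.+2) ?(leq_trans sq) //.
  transitivity (\sum_i sc (d 0 i) (pev sc phi n.+2 (p i) v0)).
    rewrite /pev /ksc; under [RHS]eq_bigr do rewrite rho_suml.
    rewrite exchange_big; apply: eq_bigr => m _; rewrite coef_sum rmorph_sum rho_sumr.
    by apply: eq_bigr => i _; rewrite coefZ rmorphM mulrC rhoM.
  pose full : {poly K} := \prod_k ('X - (cs k)%:P).
  transitivity (\sum_i sc (d 0 i) (pev sc phi n.+2 full (u (cs i)))).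
    apply: eq_bigr => i _; congr (sc _ _).
    rewrite /full (bigD1 i) //= -/(p i) pev_root ?uP //; try exact: ksc0.
    - by rewrite -(pevE _ _ _ (sp i)) (pevE n.+2) // (leq_trans (sp i)).
    - exact: kscM.
    - exact: kscD.
    - exact: kscDl.
    - by move=> c x; rewrite /ksc phiR.
  transitivity (pev sc phi n.+2 full (\sum_i sc (d 0 i) (u (cs i)))).
    rewrite /pev /ksc; under eq_bigr do rewrite rho_suml.
    rewrite exchange_big; apply: eq_bigr => m _.
    rewrite (big_morph _ (iD m) (_ : iter m phi 0 = 0)); last first.
      by apply: (addrI (iter m phi 0)); rewrite -iD !addr0.
    by rewrite rho_suml; apply: eq_bigr => i _; rewrite isc /ksc rhoAC.
  by rewrite du /pev big1 // => i _; rewrite (_ : iter i phi 0 = 0) ?ksc0 //; elim: (i : nat) => //= m ->; exact: (thom0 hphi).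
have [|||||| mu [w [w0 we _]]] := @poly_eigenvector K V sc phi _ _ _ _ _ _ q v0 q0 v00 qv => //.
- exact: ksc1.
- exact: kscM.
- exact: kscD.
- exact: kscDl.
- by move=> c x; rewrite /ksc phiR.
exact: (noeig mu w).
Qed.
End Simple.

Lemma char_of_eigen (V : tmod alpha) (w : V) : w != 0 ->
  (forall r, exists c, rho w r = @ksc K A kc alpha V c w) ->
  exists chi : {rmorphism A -> K}, (forall c, chi (kc c) = c) /\
    forall r, rho w r = rho w (kc (chi r)).
Proof.
move=> w0 eig; pose f r := projT1 (cid (eig r)).
have fP r : rho w r = rho w (kc (f r)) by rewrite /f; case: cid.
have uniq c d : rho w (kc c) = rho w (kc d) -> c = d.
  move/eqP; rewrite -subr_eq0 -rhoBr -rmorphB => /eqP e; apply/eqP; rewrite -subr_eq0.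
  by apply: contraNT w0 => cd; apply/eqP; exact: (ksc_eq0 cd e).
have fB : zmod_morphism f by move=> r s; apply: uniq; rewrite -fP !rhoBr rmorphB rhoBr -!fP.
have fM : monoid_morphism f.
  split; first by apply: uniq; rewrite -fP rmorph1.
  by move=> r s; apply: uniq; rewrite -fP rhoM [rho w r]fP rhoAC [rho w s]fP -rhoM -rmorphM mulrC.
pose F : {rmorphism A -> K} := HB.pack f (GRing.isZmodMorphism.Build _ _ f fB) (GRing.isMonoidMorphism.Build _ _ f fM).
by exists F; split=> // c; apply: uniq; rewrite -fP.
Qed.

Lemma joint_eigen_all (V : tmod alpha) (w : V) a b : rho w gx = @ksc K A kc alpha V a w ->
  rho w gy = ksc kc b w -> forall r, exists c, rho w r = ksc kc c w.
Proof.
move=> ex ey; apply: Agen.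
- by move=> c; exists c.
- by move=> r s [c rE] [d sE]; exists (c + d); rewrite rhoDr rE sE kscDl.
- by move=> r [c rE]; exists (c * a); rewrite rhoM rE ksc_rho ex kscM.
- by move=> r [c rE]; exists (c * b); rewrite rhoM rE ksc_rho ey kscM.
Qed.

(** If theta acts as zero, the elements of A act by endomorphisms and Schur's lemma makes them
    scalars; otherwise the assumed eigenvector feeds the Artin-Rees argument. *)
Theorem tdiamond_of_eigen :
  (forall V : tmod alpha, tsimple V -> (exists v : V, tt v != 0) ->
     exists w : V, w != 0 /\ forall r, exists c, rho w r = ksc kc c w) -> tdiamond alpha.
Proof.
move=> eig V E j sV hj ij iE ej N fN.
case: (pselect (exists v : V, tt v != 0)) => [nz|z].
  have [w [w0 we]] := eig V sV nz.
  have [chi [chi_kc chiw]] := char_of_eigen w0 we.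
  have ttw : tt w != 0.
    apply/eqP => tw; case: nz => v /eqP; apply; move: v.
    apply: (tsimple_all sV); last by exists w.
    split=> [|x y ex ey|x r ex|x ex]; rewrite ?tt0 ?ttB ?ex ?ey ?subr0 ?tt0 //.
    by rewrite -[r]alpha'K tt_rho ex rho0l.
  exact: (tartinian_torsionfree alpha'K alpha_kc Agen sV hj ij ej fN chi_kc w0 ttw chiw).
have z0 (v : V) : tt v = 0 by apply: contrapT => /eqP h; apply: z; exists v.
have endo r : thom (fun v : V => rho v r).
  by split=> [x y|x s|x]; rewrite ?rhoDl ?z0 ?rho0l // rhoAC.
have [v0 v00] := sV.1.
have [|chi [chi_kc chiv]] := char_of_eigen v00.
  by move=> r; have [c cP] := schur sV (endo r); exists c.
suff chiV (v : V) r : rho v r = rho v (kc (chi r)).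
  exact: (tartinian_theta0 alpha'K alpha_kc Agen sV hj ej fN z0 chiV).
have [c cP] := schur sV (endo r).
have e : ksc kc c v0 = ksc kc (chi r) v0 by rewrite -cP chiv.
have -> : chi r = c.
  apply/eqP; rewrite eq_sym -subr_eq0; apply: contraNT v00 => cd; apply/eqP.
  by apply: (@ksc_eq0 K A kc alpha V _ _ cd); rewrite /ksc rmorphB rhoBr -[rho v0 (kc c)]/(ksc kc c v0) e subrr.
exact: cP.
Qed.

(** * Automorphisms of finite order *)

Section FiniteOrder.
Variable n : nat.
Hypotheses (n0 : (0 < n)%N) (alpha_n : forall r, iter n alpha r = r).

Lemma central_scalar (V : tmod alpha) (sV : tsimple V) r : alpha r = r ->
  exists c, forall v : V, rho v r = ksc kc c v.
Proof.
move=> ar; apply: (schur sV); split=> [x y|x s|x]; first exact: rhoDl.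
  exact: rhoAC.
by rewrite -[in RHS]ar tt_rho.
Qed.

(** g is a root of the product of the X - alpha^i(g). The coefficients of this product are fixed by
    [alpha], hence act as scalars on V. *)
Lemma finite_poly (V : tmod alpha) (sV : tsimple V) (g : A) :
  exists2 q : {poly K}, q != 0 & forall v : V, pev (@ksc K A kc alpha V) (fun x => rho x g) (size q) q v = 0.
Proof.
pose P : {poly A} := \prod_(i < n) ('X - (iter i alpha g)%:P).
have Pa m : alpha P`_m = P`_m.
  rewrite -coef_map; suff -> : map_poly alpha P = P by [].
  rewrite rmorph_prod.
  rewrite /P -(prednK n0) big_ord_recr [RHS]big_ord_recl /= mulrC.
  rewrite rmorphB /= map_polyX map_polyC /= -[alpha (iter _ _ _)]/(iter n.-1.+1 alpha g) prednK // alpha_n.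
  by congr (_ * _); apply: eq_bigr => i _; rewrite rmorphB /= map_polyX map_polyC.
have sP : size P = n.+1.
  by rewrite size_prod_XsubC -[index_enum _]enumT size_enum_ord.
have Pn : P`_n = 1.
  have : P \is monic by apply: monic_prod => i _; exact: monicXsubC.
  by rewrite monicE lead_coefE sP => /eqP.
pose c m := projT1 (cid (central_scalar sV (Pa m))).
have cP m (v : V) : rho v P`_m = ksc kc (c m) v by rewrite /c; case: cid.
exists (\poly_(m < n.+1) c m).
  apply/eqP => /(f_equal (fun p : {poly K} => p`_n)); rewrite coef_poly ltnSn coef0 => cn0.
  have [v0 v00] := sV.1; have := cP n v0; rewrite Pn rho1 cn0 ksc0l => v0E.
  by rewrite v0E eqxx in v00.
move=> v; set q := \poly_(_ < _) _.
have le : (size q <= n.+1)%N by exact: size_poly.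
transitivity (\sum_(i < n.+1) rho v (P`_i * g ^+ i)).
  rewrite /pev (big_ord_widen n.+1 (fun i => ksc kc q`_i (iter i (fun x => rho x g) v)) le) big_mkcond.
  apply: eq_bigr => i _; rewrite rhoM cP ksc_rho.
  have -> : iter i (fun x => rho x g) v = rho v (g ^+ i).
    by elim: (i : nat) => [|m IH]; rewrite ?expr0 ?rho1 // exprSr rhoM /= IH.
  case: ltnP => lei; first by rewrite coef_poly ltn_ord.
  have : q`_i = 0 by rewrite nth_default.
  by rewrite coef_poly ltn_ord => ->; rewrite ksc0l.
rewrite -rho_sumr (_ : \sum_(i < n.+1) _ = P.[g]); last by rewrite horner_coef sP.
rewrite /P horner_prod -(prednK n0) big_ord_recl hornerXsubC /= subrr mul0r.
exact: rho0.
Qed.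

Lemma finite_order_eigen (V : tmod alpha) : tsimple V ->
  exists w : V, w != 0 /\ forall r, exists c, rho w r = ksc kc c w.
Proof.
move=> sV; have [v0 v00] := sV.1.
have eig g v : v != 0 -> exists (mu : K) (w : V), [/\ w != 0, rho w g = ksc kc mu w &
    forall P : V -> Prop, (forall x y, P x -> P y -> P (x - y)) ->
      (forall c x, P x -> P (ksc kc c x)) -> (forall x, P x -> P (rho x g)) -> P v -> P w].
  move=> v00'; have [q q0 qP] := finite_poly sV g.
  apply: (@poly_eigenvector K V (@ksc K A kc alpha V) (fun x => rho x g) _ _ _ _ _ _ q v) => //.
  - exact: ksc1.
  - exact: kscM.
  - exact: kscD.
  - exact: kscDl.
  - by move=> x y; rewrite rhoDl.
  - by move=> c x; rewrite ksc_rho.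
have [a [w [w0 wa _]]] := eig gx v0 v00.
have [b [w' [w'0 w'b w'P]]] := eig gy w w0.
exists w'; split=> //; apply: (joint_eigen_all (a := a) (b := b)) => //.
apply: (w'P (fun x => rho x gx = ksc kc a x)) => //.
- by move=> x y ex ey; rewrite rhoBl ex ey kscB.
- by move=> c x ex; rewrite ksc_rho ex !kscM mulrC.
- by move=> x ex; rewrite rhoAC ex ksc_rho.
Qed.

Theorem finite_order_tdiamond : tdiamond alpha.
Proof. by apply: tdiamond_of_eigen => V sV _; exact: finite_order_eigen. Qed.

(** theta^n is central, so it acts as a scalar c, and theta^n - c annihilates V. *)
Theorem finite_order_not_tprimitive : ~ tprimitive alpha.
Proof.
case=> V sV fV.
have hn : thom (fun v : V => iter n (@tt _ _ V) v).
  split=> [x y|x r|x]; [exact: iter_ttD | by rewrite -[r in LHS]alpha_n iter_tt_rho |].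
  by rewrite -iterSr.
have [c cP] := schur sV hn.
have [|v /eqP] := fV ('X^n - (kc c)%:P).
  apply/eqP=> /(f_equal (fun p : {poly A} => p`_n)).
  rewrite coefB coefXn eqxx coefC coef0 (gtn_eqF n0) subr0 => /eqP.
  by rewrite oner_eq0.
apply; rewrite tactDr tactN tactC -[rho v _]/(ksc kc c v) -cP.
rewrite (@tactE _ _ _ _ _ n.+1) ?size_polyXn // big_ord_recr /= coefXn eqxx rho1.
rewrite big1 ?add0r ?subrr // => i _.
by rewrite coefXn (ltn_eqF (ltn_ord i)) rho0 iter_tt0.
Qed.
End FiniteOrder.
End Schur.

(** * Irreducible polynomials and torsion in simple modules *)

Section TwoVar.
Variable K : closedFieldType.
Local Notation R := {poly {poly K}}.
Implicit Types (p q f g d : R) (h : {poly K}).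

Definition kk : {rmorphism K -> R} := polyC \o polyC.
Definition xx : R := 'X%:P.
Definition yy : R := 'X.

Lemma R_gen (P : R -> Prop) : (forall c, P (kk c)) ->
  (forall r s, P r -> P s -> P (r + s)) -> (forall r, P r -> P (r * xx)) ->
  (forall r, P r -> P (r * yy)) -> forall r, P r.
Proof.
move=> PK PD Px Py r; elim/poly_ind: r => [|r c Pr]; first by have := PK 0; rewrite rmorph0.
apply: (PD); first exact: Py.
elim/poly_ind: c => [|c a Pc]; first by have := PK 0; rewrite rmorph0.
rewrite polyCD polyCM; apply: PD; [exact: Px | exact: PK].
Qed.

(** The degree of the leading monomial, not the total degree. It is additive on products and, among
    non-zero polynomials, zero exactly on constants, which is what factorisation arguments use. *)
Definition mdeg p : nat := ((size p).-1 + (size (lead_coef p)).-1)%N.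

Lemma mdegM p q : p != 0 -> q != 0 -> mdeg (p * q) = (mdeg p + mdeg q)%N.
Proof.
move=> p0 q0; rewrite /mdeg lead_coefM !size_mul ?lead_coef_eq0 //.
have : (0 < size p)%N by rewrite size_poly_gt0.
have : (0 < size q)%N by rewrite size_poly_gt0.
have : (0 < size (lead_coef p))%N by rewrite size_poly_gt0 lead_coef_eq0.
have : (0 < size (lead_coef q))%N by rewrite size_poly_gt0 lead_coef_eq0.
move: (size p) (size q) (size (lead_coef p)) (size (lead_coef q)) => [|a] [|b] [|c] [|d] //= _ _ _ _.
by rewrite !addnS /= addnACA.
Qed.

Lemma mdeg0P p : p != 0 -> mdeg p = 0%N -> exists2 c, c != 0 & p = kk c.
Proof.
move=> p0 /eqP; rewrite addn_eq0 => /andP [s1 s2].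
have : (0 < size (lead_coef p))%N by rewrite size_poly_gt0 lead_coef_eq0.
have := p0; rewrite -size_poly_gt0 => s1' s2'.
have /size_poly1P [h h0 pE] : size p == 1 by apply/eqP; lia.
move: s2 s2'; rewrite pE lead_coefC => s2 s2'.
have /size_poly1P [c c0 hE] : size h == 1 by apply/eqP; lia.
by exists c; rewrite // hE.
Qed.

Definition rdvd p f := exists q, f = q * p.
Definition rirr p := [/\ p != 0, mdeg p != 0%N & forall a b, p = a * b -> mdeg a = 0%N \/ mdeg b = 0%N].

Definition evx (a : K) : {rmorphism R -> {poly K}} := map_poly (horner_eval a).

Lemma evxE a f i : (evx a f)`_i = (f`_i).[a].
Proof. by rewrite coef_map. Qed.

Lemma evx_xx a : evx a (xx - kk a) = 0.
Proof. by apply/polyP=> i; rewrite evxE /xx /kk /= -polyCB coefC; case: eqP => _; rewrite ?hornerXsubC ?subrr ?horner0 coef0. Qed.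

Lemma evx_eq0 a f : evx a f = 0 -> rdvd (xx - kk a) f.
Proof.
move=> e; exists (\poly_(i < size f) (f`_i %/ ('X - a%:P))).
apply/polyP=> i; rewrite /xx /kk /= -polyCB coefMC coef_poly.
case: ltnP => [_|le]; last by rewrite mul0r nth_default.
by rewrite divpK // dvdp_XsubCl rootE -evxE e coef0.
Qed.

Lemma xk_neq0 a : xx - kk a != 0.
Proof. by rewrite /xx /kk /= -polyCB polyC_eq0 polyXsubC_eq0. Qed.

Lemma closed_factor (c : {poly K}) : (1 < size c)%N -> exists a (c' : {poly K}), [/\ c = ('X - a%:P) * c', c' != 0 & size c = (size c').+1].
Proof.
move=> sc; have /closed_rootP [a ra] : size c != 1 by rewrite neq_ltn sc orbT.
have [c' cE] := factor_theorem c a ra; exists a, c'; rewrite mulrC in cE.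
have c0 : c' != 0 by apply: contraTneq sc => c0; rewrite cE c0 mulr0 size_poly0.
by split=> //; rewrite cE mulrC size_Mmonic ?monicXsubC // size_XsubC addn2.
Qed.

Lemma closed_ind (Q : {poly K} -> Prop) : (forall b, b != 0 -> Q b%:P) ->
  (forall a (c : {poly K}), c != 0 -> Q c -> Q (('X - a%:P) * c)) -> forall c : {poly K}, c != 0 -> Q c.
Proof.
move=> Q0 QS c; move: {2}(size c) (leqnn (size c)) => n; elim: n c => [|n IH] c le c0.
  by move: le; rewrite leqn0 size_poly_eq0 (negPf c0).
case: (leqP (size c) 1) => [le1|gt1].
  have /size_poly1P [b b0 ->] : size c == 1 by rewrite eqn_leq le1 size_poly_gt0.
  exact: Q0.
have [a [c' [cE c'0 sc]]] := closed_factor gt1.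
by rewrite cE; apply: QS => //; apply: IH => //; lia.
Qed.

Lemma lin_split a f q d : (xx - kk a) * f = q * d ->
  (exists2 q', q = (xx - kk a) * q' & f = q' * d) \/
  (exists2 d', d = (xx - kk a) * d' & f = q * d').
Proof.
move=> e; have := f_equal (evx a) e; rewrite !rmorphM evx_xx mul0r => /esym/eqP.
rewrite mulf_eq0 => /orP [/eqP/evx_eq0 [q' qE]|/eqP/evx_eq0 [d' dE]].
  left; exists q'; first by rewrite mulrC.
  by apply: (mulfI (xk_neq0 a)); rewrite e qE mulrA [_ * q']mulrC.
right; exists d'; first by rewrite mulrC.
by apply: (mulfI (xk_neq0 a)); rewrite e dE mulrA mulrC.
Qed.

Lemma polyC_lin a (c : {poly K}) : (('X - a%:P) * c)%:P = (xx - kk a) * c%:P.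
Proof. by rewrite polyCM polyCB. Qed.

Lemma kkV b : b != 0 -> kk b^-1 * kk b = 1.
Proof. by move=> b0; rewrite -rmorphM mulVf // rmorph1. Qed.

(** Gauss's lemma for K[x][y]: each linear factor x - a of c is prime, because setting x = a lands
    in a domain, so it cancels from q or from d. *)
Lemma split_x (c : {poly K}) f q d : c != 0 -> c%:P * f = q * d ->
  exists q1 d1 (c2 : {poly K}), f = q1 * d1 /\ d = c2%:P * d1.
Proof.
move=> c0; move: c c0 f q d; apply: closed_ind => [b b0|a c c0 IH] f q d.
  move=> e; exists (kk b^-1 * q), d, 1; rewrite polyC1 mul1r; split=> //.
  by rewrite -mulrA -e mulrA kkV // mul1r.
rewrite polyC_lin -mulrA => /lin_split [[q' _]|[d' dE]] /IH [q1 [d1 [c2 [fE d1E]]]].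
  by exists q1, d1, c2.
by exists q1, d1, (('X - a%:P) * c2); split=> //; rewrite polyC_lin -mulrA -d1E.
Qed.

Lemma irr_evx a p : rirr p -> (1 < size p)%N -> evx a p <> 0.
Proof.
move=> [p0 m0 pirr] sp /evx_eq0 [g pE].
have g0 : g != 0 by apply: contraNneq p0 => g0; rewrite pE g0 mul0r.
have [mg|] := pirr _ _ pE.
  have [b b0 gE] := mdeg0P g0 mg; move: sp; rewrite pE gE /kk /xx /= -polyCB -polyCM.
  by rewrite ltnNge size_polyC_leq1.
by rewrite /xx /kk /= -polyCB /mdeg lead_coefC size_XsubC addn1.
Qed.

Lemma cancel_x p (c : {poly K}) f q : rirr p -> (1 < size p)%N -> c != 0 -> c%:P * f = q * p -> rdvd p f.
Proof.
move=> ip sp c0; move: c c0 f q; apply: closed_ind => [b b0|a c c0 IH] f q.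
  by move=> e; exists (kk b^-1 * q); rewrite -mulrA -e mulrA kkV // mul1r.
rewrite polyC_lin -mulrA => /lin_split [[q' _ /IH //]|[d' pE _]].
by case: (@irr_evx a p ip sp); rewrite pE rmorphM evx_xx mul0r.
Qed.

(** Bezout over K(x) with denominators cleared. Take d of least y-degree in the ideal (p, f);
    pseudo-division shows that it divides p and f up to factors in K[x]. By [split_x] and
    irreducibility, either p divides f, or d lies in K[x]. *)
Lemma irr_bezout p f : rirr p -> (1 < size p)%N -> ~ rdvd p f ->
  exists (c : {poly K}) u w, c != 0 /\ c%:P = u * p + w * f.
Proof.
move=> ip sp nd; pose J d := exists u w, d = u * p + w * f.
have [p0 m0 pirr] := ip.
have Jp : J p by exists 1, 0; rewrite mul1r mul0r addr0.
have Jf : J f by exists 0, 1; rewrite mul1r mul0r add0r.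
have JM r d : J d -> J (r * d) by move=> [u [w ->]]; exists (r * u), (r * w); rewrite mulrDr !mulrA.
have JB d d' : J d -> J d' -> J (d - d').
  by move=> [u [w ->]] [u' [w' ->]]; exists (u - u'), (w - w'); rewrite !mulrBl opprD addrACA.
have [|n /asboolP [d [Jd d0 sd]] nmin] := @ex_minnP (fun n => `[< exists d, [/\ J d, d != 0 & size d = n] >]).
  by exists (size p); apply/asboolP; exists p.
have div g : J g -> exists k q, (lead_coef d ^+ k)%:P * g = q * d.
  move=> Jg; exists (scalp g d), (g %/ d); rewrite mul_polyC Pdiv.Idomain.divp_eq.
  suff -> : g %% d = 0 by rewrite addr0.
  apply: contrapT => /eqP r0; have := nmin (size (g %% d)).
  have := ltn_modp g d; rewrite d0 sd => lt; case: asboolP => [_ /(_ isT)|[]]; first lia.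
  exists (g %% d); split=> //.
  have := Pdiv.Idomain.divp_eq g d; move/eqP; rewrite addrC -subr_eq => /eqP <-.
  by apply: JB; [rewrite -mul_polyC; exact: JM | exact: JM].
have lk0 k : lead_coef d ^+ k != 0 by rewrite expf_neq0 ?lead_coef_eq0.
have [k [q pE]] := div p Jp.
have [q1 [d1 [c2 [pE1 dE]]]] := split_x (lk0 k) pE.
have q10 : q1 != 0 by apply: contraNneq p0 => z; rewrite pE1 z mul0r.
have d10 : d1 != 0 by apply: contraNneq p0 => z; rewrite pE1 z mulr0.
have [mq|md] := pirr _ _ pE1.
  have [b b0 q1E] := mdeg0P q10 mq.
  have [k' [q' fE]] := div f Jf; case: nd.
  apply: (@cancel_x p (lead_coef d ^+ k') f (q' * c2%:P * kk b^-1)) => //.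
  by rewrite fE dE pE1 q1E -!mulrA [kk b^-1 * _]mulrA kkV // mul1r.
have [b b0 d1E] := mdeg0P d10 md.
have [u [w dJ]] := Jd; exists (c2 * b%:P), u, w; split.
  by apply: contraNneq d0 => z; rewrite dE d1E /kk /= -polyCM z.
by rewrite -dJ dE d1E /kk /= polyCM.
Qed.

Lemma irr_size1 p : rirr p -> (size p <= 1)%N -> exists a b, b != 0 /\ p = kk b * (xx - kk a).
Proof.
move=> [p0 m0 pirr] sp.
have /size_poly1P [h h0 pE] : size p == 1 by rewrite eqn_leq sp size_poly_gt0.
have sh : (1 < size h)%N by move: m0; rewrite pE /mdeg lead_coefC size_polyC h0 /=; lia.
have [a [h' [hE h'0 _]]] := closed_factor sh.
have [|m|] := pirr h'%:P (xx - kk a).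
- by rewrite pE hE polyC_lin mulrC.
- have [|b b0 e] := mdeg0P _ m; first by rewrite polyC_eq0.
  by exists a, b; rewrite pE hE polyC_lin e mulrC.
- by rewrite /xx /kk /= -polyCB /mdeg lead_coefC size_XsubC addn1.
Qed.

Lemma irr_prime p f g : rirr p -> rdvd p (f * g) -> rdvd p f \/ rdvd p g.
Proof.
move=> ip [q fgE]; case: (leqP (size p) 1) => [le|sp]; last first.
  case: (pselect (rdvd p f)) => [|nd]; [by left | right].
  have [c [u [w [c0 cE]]]] := irr_bezout ip sp nd.
  apply: (@cancel_x p c g (u * g + w * q)) => //.
  by rewrite cE !mulrDl -!mulrA fgE [p * g]mulrC.
have [a [b [b0 pE]]] := irr_size1 ip le.
have ex r : evx a r = 0 -> rdvd p r.
  move=> /evx_eq0 [s ->]; exists (s * kk b^-1).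
  by rewrite pE -mulrA [kk b^-1 * _]mulrA kkV // mul1r.
have e0 : evx a p = 0 by rewrite pE rmorphM evx_xx mulr0.
have := f_equal (evx a) fgE; rewrite !rmorphM e0 !mulr0 => /eqP.
by rewrite mulf_eq0 => /orP [/eqP/ex|/eqP/ex]; [left | right].
Qed.

Lemma irr_prime_prod p (I : finType) (F : I -> R) : rirr p -> rdvd p (\prod_i F i) ->
  exists i, rdvd p (F i).
Proof.
move=> ip; rewrite /index_enum; case: index_enum_key => /=; elim: (Finite.enum I) => [|i l IH].
  rewrite big_nil => -[q e]; case: ip => p0 m0 _; exfalso; case/eqP: m0.
  have q0 : q != 0 by apply: contra_eq_neq e => ->; rewrite mul0r oner_eq0.
  have := f_equal mdeg e; rewrite mdegM // /mdeg size_poly1 lead_coef1 size_poly1 /=.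
  by lia.
by rewrite big_cons => /(irr_prime ip) [h|/IH //]; exists i.
Qed.

(** * Torsion vectors in simple modules *)

Section Modules.
Hypothesis unc : forall s : nat -> K, exists c, forall n, s n <> c.
Variables (alpha alpha' : {rmorphism R -> R}).
Hypotheses (alphaK : cancel alpha alpha') (alpha'K : cancel alpha' alpha).
Hypothesis alpha_kk : forall c, alpha (kk c) = kk c.
Local Notation sc := (ksc kk).

Lemma pev_rho (V : tmod alpha) (v : V) r (q : {poly K}) n : (size q <= n)%N ->
  pev (@ksc K _ kk alpha V) (fun x => rho x r) n q v = rho v (\sum_(i < n) kk q`_i * r ^+ i).
Proof.
move=> le; rewrite rho_sumr; apply: eq_bigr => i _.
rewrite mulrC rhoM; congr (rho _ _).
by elim: (i : nat) => [|m IH]; rewrite ?expr0 ?rho1 // exprSr rhoM /= IH.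
Qed.

Lemma eig_rho (V : tmod alpha) (v : V) r (q : {poly K}) : q != 0 -> v != 0 ->
  rho v (\sum_(i < size q) kk q`_i * r ^+ i) = 0 ->
  exists (mu : K) (w : V), [/\ w != 0, rho w r = sc mu w & exists s, w = rho v s].
Proof.
move=> q0 v0 e.
have [|||||||mu [w [w0 we wP]]] := @poly_eigenvector K V (@ksc K _ kk alpha V) (fun x => rho x r) _ _ _ _ _ _ q v q0 v0.
- exact: ksc1.
- exact: kscM.
- exact: kscD.
- exact: kscDl.
- by move=> x y; rewrite rhoDl.
- by move=> c x; rewrite ksc_rho.
- by rewrite pev_rho.
exists mu, w; split=> //; apply: (wP (fun w => exists s, w = rho v s)).
- by move=> _ _ [s ->] [t ->]; exists (s - t); rewrite rhoBr.
- by move=> c _ [s ->]; exists (s * kk c); rewrite rhoM.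
- by move=> _ [s ->]; exists (s * r); rewrite rhoM.
- by exists 1; rewrite rho1.
Qed.

Lemma sum_xx (c : {poly K}) : \sum_(i < size c) kk c`_i * xx ^+ i = c%:P.
Proof.
rewrite -[in RHS](coefK c) poly_def rmorph_sum; apply: eq_bigr => i _.
by rewrite /= -mul_polyC polyCM /xx /kk /= polyC_exp.
Qed.

Lemma sum_yy (c : {poly K}) : \sum_(i < size c) kk c`_i * yy ^+ i = map_poly polyC c.
Proof.
rewrite [RHS](_ : _ = \poly_(i < size c) (c`_i)%:P) // poly_def.
by apply: eq_bigr => i _; rewrite -mul_polyC.
Qed.

(** Bezout yields a polynomial in x alone that kills v, or p itself is linear in x; either way there
    is an eigenvector of x. Setting x to its eigenvalue leaves p or r non-zero, which gives a
    polynomial in y killing that vector, hence an eigenvector of y. *)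
Lemma joint_eigen (V : tmod alpha) (v : V) p r : v != 0 -> rho v p = 0 -> rho v r = 0 ->
  rirr p -> ~ rdvd p r -> exists w : V, w != 0 /\ forall s, exists c, rho w s = sc c w.
Proof.
move=> v0 vp vr ip nd.
have [a [w [w0 wx wp wr nz]]] : exists a (w : V),
    [/\ w != 0, rho w xx = sc a w, rho w p = 0, rho w r = 0 & evx a p <> 0 \/ evx a r <> 0].
  case: (leqP (size p) 1) => [le|sp].
    have [a [b [b0 pE]]] := irr_size1 ip le; exists a, v; split=> //.
      move: vp; rewrite pE rhoM -[rho v (kk b)]/(sc b v) ksc_rho => /(ksc_eq0 b0) /eqP.
      by rewrite rhoBr subr_eq0 => /eqP.
    right=> /evx_eq0 [s rE]; apply: nd; exists (s * kk b^-1).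
    by rewrite rE pE -mulrA [kk b^-1 * _]mulrA kkV // mul1r.
  have [c [u [s [c0 cE]]]] := irr_bezout ip sp nd.
  have [|a [w [w0 wx [t wE]]]] := @eig_rho V v xx c c0 v0.
    by rewrite sum_xx cE rhoDr [u * p]mulrC [s * r]mulrC !rhoM vp vr !rho0l addr0.
  exists a, w; split=> //; last by left; exact: irr_evx.
  - by rewrite wE rhoAC vp rho0l.
  - by rewrite wE rhoAC vr rho0l.
have [h [h0 wh]] : exists h : R, evx a h <> 0 /\ rho w h = 0.
  by case: nz => nz; [exists p | exists r].
have /eqP q0 := h0.
have e1 : rho w (map_poly polyC (evx a h)) = 0.
  have /evx_eq0 [s sE] : evx a (h - map_poly polyC (evx a h)) = 0.
    by apply/polyP=> i; rewrite evxE coefB coef_map /= hornerD hornerN hornerC evxE subrr coef0.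
  have hE : h = (xx - kk a) * s + map_poly polyC (evx a h) by rewrite mulrC -sE subrK.
  have := wh; rewrite {1}hE rhoDr rhoM rhoBr wx.
  by rewrite [sc a w - _]subrr rho0l add0r.
have [|b [w' [w'0 w'y [t w'E]]]] := @eig_rho V w yy (evx a h) q0 w0; first by rewrite sum_yy.
exists w'; split=> //; apply: (joint_eigen_all R_gen (a := a) (b := b)) => //.
by rewrite w'E rhoAC wx ksc_rho.
Qed.

Lemma irr_killer (V : tmod alpha) (v : V) r : v != 0 -> r != 0 -> rho v r = 0 ->
  exists p (w : V), [/\ rirr p, w != 0 & rho w p = 0].
Proof.
move=> v0 r0 vr.
have [|n /asboolP [p [w [p0 w0 wp mp]]] nmin] := @ex_minnP
   (fun n => `[< exists p (w : V), [/\ p != 0, w != 0, rho w p = 0 & mdeg p = n] >]).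
  by exists (mdeg r); apply/asboolP; exists r, v.
exists p, w; split=> //; split=> // [|a b pE].
  apply/eqP => m0; have [c c0 pE] := mdeg0P p0 m0; move: wp; rewrite pE => /(ksc_eq0 c0) we.
  by rewrite we eqxx in w0.
have a0 : a != 0 by apply: contraNneq p0 => z; rewrite pE z mul0r.
have b0 : b != 0 by apply: contraNneq p0 => z; rewrite pE z mulr0.
have mE : (mdeg a + mdeg b = n)%N by rewrite -mdegM // -pE.
case: (eqVneq (rho w a) 0) => [wa|wa].
  right; have := nmin (mdeg a); case: asboolP => [_ /(_ isT)|[]]; first lia.
  by exists a, w.
left; have := nmin (mdeg b); case: asboolP => [_ /(_ isT)|[]]; first lia.
by exists b, (rho w a); rewrite -rhoM -pE.
Qed.

Lemma rirr_aut (f g : {rmorphism R -> R}) p : cancel f g -> cancel g f ->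
  (forall c, f (kk c) = kk c) -> rirr p -> rirr (f p).
Proof.
move=> fK gK fc [p0 m0 pirr].
have gc c : g (kk c) = kk c by rewrite -[in LHS]fc fK.
have gm a : a != 0 -> mdeg (g a) = 0%N -> mdeg a = 0%N.
  move=> a0 ma; have [|c c0 e] := mdeg0P _ ma.
    by rewrite -(rmorph0 g) (inj_eq (can_inj gK)).
  by rewrite -[a]gK e fc /kk /mdeg /= lead_coefC !size_polyC polyC_eq0 c0.
have fp0 : f p != 0 by rewrite -(rmorph0 f) (inj_eq (can_inj fK)).
split=> //.
  apply/eqP => mf; have [c c0 e] := mdeg0P fp0 mf; case/eqP: m0.
  by rewrite -[p]fK e gc /kk /mdeg /= lead_coefC !size_polyC polyC_eq0 c0.
move=> a b e.
have a0 : a != 0 by apply: contraNneq fp0 => z; rewrite e z mul0r.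
have b0 : b != 0 by apply: contraNneq fp0 => z; rewrite e z mulr0.
have : p = g a * g b by rewrite -rmorphM -e fK.
by case/pirr => m; [left | right]; exact: gm.
Qed.

Lemma dvd_irr p q : rirr p -> rirr q -> rdvd p q -> exists2 c, c != 0 & q = kk c * p.
Proof.
move=> [p0 m0 _] [q0 _ qirr] [s e]; have s0 : s != 0 by apply: contraNneq q0 => z; rewrite e z mul0r.
have [m|m] := qirr _ _ e; last by rewrite m eqxx in m0.
by have [c c0 sE] := mdeg0P s0 m; exists c; rewrite -?sE.
Qed.

(** The sums of the theta^(i+1)(v r) form a submodule containing [tt v], hence all of V; in
    particular they represent v itself. *)
Lemma simple_expand (V : tmod alpha) (v : V) : tsimple V -> (exists v : V, tt v != 0) -> v != 0 ->
  exists n (F : nat -> R), v = \sum_(i < n) iter i.+1 (@tt _ _ V) (rho v (F i)).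
Proof.
move=> sV nz v0.
pose S (u : V) := exists n (F : nat -> R), u = \sum_(i < n) iter i.+1 (@tt _ _ V) (rho v (F i)).
suff: forall u, S u by apply.
have tv : tt v != 0.
  apply/eqP => tv; case: nz => u /eqP; apply; move: u.
  apply: (tsimple_all sV); last by exists v.
  split=> [|x y ex ey|x r ex|x ex]; rewrite ?tt0 ?ttB ?ex ?ey ?subr0 ?tt0 //.
  by rewrite -[r]alpha'K tt_rho ex rho0l.
have ext n m (F : nat -> R) : (n <= m)%N -> exists F' : nat -> R,
    \sum_(i < n) iter i.+1 (@tt _ _ V) (rho v (F i))
    = \sum_(i < m) iter i.+1 (@tt _ _ V) (rho v (F' i)).
  move=> le; exists (fun i => if (i < n)%N then F i else 0).
  rewrite (big_ord_widen m (fun i => iter i.+1 (@tt _ _ V) (rho v (F i))) le) big_mkcond.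
  by apply: eq_bigr => i _; case: ifP => //; rewrite rho0 iter_tt0.
apply: (tsimple_all sV); last first.
  by exists (tt v); split=> //; exists 1%N, (fun _ => 1); rewrite big_ord1 rho1.
split.
- by exists 0%N, (fun _ => 0); rewrite big_ord0.
- move=> _ _ [n [F ->]] [m [G ->]].
  have [F' ->] := ext n (maxn n m) F (leq_maxl _ _).
  have [G' ->] := ext m (maxn n m) G (leq_maxr _ _).
  exists (maxn n m), (fun i => F' i - G' i); rewrite -sumrB.
  by apply: eq_bigr => i _; rewrite rhoBr iter_ttB.
- move=> _ r [n [F ->]]; exists n, (fun i => F i * iter i.+1 alpha r).
  by rewrite rho_suml; apply: eq_bigr => i _; rewrite rhoM iter_tt_rho.
- move=> _ [n [F ->]]; exists n.+1, (fun i => if i is k.+1 then F k else 0).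
  rewrite big_ord_recl rho0 iter_tt0 add0r (big_morph _ (@ttD _ _ V) (@tt0 _ _ V)).
  by apply: eq_bigr.
Qed.

(** Let p be irreducible with w p = 0. Expanding w by [simple_expand], w is also killed by the
    product of the alpha'^(i+1)(p). If p does not divide this product, [joint_eigen] applies; if it
    does, p divides one factor, which is irreducible too, so p is associated to one of its
    images. *)
Theorem torsion_dichotomy (V : tmod alpha) (v : V) r : tsimple V -> (exists v : V, tt v != 0) ->
  v != 0 -> r != 0 -> rho v r = 0 ->
  (exists w : V, w != 0 /\ forall s, exists c, rho w s = sc c w) \/
  exists p (w : V) m c, [/\ rirr p, w != 0, rho w p = 0, c != 0 & iter m.+1 alpha p = kk c * p].
Proof.
move=> sV nz v0 r0 vr; have [p [w [ip w0 wp]]] := irr_killer v0 r0 vr.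
have [n [F wE]] := simple_expand sV nz w0.
pose r' := \prod_(i < n) iter i.+1 alpha' p.
have aaK m : cancel (iter m alpha') (iter m alpha) by exact: iter_can.
have wr' : rho w r' = 0.
  rewrite wE rho_suml big1 // => i _; rewrite /r' (bigD1 i) //= -iterS rhoM.
  by rewrite -[rho (iter _ _ _) _]iter_tt_rho -iterS aaK rhoAC wp rho0l iter_tt0 rho0l.
case: (pselect (rdvd p r')) => [|nd]; last by left; exact: (joint_eigen w0 wp wr' ip nd).
move/(irr_prime_prod ip) => [i di]; right.
have irra : forall m, rirr (iter m alpha' p).
  elim=> // m; apply: rirr_aut alpha'K alphaK _ => c.
  by rewrite -[in LHS]alpha_kk alphaK.
have [c c0 e] := dvd_irr ip (irra i.+1) di.
exists p, w, i, c^-1; split; rewrite ?invr_eq0 //.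
have ikk m b : iter m alpha (kk b) = kk b by elim: m => //= m ->; exact: alpha_kk.
have := f_equal (iter i.+1 alpha) e; rewrite aaK iter_rmorphM ikk => pE.
by rewrite {2}pE mulrA kkV // mul1r.
Qed.
End Modules.
End TwoVar.

(** * Faithful simple modules *)

Section Faithful.
Variables (A : idomainType) (alpha alpha' : {rmorphism A -> A}).
Hypotheses (alphaK : cancel alpha alpha') (alpha'K : cancel alpha' alpha).
Variable V : tmod alpha.
Hypotheses (sV : tsimple V) (ttV : exists v : V, tt v != 0).

Lemma tt_inj (v : V) : tt v = 0 -> v = 0.
Proof.
move=> tv; apply: contrapT => /eqP nv; case: ttV => u /eqP; apply; move: u.
apply: (tsimple_all sV); last by exists v.
split=> [|x y ex ey|x r ex|x ex]; rewrite ?tt0 ?ttB ?ex ?ey ?subr0 ?tt0 //.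
by rewrite -[r]alpha'K tt_rho ex rho0l.
Qed.

Lemma iter_tt_inj n (v : V) : iter n (@tt _ _ V) v = 0 -> v = 0.
Proof. by elim: n => //= n IH /tt_inj. Qed.

Lemma rho_iter n (v : V) r : rho (iter n (@tt _ _ V) v) r = iter n (@tt _ _ V) (rho v (iter n alpha r)).
Proof. by rewrite iter_tt_rho. Qed.

Lemma iter_ttV_rho n (v : V) r : iter n (@tt _ _ V) (rho v r) = rho (iter n (@tt _ _ V) v) (iter n alpha' r).
Proof. by rewrite -iter_tt_rho (iter_can n alpha'K). Qed.

Lemma iter_inj n : injective (iter n alpha).
Proof. exact: can_inj (iter_can n alphaK). Qed.

(** Shorten an annihilating polynomial: multiplying by alpha^n(r) before and by r after, and
    subtracting, cancels the term of index n and scales that of index i by alpha^n(r) - alpha^i(r),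
    non-zero for a suitable r at a chosen i. A single remaining term is freed from theta by
    injectivity. *)
Lemma unfaithful_torsion (s : {poly A}) : (forall n, exists r, iter n.+1 alpha r != r) ->
  s != 0 -> (forall v : V, tact v s = 0) -> exists2 r, r != 0 & forall v : V, rho v r = 0.
Proof.
move=> inf s0 sV0.
suff H n : forall F : nat -> A, (exists i, (i < n)%N /\ F i != 0) ->
   (forall v : V, \sum_(i < n) iter i (@tt _ _ V) (rho v (F i)) = 0) ->
   exists2 r, r != 0 & forall v : V, rho v r = 0.
  apply: (H (size s) (nth 0 s)) => //; exists (size s).-1.
  by rewrite -lead_coefE lead_coef_eq0 s0 ltn_predL lt0n size_poly_eq0 s0.
elim: n => [|n IH] F [i [lt Fi]] FV; first by [].
case: (pselect (exists i, (i < n)%N /\ F i != 0)) => [[k [ltk Fk]]|no]; last first.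
  have z k : (k < n)%N -> F k = 0.
    by move=> ltk; apply/eqP/negPn/negP => h; apply: no; exists k.
  have ni : i = n by move: lt; rewrite ltnS leq_eqVlt => /orP [/eqP //|/z e]; rewrite e eqxx in Fi.
  exists (F n); first by rewrite -ni.
  move=> v; have := FV v; rewrite big_ord_recr big1 /= => [|l _]; last by rewrite z ?rho0 ?iter_tt0.
  by rewrite add0r => /iter_tt_inj.
have [r rn] : exists r, iter n alpha r != iter k alpha r.
  have [r rn] := inf (n - k).-1; exists r; apply: contraNneq rn => e.
  apply/eqP/(@iter_inj k); rewrite -iterD -e; congr (iter _ _ _); lia.
apply: (IH (fun i => (iter n alpha r - iter i alpha r) * F i)).
  by exists k; rewrite mulf_neq0 // subr_eq0.
move=> v; have e1 := FV (rho v (iter n alpha r)); have := FV v.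
move/(f_equal (fun x => rho x r)); rewrite rho0l rho_suml big_ord_recr /= => e2.
move: e1; rewrite big_ord_recr /= => e1.
have e3 := subrr (0 : V); rewrite -[X in _ - X]e2 -[X in X - _]e1 opprD addrACA in e3.
apply: etrans e3; apply: esym.
rewrite -sumrB rho_iter -!rhoM mulrC subrr addr0; apply: eq_bigr => l _.
by rewrite -!rhoM rho_iter -!rhoM -iter_ttB -rhoBr mulrBl [F l * _]mulrC.
Qed.

Hypothesis tfree : forall (v : V) r, v != 0 -> r != 0 -> rho v r != 0.
Variable v0 : V.
Hypothesis v00 : v0 != 0.
Local Notation e i := (iter i (@tt _ _ V) v0).
Definition span n (F : nat -> A) : V := \sum_(i < n) rho (e i) (F i).

Lemma span_ext n m (F : nat -> A) : (n <= m)%N ->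
  span n F = span m (fun i => if (i < n)%N then F i else 0).
Proof.
move=> le; rewrite /span (big_ord_widen m (fun i => rho (e i) (F i)) le) big_mkcond.
by apply: eq_bigr => i _; case: ifP => //; rewrite rho0.
Qed.

(** Moving theta past a coefficient applies [alpha'], so these combinations form a submodule; it is
    non-zero because V is torsion-free. *)
Lemma ideal_span (I : A -> Prop) : ideal I -> (forall x, I x -> I (alpha' x)) ->
  (exists x, I x /\ x != 0) -> forall u : V, exists n F, (forall i, I (F i)) /\ u = span n F.
Proof.
move=> [I0 IB IM] Ia [x [Ix x0]]; apply: (tsimple_all sV); last first.
  exists (rho v0 x); split; last exact: tfree.
  by exists 1%N, (fun _ => x); split=> //; rewrite /span big_ord1.
have Iif F n : (forall i, I (F i)) -> forall i, I (if (i < n)%N then F i else 0).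
  by move=> IF i; case: ifP.
split.
- by exists 0%N, (fun _ => 0); split=> //; rewrite /span big_ord0.
- move=> _ _ [n [F [IF ->]]] [m [G [IG ->]]].
  rewrite (@span_ext n (maxn n m)) ?leq_maxl // (@span_ext m (maxn n m)) ?leq_maxr //.
  exists (maxn n m), (fun i => (if (i < n)%N then F i else 0) - (if (i < m)%N then G i else 0)).
  split; last by rewrite -sumrB; apply: eq_bigr => i _; rewrite -rhoBr.
  by move=> i /=; apply: IB; exact: Iif.
- move=> _ r [n [F [IF ->]]]; exists n, (fun i => F i * r); split=> [i|]; first exact: IM.
  by rewrite rho_suml; apply: eq_bigr => i _; rewrite rhoM.
- move=> _ [n [F [IF ->]]]; exists n.+1, (fun i => if i is k.+1 then alpha' (F k) else 0).
  split=> [[|i] //|]; first exact: Ia.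
  rewrite /span big_ord_recl rho0 add0r (big_morph _ (@ttD _ _ V) (@tt0 _ _ V)).
  by apply: eq_bigr => i _; exact: (@iter_ttV_rho 1).
Qed.

(** As theta is onto, v0 = theta(x) with x a combination of the theta^i v0. Hence v0 is a
    combination of those with i >= 1, a non-trivial relation, and the shortest relation has an
    independent initial segment. *)
Lemma min_relation : exists m a G, [/\ a != 0, rho (e m) a = span m G &
  forall F, span m F = 0 -> forall i, (i < m)%N -> F i = 0].
Proof.
have [x xE] : exists x, v0 = tt x.
  move: v0; apply: (tsimple_all sV); last by case: ttV => v tv; exists (tt v); split=> //; exists v.
  split=> [|_ _ [x ->] [y ->]|_ r [x ->]|_ [x ->]].
  - by exists 0; rewrite tt0.
  - by exists (x - y); rewrite ttB.
  - by exists (rho x (alpha r)); rewrite tt_rho.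
  - by exists (tt x).
have [|||n [F [_ xF]]] := @ideal_span (fun _ => True) _ _ _ x; rewrite /ideal //.
  by exists 1; rewrite oner_neq0.
have v0E : v0 = span n.+1 (fun i => if i is k.+1 then alpha' (F k) else 0).
  rewrite {1}xE xF /span big_ord_recl rho0 add0r (big_morph _ (@ttD _ _ V) (@tt0 _ _ V)).
  by apply: eq_bigr => i _; exact: (@iter_ttV_rho 1).
pose rel m := exists a G, a != 0 /\ rho (e m) a = span m G.
have [m0 rm0] : exists m, rel m.
  apply: contrapT => no.
  have Fz (H : nat -> A) k : H 0%N = 0 -> v0 = span k H -> False.
    move=> H0; elim: k => [|k IHk].
      by rewrite /span big_ord0 => z; move: v00; rewrite z eqxx.
    rewrite /span big_ord_recr /=; case: (eqVneq (H k) 0) => [->|Hk].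
      by rewrite rho0 addr0 => /IHk.
    move=> e1; apply: no; exists k, (H k).
    case: k IHk Hk e1 => [|k] IHk Hk e1; first by rewrite H0 eqxx in Hk.
    exists (fun i => (i == 0%N)%:R - H i); split=> //.
    apply/esym; transitivity (v0 - span k.+1 H).
      rewrite /span; under eq_bigr => i _ do rewrite rhoBr; rewrite sumrB; congr (_ - _).
      rewrite big_ord_recl /= rho1 big1 ?addr0 // => i _; exact: rho0.
    by apply/eqP; rewrite subr_eq addrC -e1.
  exact: Fz v0E.
have [|m /asboolP [a [G [a0 aE]]] mmin] := @ex_minnP (fun m => `[< rel m >]).
  by exists m0; apply/asboolP.
exists m, a, G; split=> // F' F0; move: (F') F0 => {xF v0E F F'} F F0.
have H k : (k <= m)%N -> forall F : nat -> A, span k F = 0 -> forall i, (i < k)%N -> F i = 0.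
  elim: k => // k IHk ltk {}F {}F0 i; rewrite ltnS leq_eqVlt.
  move: F0; rewrite /span big_ord_recr /=; case: (eqVneq (F k) 0) => [Fk|Fk F0].
    rewrite Fk rho0 addr0 => /(IHk (ltnW ltk)) z /orP [/eqP -> //|]; exact: z.
  have := mmin k; case: asboolP => [_ /(_ isT)|[]]; first lia.
  exists (F k), (fun i => - F i); split=> //.
  rewrite /span; under eq_bigr => j _ do rewrite rhoNr; rewrite sumrN.
  by apply/eqP; rewrite -addr_eq0 addrC; apply/eqP.
exact: H.
Qed.

(** theta^k carries the relation to one with leading coefficient alpha'^k(a), so multiplying by that
    element rewrites the top term by lower ones. *)
Lemma span_shift m a G k (F : nat -> A) : rho (e m) a = span m G ->
  rho (span (m + k).+1 F) (iter k alpha' a) =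
  span (m + k) (fun i => F i * iter k alpha' a +
    (if (k <= i)%N then iter k alpha' (G (i - k)%N) * F (m + k)%N else 0)).
Proof.
move=> aE; rewrite /span big_ord_recr /= rhoDl rho_suml.
under [RHS]eq_bigr => i _ do rewrite rhoDr rhoM.
rewrite big_split; congr (_ + _).
rewrite rhoAC addnC iterD -iter_ttV_rho aE /span iter_tt_sum rho_suml.
rewrite -(big_mkord xpredT (fun i => rho (e i) (if (k <= i)%N then iter k alpha' (G (i - k)%N) * F (k + m)%N else 0))).
rewrite (@big_cat_nat _ _ _ k) ?leq_addr //= [X in _ = X + _]big_nat [X in _ = X + _]big1 ?add0r; last first.
  by move=> i /andP [_ lt]; rewrite leqNgt lt rho0.
rewrite -[X in index_iota X _]add0n big_addn addKn big_mkord; apply: eq_bigr => i _.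
by rewrite leq_addl addnK rhoM iter_ttV_rho -iterD addnC.
Qed.

Definition anorm' a k := \prod_(l < k) iter l alpha' a.

Lemma span_reduce (I : A -> Prop) m a G k (F : nat -> A) : ideal I -> rho (e m) a = span m G ->
  (forall i, I (F i)) -> exists H, (forall i, I (H i)) /\ rho (span (m + k) F) (anorm' a k) = span m H.
Proof.
move=> iI aE; case: (iI) => I0 IB IM; elim: k F => [|k IHk] F IF.
  by exists F; rewrite addn0 /anorm' big_ord0 rho1.
rewrite /anorm' big_ord_recr /= mulrC rhoM addnS (span_shift _ _ aE).
apply: IHk => i; rewrite -[X in I (_ + X)]opprK; apply: (IB); first exact: IM.
rewrite -sub0r; apply: (IB) => //; case: ifP => // _.
by rewrite mulrC; exact: IM.
Qed.

(** Write v0 with coefficients in I, then multiply by [anorm' a n] to push everything below index m.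
    As the first m vectors are independent, comparing coefficients of v0 shows that [anorm' a n]
    lies in I. *)
Lemma faithful_special : exists2 a, a != 0 & forall I : A -> Prop, ideal I ->
  (forall x, I x -> I (alpha' x)) -> (exists x, I x /\ x != 0) -> exists k, I (anorm' a k).
Proof.
have [m [a [G [a0 aE ind]]]] := min_relation; exists a => // I iI Ia nzI.
have m0 : (0 < m)%N.
  by case: m aE {ind} => // /eqP; rewrite /span big_ord0 (negPf (tfree _ _)).
have [n [F [IF v0E]]] := ideal_span iI Ia nzI v0.
have IF' i : I (if (i < n)%N then F i else 0) by case: ifP => //; case: iI.
have [H [IH]] := span_reduce n iI aE IF'.
rewrite -span_ext ?leq_addl // -v0E => e1; exists n.
have := ind (fun i => (if i == 0%N then anorm' a n else 0) - H i) _ 0%N m0.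
rewrite /= => z; suff /eqP : anorm' a n - H 0%N = 0 by rewrite subr_eq0 => /eqP ->.
apply: z; rewrite /span; under eq_bigr => i _ do rewrite rhoBr.
rewrite sumrB -[X in _ - X]e1; case: m m0 {aE ind e1 IF'} => // m _.
by rewrite big_ord_recl big1 ?addr0 ?subrr // => i _; rewrite rho0.
Qed.
End Faithful.

(** * From a faithful simple module to a bad extension *)

Section PrimitiveBad.
Variable K : closedFieldType.
Local Notation R := {poly {poly K}}.
Hypothesis unc : forall s : nat -> K, exists c, forall n, s n <> c.
Variables (alpha alpha' : {rmorphism R -> R}).
Hypotheses (alphaK : cancel alpha alpha') (alpha'K : cancel alpha' alpha).
Hypothesis alpha_kk : forall c, alpha (kk _ c) = kk _ c.

Lemma iter_alpha_kk n c : iter n alpha (kk _ c) = kk _ c.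
Proof. by elim: n => //= n ->; exact: alpha_kk. Qed.

Lemma alpha'_kk c : alpha' (kk _ c) = kk _ c.
Proof. by rewrite -[in LHS]alpha_kk alphaK. Qed.

Lemma iter_alpha'_kk n c : iter n alpha' (kk _ c) = kk _ c.
Proof. by elim: n => //= n ->; exact: alpha'_kk. Qed.

Lemma aut_ext n : iter n alpha (xx K) = xx K -> iter n alpha (yy K) = yy K -> forall r, iter n alpha r = r.
Proof.
move=> ex ey; apply: R_gen => [c|r s er es|r er|r er].
- exact: iter_alpha_kk.
- by rewrite iter_rmorphD er es.
- by rewrite iter_rmorphM er ex.
- by rewrite iter_rmorphM er ey.
Qed.

(** The eigenvalue has a finite orbit, and a polynomial in x vanishing at all its points annihilates
    w along the whole [alpha]-orbit, hence annihilates V. *)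
Lemma eigen_not_faithful (V : tmod alpha) (w : V) : tsimple V -> (exists v : V, tt v != 0) -> w != 0 ->
  (forall s, exists c, rho w s = ksc (kk K) c w) -> exists2 b, b != 0 & forall v : V, rho v b = 0.
Proof.
move=> sV ttV w0 we; have [chi [chi_kk chiw]] := char_of_eigen w0 we.
have tw : tt w != 0 by apply: contra_neq w0; exact: (tt_inj alpha'K sV ttV).
have [k [k0 ks]] := finite_orbit alpha_kk sV chi_kk w0 tw chiw.
have per r : chi (iter k alpha r) = chi r.
  by apply: contrapT => h; apply: ks; exists r.
have perm i m r : chi (iter (i + k * m) alpha r) = chi (iter i alpha r).
  elim: m => [|m IH]; first by rewrite muln0 addn0.
  by rewrite mulnS addnCA iterD per IH.
pose b := \prod_(i < k) (xx K - kk _ (chi (iter i alpha (xx K)))).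
exists b; first by apply/prodf_neq0 => i _; exact: xk_neq0.
have bk j : chi (iter j alpha b) = 0.
  have -> : iter j alpha b = \prod_(i < k) iter j alpha (xx K - kk _ (chi (iter i alpha (xx K)))).
    by apply: (big_morph (iter j alpha)); [exact: iter_rmorphM | exact: iter_rmorph1].
  rewrite rmorph_prod; have lt : (j %% k < k)%N by rewrite ltn_mod.
  apply/eqP/prodf_eq0; exists (Ordinal lt) => //=.
  rewrite iter_rmorphB iter_alpha_kk rmorphB /= chi_kk {1}(divn_eq j k) addnC mulnC perm.
  by rewrite subrr.
move=> v; have H : forall u : V, forall j, rho u (iter j alpha b) = 0.
  apply: (tsimple_all sV); last first.
    by exists w; split=> // j; rewrite chiw bk rmorph0 rho0.
  split=> [j|x y ex ey j|x r ex j|x ex j]; first exact: rho0l.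
  - by rewrite rhoBl ex ey subr0.
  - by rewrite rhoAC ex rho0l.
  - by rewrite -tt_rho -iterS ex tt0.
exact: (H v 0%N).
Qed.

(** The product b of p and its images over one period satisfies alpha(b) = c b, so the vectors it
    kills form a submodule, which contains w. *)
Lemma semi_not_faithful (V : tmod alpha) (w : V) p m c : tsimple V -> w != 0 -> p != 0 -> rho w p = 0 ->
  iter m.+1 alpha p = kk _ c * p -> exists2 b, b != 0 & forall v : V, rho v b = 0.
Proof.
move=> sV w0 p0 wp pE; pose b := \prod_(i < m.+1) iter i alpha p.
have ip0 i : iter i alpha p != 0.
  by rewrite -(iter_rmorph0 alpha i) (inj_eq (can_inj (iter_can i alphaK))).
have ab : alpha b = kk _ c * b.
  rewrite /b rmorph_prod big_ord_recr /= -[alpha (iter m alpha p)]/(iter m.+1 alpha p) pE.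
  by rewrite [in RHS]big_ord_recl /= mulrCA [p * _]mulrC mulrA.
exists b; first by apply/prodf_neq0.
apply: (tsimple_all sV); last by exists w; rewrite /b big_ord_recl rhoM wp rho0l.
split=> [|x y ex ey|x r ex|x ex]; first exact: rho0l.
- by rewrite rhoBl ex ey subr0.
- by rewrite rhoAC ex rho0l.
- by rewrite -tt_rho ab mulrC rhoM ex rho0l tt0.
Qed.

Lemma faithful_torsionfree (V : tmod alpha) : tsimple V -> (exists v : V, tt v != 0) ->
  (forall r, r != 0 -> exists v : V, rho v r != 0) ->
  forall (v : V) r, v != 0 -> r != 0 -> rho v r != 0.
Proof.
move=> sV ttV fV v r v0 r0; apply/eqP => vr.
have [b b0 bV] : exists2 b, b != 0 & forall v : V, rho v b = 0.
  have [[w [w0 we]]|[p [w [m [c [[p0 _ _] w0 wp c0 pE]]]]]] := torsion_dichotomy alphaK alpha'K alpha_kk sV ttV v0 r0 vr.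
    exact: eigen_not_faithful we.
  exact: (semi_not_faithful sV w0 p0 wp pE).
by have [u /eqP] := fV b b0; apply; exact: bV.
Qed.

(** A polynomial vanishes on the line x = c only if c is a root of its leading coefficient;
    countably many finite sets do not exhaust K. *)
Lemma generic_x (f : nat -> R) : (forall n, f n != 0) -> exists c, forall n, evx c (f n) != 0.
Proof.
move=> f0; have rts n : exists s : seq K, forall c, evx c (f n) = 0 -> c \in s.
  have [s sE] := closed_field_poly_normal (lead_coef (f n)).
  exists s => c e; have : root (lead_coef (f n)) c.
    by rewrite rootE lead_coefE -evxE e coef0.
  rewrite sE rootZ ?root_prod_XsubC // lead_coef_eq0 lead_coef_eq0; exact: f0.
have [c cP] := unc_seq unc 0 (fun n => projT1 (cid (rts n))).
exists c => n; apply/eqP => e; have /negP := cP n; apply.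
by case: cid => s /= h; exact: h.
Qed.

Lemma generic_y (f : nat -> R) : (forall n, f n != 0) -> exists c : K, forall n, (f n).[c%:P] != 0.
Proof.
move=> f0; have [|c cP] := @generic_x (fun n => swapXY (f n)).
  by move=> n; rewrite swapXY_eq0.
by exists c => n; rewrite -[f n]swapXYK horner_swapXY; exact: cP.
Qed.

(** The preimages of I under the powers of [alpha'] increase, so by Noetherianity they become
    stationary; stability under [alpha'] therefore implies stability under [alpha]. *)
Lemma ideal_alpha (I : R -> Prop) : ideal I -> (forall x, I x -> I (alpha' x)) -> forall x, I x -> I (alpha x).
Proof.
move=> [I0 IB IM] Ia.
have [||n0 nP] := ideal_acc alpha'K (@R_gen K) (L := fun n x => I (iter n alpha' x)).
- move=> n; split; rewrite ?iter_rmorph0 // => x y; rewrite ?iter_rmorphB ?iter_rmorphM; first exact: IB.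
  by move=> Ix; exact: IM.
- by move=> n x; rewrite iterS; exact: Ia.
move=> x Ix; have := nP n0.+1 (leqnSn _) (iter n0.+1 alpha x).
rewrite (iter_can n0.+1 alphaK) => /(_ Ix).
by rewrite iterSr (iter_can n0 alphaK).
Qed.

(** The bad extension lives in Frac(R), with a from [faithful_special] and g = x - c or y - c for
    generic c. The coordinate must not be fixed by a power of [alpha]; as [alpha] has infinite
    order, x or y qualifies. *)
Theorem tprimitive_not_tdiamond : tprimitive alpha -> ~ tdiamond alpha.
Proof.
move=> pr; have [V sV fV] := pr.
have inf n : (forall r, iter n.+1 alpha r = r) -> False.
  by move=> fin; exact: (finite_order_not_tprimitive unc alpha_kk (@R_gen K) (ltn0Sn n) fin pr).
have ttV : exists v : V, tt v != 0.
  by have [|v] := fV 'X; rewrite ?polyX_eq0 // tactX => h; exists v.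
have frV r : r != 0 -> exists v : V, rho v r != 0.
  by move=> r0; have [|v] := fV r%:P; rewrite ?polyC_eq0 // tactC => h; exists v.
have tfree := faithful_torsionfree sV ttV frV.
have [v0 v00] := sV.1.
have [a a0 aP] := faithful_special alpha'K sV ttV tfree v00.
have special (I : R -> Prop) : ideal I -> (forall x, I x -> I (alpha' x)) ->
    (exists x, I x /\ x != 0) -> exists m, I (\prod_(j < m) iter j.+1 alpha a).
  move=> iI Ia nz; have [k Ik] := aP I iI Ia nz; exists k.
  have H n x : I x -> I (iter n alpha x).
    by move=> Ix; elim: n => //= n; exact: ideal_alpha.
  have := H k _ Ik; rewrite /anorm'.
  have -> : iter k alpha (\prod_(l < k) iter l alpha' a) = \prod_(l < k) iter k alpha (iter l alpha' a).
    by apply: (big_morph (iter k alpha)); [exact: iter_rmorphM | exact: iter_rmorph1].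
  rewrite (reindex_inj rev_ord_inj) /=; congr I; apply: eq_bigr => i _.
  have /subnK e : (k - i.+1 <= k)%N by exact: leq_subr.
  rewrite -{1}e iterD (iter_can _ alpha'K) -iterS; congr (iter _ _ _).
  by case: i {e} => i /=; lia.
have ipow (g : {rmorphism R -> R}) h n r : cancel g h -> r != 0 -> iter n g r != 0.
  by move=> gK r0; rewrite -(iter_rmorph0 g n) (inj_eq (can_inj (iter_can n gK))).
pose psi : {rmorphism R -> R} := idfun.
have psiS b : exists r, psi r = b by exists b.
have main (L : idomainType) (e : {rmorphism R -> L}) g : e g = 0 -> g != 0 ->
   (forall k, e (iter k.+1 alpha' g) != 0) -> (forall k, e (iter k alpha a) != 0) ->
   (forall k, e (iter k alpha' a) != 0) -> ~ tdiamond alpha.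
  move=> h1 h2 h3 h4 h5.
  exact: (bad_ext_not_tdiamond alpha_kk (@frac_bad_ext _ alpha _ _ _ alphaK alpha'K psi (fun r => erefl) psiS a a0 special L e g h1 h2 h3 h4 h5)).
have iter' n r : iter n alpha r != r -> iter n alpha' r - r != 0.
  by rewrite subr_eq0; apply: contraNneq => e; rewrite -{1}e (iter_can n alpha'K).
case: (pselect (forall n, iter n.+1 alpha (xx K) != xx K)) => [nx|].
  (* Three countable families are interleaved by residue modulo 3: the conditions on the images of g
     and those on the two half-orbits of a. *)
  pose F (k : nat) := if (k %% 3 == 0)%N then iter (k %/ 3).+1 alpha' (xx K) - xx K else
    if (k %% 3 == 1)%N then iter (k %/ 3) alpha a else iter (k %/ 3) alpha' a.
  have [|c cP] := @generic_x F.
    by move=> n; rewrite /F; case: ifP => _; [exact/iter'/nx | case: ifP => _; apply: ipow; eauto].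
  apply: (main _ (evx c) (xx K - kk _ c)).
  - exact: evx_xx.
  - exact: xk_neq0.
  - move=> k; have := cP (k * 3)%N; rewrite /F modnMl mulnK //= => h.
    rewrite -iterS iter_rmorphB iter_alpha'_kk; apply: contraNneq h => h.
    move: h (evx_xx c); rewrite !rmorphB => h /eqP; rewrite subr_eq0 => /eqP ->; exact/eqP.
  - move=> k; have := cP (k * 3 + 1)%N; rewrite /F modnMDl divnMDl // addn0 //.
  - move=> k; have := cP (k * 3 + 2)%N; rewrite /F modnMDl divnMDl // addn0 //.
move=> nx; have [n nn] : exists n, iter n.+1 alpha (xx K) = xx K.
  by apply: contrapT => h; apply: nx => n; apply/eqP => e; apply: h; exists n.
have ny m : iter m.+1 alpha (yy K) != yy K.
  apply/eqP => em; apply: (inf (n.+1 * m.+1).-1); rewrite prednK //.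
  by apply: aut_ext; [rewrite mulnC|]; rewrite iterM iter_fix.
pose F (k : nat) := if (k %% 3 == 0)%N then iter (k %/ 3).+1 alpha' (yy K) - yy K else
  if (k %% 3 == 1)%N then iter (k %/ 3) alpha a else iter (k %/ 3) alpha' a.
have [|c cP] := @generic_y F.
  by move=> k; rewrite /F; case: ifP => _; [exact/iter'/ny | case: ifP => _; apply: ipow; eauto].
have hk (q : R) : horner_eval c%:P (q - kk K c) = q.[c%:P] - c%:P.
  by rewrite /horner_eval hornerD hornerN hornerC.
apply: (main _ (horner_eval c%:P) (yy K - kk _ c)).
- by rewrite [LHS]hk /yy hornerX subrr.
- by rewrite [yy K - _]/('X - c%:P%:P) polyXsubC_eq0.
- move=> k; have := cP (k * 3)%N; rewrite /F modnMl mulnK //= => h.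
  rewrite -iterS iter_rmorphB iter_alpha'_kk; move: h; rewrite [X in _ -> X != 0]hk hornerD hornerN /yy hornerX.
  by [].
- move=> k; have := cP (k * 3 + 1)%N; rewrite /F modnMDl divnMDl // addn0 //.
- move=> k; have := cP (k * 3 + 2)%N; rewrite /F modnMDl divnMDl // addn0 //.
Qed.

Theorem not_tprimitive_tdiamond : (forall n, exists r, iter n.+1 alpha r != r) ->
  (forall p m c, rirr p -> c != 0 -> iter m.+1 alpha p <> kk _ c * p) ->
  ~ tprimitive alpha -> tdiamond alpha.
Proof.
move=> inf nosemi npr; apply: (tdiamond_of_eigen unc alpha'K alpha_kk (@R_gen K)) => V sV ttV.
have [s s0 sV0] : exists2 s, s != 0 & forall v : V, tact v s = 0.
  apply: contrapT => no; apply: npr; exists V => // s s0; apply: contrapT => h.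
  by apply: no; exists s => // v; apply: contrapT => /eqP hv; apply: h; exists v.
have [r r0 rV] := unfaithful_torsion alphaK alpha'K sV ttV inf s0 sV0.
have [v v0] := sV.1.
have [//|[p [w [m [c [ip _ _ c0 pE]]]]]] := torsion_dichotomy alphaK alpha'K alpha_kk sV ttV v0 r0 (rV v).
by case: (nosemi p m c ip c0 pE).
Qed.
End PrimitiveBad.

(** * Comparison with the modules of the statement *)

Lemma aut_zmod_morphism f : is_aut f -> zmod_morphism f.
Proof.
case=> fD _ _ _ _ x y; apply: (addIr (f y)).
by rewrite -fD !subrK.
Qed.

Lemma aut_monoid_morphism f : is_aut f -> monoid_morphism f.
Proof. by case. Qed.

Definition aut_rmorphism (f : Rxy -> Rxy) (H : is_aut f) : {rmorphism Rxy -> Rxy} :=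
  HB.pack f (GRing.isZmodMorphism.Build Rxy Rxy f (aut_zmod_morphism H))
    (GRing.isMonoidMorphism.Build Rxy Rxy f (aut_monoid_morphism H)).

Section Transfer.
Variables (alpha : Rxy -> Rxy) (Ha : is_aut alpha).
Let al := aut_rmorphism Ha.

Section ToT.
Variable M : rmod alpha.
Definition rt_rho (m : M) (r : Rxy) : M := rm_act m (r%:P).
Definition rt_tt (m : M) : M := rm_act m 'X.

Lemma rt_rhoDr m r s : rt_rho m (r + s) = rt_rho m r + rt_rho m s.
Proof. rewrite /rt_rho polyCD; exact: rm_actDr. Qed.
Lemma rt_rhoM m r s : rt_rho m (r * s) = rt_rho (rt_rho m r) s.
Proof.
have E : skmul alpha r%:P s%:P = (r * s)%:P := kmulCC al r s.
by rewrite /rt_rho -E; exact: rm_actM.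
Qed.
Lemma rt_rho1 m : rt_rho m 1 = m.
Proof. rewrite /rt_rho polyC1; exact: rm_act1. Qed.
Lemma rt_tt_rho m r : rt_tt (rt_rho m (alpha r)) = rt_rho (rt_tt m) r.
Proof.
have E : skmul alpha 'X r%:P = (alpha r)%:P * 'X := kmulXC al r.
have E1 : skmul alpha (alpha r)%:P 'X = (alpha r)%:P * 'X := kmulCX al (alpha r) 1.
by rewrite /rt_tt /rt_rho -!rm_actM E E1.
Qed.

Definition to_tmod : tmod alpha :=
  @Tmod Rxy alpha (rm_car M) rt_rho rt_tt (fun r x y => rm_actDl x y r%:P) rt_rhoDr
    rt_rhoM rt_rho1 (fun x y => rm_actDl x y 'X) rt_tt_rho.
End ToT.

Definition of_tmod (M : tmod al) : rmod alpha :=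
  @RMod alpha (tcar M) (@tact _ al M) (@tactDl _ al M) (@tactDr _ al M) (@tactM _ al M)
     (@tact1 _ al M).

Lemma rm_actXn (M : rmod alpha) m n : rm_act m 'X^n = iter n (@tt _ _ (to_tmod M)) m.
Proof.
elim: n => [|n IH]; first exact: rm_act1.
have E : skmul alpha 'X^n 'X = 'X^(n.+1) := kmulXX al n.
by rewrite iterS -IH -E; exact: rm_actM.
Qed.

(** The action is determined by constants and theta, so [to_tmod] loses no information. *)
Lemma rm_act_tact (M : rmod alpha) (m : M) s : rm_act m s = @tact _ al (to_tmod M) m s.
Proof.
have a0 : rm_act m 0 = 0.
  by apply: (addrI (rm_act m 0)); rewrite -(@rm_actDr _ M) !addr0.
rewrite -{1}[s]coefK poly_def (big_morph (rm_act m) (@rm_actDr _ M m) a0).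
apply: eq_bigr => i _; rewrite -mul_polyC.
have E : skmul alpha (s`_i)%:P 'X^i = (s`_i)%:P * 'X^i := kmulCX al s`_i i.
rewrite -E; transitivity (rm_act (rm_act m (s`_i)%:P) 'X^i); first exact: rm_actM.
exact: rm_actXn.
Qed.

Lemma sub_to (M : rmod alpha) (P : M -> Prop) : is_submod P <-> @tsub _ al (to_tmod M) P.
Proof.
split=> [[P0 PB PA]|sP]; first by split=> // [x r|x]; exact: PA.
by case: (sP) => P0 PB PR PT; split=> // x s Px; rewrite rm_act_tact; apply: tsub_tact.
Qed.

Lemma sub_of (M : tmod al) (P : M -> Prop) : @is_submod alpha (of_tmod M) P <-> @tsub _ al M P.
Proof.
split=> [[P0 PB PA]|sP]; last first.
  by case: (sP) => P0 PB PR PT; split=> // x s Px; apply: (@tsub_tact _ al M P).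
split=> // [x r Px|x Px].
  by rewrite -(@tactC _ al M); apply: (PA x r%:P).
by rewrite -(@tactX _ al M); apply: (PA x 'X).
Qed.

Lemma hom_to (M N : rmod alpha) (f : M -> N) :
  is_hom f <-> @thom _ al (to_tmod M) (to_tmod N) f.
Proof.
split=> [[fD fA]|[fD fR fT]]; first by split=> // [x r|x]; exact: fA.
split=> // x s; rewrite !rm_act_tact /tact.
have f0 : f 0 = 0 by apply: (addrI (f 0)); rewrite -fD !addr0.
rewrite (big_morph f fD f0); apply: eq_bigr => i _.
have -> : rho (f x : to_tmod N) s`_i = f (rho (x : to_tmod M) s`_i) by rewrite fR.
by move: (rho _ _) => z; elim: (i : nat) => // k IH; rewrite !iterS -IH; exact: fT.
Qed.

Lemma to_of_rho (M : tmod al) (m : M) r : rho (m : to_tmod (of_tmod M)) r = rho m r.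
Proof. exact: (@tactC _ al M). Qed.
Lemma to_of_tt (M : tmod al) (m : M) : tt (m : to_tmod (of_tmod M)) = tt m.
Proof. exact: (@tactX _ al M). Qed.

Lemma hom_of (M : tmod al) (N : rmod alpha) (f : M -> N) :
  @is_hom alpha (of_tmod M) N f <-> @thom _ al M (to_tmod N) f.
Proof.
rewrite (@hom_to (of_tmod M)); split=> -[fD fR fT]; split=> // [x r|x].
- by rewrite -(fR x r) to_of_rho.
- by rewrite -(fT x) to_of_tt.
- by rewrite -(fR x r) to_of_rho.
- by rewrite -(fT x) to_of_tt.
Qed.

Lemma hom_of2 (M : rmod alpha) (N : tmod al) (f : M -> N) :
  @is_hom alpha M (of_tmod N) f <-> @thom _ al (to_tmod M) N f.
Proof.
rewrite (@hom_to M (of_tmod N)); split=> -[fD fR fT]; split=> // [x r|x].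
- by rewrite (fR x r) to_of_rho.
- by rewrite (fT x) to_of_tt.
- by rewrite (fR x r) to_of_rho.
- by rewrite (fT x) to_of_tt.
Qed.

Lemma hom_of3 (M N : tmod al) (f : M -> N) :
  @is_hom alpha (of_tmod M) (of_tmod N) f <-> @thom _ al M N f.
Proof.
rewrite (@hom_of M (of_tmod N)); split=> -[fD fR fT]; split=> // [x r|x].
- by rewrite (fR x r) to_of_rho.
- by rewrite (fT x) to_of_tt.
- by rewrite (fR x r) to_of_rho.
- by rewrite (fT x) to_of_tt.
Qed.

Lemma simple_to (V : rmod alpha) : simple_mod V <-> @tsimple _ al (to_tmod V).
Proof.
by split=> -[nz sV]; split=> // P /sub_to; apply: sV.
Qed.

Lemma simple_of (V : tmod al) : simple_mod (of_tmod V) <-> tsimple V.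
Proof.
by split=> -[nz sV]; split=> // P /sub_of; apply: sV.
Qed.

Lemma inj_to (E : rmod alpha) : injective_mod E -> @tinjective _ al (to_tmod E).
Proof.
move=> iE M N i f hi ii hf.
have [g [hg gi]] := iE (of_tmod M) (of_tmod N) i f ((hom_of3 _).2 hi) ii ((hom_of _).2 hf).
by exists g; split=> //; apply/hom_of.
Qed.

Lemma inj_of (E : tmod al) : tinjective E -> injective_mod (of_tmod E).
Proof.
move=> iE M N i f hi ii hf.
have [g [hg gi]] := iE (to_tmod M) (to_tmod N) i f ((hom_to _).1 hi) ii ((hom_of2 _).1 hf).
by exists g; split=> //; apply/hom_of2.
Qed.

Lemma fg_to (M : rmod alpha) (N : M -> Prop) : fg_submod N -> @tfg _ al (to_tmod M) N.
Proof.
case=> sN [l lN]; split; first exact/sub_to.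
exists l; split=> [x xl|P sP Pl x].
  apply/lN; exists (mkseq (fun i => if i == index x l then 1 else 0) (size l)).
  rewrite size_mkseq; split=> //.
  rewrite (bigD1 (Ordinal (n:=size l) (m:=index x l) _)) ?index_mem //= => xl'.
  rewrite nth_mkseq // eqxx nth_index // big1 ?addr0; first by rewrite rm_act_tact tact1.
  move=> i /eqP ni; rewrite nth_mkseq // ifN; first by rewrite rm_act_tact tact0.
  by apply/eqP=> e; apply: ni; apply: val_inj.
case/lN => ss [_ ->]; apply: (@tsub_sum _ al (to_tmod M) P) => // i _.
by rewrite rm_act_tact; apply: tsub_tact => //; apply: Pl; rewrite mem_nth.
Qed.

Lemma diamond_of : tdiamond al -> diamond alpha.
Proof.
move=> D V E j /simple_to sV [/hom_to hj ij /inj_to iE eE] N /fg_to fN P sP PN dP.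
apply: (D (to_tmod V) (to_tmod E) j sV hj ij iE _ N fN P _ PN dP).
  by move=> Q /sub_to; apply: eE.
by move=> n; apply/sub_to.
Qed.

Lemma fg_of (M : tmod al) (N : M -> Prop) : tfg N -> @fg_submod alpha (of_tmod M) N.
Proof.
case=> sN [l [lN genN]]; split; first exact/sub_of.
pose G (x : M) := exists ss : seq skS, size ss = size l /\
      x = \sum_(i < size l) @tact _ al M (nth 0 l i) (nth 0 ss i).
exists l => x; split=> [Nx|[ss [_ ->]]]; last first.
  apply: (@tsub_sum _ al M) => // i _; apply: (@tsub_tact _ al M) => //.
  by apply: lN; rewrite mem_nth.
have app (F : skS -> skS) (op : M -> M) : {morph op : x y / x + y} ->
    (forall m s, op (@tact _ al M m s) = tact m (F s)) -> forall x, G x -> G (op x).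
  move=> opD opF _ [ss [ess ->]]; exists (map F ss); rewrite size_map; split=> //.
  have op0 : op 0 = 0 by apply: (addrI (op 0)); rewrite -opD !addr0.
  rewrite (big_morph op opD op0); apply: eq_bigr => i _.
  by rewrite opF (nth_map 0) ?ess.
suff: G x by [].
apply: (genN G) Nx; first split.
- exists (nseq (size l) 0); rewrite size_nseq; split=> //.
  by rewrite big1 // => i _; rewrite nth_nseq ltn_ord (@tact0 _ al M).
- move=> _ _ [s1 [e1 ->]] [s2 [e2 ->]].
  exists (mkseq (fun i => nth 0 s1 i - nth 0 s2 i) (size l)); rewrite size_mkseq; split=> //.
  rewrite -sumrB; apply: eq_bigr => i _.
  by rewrite nth_mkseq // (@tactDr _ al M) (@tactN _ al M).
- move=> y r; apply: (app (fun s => kmul al s r%:P) (fun y => rho y r)).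
    by move=> ? ?; exact: rhoDl.
  by move=> m s; rewrite (@tactM _ al M) (@tactC _ al M).
- move=> y; apply: (app (fun s => kmul al s 'X) (@tt _ _ M)); first exact: ttD.
  by move=> m s; rewrite (@tactM _ al M) (@tactX _ al M).
move=> y yl.
exists (mkseq (fun i => if i == index y l then 1 else 0) (size l)).
rewrite size_mkseq; split=> //.
rewrite (bigD1 (Ordinal (n:=size l) (m:=index y l) _)) ?index_mem //= => yl'.
rewrite nth_mkseq // eqxx nth_index // big1 ?addr0; first by rewrite (@tact1 _ al M).
move=> i /eqP ni; rewrite nth_mkseq // ifN; first by rewrite (@tact0 _ al M).
by apply/eqP=> e; apply: ni; apply: val_inj.
Qed.

Lemma diamond_to : diamond alpha -> tdiamond al.
Proof.
move=> D V E j /simple_of sV hj ij /inj_of iE eE N /fg_of fN P sP PN dP.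
apply: (D (of_tmod V) (of_tmod E) j sV _ N fN P _ PN dP).
  split=> //; first exact/hom_of3.
  by move=> Q /sub_of; apply: eE.
by move=> n; apply/sub_of.
Qed.

Lemma primitive_to : primitive alpha -> tprimitive al.
Proof.
case=> V [/simple_to sV fV]; exists (to_tmod V) => // s /fV [v nv].
by exists v; rewrite -rm_act_tact.
Qed.

Lemma primitive_of : tprimitive al -> primitive alpha.
Proof.
by case=> V /simple_of sV fV; exists (of_tmod V).
Qed.
End Transfer.

(** * Derivations and Jacobians *)

Section Leibniz.
Variables (A : idomainType) (D : A -> A).
Hypothesis DD : forall f g, D (f + g) = D f + D g.
Hypothesis DM : forall f g, D (f * g) = D f * g + f * D g.
Hypothesis char0 : forall n, n.+1%:R != 0 :> A.

Lemma der0 : D 0 = 0.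
Proof. by apply: (addrI (D 0)); rewrite -DD !addr0. Qed.
Lemma derN f : D (- f) = - D f.
Proof. by apply: (addrI (D f)); rewrite -DD !subrr der0. Qed.
Lemma der1 : D 1 = 0.
Proof. by apply: (addrI (D 1)); rewrite addr0 -{3}[1]mulr1 DM mulr1 mul1r. Qed.
Lemma iter_derD n f g : iter n D (f + g) = iter n D f + iter n D g.
Proof. exact: iter_morphD. Qed.
Lemma iter_der0 n : iter n D 0 = 0.
Proof. by elim: n => //= n ->; exact: der0. Qed.
Lemma derX f n : D (f ^+ n.+1) = n.+1%:R * (f ^+ n * D f).
Proof.
elim: n => [|n IH]; first by rewrite expr0 mul1r mul1r.
by rewrite exprS DM IH [f ^+ n.+1 in RHS]exprS -[n.+2]addn1 natrD [f ^+ n.+1]exprS; ring.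
Qed.

(** Leibniz's formula for D^(m+n)(fg): only one term survives. Both claims go by a common induction
    on m + n, through D(fg) = D(f) g + f D(g). *)
Lemma iter_derM m n f g : iter m.+1 D f = 0 -> iter n.+1 D g = 0 ->
  iter (m + n).+1 D (f * g) = 0 /\
  iter (m + n) D (f * g) = 'C(m + n, m)%:R * (iter m D f * iter n D g).
Proof.
move: {2}(m + n)%N (leqnn (m + n)) => N; elim: N m n f g => [|N IH] m n f g.
  rewrite leqn0 addn_eq0 => /andP [/eqP -> /eqP ->] /= f0 g0.
  by rewrite DM f0 g0 mul0r mulr0 addr0 mul1r.
case: m => [|m] le f0 g0.
  have H k : iter k D (f * g) = f * iter k D g.
    by elim: k => //= k ->; rewrite DM -[D f]/(iter 1 D f) f0 mul0r add0r.
  by rewrite add0n !H g0 mulr0 bin0 mul1r.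
case: n le g0 => [|n] le g0.
  have H k : iter k D (f * g) = iter k D f * g.
    by elim: k => //= k ->; rewrite DM -[D g]/(iter 1 D g) g0 mulr0 addr0.
  by rewrite addn0 !H f0 mul0r binn mul1r.
have [||h1 h2] := IH m n.+1 (D f) g _ _ g0; [lia | by rewrite -iterSr |].
have [||h3 h4] := IH m.+1 n f (D g) _ f0 _; [lia | by rewrite -iterSr |].
rewrite ?addSn ?addnS in h1 h2 h3 h4 *.
split; first by rewrite iterSr DM iter_derD h1 h3 addr0.
by rewrite iterSr DM iter_derD h2 h4 -!iterSr -mulrDl -natrD [in RHS]binS addnC.
Qed.

(** The degree function of a locally nilpotent derivation; in characteristic zero it is additive on
    products. *)
Definition nu f n := iter n D f != 0 /\ iter n.+1 D f = 0.

Lemma nu_ex f n : f != 0 -> iter n D f = 0 -> exists m, nu f m.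
Proof.
move=> f0 fn; have [|m /eqP fm mmin] := @ex_minnP (fun n => iter n D f == 0).
  by exists n; apply/eqP.
case: m fm mmin => [|m] fm mmin; first by rewrite -[f]/(iter 0 D f) fm eqxx in f0.
by exists m; split=> //; apply/negP => /mmin; rewrite ltnn.
Qed.

Lemma nu_uniq f m n : nu f m -> nu f n -> m = n.
Proof.
have H i j : nu f i -> nu f j -> (i < j)%N -> False.
  move=> [_ i0] [j0 _] lt; case/eqP: j0; rewrite -(subnK lt) iterD i0; exact: iter_der0.
by move=> hm hn; case: (ltngtP m n) => // lt; [case: (H m n) | case: (H n m)].
Qed.

Lemma nuM f g m n : nu f m -> nu g n -> nu (f * g) (m + n).
Proof.
move=> [f0 f1] [g0 g1]; have [h1 h2] := iter_derM f1 g1; split=> //.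
rewrite h2 !mulf_neq0 //; have : (0 < 'C(m + n, m))%N by rewrite bin_gt0 leq_addr.
by case: 'C(_, _).
Qed.

Lemma nu_der f n : nu f n.+1 -> nu (D f) n.
Proof. by rewrite /nu -!iterSr. Qed.

Lemma nuX f m k : nu f m -> nu (f ^+ k) (k * m).
Proof.
move=> h; elim: k => [|k IH]; last by rewrite exprS mulSn; exact: nuM.
by split; rewrite /= ?oner_neq0 ?der1.
Qed.

Lemma nu0 f : f != 0 -> D f = 0 -> nu f 0.
Proof. by []. Qed.
End Leibniz.

Section Substitution.
Variable K : closedFieldType.
Local Notation R := {poly {poly K}}.
Local Notation kk := (kk K).
Local Notation xx := (xx K).
Local Notation yy := (yy K).

Section Into.
Variables (S : comNzRingType) (kS : {rmorphism K -> S}) (F G : S).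

Definition subst : {rmorphism R -> S} := horner_eval G \o map_poly (horner_eval F \o map_poly kS).

Lemma subst_kk c : subst (kk c) = kS c.
Proof. by rewrite /subst /kk /= map_polyC /= /horner_eval hornerC map_polyC /= hornerC. Qed.
Lemma subst_xx : subst xx = F.
Proof. by rewrite /subst /xx /= map_polyC /= /horner_eval hornerC map_polyX hornerX. Qed.
Lemma subst_yy : subst yy = G.
Proof. by rewrite /subst /yy /= map_polyX /= /horner_eval hornerX. Qed.
End Into.

Lemma rmorph_ext (S : comNzRingType) (f g : {rmorphism R -> S}) : (forall c, f (kk c) = g (kk c)) ->
  f xx = g xx -> f yy = g yy -> f =1 g.
Proof.
move=> ek ex ey; apply: R_gen => // [r s er es|r er|r er]; first by rewrite !rmorphD er es.
  by rewrite !rmorphM er ex.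
by rewrite !rmorphM er ey.
Qed.

(** Both sides of a chain rule are derivations along the same morphism, so by [der_ext] it suffices
    to compare them at x and y. *)
Definition der_along (S : comNzRingType) (phi : R -> S) (D : R -> S) :=
  [/\ forall f g, D (f + g) = D f + D g, forall f g, D (f * g) = D f * phi g + phi f * D g
    & forall c, D (kk c) = 0].

Lemma der_ext (S : comNzRingType) (phi : R -> S) D E : der_along phi D -> der_along phi E ->
  D xx = E xx -> D yy = E yy -> D =1 E.
Proof.
move=> [DD DM Dk] [ED EM Ek] ex ey; apply: R_gen => [c|r s er es|r er|r er].
- by rewrite Dk Ek.
- by rewrite DD ED er es.
- by rewrite DM EM er ex.
- by rewrite DM EM er ey.
Qed.

(** The exponent of x comes first, although y is the outer variable. *)
Definition cf (f : R) i j := f`_j`_i.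

Lemma cfP f g : (forall i j, cf f i j = cf g i j) -> f = g.
Proof. by move=> h; apply/polyP => j; apply/polyP => i; exact: h. Qed.
Lemma cfD f g i j : cf (f + g) i j = cf f i j + cf g i j.
Proof. by rewrite /cf !coefD. Qed.
Lemma cf0 i j : cf 0 i j = 0.
Proof. by rewrite /cf !coef0. Qed.
Lemma cfZ c f i j : cf (kk c * f) i j = c * cf f i j.
Proof. by rewrite /cf /kk /= !coefCM. Qed.
Lemma cf_kk c i j : cf (kk c) i j = if (i == 0%N) && (j == 0%N) then c else 0.
Proof. by rewrite /cf /kk /= coefC; case: (j == 0%N); rewrite ?coefC ?coef0; case: (i == 0%N). Qed.
Lemma cf_xx f i j : cf (f * xx) i j = if i is k.+1 then cf f k j else 0.
Proof. by rewrite /cf /xx /= coefMC coefMX; case: i. Qed.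
Lemma cf_yy f i j : cf (f * yy) i j = if j is k.+1 then cf f i k else 0.
Proof. by rewrite /cf /yy /= coefMX; case: j => //=; rewrite coef0. Qed.
Lemma cf_sum (I : Type) (r : seq I) (P : pred I) (F : I -> R) i j :
  cf (\sum_(k <- r | P k) F k) i j = \sum_(k <- r | P k) cf (F k) i j.
Proof. by apply: (big_morph (fun f => cf f i j)); [move=> f g; exact: cfD | exact: cf0]. Qed.
Lemma cf_mon m n i j : cf (xx ^+ m * yy ^+ n) i j = ((i == m) && (j == n))%:R.
Proof.
elim: n j => [|n IH] j; last first.
  by rewrite exprSr mulrA cf_yy; case: j => [|j]; rewrite ?andbF.
rewrite expr0 mulr1; elim: m i => [|m IH] i.
  by rewrite expr0 -(rmorph1 kk) cf_kk; case: ifP.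
by rewrite exprSr cf_xx; case: i.
Qed.

Definition dx (f : R) : R := map_poly deriv f.
Definition dy (f : R) : R := f^`().

Lemma cf_dx f i j : cf (dx f) i j = cf f i.+1 j *+ i.+1.
Proof. by rewrite /cf /dx coef_map_id0 ?deriv0 // coef_deriv. Qed.
Lemma cf_dy f i j : cf (dy f) i j = cf f i j.+1 *+ j.+1.
Proof. by rewrite /cf /dy coef_deriv coefMn. Qed.

Lemma dy_der : der_along id dy.
Proof. by split=> [f g|f g|c]; [exact: derivD | exact: derivM | exact: derivC]. Qed.
Lemma dx_der : der_along id dx.
Proof.
split=> [f g|f g|c]; first by apply: cfP => i j; rewrite cfD !cf_dx cfD mulrnDl.
  apply/polyP => k; rewrite coefD !coefM /dx coef_map_id0 ?deriv0 // coefM raddf_sum -big_split.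
  by apply: eq_bigr => i _; rewrite /= derivM !coef_map_id0 ?deriv0.
by apply: cfP => i j; rewrite cf_dx cf_kk cf0 /= mul0rn.
Qed.
Lemma dx_xx : dx xx = 1. 
Proof. by apply: cfP => i j; rewrite cf_dx -[xx]mul1r cf_xx -(rmorph1 kk) !cf_kk; case: i => [|i]; rewrite ?mulr1n // mul0rn. Qed.
Lemma dx_yy : dx yy = 0.
Proof. by apply: cfP => i j; rewrite cf_dx -[yy]mul1r cf_yy; case: j => [|j]; rewrite ?cf0 ?mul0rn // -(rmorph1 kk) cf_kk mul0rn. Qed.
Lemma dy_xx : dy xx = 0. Proof. exact: derivC. Qed.
Lemma dy_yy : dy yy = 1. Proof. exact: derivX. Qed.

Definition jac f g := dx f * dy g - dy f * dx g.

Lemma jac_der (phi : {rmorphism R -> R}) f : (forall c, phi (kk c) = kk c) ->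
  der_along phi (fun s => jac f (phi s)).
Proof.
case: dx_der dy_der => [xD xM xk] [yD yM yk] pk; split=> [g h|g h|c]; rewrite /jac.
- by rewrite rmorphD xD yD; ring.
- by rewrite rmorphM xM yM; ring.
- by rewrite pk xk yk !mulr0 subrr.
Qed.
Lemma jacC f g : jac f g = - jac g f. Proof. by rewrite /jac; ring. Qed.
Lemma jacff f : jac f f = 0. Proof. by rewrite /jac mulrC subrr. Qed.

Section Auto.
Variables (alpha alpha' : {rmorphism R -> R}).
Hypotheses (alphaK : cancel alpha alpha') (alpha'K : cancel alpha' alpha).
Hypothesis alpha_kk : forall c, alpha (kk c) = kk c.
Let j := jac (alpha xx) (alpha yy).

Lemma jac_alpha_x s : jac (alpha xx) (alpha s) = j * alpha (dy s).
Proof.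
apply: (der_ext (phi := alpha) (D := fun s => jac (alpha xx) (alpha s)) (E := fun s => j * alpha (dy s))); first exact: jac_der.
- case: dy_der => [yD yM yk]; split=> [g h|g h|c]; first by rewrite yD rmorphD mulrDr.
    by rewrite yM rmorphD !rmorphM; ring.
  by rewrite yk rmorph0 mulr0.
- by rewrite jacff dy_xx rmorph0 mulr0.
- by rewrite dy_yy rmorph1 mulr1.
Qed.

Lemma jac_alpha_y s : jac (alpha s) (alpha yy) = j * alpha (dx s).
Proof.
apply: (der_ext (phi := alpha) (D := fun s => jac (alpha s) (alpha yy)) (E := fun s => j * alpha (dx s))).
- have [D1 D2 D3] := jac_der (alpha yy) alpha_kk; split=> [g h|g h|c]; rewrite ![jac (alpha _) (alpha yy)]jacC.
  + by rewrite D1 opprD.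
  + by rewrite D2; ring.
  + by rewrite D3 oppr0.
- case: dx_der => [xD xM xk]; split=> [g h|g h|c]; first by rewrite xD rmorphD mulrDr.
    by rewrite xM rmorphD !rmorphM; ring.
  by rewrite xk rmorph0 mulr0.
- by rewrite dx_xx rmorph1 mulr1.
- by rewrite jacff dx_yy rmorph0 mulr0.
Qed.

Lemma jac_alpha f g : jac (alpha f) (alpha g) = j * alpha (jac f g).
Proof.
apply: (der_ext (phi := alpha) (D := fun g => jac (alpha f) (alpha g)) (E := fun g => j * alpha (jac f g))); first exact: jac_der.
- have [D1 D2 D3] := jac_der f (phi := idfun) (fun c => erefl).
  split=> [u v|u v|c]; first by rewrite D1 rmorphD mulrDr.
    by rewrite D2 rmorphD !rmorphM /=; ring.
  by rewrite D3 rmorph0 mulr0.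
- by rewrite jacC jac_alpha_x [jac f xx]/jac dx_xx dy_xx mulr0 sub0r mulr1 rmorphN mulrN.
- by rewrite jac_alpha_y [jac f yy]/jac dx_yy dy_yy mulr0 subr0 mulr1.
Qed.

(** The chain rule for the preimages of x and y gives j times a polynomial equal to 1, so j is a
    constant. *)
Lemma jac_unit : exists2 c, c != 0 & j = kk c.
Proof.
have := jac_alpha (alpha' xx) (alpha' yy); rewrite !alpha'K {1}/jac dx_xx dx_yy dy_xx dy_yy.
rewrite mulr1 mulr0 subr0 => e.
have nz : j * alpha (jac (alpha' xx) (alpha' yy)) != 0 by rewrite -e oner_neq0.
move: nz; rewrite mulf_eq0 negb_or => /andP [j0 u0].
apply: mdeg0P => //; have := f_equal (@mdeg K) e; rewrite mdegM // /mdeg size_poly1 lead_coef1 size_poly1.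
by lia.
Qed.

(** [alpha] transports J(alpha x, .) to a constant multiple of d/dy, which lowers the y-degree. *)
Lemma jac_nilp s : exists n, iter n (jac (alpha xx)) s = 0.
Proof.
have [c c0 jE] := jac_unit; rewrite -[s]alpha'K; move: (alpha' s) => {}s.
have H n : exists2 u, u != 0 & iter n (jac (alpha xx)) (alpha s) = kk u * alpha (iter n dy s).
  elim: n => [|n [u u0 IH]]; first by exists 1; rewrite ?oner_neq0 // rmorph1 mul1r.
  exists (u * c); rewrite ?mulf_neq0 // iterS IH -alpha_kk -rmorphM jac_alpha_x jE.
  case: dy_der => _ yM yk; rewrite yM yk mul0r add0r [alpha (kk u * _)]rmorphM alpha_kk [kk (u * c)]rmorphM /= mulrA.
  by rewrite [kk c * _]mulrC.
exists (size s); have [u _ ->] := H (size s).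
have -> : iter (size s) dy s = 0 by have := derivn_poly0 (leqnn (size s)).
by rewrite rmorph0 mulr0.
Qed.
End Auto.
End Substitution.

(** * Weighted top forms *)

Section Weights.
Variable K : closedFieldType.
Hypothesis char0 : forall n, n.+1%:R != 0 :> K.
Local Notation R := {poly {poly K}}.
Local Notation kk := (kk K).
Local Notation xx := (xx K).
Local Notation yy := (yy K).
Implicit Types f g s : R.

Lemma coefM_top (u v : {poly R}) w k : (size u <= w.+1)%N -> (size v <= k.+1)%N ->
  (size (u * v)%R <= (w + k).+1)%N /\ (u * v)`_(w + k) = u`_w * v`_k.
Proof.
move=> su sv; split; first by apply: leq_trans (size_polyMleq u v) _; lia.
have lt : (w < (w + k).+1)%N by rewrite ltnS leq_addr.
rewrite coefM (bigD1 (Ordinal lt)) //= addKn big1 ?addr0 // => i ni.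
case: (ltngtP i w) => [lti|gti|e].
- by rewrite [v`__]nth_default ?mulr0 //; apply: leq_trans sv _; lia.
- by rewrite [u`__]nth_default ?mul0r //; apply: leq_trans su _; lia.
- by case/eqP: ni; apply: val_inj.
Qed.

Section Sigma.
Variables a b : nat.
Variable sig : {rmorphism R -> {poly R}}.
Hypothesis sig_kk : forall c, sig (kk c) = (kk c)%:P.
Hypotheses (sig_xx : sig xx = xx%:P * 'X^a) (sig_yy : sig yy = yy%:P * 'X^b).

(** The morphism [sig] is the grading of R by the weights a of x and b of y: its coefficient of
    index k is the component of weight k. *)
Lemma cf_sig f k i j : cf (sig f)`_k i j = if (a * i + b * j == k)%N then cf f i j else 0.
Proof.
move: f k i j; apply: R_gen => [c|f g IHf IHg|f IHf|f IHf] k i j.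
- rewrite sig_kk coefC; case: (eqVneq k 0%N) => [->|k0]; rewrite ?cf0 !cf_kk.
    by case: i => [|i]; case: j => [|j]; rewrite ?muln0 ?eqxx ?andbF /= ?if_same.
  case: ifP => // /eqP e; case: ifP => // /andP [/eqP i0 /eqP j0].
  by move: k0; rewrite -e i0 j0 !muln0.
- by rewrite rmorphD coefD !cfD IHf IHg; case: ifP => _; rewrite ?addr0.
- rewrite rmorphM sig_xx mulrA coefMXn; case: ltnP => [lt|le].
    rewrite cf0; case: eqP => // e; rewrite cf_xx; case: i e => // i e.
    by exfalso; move: lt; rewrite -e mulnS; lia.
  rewrite coefMC !cf_xx; case: i => [|i]; first by rewrite if_same.
  rewrite IHf; congr (if _ then _ else _); rewrite mulnS.
  by apply/eqP/eqP; lia.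
- rewrite rmorphM sig_yy mulrA coefMXn; case: ltnP => [lt|le].
    rewrite cf0; case: eqP => // e; rewrite cf_yy; case: j e => // j e.
    by exfalso; move: lt; rewrite -e mulnS; lia.
  rewrite coefMC !cf_yy; case: j => [|j]; first by rewrite if_same.
  rewrite IHf; congr (if _ then _ else _); rewrite mulnS.
  by apply/eqP/eqP; lia.
Qed.

Definition cwise (d : R -> R) (u : {poly R}) := map_poly d u.

Lemma dx0 : dx (0 : R) = 0. Proof. by rewrite /dx map_poly0. Qed.
Lemma dy0 : dy (0 : R) = 0. Proof. exact: deriv0. Qed.

Lemma cwise_der d (phi : {rmorphism R -> {poly R}}) : der_along id d ->
  (forall c, phi (kk c) = (kk c)%:P) -> der_along phi (fun s => cwise d (phi s)).
Proof.
move=> [dD dM dk] pk; have d0 : d 0 = 0 by apply: (addrI (d 0)); rewrite -dD !addr0.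
split=> [f g|f g|c].
- by apply/polyP => i; rewrite rmorphD coefD !coef_map_id0 // coefD dD.
- apply/polyP => k; rewrite rmorphM coefD !coefM coef_map_id0 // coefM.
  rewrite (big_morph d dD d0) -big_split; apply: eq_bigr => i _.
  by rewrite dM !coef_map_id0.
- apply/polyP => i; rewrite [RHS]coef0 pk [LHS]coef_map_id0 // [((kk c)%:P)`_i]coefC.
  by case: (i == 0%N); [exact: dk | exact: d0].
Qed.

Lemma sig_dx s : sig (dx s) * 'X^a = cwise (@dx K) (sig s).
Proof.
apply: (der_ext (phi := sig) (D := fun s => sig (dx s) * 'X^a) (E := fun s => cwise (@dx K) (sig s))).
- case: (dx_der K) => [D1 D2 D3]; split=> [f g|f g|c].
  + by rewrite D1 rmorphD mulrDl.
  + by rewrite D2 rmorphD !rmorphM; ring.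
  + by rewrite D3 rmorph0 mul0r.
- by apply: cwise_der; [exact: dx_der | exact: sig_kk].
- rewrite dx_xx rmorph1 mul1r sig_xx; apply/polyP => i.
  rewrite coef_map_id0 ?dx0 // coefCM coefXn; case: eqP => _; rewrite ?mulr1 ?mulr0 ?dx_xx ?dx0 //.
- rewrite dx_yy rmorph0 mul0r sig_yy; apply/polyP => i.
  by rewrite coef_map_id0 ?dx0 // coefCM coefXn coef0; case: eqP => _; rewrite ?mulr1 ?mulr0 ?dx_yy ?dx0.
Qed.

Lemma sig_dy s : sig (dy s) * 'X^b = cwise (@dy K) (sig s).
Proof.
apply: (der_ext (phi := sig) (D := fun s => sig (dy s) * 'X^b) (E := fun s => cwise (@dy K) (sig s))).
- case: (dy_der K) => [D1 D2 D3]; split=> [f g|f g|c].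
  + by rewrite D1 rmorphD mulrDl.
  + by rewrite D2 rmorphD !rmorphM; ring.
  + by rewrite D3 rmorph0 mul0r.
- by apply: cwise_der; [exact: dy_der | exact: sig_kk].
- rewrite dy_xx rmorph0 mul0r sig_xx; apply/polyP => i.
  by rewrite coef_map_id0 ?dy0 // coefCM coefXn coef0; case: eqP => _; rewrite ?mulr1 ?mulr0 ?dy_xx ?dy0.
- rewrite dy_yy rmorph1 mul1r sig_yy; apply/polyP => i.
  by rewrite coef_map_id0 ?dy0 // coefCM coefXn; case: eqP => _; rewrite ?mulr1 ?mulr0 ?dy_yy ?dy0.
Qed.

Definition jacT (u v : {poly R}) := cwise (@dx K) u * cwise (@dy K) v - cwise (@dy K) u * cwise (@dx K) v.

Lemma cwiseX d (v : {poly R}) n : d 0 = 0 -> cwise d (v * 'X^n) = cwise d v * 'X^n.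
Proof.
move=> d0; apply/polyP => i; rewrite coef_map_id0 // !coefMXn; case: ifP => // _.
by rewrite coef_map_id0.
Qed.

Lemma sig_jac f g n : sig (jac f g) * 'X^(a + b + n) = jacT (sig f) (sig g * 'X^n).
Proof.
rewrite /jacT !cwiseX ?dx0 ?dy0 // -!sig_dx -!sig_dy /jac rmorphB !rmorphM !exprD.
by ring.
Qed.

Lemma jacT_top (u v : {poly R}) w k : (size u <= w.+1)%N -> (size v <= k.+1)%N ->
  (size (jacT u v) <= (w + k).+1)%N /\ (jacT u v)`_(w + k) = jac u`_w v`_k.
Proof.
move=> su sv.
have sc d n (z : {poly R}) : (size z <= n)%N -> (size (cwise d z) <= n)%N.
  by move=> le; apply: leq_trans le; rewrite /cwise map_polyE; apply: leq_trans (size_Poly _) _; rewrite size_map.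
have [s1 c1] := coefM_top (sc (@dx K) _ _ su) (sc (@dy K) _ _ sv).
have [s2 c2] := coefM_top (sc (@dy K) _ _ su) (sc (@dx K) _ _ sv).
split; last by rewrite coefB c1 c2 !coef_map_id0 ?dx0 ?dy0.
apply: leq_trans (size_polyD _ _) _; rewrite size_polyN geq_max s1 s2 //.
Qed.

(** Through [sig] the Jacobian becomes [jacT], up to a power of the weight variable, and the
    coefficient of maximal index in an iterate of [jacT] is the iterated Jacobian of the top
    forms. *)
Lemma top_nilp F w s k n : (size (sig F) <= w.+1)%N -> (size (sig s) <= k.+1)%N ->
  iter n (jac F) s = 0 -> iter n (jac (sig F)`_w) (sig s)`_k = 0.
Proof.
move=> sF ss Fs.
have H m : (size (iter m (jacT (sig F)) (sig s)) <= (m * w + k).+1)%N /\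
    (iter m (jacT (sig F)) (sig s))`_(m * w + k) = iter m (jac (sig F)`_w) (sig s)`_k.
  elim: m => [|m [IH1 IH2]]; first by rewrite mul0n add0n.
  by rewrite !iterS mulSn -addnA -IH2; exact: jacT_top.
have H2 m : iter m (jacT (sig F)) (sig s) = sig (iter m (jac F) s) * 'X^(m * (a + b)).
  elim: m => [|m IH]; first by rewrite mul0n expr0 mulr1.
  by rewrite !iterS IH -sig_jac mulSn.
by rewrite -(H n).2 H2 Fs rmorph0 mul0r coef0.
Qed.
End Sigma.

Lemma jac_nilp_gen H : (exists n, iter n (jac H) xx = 0) -> (exists n, iter n (jac H) yy = 0) ->
  forall s, exists n, iter n (jac H) s = 0.
Proof.
have [JD JM Jk] := @jac_der K idfun H (fun c => erefl).
have J0 n : iter n (jac H) 0 = 0 by exact: iter_der0.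
have up n m s : (n <= m)%N -> iter n (jac H) s = 0 -> iter m (jac H) s = 0.
  by move=> le e; rewrite -(subnK le) iterD e J0.
have mul f g : (exists n, iter n (jac H) f = 0) -> (exists n, iter n (jac H) g = 0) ->
    exists n, iter n (jac H) (f * g) = 0.
  move=> [n fn] [m gm]; exists (n + m).+1.
  by have [] := @iter_derM _ (jac H) JD JM n m f g (up _ _ _ (leqnSn n) fn) (up _ _ _ (leqnSn m) gm).
move=> hx hy; apply: R_gen => [c|f g [n fn] [m gm]|f hf|f hf].
- by exists 1%N; exact: Jk.
- exists (n + m)%N; rewrite (iter_derD JD) (up n) ?leq_addr // (up m) ?leq_addl // addr0 //.
- exact: mul.
- exact: mul.
Qed.
End Weights.

(** * Jung's degree reduction *)

Section JungStep.
Variable K : closedFieldType.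
Hypothesis char0 : forall n, n.+1%:R != 0 :> K.
Local Notation R := {poly {poly K}}.
Local Notation kk := (kk K).
Local Notation xx := (xx K).
Local Notation yy := (yy K).

Lemma char0R n : n.+1%:R != 0 :> R.
Proof. by rewrite -(rmorph_nat kk) /kk /= !polyC_eq0. Qed.
Lemma kk_eq0 c : (kk c == 0) = (c == 0).
Proof. by rewrite /kk /= !polyC_eq0. Qed.
Lemma xx_neq0 : xx != 0. Proof. by rewrite polyC_eq0 polyX_eq0. Qed.
Lemma yy_neq0 : yy != 0. Proof. by rewrite polyX_eq0. Qed.

Section Homogeneous.
Variables X Y : R.
(** The form is indexed by a polynomial in one variable, so that splitting h over K splits the form
    into factors X - zY. *)
Definition homog e (h : {poly K}) : R := \sum_(l < e.+1) kk h`_l * (X ^+ l * Y ^+ (e - l)).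

Lemma homogM e (h : {poly K}) c : (size h <= e.+1)%N ->
  homog e.+1 (('X - c%:P) * h) = (X - kk c * Y) * homog e h.
Proof.
move=> sh; rewrite /homog.
transitivity (\sum_(l < e.+2) kk (if l == 0%N :> nat then 0 else h`_l.-1) * (X ^+ l * Y ^+ (e.+1 - l))
  - \sum_(l < e.+2) kk (c * h`_l) * (X ^+ l * Y ^+ (e.+1 - l))).
  rewrite -sumrB; apply: eq_bigr => l _.
  by rewrite mulrBl coefB coefXM coefCM rmorphB mulrBl.
rewrite mulrBl big_ord_recl /= rmorph0 mul0r add0r; congr (_ - _).
  rewrite mulr_sumr; apply: eq_bigr => l _; rewrite /bump /= add1n subSS exprS; ring.
rewrite big_ord_recr /= (nth_default _ sh) mulr0 rmorph0 mul0r addr0 mulr_sumr.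
apply: eq_bigr => l _; rewrite rmorphM subSn -1?ltnS // exprS; ring.
Qed.

Lemma homog_prod (s : seq K) d :
  homog (size s) (d *: \prod_(z <- s) ('X - z%:P)) = kk d * \prod_(z <- s) (X - kk z * Y).
Proof.
elim: s => [|z s IH]; first by rewrite !big_nil /homog big_ord1 /= alg_polyC coefC !expr0 !mulr1.
rewrite !big_cons scalerAr homogM ?IH; last first.
  by apply: leq_trans (size_scale_leq _ _) _; rewrite size_prod_XsubC.
by rewrite mulrCA.
Qed.
End Homogeneous.

Section Form.
Variables (F : R) (A B : nat).
Hypotheses (A0 : (0 < A)%N) (B0 : (0 < B)%N).
Hypothesis FAB : forall i j, cf F i j != 0 -> (i <= A)%N /\ (j <= B)%N.
Hypotheses (FA : exists j, cf F A j != 0) (FB : exists i, cf F i B != 0).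
Hypothesis Fnil : forall s, exists n, iter n (jac F) s = 0.
Variable sig : {rmorphism R -> {poly R}}.
Hypothesis sig_kk : forall c, sig (kk c) = (kk c)%:P.
Hypotheses (sig_xx : sig xx = xx%:P * 'X^B) (sig_yy : sig yy = yy%:P * 'X^A).

Let w := (size (sig F)).-1.
Let H := (sig F)`_w.
Let D := jac H.

Lemma cfs f k i j : cf (sig f)`_k i j = if (B * i + A * j == k)%N then cf f i j else 0.
Proof. exact: cf_sig. Qed.

Lemma wt_le i j : cf F i j != 0 -> (B * i + A * j <= w)%N.
Proof.
move=> c0; suff : (B * i + A * j < size (sig F))%N by rewrite /w; case: (size _).
rewrite ltnNge; apply/negP => le; have := cfs F (B * i + A * j) i j.
by rewrite nth_default // cf0 eqxx => /esym e; rewrite e eqxx in c0.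
Qed.

Lemma cfHP i j : cf H i j != 0 -> [/\ (B * i + A * j = w)%N, cf F i j != 0, (i <= A)%N & (j <= B)%N].
Proof.
rewrite /H cfs; case: (B * i + A * j =P w)%N => [e c0|_]; last by rewrite eqxx.
by have [] := FAB c0.
Qed.

Lemma H_neq0 : H != 0.
Proof.
have [j c0] := FA; rewrite /H -lead_coefE lead_coef_eq0; apply: contraNneq c0 => e.
by have := cfs F (B * A + A * j) A j; rewrite e coef0 cf0 eqxx => <-.
Qed.

Lemma sigF_size : (size (sig F) <= w.+1)%N. Proof. exact: leqSpred. Qed.

Lemma D_der : der_along id D.
Proof. exact: (@jac_der K idfun H (fun c => erefl)). Qed.

Lemma D_nil s : exists n, iter n D s = 0.
Proof.
apply: jac_nilp_gen => //.
  have [n e] := Fnil xx; exists n; have := top_nilp sig_kk sig_xx sig_yy sigF_size _ e (k := B).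
  by rewrite sig_xx coefCM coefXn eqxx mulr1; apply; rewrite size_Cmul ?xx_neq0 // size_polyXn.
have [n e] := Fnil yy; exists n; have := top_nilp sig_kk sig_xx sig_yy sigF_size _ e (k := A).
by rewrite sig_yy coefCM coefXn eqxx mulr1; apply; rewrite size_Cmul ?yy_neq0 // size_polyXn.
Qed.

Lemma nuE f : f != 0 -> exists n, nu D f n.
Proof. by move=> f0; have [n e] := D_nil f; exact: nu_ex f0 e. Qed.

(** H itself has degree 0 for D = J(H, .), and [nu] is additive, so every factor of H has degree 0,
    that is, lies in the kernel of D. *)
Lemma D_factor f g : H = f * g -> D f = 0.
Proof.
case: D_der => DD DM _ e; have := H_neq0; rewrite e mulf_eq0 negb_or => /andP [f0 g0].
have [m fm] := nuE f0; have [n gn] := nuE g0.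
have := nu_uniq DD (nuM DD DM char0R fm gn) (nu0 _ _); rewrite -e => /(_ H_neq0 (jacff _)) /eqP.
by rewrite addn_eq0 => /andP [/eqP m0 _]; case: fm => _; rewrite m0.
Qed.

Lemma D_xx : D xx = - dy H.
Proof. by rewrite /D /jac dx_xx dy_xx mulr0 mulr1 sub0r. Qed.
Lemma D_yy : D yy = dx H.
Proof. by rewrite /D /jac dx_yy dy_yy mulr0 mulr1 subr0. Qed.

Lemma natmul_neq0 (c : K) n : c != 0 -> c *+ n.+1 != 0.
Proof. by move=> c0; rewrite -mulr_natr mulf_neq0. Qed.

(** If H contains a power of y alone, its weight is at most AB. Otherwise x divides H, so D(x) =
    -dH/dy vanishes and H consists of powers of x alone, again of weight at most AB. But F contains
    some x^i0 y^B, of weight at least AB; hence w = AB and i0 = 0. *)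
Lemma w_eq : (w = A * B)%N /\ cf H 0 B != 0.
Proof.
have [i0 c0] := FB; have wi := wt_le c0.
have fin k l : (w = B * k + A * l)%N -> (B * k + A * l <= A * B)%N -> (w = A * B)%N /\ cf H 0 B != 0.
  move=> wE le; have i00 : i0 = 0%N.
    apply/eqP; rewrite -leqn0 -(leq_pmul2l B0); lia.
  have wAB : w = (A * B)%N by lia.
  by split=> //; rewrite /H cfs wAB muln0 add0n eqxx -i00.
case: (pselect (exists j, cf H 0 j != 0)) => [[j cj]|no].
  have [wj _ _ jB] := cfHP cj; apply: (fin 0%N j); rewrite -?wj //.
  by rewrite muln0 add0n leq_mul2l jB orbT.
have e0 : evx 0 H = 0.
  apply/polyP => j; rewrite evxE horner_coef0 coef0; apply/eqP/negPn/negP => h.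
  by apply: no; exists j.
have [q] := evx_eq0 e0; rewrite rmorph0 subr0 mulrC => /D_factor; rewrite D_xx => /eqP.
rewrite oppr_eq0 => /eqP dH.
have [i [j cij]] : exists i j, cf H i j != 0.
  apply: contrapT => h; case/eqP: H_neq0; apply: cfP => i j; rewrite cf0.
  by apply/eqP/negPn/negP => hh; apply: h; exists i, j.
have [wE _ iA jB] := cfHP cij.
case: j cij wE jB => [|j] cij wE jB.
  by apply: (fin i 0%N); rewrite -?wE // muln0 addn0 mulnC leq_mul2r iA orbT.
by case/eqP: (natmul_neq0 j cij); rewrite -cf_dy dH cf0.
Qed.

Lemma cfHA : cf H A 0 != 0.
Proof.
have [j c0] := FA; have := wt_le c0; have [wE _] := w_eq; rewrite wE => le.
have j0 : j = 0%N by apply/eqP; rewrite -leqn0 -(leq_pmul2l A0); lia.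
by rewrite /H cfs wE muln0 addn0 mulnC eqxx -j0.
Qed.

Let e := gcdn A B.
Let b' := (A %/ e)%N.
Let a' := (B %/ e)%N.

Lemma e_gt0 : (0 < e)%N. Proof. by rewrite gcdn_gt0 A0. Qed.
Lemma AE : (A = b' * e)%N. Proof. by rewrite divnK // dvdn_gcdl. Qed.
Lemma BE : (B = a' * e)%N. Proof. by rewrite divnK // dvdn_gcdr. Qed.
Lemma b'0 : (0 < b')%N. Proof. by move: A0; rewrite {1}AE muln_gt0 => /andP []. Qed.
Lemma a'0 : (0 < a')%N. Proof. by move: B0; rewrite {1}BE muln_gt0 => /andP []. Qed.
Lemma co : coprime b' a'.
Proof.
rewrite /coprime -(eqn_pmul2r e_gt0) mul1n muln_gcdl -AE -BE; exact: eqxx.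
Qed.

(** Dividing B i + A j = A B by the gcd e leaves coprime coefficients a' and b', so b' divides i and
    the exponents run along a segment with e + 1 lattice points. *)
Lemma exps i j : cf H i j != 0 -> exists2 l, (l <= e)%N & i = (b' * l)%N /\ j = (a' * (e - l))%N.
Proof.
move=> /cfHP [wE _ iA jB]; have [wAB _] := w_eq; rewrite wAB in wE.
have eq1 : (a' * i + b' * j = a' * b' * e)%N.
  apply/eqP; rewrite -(eqn_pmul2r e_gt0); apply/eqP.
  rewrite mulnDl -mulnAC -BE -[(b' * j * e)%N]mulnAC -AE wE {1}AE {1}BE; ring.
have /dvdnP [l lE] : (b' %| i)%N.
  rewrite -(Gauss_dvdr _ co) -(dvdn_addl _ (dvdn_mulr j (dvdnn b'))) eq1 -mulnA mulnCA.
  exact: dvdn_mulr.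
have le : (l <= e)%N by rewrite -(leq_pmul2l b'0) -AE mulnC -lE.
exists l => //; split; first by rewrite lE mulnC.
apply/eqP; rewrite -(eqn_pmul2l b'0); apply/eqP.
have := eq1; rewrite lE mulnBr; have : (a' * l <= a' * e)%N by rewrite leq_mul2l le orbT.
by nia.
Qed.

Let X := xx ^+ b'.
Let Y := yy ^+ a'.
Let h := \poly_(l < e.+1) cf H (b' * l) (a' * (e - l)).

Lemma H_homog : H = homog X Y e h.
Proof.
apply: cfP => i j; rewrite /homog cf_sum.
under eq_bigr => l _ do rewrite cfZ -!exprM cf_mon coef_poly ltn_ord.
case: (pselect (exists2 l, (l <= e)%N & i = (b' * l)%N /\ j = (a' * (e - l))%N)) => [[l le [iE jE]]|no].
  have lt : (l < e.+1)%N by [].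
  rewrite (bigD1 (Ordinal lt)) //= -iE -jE !eqxx mulr1 big1 ?addr0 // => k nk.
  case: eqP => [ik|]; last by rewrite mulr0.
  case/eqP: nk; apply: val_inj => /=; apply/eqP; rewrite -(eqn_pmul2l b'0) -ik iE //.
case: (eqVneq (cf H i j) 0) => [->|/exps //].
rewrite big1 // => l _; case: eqP => [iE|]; rewrite ?mulr0 //; case: eqP => [jE|]; rewrite ?mulr0 //.
by case: no; exists l; rewrite -1?ltnS.
Qed.

(** H splits into factors X - zY, all killed by D. Two different values of z would force D(X) = 0,
    hence dH/dy = 0, although y^B occurs in H. *)
Lemma H_power : exists d z, [/\ d != 0, z != 0 & H = kk d * (X - kk z * Y) ^+ e].
Proof.
have he : h`_e != 0 by rewrite coef_poly ltnSn subnn muln0 -AE cfHA.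
have h0 : h`_0 != 0 by rewrite coef_poly /= muln0 subn0 -BE; have [] := w_eq.
have sh : size h = e.+1.
  apply/eqP; rewrite eqn_leq size_poly ltnNge; apply/negP => /leq_sizeP /(_ e (leqnn e)) z.
  by rewrite z eqxx in he.
have [s sE] := closed_field_poly_normal h; set d := lead_coef h in sE.
have d0 : d != 0 by rewrite lead_coef_eq0 -size_poly_eq0 sh.
have ss : size s = e by move: sh; rewrite sE size_scale // size_prod_XsubC => -[].
have HE : H = kk d * \prod_(z <- s) (X - kk z * Y) by rewrite H_homog -ss -homog_prod -sE.
case: D_der => DD DM Dk.
have Dz z : z \in s -> D (X - kk z * Y) = 0.
  move=> zs; apply: (@D_factor _ (kk d * \prod_(z <- rem z s) (X - kk z * Y))).
  by rewrite HE (big_rem z zs) /= mulrCA.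
have DN := derN DD.
have DE z : D (X - kk z * Y) = D X - kk z * D Y by rewrite DD DN DM Dk mul0r add0r.
have DX0 : D X != 0.
  apply/eqP; rewrite /X -(prednK b'0) (derX DM) => /eqP; rewrite !mulf_eq0 (negPf (char0R _)) /=.
  rewrite expf_eq0 (negPf xx_neq0) andbF /= D_xx oppr_eq0 => /eqP dH.
  have [_ c] := w_eq; have := natmul_neq0 B.-1 c; rewrite -{1}(prednK B0) -cf_dy dH cf0 eqxx //.
case: s sE ss HE Dz => [|z s] sE ss HE Dz; first by have := e_gt0; rewrite -ss.
exists d, z; split=> //.
  apply: contraNneq h0 => z0; rewrite sE -horner_coef0 hornerZ big_cons hornerM z0 hornerXsubC.
  by rewrite subrr mul0r mulr0.
have all z' : z' \in z :: s -> z' = z.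
  move=> z's; have /eqP := Dz z' z's; have /eqP := Dz z (mem_head _ _).
  rewrite !DE !subr_eq0 => /eqP e1 /eqP e2; apply: contraNeq DX0 => nz.
  have /eqP : kk (z' - z) * D Y = 0 by rewrite rmorphB mulrBl -e1 -e2 subrr.
  by rewrite mulf_eq0 kk_eq0 subr_eq0 (negPf nz) /= e1 => /eqP ->; rewrite mulr0.
rewrite HE; congr (_ * _); rewrite -ss.
transitivity (\prod_(z0 <- z :: s) (X - kk z * Y)); last by rewrite big_const_seq count_predT iter_mulr_1.
by rewrite !big_seq; apply: eq_bigr => z' /all ->.
Qed.

(** Let m and n be the degrees of x and y for D. Differentiating the power found in [H_power] gives
    m - 1 = (a' - 1) n and n - 1 = (b' - 1) m. These are incompatible when a' and b' both exceed 1,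
    so one of A and B divides the other. *)
Theorem jung_form : (size (sig F) <= (A * B).+1)%N /\
  exists d z q, [/\ d != 0, (0 < q)%N &
   (B = q * A)%N /\ (sig F)`_(A * B) = kk d * (xx - kk z * yy ^+ q) ^+ A \/
   (A = q * B)%N /\ (sig F)`_(A * B) = kk d * (yy - kk z * xx ^+ q) ^+ B].
Proof.
have [wAB c0B] := w_eq; split; first by rewrite -wAB; exact: sigF_size.
have [d [z [d0 z0 HE]]] := H_power; case: D_der => DD DM Dk.
pose q := X - kk z * Y.
have q0 : q != 0.
  apply: contraNneq H_neq0 => z'; rewrite HE -/q z' expr0n; have := e_gt0.
  by case: e => //= n _; rewrite mulr0.
have Dq : D q = 0.
  apply: (@D_factor _ (kk d * q ^+ e.-1)).
  by rewrite HE -/q mulrCA -exprS prednK // e_gt0.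
have nq : nu D q 0 by [].
have nk u : u != 0 -> nu D (kk u) 0 by move=> u0; split=> /=; [rewrite kk_eq0 | exact: Dk].
have [m mx] := nuE xx_neq0; have [n ny] := nuE yy_neq0.
case: (dx_der K) (dy_der K) => [xD xM xk] [yD yM yk].
have xN := derN xD; have yN := derN yD.
have dX k : dx (yy ^+ k) = 0 by case: k => [|k]; rewrite ?(der1 xM) // (derX xM) dx_yy !mulr0.
have dY k : dy (xx ^+ k) = 0 by case: k => [|k]; rewrite ?(der1 yM) // (derX yM) dy_xx !mulr0.
have yX k (f : R) : (0 < k)%N -> dy (f ^+ k) = k%:R * (f ^+ k.-1 * dy f) by case: k => // k _; exact: (derX yM).
have xX k (f : R) : (0 < k)%N -> dx (f ^+ k) = k%:R * (f ^+ k.-1 * dx f) by case: k => // k _; exact: (derX xM).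
have e1 : D xx = kk (d * e%:R * z * a'%:R) * (q ^+ e.-1 * yy ^+ a'.-1).
  rewrite D_xx HE -/q yM yk mul0r add0r (yX _ _ e_gt0).
  rewrite /q yD yN yM yk /X dY /Y (yX _ _ a'0) dy_yy !rmorphM !rmorph_nat.
  by ring.
have e2 : D yy = kk (d * e%:R * b'%:R) * (q ^+ e.-1 * xx ^+ b'.-1).
  rewrite D_yy HE -/q xM xk mul0r add0r (xX _ _ e_gt0).
  rewrite /q xD xN xM xk /Y dX /X (xX _ _ b'0) dx_xx !rmorphM !rmorph_nat.
  by ring.
have nz k : (0 < k)%N -> k%:R != 0 :> K by case: k => // k _; exact: char0.
have := e_gt0; have := a'0; have := b'0 => hb ha he.
have mul := nuM DD DM char0R; have pw := nuX DD DM char0R.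
have nqe : nu D (q ^+ e.-1) 0 by rewrite -(muln0 e.-1); exact: pw.
have n1 : nu D (D xx) (a'.-1 * n).
  rewrite e1 -[(a'.-1 * n)%N]add0n; apply: (mul); first by apply: nk; rewrite !mulf_neq0 ?nz.
  by rewrite -[(a'.-1 * n)%N]add0n; apply: (mul) => //; exact: pw.
have n2 : nu D (D yy) (b'.-1 * m).
  rewrite e2 -[(b'.-1 * m)%N]add0n; apply: (mul); first by apply: nk; rewrite !mulf_neq0 ?nz.
  by rewrite -[(b'.-1 * m)%N]add0n; apply: (mul) => //; exact: pw.
case: m mx n2 => [[_ /= mx]|m mx] n2.
  by case: n1 => /eqP; rewrite mx (iter_der0 DD).
case: n ny n1 => [[_ /= ny]|n ny] n1.
  by case: n2 => /eqP; rewrite ny (iter_der0 DD).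
have E1 := nu_uniq DD (nu_der mx) n1; have E2 := nu_uniq DD (nu_der ny) n2.
rewrite -wAB -/H; case: (eqVneq b' 1%N) => [b1|nb].
  exists d, z, a'; split=> //; left; have A_e : A = e by rewrite {1}AE b1 mul1n.
  by split; [rewrite {1}BE A_e | rewrite HE /X /Y b1 expr1 A_e].
case: (eqVneq a' 1%N) => [a1|na]; last first.
  exfalso; have : (1 < b')%N by case: b' hb nb => [|[]].
  have : (1 < a')%N by case: a' ha na => [|[]].
  by move: E1 E2; nia.
(* From x^b' - z y = -z (y - z^-1 x^b'). *)
exists (d * (- z) ^+ B), z^-1, b'; have B_e : B = e by rewrite {1}BE a1 mul1n.
split=> //; first by rewrite mulf_neq0 // expf_neq0 // oppr_eq0.
right; split; first by rewrite {1}AE B_e.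
rewrite HE /X /Y a1 expr1 -B_e rmorphM -mulrA rmorphXn -exprMn_comm; last exact: mulrC.
congr (_ * _ ^+ _); rewrite mulrBr rmorphN mulNr mulNr opprK mulrA -rmorphM divff // rmorph1 mul1r addrC.
by [].
Qed.
End Form.

Section Reduce.
Variables (F : R) (A B : nat).
Hypotheses (A0 : (0 < A)%N) (B0 : (0 < B)%N).
Variable sig : {rmorphism R -> {poly R}}.
Hypothesis sig_kk : forall c, sig (kk c) = (kk c)%:P.
Hypotheses (sig_xx : sig xx = xx%:P * 'X^B) (sig_yy : sig yy = yy%:P * 'X^A).
Hypothesis sF : (size (sig F) <= (A * B).+1)%N.
Variable tau : {rmorphism R -> R}.
Hypothesis tau_kk : forall c, tau (kk c) = kk c.
Hypotheses (tau_xx : sig (tau xx) = map_poly tau (sig xx)) (tau_yy : sig (tau yy) = map_poly tau (sig yy)).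

(** [tau] respects the grading, so it acts on each weight component separately, and in weight AB
    only the image of the top form of F remains. *)
Lemma tau_wt i j : cf (tau F) i j != 0 ->
  (B * i + A * j < A * B)%N \/ cf (tau (sig F)`_(A * B)) i j != 0.
Proof.
move=> c0; have comm f : sig (tau f) = map_poly tau (sig f).
  apply: (@rmorph_ext K _ (sig \o tau) (map_poly tau \o sig)) => //= c.
  by rewrite tau_kk sig_kk map_polyC /= tau_kk.
have := cf_sig sig_kk sig_xx sig_yy (tau F) (B * i + A * j) i j.
rewrite eqxx comm coef_map /= => e; rewrite -e in c0.
case: (ltngtP (B * i + A * j) (A * B)) => [lt|gt|eq]; first by left.
  by move: c0; rewrite nth_default ?rmorph0 ?cf0 ?eqxx //; apply: leq_trans sF _.
by right; rewrite -eq.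
Qed.
End Reduce.
End JungStep.

(** * Tame automorphisms *)

Lemma weight_lt A B i j : (B * i + A * j < A * B)%N -> (i < A)%N /\ (j < B)%N.
Proof.
move=> lt; split; rewrite ltnNge; apply/negP => h.
  by have : (B * A <= B * i)%N; [rewrite leq_mul2l h orbT | lia].
by have : (A * B <= A * j)%N; [rewrite leq_mul2l h orbT | lia].
Qed.

Lemma add_lt a b A B N : (a <= A)%N -> (b < B)%N -> (A + B <= N.+1)%N -> (a + b <= N)%N.
Proof. by lia. Qed.

Section Tame.
#[local] Opaque kk.
Variable K : closedFieldType.
Hypothesis char0 : forall n, n.+1%:R != 0 :> K.
Local Notation R := {poly {poly K}}.
Local Notation kk := (kk K).
Local Notation xx := (xx K).
Local Notation yy := (yy K).
Local Notation morph := {rmorphism R -> R}.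
Implicit Types (f g : morph) (p : {poly K}).

Definition kalg f := forall c, f (kk c) = kk c.
Definition py : {rmorphism {poly K} -> R} := map_poly polyC.
Definition px : {rmorphism {poly K} -> R} := polyC.

Lemma py_X : py 'X = yy. Proof. exact: map_polyX. Qed.
Lemma py_C c : py c%:P = kk c. Proof. exact: map_polyC. Qed.

Lemma px_X : px 'X = xx. Proof. by []. Qed.
Lemma px_C c : px c%:P = kk c. Proof. by []. Qed.
Lemma cf_px p i j : cf (px p) i j = if j == 0%N then p`_i else 0.
Proof. by rewrite /cf /px /= coefC; case: (j == 0%N); rewrite ?coef0. Qed.
#[local] Opaque py px.

Lemma poly_rmorph_ext (S : comNzRingType) (f g : {rmorphism {poly K} -> S}) :
  (forall c, f c%:P = g c%:P) -> f 'X = g 'X -> f =1 g.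
Proof.
by move=> ec eX; elim/poly_ind => [|p c IH]; rewrite ?rmorph0 // !rmorphD !rmorphM IH ec eX.
Qed.

Lemma kalg_py f p a b : kalg f -> f yy = kk a * yy + kk b -> f (py p) = py (p \Po (a *: 'X + b%:P)).
Proof.
move=> fk fy.
apply: (poly_rmorph_ext (f := f \o py) (g := py \o comp_poly (a *: 'X + b%:P))) => [c|] /=.
  by rewrite comp_polyC py_C fk.
by rewrite comp_polyX py_X fy -mul_polyC rmorphD rmorphM !py_C py_X.
Qed.

Lemma kalg_ext f g : kalg f -> kalg g -> f xx = g xx -> f yy = g yy -> f =1 g.
Proof. by move=> fk gk; apply: rmorph_ext => c; rewrite fk gk. Qed.

Lemma kalg_comp f g : kalg f -> kalg g -> kalg (f \o g).
Proof. by move=> fk gk c; rewrite /= gk fk. Qed.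

Definition kaut f := kalg f /\ exists f' : morph, [/\ kalg f', cancel f f' & cancel f' f].

Lemma kaut_comp f g : kaut f -> kaut g -> kaut (f \o g).
Proof.
move=> [fk [f' [f'k fK f'K]]] [gk [g' [g'k gK g'K]]]; split; first exact: kalg_comp.
by exists (g' \o f'); split; [exact: kalg_comp | move=> r /=; rewrite fK gK | move=> r /=; rewrite g'K f'K].
Qed.

Definition ksubst (F G : R) : morph := subst kk F G.
Lemma ksubst_kalg F G : kalg (ksubst F G). Proof. exact: subst_kk. Qed.
Lemma ksubst_xx F G : ksubst F G xx = F. Proof. exact: subst_xx. Qed.
Lemma ksubst_yy F G : ksubst F G yy = G. Proof. exact: subst_yy. Qed.

#[local] Opaque ksubst.

Lemma kaut_id : kaut idfun.
Proof. by split=> //; exists idfun; split. Qed.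

Lemma mutual_can f g : kalg f -> kalg g -> f (g xx) = xx -> f (g yy) = yy -> cancel g f.
Proof.
move=> fk gk ex ey r; have := @kalg_ext (f \o g) idfun; apply=> //; exact: kalg_comp.
Qed.

(** The elementary, or de Jonquieres, automorphisms; together with the swap [pif] they generate the
    tame ones. *)
Definition eform f l m c p := [/\ l != 0, m != 0, f xx = kk l * xx + py p & f yy = kk m * yy + kk c].
Definition isE f := kalg f /\ exists l m c p, eform f l m c p.
Definition mkE l m c p := ksubst (kk l * xx + py p) (kk m * yy + kk c).

Lemma mkE_form l m c p : l != 0 -> m != 0 -> eform (mkE l m c p) l m c p.
Proof. by move=> l0 m0; split=> //; rewrite /mkE ?ksubst_xx ?ksubst_yy. Qed.
Lemma mkE_isE l m c p : l != 0 -> m != 0 -> isE (mkE l m c p).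
Proof. by move=> l0 m0; split; [exact: ksubst_kalg | exists l, m, c, p; exact: mkE_form]. Qed.

#[local] Opaque mkE.

Lemma isE_id : isE idfun.
Proof.
split=> //; exists 1, 1, 0, 0; split; rewrite ?oner_neq0 // !rmorph1 mul1r /= ?rmorph0 addr0 //.
Qed.

Lemma isE_comp f g : isE f -> isE g -> isE (f \o g).
Proof.
move=> [fk [l [m [c [p [l0 m0 fx fy]]]]]] [gk [l' [m' [c' [p' [l'0 m'0 gx gy]]]]]].
split; first exact: kalg_comp.
exists (l * l'), (m * m'), (m' * c + c'), (l' *: p + (p' \Po (m *: 'X + c%:P))).
split; rewrite ?mulf_neq0 //= ?gx ?gy rmorphD rmorphM !fk ?fx ?fy.
  by rewrite (kalg_py p' fk fy) -[l' *: p]mul_polyC [py (_ + _)]rmorphD [py (_ * _)]rmorphM py_C [kk (l * l')]rmorphM; ring.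
by rewrite rmorphD !rmorphM; ring.
Qed.

Lemma isE_inv f : isE f -> exists g, [/\ isE g, cancel f g & cancel g f].
Proof.
move=> [fk [l [m [c [p [l0 m0 fx fy]]]]]].
pose q := - (l^-1 *: (p \Po (m^-1 *: 'X + (- c / m)%:P))).
pose g := mkE l^-1 m^-1 (- c / m) q.
have [l'0 m'0] : l^-1 != 0 /\ m^-1 != 0 by rewrite !invr_eq0.
have [_ _ gx gy] := mkE_form (- c / m) q l'0 m'0; rewrite -/g in gx gy.
have gk : kalg g by exact: ksubst_kalg.
have lK : kk l^-1 * kk l = 1 by exact: kkV.
have mK : kk m^-1 * kk m = 1 by exact: kkV.
have gp := kalg_py p gk gy.
have gfx : g (f xx) = xx.
  rewrite fx rmorphD rmorphM gk gx gp /q rmorphN -mul_polyC rmorphM py_C mulrDr mulrA mulrN mulrA.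
  by rewrite [kk l * _]mulrC lK !mul1r subrK.
have gfy : g (f yy) = yy.
  rewrite fy rmorphD rmorphM !gk gy mulrDr mulrA [kk m * _]mulrC mK mul1r -rmorphM mulrC divfK //.
  by rewrite rmorphN subrK.
have gf : cancel f g by exact: mutual_can.
exists g; split=> //; first exact: mkE_isE.
have fgy : f (g yy) = yy.
  rewrite gy rmorphD rmorphM !fk fy mulrDr mulrA mK mul1r -addrA -rmorphM -rmorphD.
  by rewrite mulrC mulNr addrN rmorph0 addr0.
apply: mutual_can => //.
rewrite gx rmorphD rmorphM fk fx /q rmorphN -mul_polyC rmorphM py_C rmorphN rmorphM fk.
rewrite -[py (p \Po _)]gp.
have fgp : f (g (py p)) = py p.
  have := @poly_rmorph_ext R (f \o (g \o py)) py; apply=> [d|] /=; first by rewrite py_C gk fk.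
  by rewrite py_X fgy.
by rewrite fgp mulrDr mulrA lK mul1r addrK.
Qed.

Lemma isE_kaut f : isE f -> kaut f.
Proof.
move=> Ef; have [g [Eg fK gK]] := isE_inv Ef; split; first by case: Ef.
by exists g; split=> //; case: Eg.
Qed.

Definition pif := ksubst yy xx.
Lemma pif_kalg : kalg pif. Proof. exact: ksubst_kalg. Qed.
Lemma pif_xx : pif xx = yy. Proof. exact: ksubst_xx. Qed.
Lemma pif_yy : pif yy = xx. Proof. exact: ksubst_yy. Qed.
Lemma pifK : cancel pif pif.
Proof. by apply: mutual_can; rewrite ?pif_xx ?pif_yy ?pif_xx //; exact: pif_kalg. Qed.
Lemma pif_kaut : kaut pif.
Proof. by split; [exact: pif_kalg | exists pif; split; [exact: pif_kalg | exact: pifK | exact: pifK]]. Qed.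
#[local] Opaque pif.
Lemma pif_py p : pif (py p) = px p.
Proof.
apply: (poly_rmorph_ext (f := pif \o py) (g := px)) => [c|] /=; first by rewrite py_C pif_kalg.
by rewrite py_X pif_yy.
Qed.
Lemma pif_px p : pif (px p) = py p. Proof. by rewrite -pif_py pifK. Qed.

Fixpoint W (l : seq morph) : morph := if l is e :: l' then pif \o (e \o W l') else idfun.
Definition allE l := forall i, (i < size l)%N -> isE (nth (idfun : morph) l i).

Lemma allE_cons e l : isE e -> allE l -> allE (e :: l).
Proof. by move=> Ee El [|i]; [|exact: El]. Qed.
Lemma allE_cat l1 l2 : allE (l1 ++ l2) <-> allE l1 /\ allE l2.
Proof.
split=> [h|[h1 h2] i]; last first.
  rewrite size_cat nth_cat => lt; case: ltnP => le; [exact: h1 | apply: h2; lia].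
split=> i lt; first by have := h i; rewrite nth_cat lt size_cat; apply; lia.
by have := h (size l1 + i)%N; rewrite nth_cat size_cat addKn ifF; [apply|]; lia.
Qed.
Lemma W_cat l1 l2 r : W (l1 ++ l2) r = W l1 (W l2 r).
Proof. by elim: l1 r => //= e l IH r; rewrite IH. Qed.
Lemma W_kaut l : allE l -> kaut (W l).
Proof.
elim: l => [_|e l IH El]; first exact: kaut_id.
apply: kaut_comp; first exact: pif_kaut.
apply: kaut_comp; first by apply: isE_kaut; exact: (El 0%N).
by apply: IH => i; exact: (El i.+1).
Qed.

Definition tame f := exists e0 l, [/\ isE e0, allE l & forall r, f r = e0 (W l r)].

Lemma tame_E e f : isE e -> tame f -> tame (e \o f).
Proof.
move=> Ee [e0 [l [E0 El fE]]]; exists (e \o e0), l; split=> //; first exact: isE_comp.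
by move=> r /=; rewrite fE.
Qed.
Lemma tame_pi f : tame f -> tame (pif \o f).
Proof.
move=> [e0 [l [E0 El fE]]]; exists idfun, (e0 :: l); split; first exact: isE_id.
  exact: allE_cons.
by move=> r /=; rewrite fE.
Qed.
Lemma tame_ext f g : f =1 g -> tame g -> tame f.
Proof. by move=> fg [e0 [l [E0 El gE]]]; exists e0, l; split=> // r; rewrite fg. Qed.
Lemma tame_piN f : tame (pif \o f) -> tame f.
Proof. by move=> h; apply: tame_ext (tame_pi h) => r /=; rewrite pifK. Qed.
Lemma tame_EN e f : isE e -> tame (e \o f) -> tame f.
Proof.
move=> Ee h; have [g [Eg eK _]] := isE_inv Ee.
by apply: tame_ext (tame_E Eg h) => r /=; rewrite eK.
Qed.

(** x is the image of q(x) under f', and x does not factor, so q is linear. The constant Jacobian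
    then forces f(y) to be a multiple of y plus a polynomial in x: an elementary map conjugated by
    the swap. *)
Lemma jung_base f q : kaut f -> f xx = px q -> tame f.
Proof.
move=> [fk [f' [f'k fK f'K]]] fx.
have sq1 : (1 < size q)%N.
  rewrite ltnNge; apply/negP => /size1_polyC qE; have := f_equal f' fx; rewrite fK qE.
  rewrite px_C f'k => e; have := cf_kk q`_0 1 0; rewrite -e -[xx]mul1r cf_xx -(rmorph1 kk) cf_kk /=.
  by move/eqP; rewrite oner_eq0.
have sq : size q = 2%N.
  apply/eqP; rewrite eqn_leq sq1 andbT leqNgt; apply/negP => sq2.
  have [a [q' [qE q'0 sq']]] := closed_factor sq1.
  have := f_equal f' fx; rewrite fK qE rmorphM rmorphM => e.
  have d0 : f' (px ('X - a%:P)) != 0.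
    by apply: contraTneq (@xx_neq0 K) => d0; rewrite e d0 mul0r eqxx.
  have q0 : f' (px q') != 0 by apply: contraTneq (@xx_neq0 K) => q0; rewrite e q0 mulr0 eqxx.
  have := mdegM d0 q0; rewrite -e {1}/mdeg /xx size_polyC polyX_eq0 lead_coefC size_polyX /= => m1.
  have cst (r : {poly K}) : f' (px r) != 0 -> mdeg (f' (px r)) = 0%N -> (size r <= 1)%N.
    move=> r0 m; have [c _ rE] := mdeg0P r0 m; have := f_equal f rE; rewrite f'K fk => rc.
    have -> : r = c%:P by apply: (@polyC_inj {poly K}).
    exact: size_polyC_leq1.
  case: (posnP (mdeg (f' (px ('X - a%:P))))) => [m|m]; first by have := cst _ d0 m; rewrite size_XsubC.
  have /(cst _ q0) : mdeg (f' (px q')) = 0%N by lia.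
  by rewrite -ltnS -sq' leqNgt sq2.
pose l := q`_1; pose c := q`_0.
have qE : q = l *: 'X + c%:P.
  apply/polyP => -[|[|i]]; rewrite coefD coefZ coefX coefC /= ?mulr0 ?mulr1 ?add0r ?addr0 //.
  by rewrite nth_default // sq.
have l0 : l != 0.
  have : lead_coef q != 0 by rewrite lead_coef_eq0 -size_poly_eq0 sq.
  by rewrite lead_coefE sq.
have [u u0 jE] := jac_unit f'K fk.
have fx' : f xx = kk l * xx + kk c by rewrite fx qE -mul_polyC rmorphD rmorphM.
have dG : dy (f yy) = kk (u / l).
  have [xD xM xk] := dx_der K; have [yD yM yk] := dy_der K.
  move: jE; rewrite /jac fx' xD xM yD yM !xk !yk dx_xx dy_xx mulr1 !mulr0 !mul0r !addr0 add0r.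
  rewrite mul0r subr0 => e; apply: (mulfI (x := kk l)); first by rewrite kk_eq0.
  by rewrite e -rmorphM mulrC divfK.
pose g := (f yy)`_0.
have GE : f yy = kk (u / l) * yy + px g.
  apply: cfP => i j; have := f_equal (fun r => cf r i j.-1) dG; rewrite cf_dy cf_kk.
  rewrite cfD cf_yy cf_px; case: j => [|j] /=; first by rewrite add0r.
  rewrite cf_kk addr0; case: ifP => [/andP [_ /eqP ->]|_] e; first by rewrite -e mulr1n.
  by move/eqP: e; rewrite -mulr_natr mulf_eq0 (negPf (char0 _)) orbF => /eqP ->.
have m0 : u / l != 0 by rewrite mulf_neq0 // invr_eq0.
move: (u / l) m0 GE dG => m m0 GE dG.
have Ee : isE (pif \o (f \o pif)).
  split; first by do 2?apply: kalg_comp => //; exact: pif_kalg.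
  exists m, l, c, g; split=> //=; rewrite ?pif_xx ?pif_yy ?GE ?fx' rmorphD rmorphM !pif_kalg ?pif_yy ?pif_xx //.
  by rewrite pif_px.
exists idfun, [:: (pif \o (f \o pif) : morph); (idfun : morph)]; split; first exact: isE_id.
  by apply: allE_cons => //; apply: allE_cons => //; exact: isE_id.
by move=> r /=; rewrite !pifK.
Qed.

Definition degx (F : R) := (size (swapXY F)).-1.
Definition degy (F : R) := (size F).-1.

Lemma cf_swap (F : R) i j : cf (swapXY F) i j = cf F j i.
Proof. by rewrite /cf coef_swapXY. Qed.
Lemma degy_le (F : R) i j : cf F i j != 0 -> (j <= degy F)%N.
Proof.
move=> c0; have : (j < size F)%N; last by rewrite /degy; case: (size F).
by rewrite ltnNge; apply: contra c0 => le; have -> : cf F i j = 0; [rewrite /cf; have -> : F`_j = 0 by exact: nth_default | exact: eqxx]; exact: coef0.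
Qed.
Lemma degx_le (F : R) i j : cf F i j != 0 -> (i <= degx F)%N.
Proof. by rewrite -cf_swap => /degy_le. Qed.
Lemma degy_ex (F : R) : F != 0 -> exists i, cf F i (degy F) != 0.
Proof.
move=> F0; exists (size (lead_coef F)).-1.
by rewrite /cf /degy -lead_coefE -lead_coefE !lead_coef_eq0.
Qed.
Lemma degx_ex (F : R) : F != 0 -> exists j, cf F (degx F) j != 0.
Proof. by rewrite -swapXY_eq0 => /degy_ex [j]; rewrite cf_swap => h; exists j. Qed.

Lemma degy0 (F : R) : degy F = 0%N -> F = px F`_0.
Proof. by rewrite /degy => d; apply: size1_polyC; case: (size F) d => // n /= ->. Qed.
Lemma cf_pif (F : R) i j : cf (pif F) i j = cf F j i.
Proof.
move: F i j; apply: R_gen => [c|f g IHf IHg|f IHf|f IHf] i j.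
- by rewrite pif_kalg !cf_kk andbC.
- by rewrite rmorphD !cfD IHf IHg.
- by rewrite rmorphM pif_xx cf_yy cf_xx; case: j.
- by rewrite rmorphM pif_yy cf_yy cf_xx; case: i.
Qed.
Lemma degx0 (F : R) : degx F = 0%N -> pif F = px (pif F)`_0.
Proof.
move=> d; apply: degy0; apply/eqP; rewrite -leqn0 -d.
case: (eqVneq (pif F) 0) => [->|n0]; first by rewrite /degy size_poly0.
by have [i ci] := degy_ex n0; move: ci; rewrite cf_pif => /degx_le.
Qed.

(** Induction on the sum of the x- and y-degrees of f(x). Its top form is a constant times a power
    of x - z y^q or of y - z x^q; an elementary map straightens it to a power of a coordinate, which
    lowers one of the two degrees. *)
Theorem jung f : kaut f -> tame f.
Proof.
move: {2}(degx (f xx) + degy (f xx))%N (leqnn (degx (f xx) + degy (f xx))) => N.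
elim: N f => [|N IH] f le fa.
  by apply: (jung_base fa); apply: degy0; move: le; rewrite leqn0 addn_eq0 => /andP [_ /eqP].
have [fk [f' [f'k fK f'K]]] := fa.
set F := f xx in le; pose A := degx F; pose B := degy F.
have F0 : F != 0 by rewrite -(rmorph0 f) (inj_eq (can_inj fK)) xx_neq0.
case: (posnP B) => [B0|B0]; first by apply: (jung_base fa); exact: degy0 B0.
case: (posnP A) => [A0|A0].
  by apply/tame_piN/jung_base; [exact: kaut_comp pif_kaut fa | exact: degx0 A0].
have FAB i j : cf F i j != 0 -> (i <= A)%N /\ (j <= B)%N.
  by move=> c; split; [exact: degx_le c | exact: degy_le c].
pose sig : {rmorphism R -> {poly R}} := subst (polyC \o kk : {rmorphism K -> {poly R}}) (xx%:P * 'X^B) (yy%:P * 'X^A).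
have sk c : sig (kk c) = (kk c)%:P by exact: subst_kk.
have sx : sig xx = xx%:P * 'X^B by exact: subst_xx.
have sy : sig yy = yy%:P * 'X^A by exact: subst_yy.
move: sig sk sx sy => sig sk sx sy.
have Fnil := jac_nilp f'K fk.
have [sF [d [z [q [d0 q0 cases]]]]] := jung_form char0 A0 B0 FAB (degx_ex F0) (degy_ex F0) Fnil sk sx sy.
have one0 : 1 != 0 :> K by rewrite oner_neq0.
(* [t] sends x to x + z y^q, hence x - z y^q to x. *)
pose t := mkE 1 1 0 (z *: 'X^q).
have Et : isE t by exact: mkE_isE.
have [_ _ tx ty] := mkE_form 0 (z *: 'X^q) one0 one0; rewrite -/t in tx ty.
have tk : kalg t by case: Et.
rewrite rmorph1 mul1r -mul_polyC rmorphM py_C rmorphXn py_X in tx.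
rewrite rmorph1 mul1r rmorph0 addr0 in ty.
case: cases => [[BE HE]|[AE HE]].
  apply: (tame_EN Et); apply: IH; last exact: kaut_comp (isE_kaut Et) fa.
  have c1 : sig (t xx) = map_poly t (sig xx).
    rewrite tx rmorphD rmorphM rmorphXn sk sx sy rmorphM /= map_polyC map_polyXn /= tx polyCD polyCM polyC_exp.
    by rewrite exprMn -exprM mulnC -BE mulrDl mulrA.
  have c2 : sig (t yy) = map_poly t (sig yy).
    by rewrite ty sy rmorphM /= map_polyC map_polyXn /= ty.
  have wt i j : cf (t F) i j != 0 -> (i <= A)%N /\ (j < B)%N.
    move=> /(tau_wt sk sx sy sF tk c1 c2) [lt|].
      by have [/ltnW] := weight_lt lt.
    rewrite HE rmorphM tk rmorphXn rmorphB tx rmorphM tk rmorphXn ty addrK.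
    rewrite -[xx ^+ A]mulr1 -(expr0 yy) cfZ cf_mon; case: (i =P A) => [->|]; rewrite ?mulr0 ?eqxx //.
    by case: (j =P 0%N) => [->|]; rewrite ?mulr0 ?eqxx.
  have tF0 : t F != 0.
    by have [_ [t' [_ tK _]]] := isE_kaut Et; rewrite -(rmorph0 t) (inj_eq (can_inj tK)).
  have [i /wt [_ h1]] := degy_ex tF0; have [j /wt [h2 _]] := degx_ex tF0.
  exact: add_lt h2 h1 le.
(* The same map with the coordinates exchanged, sending y - z x^q to y. *)
pose t' : morph := pif \o (t \o pif).
have t'a : kaut t' by apply: kaut_comp pif_kaut _; apply: kaut_comp (isE_kaut Et) pif_kaut.
have t'k : kalg t' by case: t'a.
have t'x : t' xx = xx by rewrite /t' /= pif_xx ty pif_yy.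
have t'y : t' yy = yy + kk z * xx ^+ q.
  by rewrite /t' /= pif_yy tx rmorphD rmorphM pif_kalg rmorphXn pif_xx pif_yy.
suff: tame (t' \o f).
  move=> h; apply/tame_piN/(tame_EN Et)/tame_piN; apply: tame_ext h => r /=.
  by [].
clearbody t'; apply: IH; last exact: kaut_comp t'a fa.
have c1 : sig (t' yy) = map_poly t' (sig yy).
  rewrite t'y rmorphD rmorphM rmorphXn sk sx sy rmorphM /= map_polyC map_polyXn /= t'y polyCD polyCM polyC_exp.
  by rewrite exprMn -exprM mulnC -AE mulrDl mulrA.
have c2 : sig (t' xx) = map_poly t' (sig xx).
  by rewrite t'x sx rmorphM /= map_polyC map_polyXn /= t'x.
have wt i j : cf (t' F) i j != 0 -> (i < A)%N /\ (j <= B)%N.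
  move=> /(tau_wt sk sx sy sF t'k c2 c1) [lt|].
    by have [? /ltnW] := weight_lt lt.
  rewrite HE rmorphM t'k rmorphXn rmorphB t'y rmorphM t'k rmorphXn t'x addrK.
  rewrite -[yy ^+ B]mul1r -(expr0 xx) cfZ cf_mon; case: (i =P 0%N) => [->|]; rewrite ?mulr0 ?eqxx //.
  by case: (j =P B) => [->|]; rewrite ?mulr0 ?eqxx.
have tF0 : t' F != 0.
  by have [_ [t'' [_ tK _]]] := t'a; rewrite -(rmorph0 t') (inj_eq (can_inj tK)).
have [i /wt [_ h1]] := degy_ex tF0; have [j /wt [h2 _]] := degx_ex tF0.
by rewrite addnC; apply: (add_lt h1 h2); rewrite addnC.
Qed.
End Tame.

(** * Conjugation to a reduced word *)

Section Words.
#[local] Opaque kk py px ksubst mkE pif.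
Variable K : closedFieldType.
Local Notation R := {poly {poly K}}.
Local Notation kk := (kk K).
Local Notation xx := (xx K).
Local Notation yy := (yy K).
Local Notation pif := (pif K).
Local Notation py := (py K).
Local Notation morph := {rmorphism R -> R}.
Implicit Types (f g : morph) (p : {poly K}).

Definition cj f g := exists b b' : morph, [/\ kalg b, cancel b b', cancel b' b & forall r, f (b r) = b (g r)].

Lemma cj_ext f g : f =1 g -> cj f g.
Proof. by move=> e; exists idfun, idfun; split. Qed.
Lemma cj_trans f g h : cj f g -> cj g h -> cj f h.
Proof.
move=> [b [b' [bk bK b'K e]]] [c [c' [ck cK c'K e']]]; exists (b \o c), (c' \o b'); split.
- exact: kalg_comp.
- by move=> r /=; rewrite bK cK.
- by move=> r /=; rewrite c'K b'K.
- by move=> r /=; rewrite e e'.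
Qed.
Lemma cj_swap f g (h h' : morph) : kaut f -> (forall r, h r = f (g r)) -> (forall r, h' r = g (f r)) -> cj h h'.
Proof.
by move=> [fk [f' [f'k fK f'K]]] hE h'E; exists f, f'; split=> // r; rewrite hE h'E.
Qed.

(** The size condition says that p has degree at least 2: composed with the swap, e is a generalised
    Henon map. *)
Definition isH e := kalg e /\ exists l m c p, eform e l m c p /\ (2 < size p)%N.

Lemma py_lin p : (size p <= 2)%N -> py p = kk p`_1 * yy + kk p`_0.
Proof.
move=> sp; have {1}-> : p = (p`_1)%:P * 'X + (p`_0)%:P.
  apply/polyP => -[|[|i]]; rewrite coefD coefCM coefX coefC /= ?mulr0 ?mulr1 ?add0r ?addr0 //.
  by rewrite nth_default //; apply: leq_trans sp _.
by rewrite rmorphD rmorphM !py_C py_X.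
Qed.

Lemma isE_lin f l m c h d : kalg f -> l != 0 -> m != 0 -> f xx = kk l * xx + (kk h * yy + kk d) ->
  f yy = kk m * yy + kk c -> isE f.
Proof.
move=> fk l0 m0 fx fy; split=> //; exists l, m, c, (h%:P * 'X + d%:P); split=> //.
by rewrite fx rmorphD rmorphM !py_C py_X.
Qed.

(** Bruhat decomposition of an affine map: conjugated by the swap it is lower triangular, and either
    diagonal (h = 0) or in the big cell. *)
Lemma bruhat e : isE e -> ~ isH e ->
  (exists2 e', isE e' & forall r, pif (e (pif r)) = e' r) \/
  (exists e' e'', [/\ isE e', isE e'' & forall r, pif (e (pif r)) = e' (pif (e'' r))]).
Proof.
move=> [ek [l [m [c [p [l0 m0 ex ey]]]]]] nH.
have sp : (size p <= 2)%N.
  by rewrite leqNgt; apply/negP => sp; apply: nH; split=> //; exists l, m, c, p; split.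
rewrite (py_lin sp) in ex; move: p`_1 p`_0 ex => h d ex {sp nH}.
have pk := @pif_kalg K; pose pep : morph := pif \o (e \o pif).
have pepk : kalg pep by do 2?apply: kalg_comp.
have px' : pep xx = kk m * xx + kk c by rewrite /pep /= pif_xx ey rmorphD rmorphM !pk pif_yy.
have py' : pep yy = kk l * yy + kk h * xx + kk d.
  by rewrite /pep /= pif_yy ex !rmorphD !rmorphM !pk pif_yy pif_xx addrA.
case: (eqVneq h 0) => [h0|h0].
  left; exists pep => //; apply: (@isE_lin _ m l d 0 c) => //.
    by rewrite px' rmorph0 mul0r add0r.
  by rewrite py' h0 rmorph0 mul0r addr0.
right; pose e' := mkE 1 1 0 ((l / h)%:P * 'X).
pose e'' := mkE (- (m * l / h)) h d (m%:P * 'X + c%:P).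
have o0 : 1 != 0 :> K by rewrite oner_neq0.
have n0 : - (m * l / h) != 0 by rewrite oppr_eq0 !mulf_neq0 // invr_eq0.
have [_ _ x1 y1] := mkE_form 0 ((l / h)%:P * 'X) o0 o0; rewrite -/e' in x1 y1.
have [_ _ x2 y2] := mkE_form d (m%:P * 'X + c%:P) n0 h0; rewrite -/e'' in x2 y2.
have [E1 E2] : isE e' /\ isE e'' by split; exact: mkE_isE.
have [k1 k2] : kalg e' /\ kalg e'' by split; [case: E1 | case: E2].
exists e', e''; split=> // r.
apply: (@kalg_ext K pep (e' \o (pif \o e''))) => //; first by do 2?apply: kalg_comp.
  rewrite px' /= x2 !rmorphD !rmorphM !py_C py_X !pk !k1 pif_xx pif_yy y1 x1 rmorphM py_C py_X.
  rewrite rmorph1 rmorph0 !mul1r addr0 mulrDr !rmorphN !rmorphM; ring.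
rewrite py' /= y2 rmorphD rmorphM !pk rmorphD rmorphM !k1 pif_yy x1 rmorphM py_C py_X rmorph1 mul1r.
have hl : kk h * kk (l / h) = kk l by rewrite -rmorphM mulrC divfK.
rewrite mulrDr mulrA hl; ring.
Qed.

(** The swap times an affine elementary map is affine; over an algebraically closed field its linear
    part has an eigenvector, so it can be triangularised. *)
Lemma affine_conj e (h : morph) : isE e -> ~ isH e -> (forall r, h r = pif (e r)) ->
  exists2 g, cj h g & isE g.
Proof.
move=> [ek [l [m [c [p [l0 m0 ex ey]]]]]] nH hE.
have sp : (size p <= 2)%N.
  by rewrite leqNgt; apply/negP => sp; apply: nH; split=> //; exists l, m, c, p; split.
rewrite (py_lin sp) in ex; move: p`_1 p`_0 ex => n d ex {sp nH}.
have pk := @pif_kalg K.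
have hk : kalg h by move=> u; rewrite hE ek pk.
have hx : h xx = kk l * yy + kk n * xx + kk d by rewrite hE ex !rmorphD !rmorphM !pk pif_xx pif_yy addrA.
have hy : h yy = kk m * xx + kk c by rewrite hE ey rmorphD rmorphM !pk pif_yy.
have [rr] : exists r, root ('X^2 - n *: 'X - (m * l)%:P) r.
  apply/closed_rootP; suff -> : size ('X^2 - n *: 'X - (m * l)%:P) = 3 by [].
  rewrite -addrA size_polyDl ?size_polyXn // -opprD size_polyN.
  apply: leq_ltn_trans (size_polyD _ _) _; rewrite gtn_max; apply/andP; split.
    by apply: leq_ltn_trans (size_scale_leq _ _) _; rewrite size_polyX.
  exact: leq_ltn_trans (size_polyC_leq1 _) _.
rewrite rootE !hornerE => /eqP re.
have r0 : rr != 0.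
  apply: contra_eq_neq re => ->; rewrite expr0n /= mulr0 subr0 sub0r oppr_eq0.
  by rewrite mulf_neq0.
have nr : n - rr = - (m * l / rr).
  apply: (mulIf r0); rewrite mulNr divfK //; apply/eqP; rewrite -subr_eq0 opprK -[X in _ == X]oppr0 -re.
  by apply/eqP; ring.
(* By the equation for [rr], the form rr x + l y is multiplied by [rr] under the linear part of h;
   it becomes the new y. *)
pose b := ksubst xx (kk rr * xx + kk l * yy).
pose b' := ksubst xx (kk l^-1 * (yy - kk rr * xx)).
have bk : kalg b by exact: ksubst_kalg.
have b'k : kalg b' by exact: ksubst_kalg.
have [bx b_y] : b xx = xx /\ b yy = kk rr * xx + kk l * yy by rewrite /b ksubst_xx ksubst_yy.
have [b'x b'y] : b' xx = xx /\ b' yy = kk l^-1 * (yy - kk rr * xx) by rewrite /b' ksubst_xx ksubst_yy.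
have lK : kk l^-1 * kk l = 1 by exact: kkV.
have bK : cancel b b'.
  apply: mutual_can => //; rewrite ?bx ?b'x // b_y rmorphD !rmorphM !b'k b'x b'y mulrA.
  by rewrite [kk l * _]mulrC lK mul1r addrC subrK.
have b'K : cancel b' b.
  apply: mutual_can => //; rewrite ?b'x ?bx // b'y rmorphM rmorphB rmorphM !bk bx b_y addrC addKr.
  by rewrite mulrA lK mul1r.
pose g : morph := b' \o (h \o b).
exists g; first by exists b, b'; split=> // r; rewrite /g /= b'K.
apply: (@isE_lin _ (n - rr) rr (rr * d + l * c) 1 d); rewrite ?r0 //.
- by do 2?apply: kalg_comp.
- by rewrite nr oppr_eq0 !mulf_neq0 // invr_eq0.
- rewrite /g /= bx hx !rmorphD !rmorphM !b'k b'x b'y mulrA [kk l * _]mulrC lK rmorph1 !mul1r rmorphN; ring.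
- have e2 : rr ^+ 2 = n * rr + m * l by apply/eqP; rewrite -subr_eq0 opprD addrA; apply/eqP.
  have -> : kk (rr * d + l * c) = kk rr * kk d + kk l * kk c by rewrite rmorphD !rmorphM.
  rewrite /g /= b_y rmorphD !rmorphM !hk hx hy !rmorphD !rmorphM !b'k !rmorphD !rmorphM !b'k b'x b'y.
  have -> : kk rr * (kk l * (kk l^-1 * (yy - kk rr * xx)) + kk n * xx + kk d) =
     (kk l^-1 * kk l) * (kk rr * yy - kk (rr ^+ 2) * xx) + kk (n * rr) * xx + kk rr * kk d.
    by rewrite rmorphXn rmorphM; ring.
  by rewrite lK e2 rmorphD !rmorphM; ring.
Qed.

Lemma W_rE (l : seq morph) (e : morph) : l <> [::] -> allE l -> isE e -> exists l' : seq morph, [/\ size l' = size l, allE l' & forall r, W l (e r) = W l' r].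
Proof.
case/lastP: l => // l e4 _; rewrite -cats1 => /allE_cat [El E4] Ee; exists (l ++ [:: (e4 \o e : morph)]).
split; first by rewrite !size_cat.
  apply/allE_cat; split=> //; apply: allE_cons => //; apply: isE_comp => //; exact: (E4 0%N).
by move=> r; rewrite !W_cat.
Qed.

Definition normal f := exists g, cj f g /\ (isE g \/ exists l : seq morph, [/\ l <> [::], forall i, (i < size l)%N -> isH (nth (idfun : morph) l i) & g =1 W l]).

Lemma normal_cj f g : cj f g -> normal g -> normal f.
Proof. by move=> h [k [gk c]]; exists k; split=> //; exact: cj_trans gk. Qed.

(** A letter with p of degree at most 1 is rotated to the front by conjugation, and [bruhat] merges
    it with the next letter; the outer factor is moved to the other end by another conjugation. The
    word gets shorter each time. *)
Lemma word_normal N (l : seq morph) f : (size l <= N)%N -> allE l -> f =1 W l -> normal f.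
Proof.
elim: N l f => [|N IH] l f le El fE.
  exists f; split; first exact: cj_ext.
  left; have l0 : l = [::] by case: l le {El fE}.
  by have [k _] := isE_id K; split=> [c|]; rewrite ?fE ?l0 //; exists 1, 1, 0, 0; rewrite /eform !fE l0 oner_neq0 !rmorph1 !rmorph0 !mul1r !addr0.
case: (pselect (forall i, (i < size l)%N -> isH (nth (idfun : morph) l i))) => [aH|].
  case: (pselect (l = [::])) => [l0|nl]; first by apply: (IH l) => //; rewrite l0.
  by exists f; split; [exact: cj_ext | right; exists l].
move=> nH; have [i [lt nHi]] : exists i, (i < size l)%N /\ ~ isH (nth (idfun : morph) l i).
  by apply: contrapT => h; apply: nH => i lt; apply: contrapT => hh; apply: h; exists i.
have El' := El; set e := nth _ l i in nHi.
have lE : l = take i l ++ e :: drop i.+1 l by rewrite -drop_nth // cat_take_drop.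
have Ee : isE e by exact: El.
move: (take i l) (drop i.+1 l) lE => l1 l2 lE; rewrite lE in El le.
have {El} [El1 El2] := (allE_cat _ _).1 El.
have {}El2 : allE l2 by move=> k; exact: (El2 k.+1).
have s12 : (size (l2 ++ l1) <= N)%N by move: le; rewrite !size_cat /=; lia.
have El21 : allE (l2 ++ l1) by apply/allE_cat.
pose h : morph := pif \o (e \o W (l2 ++ l1)).
have fh : cj f h.
  apply: (@cj_swap (W l1) (pif \o (e \o W l2))); first exact: W_kaut.
    by move=> r; rewrite fE lE W_cat.
  by move=> r; rewrite /h /= W_cat.
apply: (normal_cj fh); move: (l2 ++ l1) s12 El21 @h {fh} => l3 s3 El3 h.
case: l3 s3 El3 @h => [|e1 l3] s3 El3 h.
  by have [g hg Eg] := @affine_conj e h Ee nHi (fun r => erefl); exists g; split=> //; left.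
have E1 : isE e1 by exact: (El3 0%N).
have {}El3 : allE l3 by move=> k; exact: (El3 k.+1).
have [[e' E' pE]|[e' [e'' [E' E'' pE]]]] := bruhat Ee nHi.
  have ek : isE (e' \o e1) by exact: isE_comp.
  apply: (@normal_cj _ (W l3 \o (e' \o e1))).
    apply: (@cj_swap (e' \o e1) (W l3)) => [|r|r]; [exact: isE_kaut | exact: (pE (e1 (W l3 r))) | by []].
  case: (pselect (l3 = [::])) => [->|nl].
    exists (e' \o e1); split; last by left.
    by apply: cj_ext => r.
  have [l4 [s4 E4 lE4]] := W_rE nl El3 ek.
  by apply: (IH l4) => //; rewrite s4; move: s3 => /=; lia.
apply: (@normal_cj _ (W ((e'' \o e1 : morph) :: l3) \o e')).
  apply: (@cj_swap e' (W ((e'' \o e1 : morph) :: l3))) => [|r|r]; [exact: isE_kaut | exact: (pE (e1 (W l3 r))) | by []].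
have [||l4 [s4 E4 lE4]] := @W_rE ((e'' \o e1 : morph) :: l3) e' _ _ E'; first by [].
  by apply: allE_cons => //; exact: isE_comp.
by apply: (IH l4) => //; rewrite s4; move: s3 => /=; lia.
Qed.

Lemma tame_normal f : tame f -> normal f.
Proof.
move=> [e0 [l [E0 El fE]]].
apply: (@normal_cj _ (W l \o e0)); first by apply: (@cj_swap e0 (W l)) => //; exact: isE_kaut.
case: (pselect (l = [::])) => [->|nl].
  by exists e0; split; [apply: cj_ext | left].
by have [l4 [s4 E4 lE4]] := W_rE nl El E0; apply: (word_normal (leqnn (size l4))).
Qed.
End Words.

(** * Products of Henon maps have no invariant curve *)

Lemma coef_exp_lin (A : comNzRingType) (a b : A) i r :
  ((b%:P * 'X + a%:P) ^+ i)`_r = (b ^+ r * a ^+ (i - r)) *+ 'C(i, r).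
Proof.
elim: i r => [|i IH] r.
  by rewrite expr0 coef1; case: r => [|r]; rewrite ?bin0n /= ?mulr0n // !expr0 mulr1.
rewrite exprS mulrDl coefD -mulrA coefCM coefXM coefCM !IH.
case: r => [|r]; first by rewrite /= mulr0 add0r !bin0 !subn0 !mulr1n !expr0 !mul1r exprS.
rewrite /= binS mulrnDr addrC subSS; congr (_ + _).
  case: (ltnP r i) => [lt|le]; last by rewrite bin_small // !mulr0n mulr0.
  by rewrite mulrnAr mulrCA -exprS -subSn // subSS.
by rewrite mulrnAr mulrA -exprS.
Qed.

Lemma comp_poly_wide (A : comNzRingType) (p q : {poly A}) N : (size p <= N)%N ->
  p \Po q = \sum_(j < N) p`_j *: q ^+ j.
Proof.
move=> le; rewrite comp_polyE (big_ord_widen N (fun j => p`_j *: q ^+ j) le) big_mkcond.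
by apply: eq_bigr => j _; case: ltnP => // h; rewrite nth_default // scale0r.
Qed.

Section Henon.
Variable K : closedFieldType.
Local Notation R := {poly {poly K}}.
Local Notation kk := (kk K).
Local Notation xx := (xx K).
Local Notation yy := (yy K).
Local Notation morph := {rmorphism R -> R}.
Implicit Types f : R.

(** The y-degree of the coefficient of the highest power of x; [lyd] is its mirror image. *)
Definition lxd f := (size (lead_coef (swapXY f))).-1.
Definition lyd f := (size (lead_coef f)).-1.

Lemma fexp N f : (forall i j, cf f i j != 0 -> (i < N)%N && (j < N)%N) ->
  f = \sum_(j < N) \sum_(i < N) kk (cf f i j) * (xx ^+ i * yy ^+ j).
Proof.
move=> fN; apply: cfP => a b; rewrite cf_sum.
under eq_bigr => j _ do (rewrite cf_sum; under eq_bigr => i _ do rewrite cfZ cf_mon).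
case: (eqVneq (cf f a b) 0) => [c0|/fN /andP [ltA ltB]].
  rewrite c0 big1 // => j _; rewrite big1 // => i _.
  case: eqP => [<-|]; rewrite ?mulr0 //; case: eqP => [<-|]; rewrite ?mulr0 //.
  by rewrite c0 mul0r.
rewrite (bigD1 (Ordinal ltB)) //= (bigD1 (Ordinal ltA)) //= !eqxx mulr1.
rewrite big1 ?addr0 ?big1 ?addr0 // => [j nj|i ni].
  by rewrite big1 // => i _; rewrite [b == _]eq_sym (negPf (nj : (j : nat) != b)) andbF mulr0.
by rewrite [a == _]eq_sym (negPf (ni : (i : nat) != a)) mulr0.
Qed.

Section Step.
Variables (e : morph) (l m c : K) (p : {poly K}) (d : nat).
Hypothesis ek : kalg e.
Hypotheses (l0 : l != 0) (m0 : m != 0) (ex : e xx = kk l * xx + py K p) (ey : e yy = kk m * yy + kk c).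
Hypotheses (sp : size p = d.+1) (d2 : (2 <= d)%N).
Variable f : R.
Hypothesis f0 : f != 0.
Let g := pif K (e f).
Let v := m *: 'X + c%:P : {poly K}.

Lemma g_coef N r : (forall i j, cf f i j != 0 -> (i < N)%N && (j < N)%N) ->
  g`_r = \sum_(j < N) \sum_(i < N) (cf f i j * l ^+ r *+ 'C(i, r)) *: (p ^+ (i - r) * v ^+ j).
Proof.
move=> fN; rewrite /g {1}(fexp fN).
have gx : pif K (e xx) = (l%:P)%:P * 'X + p%:P.
  by rewrite ex rmorphD rmorphM pif_kalg pif_xx pif_py.
have gy : pif K (e yy) = v%:P.
  by rewrite ey rmorphD rmorphM !pif_kalg pif_yy /v polyCD -mul_polyC polyCM.
rewrite rmorph_sum rmorph_sum coef_sum; apply: eq_bigr => j _.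
rewrite rmorph_sum rmorph_sum coef_sum; apply: eq_bigr => i _.
rewrite !rmorphM !rmorphXn ek pif_kalg gx gy -polyC_exp [kk _]/((cf f i j)%:P%:P).
rewrite coefCM coefMC coef_exp_lin -polyC_exp -mul_polyC polyCMn polyCM.
by rewrite !mulrnAl mulrnAr !mulrA.
Qed.

Let D := degx f.
Let N := (degx f + degy f).+1.

Lemma fN : forall i j, cf f i j != 0 -> (i < N)%N && (j < N)%N.
Proof.
move=> i j cij; have := degx_le cij; have := degy_le cij; rewrite /N.
by move: (degx f) (degy f) => a b; lia.
Qed.

Lemma size_v : size v = 2%N.
Proof. by rewrite /v size_polyDl size_scale // size_polyX // ltnS size_polyC_leq1. Qed.

Lemma g_lead : size g = D.+1 /\ g`_D = l ^+ D *: (lead_coef (swapXY f) \Po v).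
Proof.
have gr r : (D < r)%N -> g`_r = 0.
  move=> lt; rewrite (g_coef _ fN) big1 // => j _; rewrite big1 // => i _.
  case: (eqVneq (cf f i j) 0) => [->|/degx_le le]; first by rewrite mul0r mul0rn scale0r.
  by rewrite bin_small ?mulr0n ?scale0r //; apply: leq_ltn_trans le lt.
have gD : g`_D = l ^+ D *: (lead_coef (swapXY f) \Po v).
  have lE j : (lead_coef (swapXY f))`_j = cf f D j.
    by rewrite lead_coefE -[RHS]cf_swap.
  rewrite (g_coef _ fN) (@comp_poly_wide _ _ _ N); last first.
    apply/leq_sizeP => j le; rewrite lE; apply/eqP/negPn/negP => /fN /andP [_].
    by rewrite ltnNge le.
  rewrite scaler_sumr; apply: eq_bigr => j _; rewrite lE.
  have lt : (D < N)%N by rewrite /N ltnS leq_addr.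
  rewrite (bigD1 (Ordinal lt)) //= binn subnn expr0 mul1r mulr1n [cf f D j * _]mulrC scalerA big1 ?addr0 //.
  move=> i ni; case: (eqVneq (cf f i j) 0) => [->|/degx_le le]; first by rewrite mul0r mul0rn scale0r.
  rewrite bin_small ?mulr0n ?scale0r // ltn_neqAle; apply/andP; split; last exact: le.
  by apply: contra ni => /eqP e'; apply/eqP/val_inj.
split=> //; apply/eqP; rewrite eqn_leq; apply/andP; split; first exact/leq_sizeP.
rewrite ltnNge; apply/negP => /leq_sizeP /(_ D (leqnn D)); rewrite gD => /eqP.
rewrite scale_poly_eq0 expf_eq0 (negPf l0) andbF /= comp_poly_eq0 ?size_v //.
by rewrite lead_coef_eq0 swapXY_eq0 (negPf f0).
Qed.

Lemma g_degy : degy g = degx f.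
Proof. by rewrite /degy (proj1 g_lead). Qed.

Lemma g_lyd : lyd g = lxd f.
Proof.
have [sg gD] := g_lead; rewrite /lyd lead_coefE sg /= gD size_scale ?expf_neq0 //.
by rewrite size_comp_poly2 // size_v.
Qed.

Lemma coef_top (a b : {poly K}) A B : (size a <= A.+1)%N -> (size b <= B.+1)%N ->
  (size (a * b)%R <= (A + B).+1)%N /\ (a * b)`_(A + B) = a`_A * b`_B.
Proof.
move=> su sv; split; first by apply: leq_trans (size_polyMleq a b) _; lia.
have lt : (A < (A + B).+1)%N by rewrite ltnS leq_addr.
rewrite coefM (bigD1 (Ordinal lt)) //= addKn big1 ?addr0 // => i ni.
case: (ltngtP i A) => [lti|gti|e'].
- by rewrite [b`__]nth_default ?mulr0 //; apply: leq_trans sv _; lia.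
- by rewrite [a`__]nth_default ?mul0r //; apply: leq_trans su _; lia.
- by case/eqP: ni; apply: val_inj.
Qed.

Lemma coef_pow (a : {poly K}) A n : (size a <= A.+1)%N ->
  (size (a ^+ n)%R <= (A * n).+1)%N /\ (a ^+ n)`_(A * n) = a`_A ^+ n.
Proof.
move=> sa; elim: n => [|n [IH1 IH2]]; first by rewrite muln0 !expr0 size_poly1 coef1.
by rewrite !exprS mulnS -IH2; exact: coef_top.
Qed.

Section Delta.
Variable dl : nat.
Hypothesis dl_max : forall i j, cf f i j != 0 -> (d * i + j <= dl)%N.
(** The component of weight [dl] of f, for the weights d of x and 1 of y, dehomogenised. *)
Let phi := \poly_(i < N) (if (d * i <= dl)%N then cf f i (dl - d * i) else 0).
Let xi := p`_d / m ^+ d.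

Lemma phi_coef i : phi`_i = if (d * i <= dl)%N then cf f i (dl - d * i) else 0.
Proof.
rewrite coef_poly; case: ltnP => // le; case: ifP => // _.
by apply/esym/eqP/negPn/negP => /fN /andP [lt _]; rewrite ltnNge le in lt.
Qed.

Lemma term_coef i j r : cf f i j != 0 -> (r <= i)%N -> (d * r <= dl)%N ->
  (p ^+ (i - r) * v ^+ j)`_(dl - d * r) =
  if (d * i + j == dl)%N then xi ^+ (i - r) * m ^+ (dl - d * r) else 0.
Proof.
move=> cij ri dr; have le := dl_max cij.
have [s1 c1] := coef_pow (i - r) (eq_leq sp).
have [s2 c2] := coef_pow j (eq_leq size_v); rewrite mul1n in s2 c2.
have [s3 c3] := coef_top s1 s2.
have dri : (d * (i - r) = d * i - d * r)%N by rewrite mulnBr.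
have rle : (d * r <= d * i)%N by rewrite leq_mul2l ri orbT.
case: eqP => [E|NE].
  have -> : (dl - d * r = d * (i - r) + j)%N by move: E rle dri; lia.
  have v1 : v`_1 = m by rewrite /v coefD coefZ coefX coefC mulr1 addr0.
  rewrite c3 c1 c2 v1 exprD exprM mulrA -exprMn_comm; last exact: mulrC.
  by rewrite /xi divfK // expf_neq0.
by rewrite nth_default //; apply: leq_trans s3 _; move: NE le rle dri; lia.
Qed.

(** In top weight the step is x -> l y + p_d x^d, y -> m x, which on the dehomogenised form is
    translation by [xi], up to scalars. *)
Lemma g_cf r : (d * r <= dl)%N -> cf g (dl - d * r) r = l ^+ r * m ^+ (dl - d * r) * (phi \Po ('X + xi%:P))`_r.
Proof.
move=> dr; rewrite /cf (g_coef r fN) exchange_big coef_sum /= coef_comp_poly mulr_sumr.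
have -> : \sum_(i < size phi) l ^+ r * m ^+ (dl - d * r) * (phi`_i * (('X + xi%:P) ^+ i)`_r) =
   \sum_(i < N) l ^+ r * m ^+ (dl - d * r) * (phi`_i * (('X + xi%:P) ^+ i)`_r).
  rewrite (big_ord_widen N (fun i => l ^+ r * m ^+ (dl - d * r) * (phi`_i * (('X + xi%:P) ^+ i)`_r)) (size_poly _ _)).
  by rewrite big_mkcond; apply: eq_bigr => i _; case: ltnP => // h; rewrite nth_default // mul0r mulr0.
apply: eq_bigr => i _; rewrite coef_sum.
have -> : (('X + xi%:P) ^+ i)`_r = xi ^+ (i - r) *+ 'C(i, r).
  by have := coef_exp_lin xi 1 i r; rewrite polyC1 mul1r expr1n mul1r.
under eq_bigr => j _ do rewrite coefZ.
case: (ltnP i r) => [lt|ri].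
  by rewrite bin_small // mulr0n !mulr0 big1 // => j _; rewrite mulr0n mul0r.
rewrite phi_coef; case: ifP => [di|ndi]; last first.
  rewrite mul0r mulr0 big1 // => j _.
  case: (eqVneq (cf f i j) 0) => [->|cij]; first by rewrite mul0r mul0rn mul0r.
  by have := dl_max cij; move: ndi; case: leqP => //; lia.
case: (eqVneq (cf f i (dl - d * i)) 0) => [z|nz].
  rewrite z mul0r mulr0 big1 // => j _.
  case: (eqVneq (cf f i j) 0) => [->|cij]; first by rewrite mul0r mul0rn mul0r.
  rewrite term_coef //; case: eqP => [E|]; rewrite ?mulr0 //.
  by case/eqP: cij; rewrite -z -E addKn.
have /andP [_ jN] := fN nz.
rewrite (bigD1 (Ordinal jN)) //= term_coef // subnKC // eqxx big1 ?addr0.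
  rewrite mulrnAl !mulrnAr; congr (_ *+ _).
  by move: (cf f i _) (l ^+ r) (xi ^+ _) (m ^+ _) => A1 A2 A3 A4; ring.
move=> j nj; case: (eqVneq (cf f i j) 0) => [->|cij]; first by rewrite mul0r mul0rn mul0r.
rewrite term_coef //; case: eqP => [E|]; rewrite ?mulr0 //.
by case/eqP: nj; apply: val_inj; rewrite /= -E addKn.
Qed.
End Delta.

(** Let r0 and r be the orders of vanishing of phi at 0 and at the non-zero point xi, so r0 + r <=
    degx f. The surviving monomials give degy f >= dl - d r0 and degx g >= dl - d r, while dl >= d
    degx f + lxd f; adding up yields the first bound. *)
Lemma henon_ineq : (2 * degx f + 2 * lxd f <= degy f + degx g)%N /\
  (lyd f = 0%N -> (degy f <= degx f)%N -> (0 < degx f)%N -> (2 * degx f + 2 * lxd f < degy f + degx g)%N).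
Proof.
have [||dl /asboolP [i1 [j1 [c1 E1]]] dlm] := @ex_maxnP (fun k => `[< exists i j, cf f i j != 0 /\ (d * i + j = k)%N >]) (d * N + N).
- by have [j cj] := degx_ex f0; exists (d * degx f + j)%N; apply/asboolP; exists (degx f), j.
- move=> k /asboolP [i [j [/fN /andP [/ltnW li /ltnW lj] <-]]].
  by apply: leq_add => //; rewrite leq_mul2l li orbT.
have dl_max i j : cf f i j != 0 -> (d * i + j <= dl)%N.
  by move=> cij; apply: dlm; apply/asboolP; exists i, j.
pose phi := \poly_(i < N) (if (d * i <= dl)%N then cf f i (dl - d * i) else 0).
have phiE i : phi`_i = if (d * i <= dl)%N then cf f i (dl - d * i) else 0 by exact: phi_coef.
pose xi := p`_d / m ^+ d.
have pd : p`_d != 0.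
  have : lead_coef p != 0 by rewrite lead_coef_eq0 -size_poly_eq0 sp.
  by rewrite lead_coefE sp.
have xi0 : xi != 0 by rewrite mulf_neq0 // invr_eq0 expf_neq0.
have phi1 : phi`_i1 != 0 by rewrite phiE -E1 leq_addr addKn.
have phi0 : phi != 0 by apply: contraNneq phi1 => ->; rewrite coef0.
have sphi : (0 < size phi)%N by rewrite size_poly_gt0.
have top : phi`_(size phi).-1 != 0 by rewrite -lead_coefE lead_coef_eq0.
have [topd topD] : (d * (size phi).-1 <= dl)%N /\ ((size phi).-1 <= degx f)%N.
  by move: top; rewrite phiE; case: ifP => [h /degx_le|_]; rewrite ?eqxx.
have [r [q]] := multiplicity_XsubC phi xi; rewrite phi0 /= => qr phiq.
have [|r0 r0n r0min] := @ex_minnP (fun i => phi`_i != 0); first by exists i1.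
have sum_r : (r0 + r <= (size phi).-1)%N.
  have dv1 : 'X^r0 %| phi.
    have -> : phi = \sum_(i < size phi) phi`_i *: 'X^i by rewrite -poly_def coefK.
    elim/big_ind: _ => [|a b|i _]; [exact: dvdp0 | exact: dvdp_add |].
    case: (leqP r0 i) => [le|lt]; first by rewrite -mul_polyC dvdp_mull // dvdp_exp2l.
    by have : phi`_i == 0; [apply: contraTT lt => /r0min; rewrite -leqNgt | move/eqP->; rewrite scale0r dvdp0].
  have dv2 : ('X - xi%:P) ^+ r %| phi by rewrite phiq dvdp_mull.
  have : 'X^r0 * ('X - xi%:P) ^+ r %| phi.
    rewrite Gauss_dvdp ?dv1 // coprimep_expl // coprimep_expr // coprimep_XsubC rootE hornerX //.
  move/(dvdp_leq phi0); rewrite size_mul ?expf_neq0 ?polyX_eq0 ?polyXsubC_eq0 //.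
  rewrite size_polyXn size_exp_XsubC addSn addnS /= => h; rewrite -ltnS prednK //.
have drl : (d * r <= dl)%N.
  by apply: leq_trans topd; rewrite leq_mul2l; apply/orP; right; apply: leq_trans sum_r; exact: leq_addl.
have gne : cf g (dl - d * r) r != 0.
  rewrite (g_cf dl_max drl) !mulf_neq0 ?expf_neq0 // -/phi -/xi phiq comp_polyM.
  have -> : ('X - xi%:P) ^+ r \Po ('X + xi%:P) = 'X^r.
    by rewrite rmorphXn /= comp_polyB comp_polyX comp_polyC addrK.
  rewrite coefMXn ltnn subnn -horner_coef0 horner_comp !hornerE.
  exact: qr.
have h1 := degx_le gne.
have [r0d cr0] : (d * r0 <= dl)%N /\ cf f r0 (dl - d * r0) != 0.
  by move: r0n; rewrite phiE; case: ifP; rewrite ?eqxx.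
have h2 := degy_le cr0.
have h3 : (d * degx f + lxd f <= dl)%N.
  apply: dl_max; rewrite -cf_swap /lxd /cf /degx -lead_coefE -lead_coefE !lead_coef_eq0 swapXY_eq0 //.
have h4 : (d * r0 + d * r <= d * degx f)%N.
  by rewrite -mulnDr leq_mul2l; apply/orP; right; apply: leq_trans topD.
have h5 : (2 * degx f <= d * degx f)%N by rewrite leq_mul2r d2 orbT.
split; first by clear -h1 h2 h3 h4 h5 drl r0d; lia.
move=> ly EX X0; have h6 : (dl - d * r0 < degy f)%N.
  rewrite ltn_neqAle h2 andbT; apply/eqP => E2.
  have r00 : r0 = 0%N.
    apply/eqP; rewrite -leqn0 -ly /lyd.
    have : (r0 < size (lead_coef f))%N; last by case: (size _).
    rewrite ltnNge; apply/negP => /leq_sizeP /(_ r0 (leqnn _)) z.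
    by move: cr0; rewrite E2 /cf /degy -lead_coefE z eqxx.
  by clear -E2 r00 h3 h5 EX X0; rewrite r00 in E2; lia.
by clear -h1 h6 h3 h4 h5 drl r0d; lia.
Qed.
End Step.

Lemma degx_kk a f : a != 0 -> degx (kk a * f) = degx f.
Proof.
move=> a0; case: (eqVneq f 0) => [->|f0]; first by rewrite mulr0.
have af0 : kk a * f != 0 by rewrite mulf_neq0 // kk_eq0.
have [j] := degx_ex f0; have [k] := degx_ex af0.
rewrite cfZ mulf_eq0 (negPf a0) => /degx_le h1 h2; apply/eqP; rewrite eqn_leq h1 /=.
by apply: (@degx_le _ _ _ j); rewrite cfZ mulf_neq0.
Qed.

(** * Degrees along the cyclic orbit of a semi-invariant *)

Section Chain.
Variables (l : seq morph) (f : R) (c : K).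
Hypothesis lH : forall i, (i < size l)%N -> isH (nth (idfun : morph) l i).
Hypotheses (l0 : l <> [::]) (f0 : f != 0) (c0 : c != 0) (fc : W l f = kk c * f).
Let k := size l.
Let en n : morph := nth (idfun : morph) (rev l) (n %% k).

Fixpoint orb n : R := if n is n'.+1 then pif K (en n' (orb n')) else f.

Lemma orbS n : orb n.+1 = pif K (en n (orb n)). Proof. by []. Qed.

Lemma k_gt0 : (0 < k)%N.
Proof. by rewrite /k; case: (l) l0. Qed.

Lemma enH n : isH (en n).
Proof.
have lt : (n %% k < k)%N by rewrite ltn_mod k_gt0.
by rewrite /en nth_rev //; apply: lH; rewrite -/k; lia.
Qed.

Lemma orb_drop j : (j <= k)%N -> orb j = W (drop (k - j) l) f.
Proof.
elim: j => [_|j IH lt]; first by rewrite subn0 drop_size.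
rewrite orbS IH 1?ltnW // /en modn_small // nth_rev // -/k.
have lt2 : (k - j.+1 < size l)%N by rewrite -/k; lia.
by rewrite (drop_nth (idfun : morph) lt2) (subnSK lt).
Qed.

Lemma orb_per n : orb (n + k) = kk c * orb n.
Proof.
elim: n => [|n IH]; first by rewrite add0n orb_drop // subnn drop0.
by rewrite addSn !orbS IH /en modnDr -/(en n) !rmorphM; have [-> _] := enH n; rewrite pif_kalg.
Qed.

Lemma orb_neq0 n : orb n != 0.
Proof.
elim: n => // n IH; rewrite orbS; have [_ [p' [_ pK _]]] := pif_kaut K.
have [ek [l' [m [d [p [ef _]]]]]] := enH n.
have [_ [e' [_ eK _]]] : kaut (en n) by apply: isE_kaut; split=> //; exists l', m, d, p.
by rewrite -(rmorph0 (pif K)) -(rmorph0 (en n)) (inj_eq (can_inj pK)) (inj_eq (can_inj eK)).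
Qed.

Lemma orb_step n : [/\ degy (orb n.+1) = degx (orb n), lyd (orb n.+1) = lxd (orb n),
  (2 * degx (orb n) + 2 * lxd (orb n) <= degy (orb n) + degx (orb n.+1))%N &
  lyd (orb n) = 0%N -> (degy (orb n) <= degx (orb n))%N -> (0 < degx (orb n))%N ->
    (2 * degx (orb n) + 2 * lxd (orb n) < degy (orb n) + degx (orb n.+1))%N].
Proof.
have [ek [l' [m [d [p [[h1 h2 h3 h4] sp]]]]]] := enH n.
have sp' : size p = (size p).-1.+1 by rewrite prednK //; apply: leq_ltn_trans sp.
have d2 : (2 <= (size p).-1)%N by move: sp; rewrite {1}sp'.
have [i1 i2] := henon_ineq ek h1 h2 h3 h4 sp' d2 (orb_neq0 n).
rewrite orbS; split; [|  | exact: i1 | exact: i2].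
  exact: (g_degy ek h1 h2 h3 h4 sp' d2 (orb_neq0 n)).
exact: (g_lyd ek h1 h2 h3 h4 sp' d2 (orb_neq0 n)).
Qed.

(** The x-degrees along the orbit are periodic; suppose their maximum M, reached at n + 1, is
    positive. The inequality there forces the next x-degree to be M too and [lxd] to be 0; the
    strict inequality one step later then exceeds M. *)
Lemma henon_const : degx f = 0%N /\ degy f = 0%N.
Proof.
pose D n := degx (orb n).
have Dper n : D (n + k)%N = D n by rewrite /D orb_per degx_kk.
have Dmod n : D n = D (n %% k)%N.
  rewrite {1}(divn_eq n k); elim: (n %/ k)%N => [|q IH]; first by rewrite mul0n add0n.
  by rewrite mulSn -addnA [(k + _)%N]addnC Dper.
have Dle n : (D n <= \max_(i < k) D i)%N.
  have lt : (n %% k < k)%N by rewrite ltn_mod k_gt0.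
  by rewrite Dmod; exact: (leq_bigmax (Ordinal lt)).
(* The maximum is taken over successors, so that the preceding index is available; periodicity makes
   it the maximum over all indices. *)
have [||M /asboolP [n Dn] Mmax] := @ex_maxnP (fun M => `[< exists n, D n.+1 = M >]) (\max_(i < k) D i).
- by exists (D 1%N); apply/asboolP; exists 0%N.
- by move=> M /asboolP [n <-].
have Dmax i : (D i <= M)%N.
  rewrite -Dper; have := k_gt0; case: k => // k' _; rewrite addnS.
  by apply: Mmax; apply/asboolP; exists (i + k')%N.
have [Y1 L1 _ _] := orb_step n; have [Y2 L2 I2 _] := orb_step n.+1; have [_ _ _ I3] := orb_step n.+2.
have X0 := Dmax n; have X2 := Dmax n.+2; have X3 := Dmax n.+3.
rewrite /D in Dn X0 X2 X3.
have M0 : M = 0%N.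
  apply/eqP/negPn/negP => M0.
  rewrite Y2 L2 Dn in I3; rewrite Y1 Dn in I2.
  have e1 : degx (orb n.+2) = M by clear -I2 X0 X2; lia.
  have e2 : lxd (orb n.+1) = 0%N by clear -I2 X0 X2; lia.
  have := I3 e2; rewrite e1 leqnn lt0n => /(_ isT M0); clear -X3; lia.
split; first by apply/eqP; rewrite -leqn0 -M0; exact: (Dmax 0%N).
have := orb_per 0; have := k_gt0; rewrite add0n.
case: k => // k' _ e; have [Y _ _ _] := orb_step k'.
have : degy (orb k'.+1) = 0%N by rewrite Y; apply/eqP; rewrite -leqn0 -M0; exact: (Dmax k').
rewrite e /= => dk; apply/eqP; rewrite -leqn0 -dk.
have [i ci] := degy_ex f0; apply: (@degy_le _ _ i).
by rewrite cfZ mulf_neq0.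
Qed.
End Chain.

Theorem henon_no_semi (l : seq morph) (f : R) c : l <> [::] ->
  (forall i, (i < size l)%N -> isH (nth (idfun : morph) l i)) -> f != 0 -> c != 0 ->
  W l f = kk c * f -> exists a, f = kk a.
Proof.
move=> l0 lH f0 c0 fc; have [dx0 dy0] := henon_const lH l0 f0 c0 fc.
exists (cf f 0 0); apply: cfP => i j; rewrite cf_kk.
case: ifP => [/andP [/eqP -> /eqP ->] //|h]; apply/eqP/negPn/negP => cij.
have := degx_le cij; have := degy_le cij; rewrite dx0 dy0 !leqn0 => /eqP j0 /eqP i0.
by rewrite i0 j0 eqxx in h.
Qed.
End Henon.

(** * Triangular normal forms *)

Section NormalForms.
#[local] Opaque kk py px ksubst mkE pif.
Variable K : closedFieldType.
Hypothesis char0 : forall n, n.+1%:R != 0 :> K.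
Local Notation R := {poly {poly K}}.
Local Notation kk := (kk K).
Local Notation xx := (xx K).
Local Notation yy := (yy K).
Local Notation py := (py K).
Local Notation morph := {rmorphism R -> R}.
Implicit Types (f g : morph) (p h : {poly K}).

Definition tri2 g := kalg g /\ exists l c, [/\ l != 0, c != 0, g xx = kk l * xx & g yy = yy + kk c].
Definition tri3 g := kalg g /\ exists l m p, [/\ l != 0, m != 0, forall i, p`_i != 0 -> l = m ^+ i,
  g xx = kk l * xx + py p & g yy = kk m * yy].

Lemma conj_h g l m c p h : kalg g -> eform g l m c p ->
  exists g1, [/\ cj g g1, kalg g1 & eform g1 l m c (p - l *: h + (h \Po (m *: 'X + c%:P)))].
Proof.
move=> gk [l0 m0 gx gy].
have o0 : 1 != 0 :> K by rewrite oner_neq0.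
pose b := mkE 1 1 0 h; pose b' := mkE 1 1 0 (- h).
have [_ _ bx b_y] := mkE_form 0 h o0 o0; have [_ _ b'x b'y] := mkE_form 0 (- h) o0 o0.
rewrite -/b -/b' in bx b_y b'x b'y.
have bk : kalg b by exact: ksubst_kalg.
have b'k : kalg b' by exact: ksubst_kalg.
have idp (q : {poly K}) : q \Po (1 *: 'X + 0%:P) = q by rewrite scale1r addr0 comp_polyXr.
have bp q : b (py q) = py q by rewrite (kalg_py q bk b_y) idp.
have b'p q : b' (py q) = py q by rewrite (kalg_py q b'k b'y) idp.
rewrite rmorph1 !mul1r ?rmorph0 ?addr0 in bx b_y b'x b'y.
have bK : cancel b b'.
  by apply: (mutual_can b'k bk); [rewrite bx rmorphD b'x b'p rmorphN subrK | rewrite b_y b'y].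
have b'K : cancel b' b.
  by apply: (mutual_can bk b'k); [rewrite b'x rmorphD bx bp rmorphN addrK | rewrite b'y b_y].
exists (b' \o (g \o b)); split.
- by exists b, b'; split=> // r /=; rewrite b'K.
- by do 2?apply: kalg_comp.
split=> //=.
  have -> : py (p - l *: h + (h \Po (m *: 'X + c%:P))) = py p - kk l * py h + py (h \Po (m *: 'X + c%:P)).
    by rewrite rmorphD rmorphB -[l *: h]mul_polyC [py (_ * _)]rmorphM py_C.
  rewrite bx [g _]rmorphD (kalg_py h gk gy) gx; move: (h \Po _) => z.
  by rewrite !rmorphD rmorphM b'k !b'p b'x rmorphN; ring.
by rewrite b_y gy rmorphD rmorphM !b'k b'y.
Qed.

Lemma conj_t g l m c p t : kalg g -> eform g l m c p ->
  exists g1, [/\ cj g g1, kalg g1 & eform g1 l m (c + t - m * t) (p \Po ('X - t%:P))].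
Proof.
move=> gk [l0 m0 gx gy].
have o0 : 1 != 0 :> K by rewrite oner_neq0.
pose b := mkE 1 1 t 0; pose b' := mkE 1 1 (- t) 0.
have [_ _ bx b_y] := mkE_form t 0 o0 o0; have [_ _ b'x b'y] := mkE_form (- t) 0 o0 o0.
rewrite -/b -/b' in bx b_y b'x b'y.
have bk : kalg b by exact: ksubst_kalg.
have b'k : kalg b' by exact: ksubst_kalg.
have b'p q : b' (py q) = py (q \Po ('X - t%:P)) by rewrite (kalg_py q b'k b'y) scale1r polyCN.
rewrite rmorph1 !mul1r ?rmorph0 ?addr0 in bx b_y b'x b'y.
have bK : cancel b b'.
  by apply: (mutual_can b'k bk); [rewrite bx b'x | rewrite b_y rmorphD b'y b'k rmorphN subrK].
have b'K : cancel b' b.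
  by apply: (mutual_can bk b'k); [rewrite b'x bx | rewrite b'y rmorphD b_y bk rmorphN addrK].
exists (b' \o (g \o b)); split.
- by exists b, b'; split=> // r /=; rewrite b'K.
- by do 2?apply: kalg_comp.
split=> //=; first by rewrite bx gx rmorphD rmorphM b'k b'x b'p.
have -> : kk (c + t - m * t) = kk c + kk t - kk m * kk t by rewrite rmorphB rmorphD rmorphM.
by rewrite b_y [g _]rmorphD gy gk !rmorphD rmorphM !b'k b'y rmorphN; ring.
Qed.

Lemma coefXc (c : K) n i : (('X + c%:P) ^+ n)`_i = c ^+ (n - i) *+ 'C(n, i).
Proof. by have := coef_exp_lin c 1 n i; rewrite polyC1 mul1r expr1n mul1r. Qed.

(** Cancel the top coefficient and induct. The operator h -> l h - h(X + c) preserves the degree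
    with factor l - 1, unless l = 1, when it lowers the degree n + 1 to n with factor -(n + 1) c. *)
Lemma shift_solve (l c : K) : c != 0 -> forall p, exists h, l *: h - (h \Po ('X + c%:P)) = p.
Proof.
move=> c0 p; move: {2}(size p) (leqnn (size p)) => n; elim: n p => [|n IH] p sp.
  by exists 0; rewrite scaler0 comp_poly0 subr0; apply/esym/eqP; rewrite -size_poly_leq0.
pose T h := l *: h - (h \Po ('X + c%:P)).
have TX k i : (T 'X^k)`_i = l * (i == k)%:R - c ^+ (k - i) *+ 'C(k, i).
  by rewrite /T coefB coefZ coefXn comp_Xn_poly coefXc.
have [k [u [Tn Ti]]] : exists k u, (T (u *: 'X^k))`_n = p`_n /\ forall i, (n < i)%N -> (T (u *: 'X^k))`_i = 0.
  have TZ u q : T (u *: q) = u *: T q by rewrite /T comp_polyZ scalerBr !scalerA [l * u]mulrC.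
  case: (eqVneq l 1) => [l1|l1].
    exists n.+1, (- p`_n / (n.+1%:R * c)); split=> [|i lt]; rewrite TZ coefZ TX.
      rewrite -[n == n.+1]/(n == n.+1) ltn_eqF // mulr0 sub0r subSnn expr1 binSn -[c *+ _]mulr_natl.
      by rewrite mulrN !mulNr opprK divfK // mulf_neq0.
    case: (ltngtP i n.+1) lt => [lt1 lt2|gt _|-> _]; first by move: lt1; rewrite ltnS leqNgt lt2.
      by rewrite bin_small // mulr0n mulr0 subr0 mulr0.
    by rewrite subnn binn expr0 l1 mulr1 subrr mulr0.
  exists n, (p`_n / (l - 1)); split=> [|i lt]; rewrite TZ coefZ TX.
    by rewrite eqxx mulr1 subnn binn expr0 mulr1n divfK // subr_eq0.
  by rewrite gtn_eqF // bin_small // mulr0 mulr0n subr0 mulr0.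
have [|h hE] := IH (p - T (u *: 'X^k)).
  apply/leq_sizeP => i le; rewrite coefB; case: (ltngtP i n) le => // [gt _|-> _].
    by rewrite Ti // subr0 nth_default //; apply: leq_trans sp _.
  by rewrite Tn subrr.
exists (h + u *: 'X^k); rewrite scalerDr comp_polyD opprD addrACA hE -/(T _) subrK //.
Qed.

(** Conjugating by x -> x + h(y) changes the i-th coefficient of p by (m^i - l) h_i, so exactly the
    resonant ones, with l = m^i, cannot be removed. *)
Lemma tri3_normal g l m p : kalg g -> eform g l m 0 p -> exists2 g1, cj g g1 & tri3 g1.
Proof.
move=> gk ge; pose h := \poly_(i < size p) (if l == m ^+ i then 0 else p`_i / (l - m ^+ i)).
have [g1 [gg1 g1k [l0 m0 g1x g1y]]] := conj_h h gk ge.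
exists g1 => //; split=> //; eexists l, m, _; split; [exact: l0 | exact: m0 | | exact: g1x |].
  move=> i; apply: contraNeq => ne.
  have hm : (h \Po (m *: 'X + 0%:P))`_i = m ^+ i * h`_i.
    rewrite addr0 -mul_polyC (@comp_poly_wide _ _ _ (i.+1 + size h)) ?leq_addl // coef_sum.
    have lt : (i < i.+1 + size h)%N by rewrite addSn ltnS leq_addr.
    rewrite (bigD1 (Ordinal lt)) //= big1 ?addr0 => [|j nj].
      by rewrite coefZ exprMn_comm ?coefXn -?polyC_exp ?coefCM ?coefXn ?eqxx ?mulr1 1?mulrC //; exact: mulrC.
    rewrite coefZ exprMn_comm; last exact: mulrC.
    rewrite -polyC_exp coefCM coefXn eq_sym (negPf (nj : (j : nat) != i)) !mulr0 //.
  rewrite coefD coefB coefZ hm coef_poly (negPf ne).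
  case: ltnP => [_|le]; last by rewrite nth_default // !mulr0 subr0 addr0.
  have nz : l - m ^+ i != 0 by rewrite subr_eq0.
  by apply/eqP; field.
by rewrite g1y rmorph0 addr0.
Qed.

(** For m != 1 a translation moves the fixed point of y -> m y + c to 0; for m = 1 and c != 0,
    [shift_solve] removes p altogether. *)
Theorem E_normal g : isE g -> exists2 g1, cj g g1 & tri2 g1 \/ tri3 g1.
Proof.
move=> [gk [l [m [c [p ge]]]]]; have [l0 m0 gx gy] := ge.
case: (eqVneq m 1) => [m1|m1]; last first.
  have [g1 [gg1 g1k g1e]] := conj_t (c / (m - 1)) gk ge.
  have cz : c + c / (m - 1) - m * (c / (m - 1)) = 0 by field; rewrite subr_eq0.
  rewrite cz in g1e; have [g2 g12 g2t] := tri3_normal g1k g1e.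
  by exists g2; [exact: cj_trans gg1 g12 | right].
case: (eqVneq c 0) => [cz|c0].
  rewrite cz in ge; have [g2 g12 g2t] := tri3_normal gk ge.
  by exists g2 => //; right.
have [h hE] := shift_solve l c0 p.
have [g1 [gg1 g1k [_ _ g1x g1y]]] := conj_h h gk ge.
exists g1 => //; left; split=> //; exists l, c; split=> //; last by rewrite g1y m1 rmorph1 mul1r.
by rewrite g1x m1 scale1r -hE -addrA [- _ + _]addrC addrA subrK subrr rmorph0 addr0.
Qed.

Theorem semi_triangular f (P : R) c : kaut f -> P != 0 -> c != 0 -> f P = kk c * P ->
  (forall a, P <> kk a) -> exists2 g, cj f g & tri2 g \/ tri3 g.
Proof.
move=> fa P0 c0 fP nc.
have [g [fg [Eg|[l [l0 lH gE]]]]] := tame_normal (jung char0 fa).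
  by have [g1 gg1 t] := E_normal Eg; exists g1 => //; exact: cj_trans fg gg1.
have [b [b' [bk bK b'K fb]]] := fg.
have b'k a : b' (kk a) = kk a by rewrite -[in LHS]bk bK.
have [|||a aE] := @henon_no_semi K l (b' P) c l0 lH.
- by rewrite -(rmorph0 b') (inj_eq (can_inj b'K)).
- exact: c0.
- by rewrite -gE; apply: (can_inj bK); rewrite -fb b'K fP rmorphM b'K bk.
by case: (nc a); rewrite -[P]b'K aE bk.
Qed.

(** The product of the images of p over one period is a non-constant semi-invariant of f itself, so
    [semi_triangular] applies. *)
Theorem square_nosemi f : kaut f -> ~ (exists2 g, cj f g & tri2 g \/ tri3 g) ->
  forall (p : R) m c, rirr p -> c != 0 -> iter m.+1 f p <> kk c * p.
Proof.
move=> fa nt p m c [p0 mp _] c0 pE; apply: nt.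
have [fk [f' [f'k fK f'K]]] := fa.
pose b := \prod_(i < m.+1) iter i f p.
have ip0 i : iter i f p != 0.
  by rewrite -(iter_rmorph0 f i) (inj_eq (can_inj (iter_can i fK))).
have fb : f b = kk c * b.
  rewrite /b rmorph_prod big_ord_recr /= -[f (iter m f p)]/(iter m.+1 f p) pE.
  by rewrite [in RHS]big_ord_recl /= mulrCA [p * _]mulrC mulrA.
have b0 : b != 0 by apply/prodf_neq0.
apply: (semi_triangular fa b0 c0 fb) => a bE.
have := f_equal (@mdeg K) bE; rewrite /b big_ord_recl /= mdegM //; last by apply/prodf_neq0 => i _; exact: (ip0 i.+1).
have -> : mdeg (kk a) = 0%N.
  by rewrite /mdeg lead_coefC !size_polyC; case: (_ == 0); case: (_ == 0).
by move/eqP; rewrite addn_eq0 (negPf mp).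
Qed.
End NormalForms.

(** * Ideals of K[t] stable under an affine substitution *)

Section PolyIdeals.
Variable K : closedFieldType.
Hypothesis char0 : forall n, n.+1%:R != 0 :> K.
Implicit Types p q : {poly K}.

Lemma natr_inj m n : m%:R = n%:R :> K -> m = n.
Proof.
suff H a b : (a < b)%N -> a%:R <> b%:R :> K.
  by move=> e; case: (ltngtP m n) => // lt; [case: (H m n lt) | case: (H n m lt)].
move=> lt /eqP; rewrite eq_sym -subr_eq0 -natrB 1?ltnW //.
by have := char0 (b - a).-1; rewrite prednK ?subn_gt0 // => /negPf ->.
Qed.

Lemma ideal_min (I : {poly K} -> Prop) : (exists q, I q /\ q != 0) ->
  exists q, [/\ I q, q != 0 & forall r, I r -> (size r < size q)%N -> r = 0].
Proof.
move=> [q0 [Iq0 q00]].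
have [|n /asboolP [q [Iq qn0 sq]] nmin] := @ex_minnP (fun n => `[< exists q, [/\ I q, q != 0 & size q = n] >]).
  by exists (size q0); apply/asboolP; exists q0.
exists q; split=> // r Ir lt; apply: contrapT => /eqP r0.
have := nmin (size r); case: asboolP => [_ /(_ isT)|[]]; last by exists r.
by rewrite leqNgt -sq lt.
Qed.

Lemma size_cancel p q : size p = size q -> p != 0 -> lead_coef p = lead_coef q -> (size (p - q)%R < size p)%N.
Proof.
move=> spq p0 lpq; have := p0; rewrite -size_poly_gt0 => sp.
rewrite -(prednK sp) ltnS; apply/leq_sizeP => i le; rewrite coefB.
case: (ltngtP (size p).-1 i) le => // [lt _|<- _].
  by rewrite !nth_default ?subrr // -?spq -(prednK sp).
by rewrite -lead_coefE lpq lead_coefE spq subrr.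
Qed.

Lemma comp_shiftK (c : K) : cancel (comp_poly ('X + c%:P)) (comp_poly ('X - c%:P)).
Proof. by move=> q; rewrite -comp_polyA comp_polyD comp_polyX comp_polyC subrK comp_polyXr. Qed.

(** q takes the value q(0) at all natural multiples of c, infinitely many points in characteristic
    zero. *)
Lemma shift_fixed (c : K) q : c != 0 -> q \Po ('X - c%:P) = q -> q = (q.[0])%:P.
Proof.
move=> c0 qc; apply/eqP; rewrite -subr_eq0; apply/negPn/negP => nz.
have per k : q.[k%:R * c] = q.[0].
  elim: k => [|k IH]; first by rewrite mul0r.
  rewrite -{1}qc horner_comp hornerXsubC -IH; congr (q.[_]).
  by rewrite -natr1 mulrDl mul1r addrK.
pose rs := [seq k%:R * c | k <- iota 0 (size (q - (q.[0])%:P)).+1].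
have ur : uniq rs by rewrite map_inj_uniq ?iota_uniq // => a b /(mulIf c0) /natr_inj.
have ar : all (root (q - (q.[0])%:P)) rs.
  by apply/allP => _ /mapP [k _ ->]; rewrite rootE hornerD hornerN hornerC per subrr.
by have := max_poly_roots nz ar ur; rewrite size_map size_iota ltnNge leqnSn.
Qed.

Lemma coef_comp_scale (u : K) q i : (q \Po (u *: 'X))`_i = u ^+ i * q`_i.
Proof.
rewrite (@comp_poly_wide _ _ _ (i.+1 + size q)) ?leq_addl // coef_sum.
have lt : (i < i.+1 + size q)%N by rewrite addSn ltnS leq_addr.
rewrite (bigD1 (Ordinal lt)) //= big1 ?addr0 => [|j nj].
  by rewrite coefZ exprZn coefZ coefXn eqxx mulr1 mulrC.
by rewrite coefZ exprZn coefZ coefXn eq_sym (negPf (nj : (j : nat) != i)) !mulr0.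
Qed.

Section Bad.
Variables (A : comNzRingType) (alpha : {rmorphism A -> A}) (psi : {rmorphism A -> {poly K}}).
Hypothesis psi_surj : forall b, exists r, psi r = b.

(** Here a = 1: an element of least degree in a stable ideal is fixed by the translation, hence
    constant, so the ideal is everything. For g take t and the point 0, where no t - kc with k > 0
    vanishes. *)
Theorem bad_shift (c : K) : c != 0 -> (forall r, psi (alpha r) = psi r \Po ('X + c%:P)) ->
  bad_ext alpha (fun r => psi r = 0).
Proof.
move=> c0 psia.
pose beta : {rmorphism {poly K} -> {poly K}} := comp_poly ('X + c%:P).
pose gamma : {rmorphism {poly K} -> {poly K}} := comp_poly ('X - c%:P).
have bK : cancel beta gamma by exact: comp_shiftK.
have gK : cancel gamma beta by have := @comp_shiftK (- c); rewrite polyCN opprK.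
have special (I : {poly K} -> Prop) : ideal I -> (forall x, I x -> I (gamma x)) ->
    (exists x, I x /\ x != 0) -> exists m, I (\prod_(j < m) iter j.+1 beta 1).
  move=> [I0 IB IM] Ig nz; exists 0%N; rewrite big_ord0.
  have [q [Iq q0 qmin]] := ideal_min nz.
  have lq : lead_coef (gamma q) = lead_coef q.
    by rewrite [gamma q]/(q \Po _) lead_coef_comp ?size_XsubC // lead_coefXsubC expr1n mulr1.
  have sq : size (gamma q) = size q by rewrite [gamma q]/(q \Po _) size_comp_poly2 ?size_XsubC.
  have gq : gamma q = q.
    apply/eqP; rewrite -subr_eq0; apply/eqP/qmin; first by apply: (IB) => //; exact: Ig.
    by rewrite -sq size_cancel // -size_poly_eq0 sq size_poly_eq0.
  have qE := shift_fixed c0 gq; have h0 : q.[0] != 0 by apply: contraNneq q0 => z; rewrite qE z.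
  by have := IM _ (q.[0]^-1)%:P Iq; rewrite {1}qE -polyCM divff.
have iX k : iter k gamma 'X = 'X - (k%:R * c)%:P.
  elim: k => [|k IH]; first by rewrite mul0r subr0.
  have gE q : gamma q = q \Po ('X - c%:P) by [].
  rewrite iterS IH gE comp_polyB comp_polyX comp_polyC -natr1 mulrDl mul1r polyCD opprD addrA.
  by rewrite addrAC.
have ev q : (horner_eval 0 : {rmorphism {poly K} -> K}) q = q.[0] by [].
apply: (@frac_bad_ext A alpha _ beta gamma bK gK psi psia psi_surj 1 (oner_neq0 _) special K (horner_eval 0) 'X).
- exact: hornerX.
- by rewrite polyX_eq0.
- move=> k; by rewrite iX ev hornerXsubC sub0r oppr_eq0 mulf_neq0.
- by move=> k; rewrite iter_rmorph1 rmorph1 oner_neq0.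
- by move=> k; rewrite iter_rmorph1 rmorph1 oner_neq0.
Qed.

(** Here a = t: an element of least degree is an eigenvector of the scaling, hence a multiple of
    some t^n, as the powers of m are distinct. For g take t - 1 and the point 1. *)
Theorem bad_scale (m : K) : m != 0 -> (forall k, m ^+ k.+1 != 1) ->
  (forall r, psi (alpha r) = psi r \Po (m *: 'X)) -> bad_ext alpha (fun r => psi r = 0).
Proof.
move=> m0 mu psia.
pose beta : {rmorphism {poly K} -> {poly K}} := comp_poly (m *: 'X).
pose gamma : {rmorphism {poly K} -> {poly K}} := comp_poly (m^-1 *: 'X).
have bE q i : (beta q)`_i = m ^+ i * q`_i by exact: coef_comp_scale.
have gE q i : (gamma q)`_i = m^-1 ^+ i * q`_i by exact: coef_comp_scale.
have mi i : m ^+ i != 0 by rewrite expf_neq0.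
have bK : cancel beta gamma.
  by move=> q; apply/polyP => i; rewrite gE bE exprVn mulKf.
have gK : cancel gamma beta.
  by move=> q; apply/polyP => i; rewrite bE gE exprVn mulVKf.
have iX k : iter k beta 'X = m ^+ k *: 'X.
  elim: k => [|k IH]; first by rewrite scale1r.
  have bE' q : beta q = q \Po (m *: 'X) by [].
  by rewrite iterS IH bE' comp_polyZ comp_polyX scalerA -exprSr.
have iXg k : iter k gamma 'X = m^-1 ^+ k *: 'X.
  elim: k => [|k IH]; first by rewrite scale1r.
  have gE' q : gamma q = q \Po (m^-1 *: 'X) by [].
  by rewrite iterS IH gE' comp_polyZ comp_polyX scalerA -exprSr.
have special (I : {poly K} -> Prop) : ideal I -> (forall x, I x -> I (gamma x)) ->
    (exists x, I x /\ x != 0) -> exists m', I (\prod_(j < m') iter j.+1 beta 'X).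
  move=> [I0 IB IM] Ig nz; have [q [Iq q0 qmin]] := ideal_min nz.
  pose n := (size q).-1; exists n.
  have sq : size q = n.+1 by rewrite prednK // size_poly_gt0.
  have gq : gamma q = (m^-1 ^+ n)%:P * q.
    apply/eqP; rewrite -subr_eq0; apply/eqP/qmin.
      by apply: (IB); [exact: Ig | rewrite mulrC; exact: IM].
    rewrite sq ltnS; apply/leq_sizeP => i le; rewrite coefB gE coefCM.
    case: (ltngtP n i) le => // [lt _|<- _]; last by rewrite subrr.
    by rewrite nth_default ?sq // !mulr0 subrr.
  have qi i : i != n -> q`_i = 0.
    move=> ni; have := f_equal (fun r : {poly K} => r`_i) gq; rewrite gE coefCM => /eqP.
    rewrite -subr_eq0 -mulrBl mulf_eq0 => /orP [|/eqP //]; rewrite subr_eq0 !exprVn => /eqP/invr_inj.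
    have H a b : (a < b)%N -> m ^+ a <> m ^+ b.
      move=> lt; rewrite -(subnK (ltnW lt)) exprD => /esym/eqP.
      rewrite -subr_eq0 -{2}[m ^+ a]mul1r -mulrBl mulf_eq0 (negPf (mi a)) orbF subr_eq0.
      by have := mu (b - a).-1; rewrite prednK ?subn_gt0 // => /negPf ->.
    by case: (ltngtP i n) ni => // lt _; [move/(H _ _ lt) | move/esym/(H _ _ lt)].
  have qE : q = q`_n *: 'X^n.
    apply/polyP => i; rewrite coefZ coefXn; case: (eqVneq i n) => [->|/qi ->]; by rewrite ?mulr1 ?mulr0.
  have qn : q`_n != 0 by rewrite -lead_coefE lead_coef_eq0.
  have -> : \prod_(j < n) iter j.+1 beta 'X = q * ((q`_n)^-1 * \prod_(j < n) m ^+ j.+1)%:P.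
    rewrite {1}qE mulrC -mul_polyC mulrA -polyCM mulrAC mulVf // mul1r.
    under eq_bigr => j _ do rewrite iX.
    rewrite scaler_prod prodr_const card_ord mul_polyC //.
  exact: IM.
have ev q : (horner_eval 1 : {rmorphism {poly K} -> K}) q = q.[1] by [].
apply: (@frac_bad_ext A alpha _ beta gamma bK gK psi psia psi_surj 'X _ special K (horner_eval 1) ('X - 1%:P)).
- by rewrite polyX_eq0.
- by rewrite [LHS](hornerXsubC 1 1) subrr.
- by rewrite polyXsubC_eq0.
- move=> k; rewrite iter_rmorphB polyC1 iter_rmorph1 iXg.
  rewrite ev hornerD hornerN hornerZ hornerX -polyC1 hornerC mulr1.
  by rewrite subr_eq0 exprVn invr_eq1.
- move=> k; rewrite iX ev hornerZ hornerX mulr1; exact: mi.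
- move=> k; by rewrite iXg ev hornerZ hornerX mulr1 expf_neq0 // invr_eq0.
Qed.
End Bad.
End PolyIdeals.

(** * Triangular automorphisms of infinite order *)

Section Triangular.
#[local] Opaque kk py px ksubst mkE pif.
Variable K : closedFieldType.
Hypothesis char0 : forall n, n.+1%:R != 0 :> K.
Local Notation R := {poly {poly K}}.
Local Notation kk := (kk K).
Local Notation xx := (xx K).
Local Notation yy := (yy K).
Local Notation py := (py K).
Local Notation px := (px K).
Local Notation morph := {rmorphism R -> R}.
Implicit Types (f g : morph) (p q : {poly K}).

Lemma cf_py p i j : cf (py p) i j = if i == 0%N then p`_j else 0.
Proof. by rewrite -pif_px cf_pif cf_px. Qed.

Lemma iter_kk g k c : kalg g -> iter k g (kk c) = kk c.
Proof. by move=> gk; elim: k => //= k ->; exact: gk. Qed.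

Section Iterates.
Variables (g : morph) (l m : K) (p : {poly K}).
Hypotheses (gk : kalg g) (l0 : l != 0) (pm : forall i, p`_i != 0 -> l = m ^+ i).
Hypotheses (gx : g xx = kk l * xx + py p) (gy : g yy = kk m * yy).

Lemma iter_y k : iter k g yy = kk (m ^+ k) * yy.
Proof.
elim: k => [|k IH]; first by rewrite expr0 rmorph1 mul1r.
by rewrite iterS IH rmorphM gk gy mulrA -rmorphM -exprSr.
Qed.

Lemma g_py q : g (py q) = py (q \Po (m *: 'X)).
Proof. by rewrite (@kalg_py K g q m 0) ?addr0 // gy rmorph0 addr0. Qed.

Lemma iter_py k q : iter k g (py q) = py (q \Po (m ^+ k *: 'X)).
Proof.
elim: k => [|k IH]; first by rewrite expr0 scale1r comp_polyXr.
by rewrite iterS IH g_py -comp_polyA comp_polyZ comp_polyX scalerA -exprSr.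
Qed.

Lemma g_p : g (py p) = kk l * py p.
Proof.
rewrite g_py -py_C -rmorphM mul_polyC; congr (py _); apply/polyP => i.
rewrite coef_comp_scale coefZ; case: (eqVneq p`_i 0) => [->|/pm ->]; by rewrite ?mulr0.
Qed.

(** By the resonance condition p(y) is itself an eigenvector for l, so the p-terms accumulate
    linearly in k; this linear growth is why g has infinite order unless p = 0. *)
Lemma iter_x k : iter k g xx = kk (l ^+ k) * (xx + kk (k%:R / l) * py p).
Proof.
elim: k => [|k IH]; first by rewrite expr0 rmorph1 mul1r mul0r rmorph0 mul0r addr0.
rewrite iterS IH rmorphM rmorphD rmorphM !gk gx g_p exprSr [kk (l ^+ k * l)]rmorphM.
have -> : kk (k.+1%:R / l) = kk (k%:R / l) + kk l^-1 by rewrite -rmorphD -natr1 mulrDl mul1r.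
have e1 : kk l * kk l^-1 = 1 by rewrite mulrC kkV.
rewrite -mulrA; congr (_ * _); rewrite !mulrDl !mulrDr [kk l * (kk l^-1 * _)]mulrA e1 mul1r.
by rewrite -addrA; congr (_ + _); rewrite addrC mulrCA.
Qed.
End Iterates.

Lemma finite_tri (g : morph) n : tri2 g \/ tri3 g -> (forall r, iter n.+1 g r = r) ->
  exists l m, [/\ l ^+ n.+1 = 1, m ^+ n.+1 = 1, g xx = kk l * xx & g yy = kk m * yy].
Proof.
move=> [[gk [l [c [l0 c0 gx gy]]]]|[gk [l [m [p [l0 m0 pm gx gy]]]]]] fin.
  have iy k : iter k g yy = yy + kk (k%:R * c).
    elim: k => [|k IH]; first by rewrite mul0r rmorph0 addr0.
    by rewrite iterS IH rmorphD gk gy -natr1 mulrDl mul1r rmorphD addrAC addrA.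
  have := fin yy; rewrite iy => /eqP; rewrite -subr_eq0 addrAC subrr add0r kk_eq0.
  by rewrite mulf_eq0 (negPf (char0 n)) (negPf c0).
have := fin yy; rewrite (iter_y gk gy) => ey.
have := fin xx; rewrite (iter_x gk l0 pm gx gy) mulrDr mulrA -rmorphM => ex.
have mn : m ^+ n.+1 = 1.
  have := f_equal (fun r => cf r 0 1) ey; rewrite cfZ -[yy]mul1r cf_yy -(rmorph1 kk) cf_kk /=.
  by rewrite mulr1.
have ln : l ^+ n.+1 = 1.
  have := f_equal (fun r => cf r 1 0) ex; rewrite cfD !cfZ cf_py /= mulr0 addr0 -[xx]mul1r cf_xx -(rmorph1 kk) cf_kk /=.
  by rewrite mulr1.
exists l, m; split=> //; rewrite gx.
have /eqP : kk (l ^+ n.+1 * (n.+1%:R / l)) * py p = 0.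
  by move: ex; rewrite ln rmorph1 mul1r => /eqP; rewrite -subr_eq0 addrAC subrr add0r => /eqP.
rewrite mulf_eq0 kk_eq0 ln mul1r mulf_eq0 (negPf (char0 n)) invr_eq0 (negPf l0) /= => /eqP ->.
by rewrite addr0.
Qed.

Lemma diag_finite (g : morph) l m n : kalg g -> g xx = kk l * xx -> g yy = kk m * yy ->
  l ^+ n = 1 -> m ^+ n = 1 -> forall r, iter n g r = r.
Proof.
move=> gk gx gy ln mn.
have it z c k : g z = kk c * z -> iter k g z = kk (c ^+ k) * z.
  move=> gz; elim: k => [|k IH]; first by rewrite expr0 rmorph1 mul1r.
  by rewrite iterS IH rmorphM gk gz mulrA -rmorphM -exprSr.
apply: R_gen => [c|r s er es|r er|r er].
- exact: iter_kk.
- by rewrite iter_rmorphD er es.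
- by rewrite iter_rmorphM er (it _ _ _ gx) ln rmorph1 mul1r.
- by rewrite iter_rmorphM er (it _ _ _ gy) mn rmorph1 mul1r.
Qed.

Section Conjugate.
Variables (f f' g : morph).
Hypotheses (fK : cancel f f') (f'K : cancel f' f).
Variables (b b' : morph).
Hypotheses (bK : cancel b b') (b'K : cancel b' b) (fb : forall r, f (b r) = b (g r)).

Lemma iter_fb n r : iter n f (b r) = b (iter n g r).
Proof. by elim: n => //= n ->; rewrite fb. Qed.

Lemma conj_iter n r : b' (iter n f r) = iter n g (b' r).
Proof. by rewrite -[r in LHS]b'K iter_fb bK. Qed.

Lemma conj_fix n : (forall r, iter n g r = r) -> forall r, iter n f r = r.
Proof. by move=> h r; rewrite -[r]b'K iter_fb h. Qed.

Lemma conj_fix' n : (forall r, iter n f r = r) -> forall r, iter n g r = r.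
Proof. by move=> h r; rewrite -[r]bK -conj_iter h. Qed.

Fixpoint mit n (h : morph) : morph := if n is n'.+1 then h \o mit n' h else idfun.
Lemma mitE n (h : morph) r : mit n h r = iter n h r.
Proof. by elim: n => //= n ->. Qed.

Section Line.
Variables (F G : {poly K}).
(** Restriction of functions to the parametrised curve t -> (F(t), G(t)). *)
Definition line : {rmorphism R -> {poly K}} := subst polyC F G.
Lemma line_k c : line (kk c) = c%:P. Proof. exact: subst_kk. Qed.
Lemma line_x : line xx = F. Proof. exact: subst_xx. Qed.
Lemma line_y : line yy = G. Proof. exact: subst_yy. Qed.
#[local] Opaque line.
Lemma line_py q : line (py q) = q \Po G.
Proof.
apply: (poly_rmorph_ext (f := line \o py) (g := comp_poly G)) => [c|] /=.
  by rewrite comp_polyC py_C line_k.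
by rewrite comp_polyX py_X line_y.
Qed.
Lemma line_px q : line (px q) = q \Po F.
Proof.
apply: (poly_rmorph_ext (f := line \o px) (g := comp_poly F)) => [c|] /=.
  by rewrite comp_polyC px_C line_k.
by rewrite comp_polyX px_X line_x.
Qed.

Lemma line_surj : F = 'X \/ G = 'X -> forall q, exists r, (line \o b') r = q.
Proof.
move=> [FX|GX] q; [exists (b (px q)) | exists (b (py q))]; rewrite /= bK.
  by rewrite line_px FX comp_polyXr.
by rewrite line_py GX comp_polyXr.
Qed.

Lemma line_comm n (w : {poly K}) : kalg g -> line (iter n g xx) = F \Po w -> line (iter n g yy) = G \Po w ->
  forall r, (line \o b') (mit n f r) = (line \o b') r \Po w.
Proof.
move=> gk ex ey r; rewrite /= mitE conj_iter -mitE.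
apply: (@rmorph_ext K _ (line \o mit n g) (comp_poly w \o line)) => [c||] /=.
- by rewrite mitE iter_kk // line_k comp_polyC.
- by rewrite mitE ex line_x.
- by rewrite mitE ey line_y.
Qed.
End Line.

#[local] Opaque line.
(** Find a line on which g, or a power of it, translates or scales by a non-root of unity: x = 0 for
    [tri2]; y = 0 when l is not a root of unity or p(0) != 0; x = 0 when m is not a root of unity;
    otherwise p != 0, and a power of g translates a line y = z0. *)
Theorem tri_bad : tri2 g \/ tri3 g -> (forall n, exists r, iter n.+1 f r != r) -> exists Q, bad_ext f Q.
Proof.
move=> tri inf.
have shift F G c : kalg g -> c != 0 -> F = 'X \/ G = 'X -> line F G (g xx) = F \Po ('X + c%:P) ->
    line F G (g yy) = G \Po ('X + c%:P) -> exists Q, bad_ext f Q.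
  move=> gk c0 FG ex ey; eexists.
  exact: (@bad_shift K char0 R f (line F G \o b') (line_surj FG) c c0 (line_comm (n := 1) gk ex ey)).
have scale F G c : kalg g -> c != 0 -> (forall k, c ^+ k.+1 != 1) -> F = 'X \/ G = 'X ->
    line F G (g xx) = F \Po (c *: 'X) -> line F G (g yy) = G \Po (c *: 'X) -> exists Q, bad_ext f Q.
  move=> gk c0 cu FG ex ey; eexists.
  exact: (@bad_scale K R f (line F G \o b') (line_surj FG) c c0 cu (line_comm (n := 1) gk ex ey)).
case: tri => [[gk [l [c [l0 c0 gx gy]]]]|[gk [l [m [p [l0 m0 pm gx gy]]]]]].
  apply: (shift 0 'X c gk c0); [by right | by rewrite gx rmorphM line_x mulr0 comp_poly0 |].
  by rewrite gy rmorphD line_y line_k comp_polyX.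
have nroot c : ~ (forall k, c ^+ k.+1 != 1 :> K) -> exists k, c ^+ k.+1 = 1.
  by move=> h; apply: contrapT => h'; apply: h => k; apply/eqP => e; apply: h'; exists k.
have y0 : line 'X 0 (g yy) = 0 by rewrite gy rmorphM line_y mulr0.
have x0 : line 'X 0 (g xx) = l *: 'X + (p`_0)%:P.
  by rewrite gx rmorphD rmorphM line_x line_k line_py comp_poly0r mul_polyC.
case: (pselect (forall k, l ^+ k.+1 != 1)) => [lu|/nroot [kl kl1]].
  apply: (scale 'X 0 l gk l0 lu); [by left | | by rewrite comp_poly0].
  rewrite x0 comp_polyX; case: (eqVneq p`_0 0) => [->|/pm l1]; first by rewrite addr0.
  by have := lu 0%N; rewrite expr1 l1 expr0 eqxx.
case: (eqVneq p`_0 0) => [p00|p00]; last first.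
  apply: (shift 'X 0 p`_0 gk p00); [by left | | by rewrite comp_poly0].
  by rewrite x0 comp_polyX (pm 0%N p00) expr0 scale1r.
case: (pselect (forall k, m ^+ k.+1 != 1)) => [mu|/nroot mr].
  (* A non-zero coefficient of index i > 0 would give l = m^i, but l is a root of unity and m is
     not. *)
  have pz : p = 0.
    apply/polyP => i; rewrite coef0; apply: contrapT => /eqP pi.
    case: i pi => [|i] pi; first by rewrite p00 eqxx in pi.
    by case/eqP: (mu (i.+1 * kl.+1).-1); rewrite prednK // exprM -(pm _ pi).
  apply: (scale 0 'X m gk m0 mu); [by right | |].
    by rewrite gx pz rmorph0 addr0 rmorphM line_x mulr0 comp_poly0.
  by rewrite gy rmorphM line_y line_k comp_polyX mul_polyC.
case: (eqVneq p 0) => [pz|pnz].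
  case: mr => km km1; have gx' : g xx = kk l * xx by rewrite gx pz rmorph0 addr0.
  have [r /eqP] := inf (kl.+1 * km.+1).-1; case; rewrite prednK //.
  apply: (conj_fix (n := (kl.+1 * km.+1)%N)); apply: (diag_finite gk gx' gy).
    by rewrite exprM kl1 expr1n.
  by rewrite mulnC exprM km1 expr1n.
(* [N.+1] is the exact order of m, hence the number of lines in the orbit of y = z0. *)
have [|N /eqP mN Nmin] := @ex_minnP (fun n => m ^+ n.+1 == 1); first by case: mr => k k1; exists k; apply/eqP.
(* p(z0) != 0 makes the translation on the line non-trivial, and z0 != 0 makes its conjugates
   distinct. *)
have [z0] : exists z, ~~ root (p * 'X) z by apply/closed_nonrootP; rewrite mulf_neq0 // polyX_eq0.
rewrite rootE hornerM hornerX mulf_eq0 negb_or => /andP [pz0 z00].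
have lN : l ^+ N.+1 = 1.
  have [i pi] : exists i, p`_i != 0.
    by exists (size p).-1; rewrite -lead_coefE lead_coef_eq0.
  by rewrite (pm i pi) exprAC mN expr1n.
pose c := N.+1%:R / l * p.[z0].
have c0 : c != 0 by rewrite !mulf_neq0 // invr_eq0.
have bad : bad_ext (mit N.+1 f) (fun r => (line 'X z0%:P \o b') r = 0).
  apply: (@bad_shift K char0 R _ _ (line_surj (or_introl erefl)) c c0).
  apply: line_comm => //.
    rewrite (iter_x gk l0 pm gx gy) lN rmorph1 mul1r rmorphD rmorphM line_x line_k line_py comp_polyX.
    by rewrite comp_polyCr -polyCM.
  by rewrite (iter_y gk gy) mN rmorph1 mul1r line_y comp_polyC.
have inj (i j : 'I_N.+1) : m ^+ i * z0 = m ^+ j * z0 -> i = j.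
  move/(mulIf z00) => e; apply: val_inj => /=.
  have H (a c' : nat) : (a < c')%N -> (c' < N.+1)%N -> m ^+ a <> m ^+ c'.
    move=> lt ltN; rewrite -(subnK (ltnW lt)) exprD => /esym/eqP.
    rewrite -subr_eq0 -{2}[m ^+ a]mul1r -mulrBl mulf_eq0 expf_eq0 (negPf m0) andbF orbF subr_eq0.
    move=> h; have := Nmin (c' - a).-1; rewrite prednK ?subn_gt0 // h => /(_ isT).
    by move: lt ltN; clear; lia.
  by case: (ltngtP i j) => // lt; [case: (H _ _ lt) | case: (H _ _ lt)].
(* Lagrange polynomials at the points m^j z0 give the elements that separate the conjugate lines, as
   [bad_ext_ind] requires. *)
pose lag (i : 'I_N.+1) : {poly K} :=
  \prod_(j < N.+1 | j != i) ((m ^+ i * z0 - m ^+ j * z0)^-1 *: ('X - (m ^+ j * z0)%:P)).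
have lagE (i j : 'I_N.+1) : (lag i).[m ^+ j * z0] = (j == i)%:R.
  rewrite horner_prod; case: (eqVneq j i) => [->|ne].
    rewrite big1 // => k nk; rewrite hornerZ hornerXsubC mulVf // subr_eq0.
    by apply: contra nk => /eqP/inj ->.
  by rewrite (bigD1 j) //= hornerZ hornerXsubC subrr mulr0 mul0r.
exists (fun _ => False).
apply: (@bad_ext_ind R f (mit N.+1 f) N _ _ (fun r => (line 'X z0%:P \o b') r = 0) (fun i => b (py (lag i))) _ bad).
- by move=> r; exact: mitE.
- by move=> r; exists (f' r).
- move=> i j; rewrite iter_fb rmorphB /= bK (iter_py gk gy) line_py.
  rewrite rmorph_nat; set w := _ \Po _; have -> : w = ((j == i)%:R)%:P.
    rewrite /w comp_polyCr horner_comp hornerZ hornerX lagE //.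
  by rewrite polyC_natr rmorph_nat subrr.
Qed.
End Conjugate.
End Triangular.

(** * The dichotomy for plane automorphisms *)

Section Generic.
#[local] Opaque kk py px ksubst mkE pif.
Variable K : closedFieldType.
Hypothesis char0 : forall n, n.+1%:R != 0 :> K.
Hypothesis unc : forall s : nat -> K, exists c, forall n, s n <> c.
Local Notation R := {poly {poly K}}.
Local Notation morph := {rmorphism R -> R}.
Variables (f f' : morph).
Hypotheses (fK : cancel f f') (f'K : cancel f' f) (fk : kalg f).

Definition fin_order (h : morph) := exists n, forall r, iter n.+1 h r = r.

Lemma fin_tdiamond : fin_order f -> tdiamond f.
Proof.
case=> n fin.
exact: (finite_order_tdiamond unc f'K fk (@R_gen K) (ltn0Sn n) fin).
Qed.

Lemma not_fin : ~ fin_order f -> forall n, exists r, iter n.+1 f r != r.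
Proof.
move=> nf n; apply: contrapT => h; apply: nf; exists n => r.
by apply/eqP/negPn/negP => hr; apply: h; exists r.
Qed.

Lemma f_kaut : kaut f.
Proof.
by split=> //; exists f'; split=> // c; rewrite -[in LHS]fk fK.
Qed.

Theorem triangular_part (g : morph) : cj f g -> tri2 g \/ tri3 g ->
  (tdiamond f <-> fin_order f) /\
  (fin_order f -> exists l m n, [/\ l ^+ n.+1 = 1, m ^+ n.+1 = 1, g (xx K) = kk K l * xx K & g (yy K) = kk K m * yy K]).
Proof.
move=> [b [b' [bk bK b'K fb]]] tri; split; last first.
  case=> n fin; have [l [m [h1 h2 h3 h4]]] := finite_tri char0 tri (conj_fix' bK b'K fb fin).
  by exists l, m, n.
split; last exact: fin_tdiamond.
move=> dia; apply: contrapT => /not_fin inf.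
have [Q bad] := tri_bad char0 f'K bK b'K fb tri inf.
exact: (bad_ext_not_tdiamond fk bad dia).
Qed.

Theorem diag_fin (g : morph) l m n n' : cj f g -> kalg g -> g (xx K) = kk K l * xx K -> g (yy K) = kk K m * yy K ->
  l ^+ n.+1 = 1 -> m ^+ n'.+1 = 1 -> fin_order f.
Proof.
move=> [b [b' [bk bK b'K fb]]] gk gx gy ln mn; exists (n.+1 * n'.+1).-1; rewrite prednK //.
apply: (conj_fix b'K fb); apply: (diag_finite gk gx gy); first by rewrite exprM ln expr1n.
by rewrite mulnC exprM mn expr1n.
Qed.

(** For finite order, diamond holds outright; otherwise [square_nosemi] rules out the second branch
    of the torsion dichotomy. *)
Theorem square_part : ~ (exists2 g, cj f g & tri2 g \/ tri3 g) -> (tdiamond f <-> ~ tprimitive f).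
Proof.
move=> nt; split=> [dia pr|npr].
  exact: (tprimitive_not_tdiamond unc fK f'K fk pr dia).
case: (pselect (fin_order f)) => [/fin_tdiamond //|/not_fin inf].
apply: (@not_tprimitive_tdiamond K unc f f' fK f'K fk inf _ npr) => p m c.
exact: (square_nosemi char0 f_kaut nt).
Qed.
End Generic.

(** * Uncountability of the real and complex numbers *)

Section Uncountable_reals.
Local Open Scope classical_set_scope.
Variables (R : realType) (s : nat -> R).

(** Keep an outer third of the interval that misses x; the supremum of the left ends then differs
    from every term of the sequence. *)
Definition third_step (x : R) (ab : R * R) : R * R :=
  let d := (ab.2 - ab.1) / 3%:R in
  if x < ab.2 - d then (ab.2 - d, ab.2) else (ab.1, ab.1 + d).

Fixpoint thirds n : R * R := if n is n'.+1 then third_step (s n') (thirds n') else (0, 1).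

Lemma thirds_spec n : (thirds n).1 < (thirds n).2 /\
  [/\ (thirds n).1 <= (thirds n.+1).1, (thirds n.+1).2 <= (thirds n).2 &
    s n < (thirds n.+1).1 \/ (thirds n.+1).2 < s n].
Proof.
have lt : (thirds n).1 < (thirds n).2.
  elim: n => [|n IH] /=; first exact: ltr01.
  rewrite /third_step; case: (thirds n) IH => a b /= ab.
  by case: ifP => _ /=; lra.
split=> //=; rewrite /third_step; case: (thirds n) lt => a b /= ab.
case: (ltP (s n) (b - (b - a) / 3%:R)) => h /=; first by split; [lra | lra | left].
by split; [lra | lra | right; lra].
Qed.

Lemma thirds_mono m n : (m <= n)%N -> (thirds m).1 <= (thirds n).1 /\ (thirds n).2 <= (thirds m).2.
Proof.
move=> le; rewrite -(subnK le); elim: (n - m)%N => [|k [h1 h2]]; first by rewrite add0n.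
have [_ [h3 h4 _]] := thirds_spec (k + m); rewrite addSn.
by split; [exact: le_trans h1 h3 | exact: le_trans h4 h2].
Qed.

Lemma realType_uncountable : exists c, forall n, s n <> c.
Proof.
pose E : set R := [set x | exists n, x = (thirds n).1].
have ub n : ubound E (thirds n).2.
  move=> _ [m ->]; have [h1 _] := thirds_mono (leq_maxl m n); have [_ h2] := thirds_mono (leq_maxr m n).
  have [h3 _] := thirds_spec (maxn m n).
  exact: le_trans h1 (le_trans (ltW h3) h2).
have ne : E !=set0 by exists (thirds 0).1; exists 0%N.
have hs : has_ubound E by exists (thirds 0).2; exact: ub.
exists (sup E) => n e.
have l1 : (thirds n.+1).1 <= sup E by apply: (ub_le_sup hs); exists n.+1.
have l2 : sup E <= (thirds n.+1).2 by apply: (ge_sup ne); exact: ub.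
have [_ [_ _ [h|h]]] := thirds_spec n; rewrite e in h.
  by have := le_lt_trans l1 h; rewrite ltxx.
by have := lt_le_trans h l2; rewrite ltxx.
Qed.
End Uncountable_reals.

Lemma CC_uncountable (s : nat -> CC) : exists c, forall n, s n <> c.
Proof.
have [c cP] := @realType_uncountable Rdefinitions.R (fun n => complex.Re (s n)).
by exists (Complex c 0) => n e; apply: (cP n); rewrite e.
Qed.

Lemma CC_char0 n : n.+1%:R != 0 :> CC.
Proof. by rewrite pnatr_eq0. Qed.

Lemma is_aut_inv f : is_aut f -> exists f', [/\ is_aut f', cancel f f' & cancel f' f].
Proof.
case=> fD fM f1 fk [f' fK f'K]; exists f'; split=> //; split.
- by move=> a b; apply: (can_inj fK); rewrite fD !f'K.
- by move=> a b; apply: (can_inj fK); rewrite fM !f'K.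
- by rewrite -{1}f1 fK.
- by move=> c; rewrite -{1}fk fK.
- by exists f.
Qed.

Lemma morph_is_aut (g : {rmorphism Rxy -> Rxy}) g' : (forall c, g (cst c) = cst c) ->
  cancel g g' -> cancel g' g -> is_aut g.
Proof.
move=> gk gK g'K; split; [exact: rmorphD | exact: rmorphM | exact: rmorph1 | exact: gk |].
by exists g'.
Qed.

(** * Matching the conjugacy and normal forms of the statement *)

Section Final.
Variables (alpha : Rxy -> Rxy) (Ha : is_aut alpha).
Let al : {rmorphism Rxy -> Rxy} := aut_rmorphism Ha.

Lemma conj_cj g (Hg : is_aut g) : conj_in_A alpha g -> @cj CC al (aut_rmorphism Hg).
Proof.
case=> b [Hb e]; have [b' [Hb' bK b'K]] := is_aut_inv Hb.
exists (aut_rmorphism Hb), (aut_rmorphism Hb'); split=> //.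
by case: Hb.
Qed.

Lemma type_tri g (Hg : is_aut g) : [\/ exists lam mu, type_i g lam mu, type_ii g | type_iii g] ->
  @tri2 CC (aut_rmorphism Hg) \/ @tri3 CC (aut_rmorphism Hg).
Proof.
have gk : @kalg CC (aut_rmorphism Hg) by case: (Hg).
case=> [[l [m [l0 m0 gx gy]]]|[l [c [l0 c0 gx gy]]]|[l [m [p [l0 m0 pm gx gy]]]]].
- right; split=> //; exists l, m, 0; split=> // [i|]; first by rewrite coef0 eqxx.
  by rewrite rmorph0 addr0.
- by left; split=> //; exists l, c.
- by right; split=> //; exists l, m, p.
Qed.

Lemma cj_conj (g : {rmorphism Rxy -> Rxy}) : @cj CC al g -> is_aut g /\ conj_in_A alpha g.
Proof.
case=> b [b' [bk bK b'K e]]; have [al' [Ha' aK a'K]] := is_aut_inv Ha.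
have Hb : is_aut b by exact: (morph_is_aut bk bK b'K).
split; last by exists b.
have gE r : g r = b' (alpha (b r)) by have := e r => /= ->; rewrite bK.
have b'k c : b' (cst c) = cst c by rewrite -{1}(bk c : b (cst c) = cst c) bK.
apply: (@morph_is_aut g (fun r => b' (al' (b r)))).
- by move=> c; rewrite gE bk; case: Ha => _ _ _ -> _; rewrite b'k.
- by move=> r; rewrite gE b'K aK bK.
- by move=> r; rewrite gE b'K a'K bK.
Qed.

Lemma tri_type (g : {rmorphism Rxy -> Rxy}) : @tri2 CC g \/ @tri3 CC g ->
  [\/ exists lam mu, type_i g lam mu, type_ii g | type_iii g].
Proof.
case=> [[gk [l [c [l0 c0 gx gy]]]]|[gk [l [m [p [l0 m0 pm gx gy]]]]]].
- by apply: Or32; exists l, c.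
- by apply: Or33; exists l, m, p.
Qed.

Lemma finite_orderE : finite_order alpha <-> @fin_order CC al.
Proof.
split=> [[[|n] [n0 h]] //|[n h]]; first by exists n.
by exists n.+1.
Qed.
End Final.

Theorem theorem7p4 (alpha : Rxy -> Rxy) (Halpha : is_aut alpha) :
  (triangular alpha ->
     (diamond alpha <-> finite_order alpha) /\
     (finite_order alpha <->
        exists (g : Rxy -> Rxy) (lam mu : CC), [/\ is_aut g, conj_in_A alpha g, type_i g lam mu,
                            is_root_of_unity lam & is_root_of_unity mu])) /\
  (square alpha -> (diamond alpha <-> ~ primitive alpha)).
Proof.
have [alpha' [Ha' aK a'K]] := is_aut_inv Halpha.
pose al := aut_rmorphism Halpha; pose al' := aut_rmorphism Ha'.
have alk : @kalg CC al by case: (Halpha).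
split.
- move=> [g [Hg cg tg]].
  have [dia fin] := triangular_part CC_char0 CC_uncountable (f := al) (f' := al') a'K alk
    (conj_cj Halpha Hg cg) (type_tri Hg tg).
  split; first split=> [/(@diamond_to _ Halpha)/dia/finite_orderE //|/(finite_orderE Halpha)/dia].
    exact: (@diamond_of _ Halpha).
  split=> [/(finite_orderE Halpha)/fin [l [m [n [ln mn gx gy]]]]|].
    have l0 : l != 0 by apply: contra_eq_neq ln => ->; rewrite expr0n eq_sym oner_eq0.
    have m0 : m != 0 by apply: contra_eq_neq mn => ->; rewrite expr0n eq_sym oner_eq0.
    by exists g, l, m; split=> //; exists n.+1.
  case=> h [l [m [Hh ch [l0 m0 hx hy] [[|n] [n0 ln]] [[|n'] [n'0 mn]]]]] //.
  apply/(finite_orderE Halpha).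
  have hk : @kalg CC (aut_rmorphism Hh) by case: (Hh).
  exact: (@diag_fin CC al (aut_rmorphism Hh) l m n n' (conj_cj Halpha Hh ch) hk hx hy ln mn).
- move=> [_ nt].
  have [|d1 d2] := @square_part CC CC_char0 CC_uncountable al al' aK a'K alk.
    case=> g /(@cj_conj _ Halpha) [Hg cg] /tri_type tg; apply: nt.
    by exists g.
  split=> [/(@diamond_to _ Halpha)/d1 np /(@primitive_to _ Halpha) //|np].
  apply: (@diamond_of _ Halpha); apply: d2 => /(@primitive_of _ Halpha); exact: np.
Qed.
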